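(* Let $\rho_0\in\mathcal{S}$ be any initial state (all objects as defined in the context). (a) Case $I=\{1,\dots,p\}$ (i.e. $J=\emptyset$). If the stochastic differential equation $$\rho^J_t=\rho_0+\int_0^tL(\rho^J_{s-})ds+\sum_{i=1}^p\int_0^t\int_{\mathbb{R}}\tilde g_i(\rho^J_{s-})\mathbf{1}_{0<x<\mathrm{Re}(v_i(\rho^J_{s-}))}[N_i(dx,ds)-dx\,ds]\qquad(\ast)$$ admits a solution $(\rho^J_t)$ which takes values in the set $\mathcal{S}$ of states, then $(\rho^J_t)$ is a solution of the martingale problem for $(\mathcal{A}^J,\rho_0)$. (b) Case $J\neq\emptyset$. If the stochastic differential equation $$\rho^J_t=\rho_0+\int_0^tL(\rho^J_{s-})ds+\sum_{i\in J\cup\{0\}}\int_0^th_i(\rho^J_{s-})dW_i(s)+\sum_{i\in I}\int_0^t\int_{\mathbb{R}}\tilde g_i(\rho^J_{s-})\mathbf{1}_{0<x<\mathrm{Re}(v_i(\rho^J_{s-}))}[N_i(dx,ds)-dx\,ds]\qquad(\ast\ast)$$ admits a solution $(\rho^J_t)$ which takes values in $\mathcal{S}$, then $(\rho^J_t)$ is a solution of the martingale problem for $(\mathcal{A}^J,\rho_0)$. (c) Consequently, if $\tilde{\mathcal{A}}^J$ denotes the infinitesimal generator of a solution of $(\ast)$ or $(\ast\ast)$, then $\tilde{\mathcal{A}}^Jf(\rho)=\mathcal{A}^Jf(\rho)$ for all states $\rho\in\mathcal{S}$ and all $f\in C^2_c(E)$.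
   Context: **Spaces.** $\mathcal{H}_0=\mathbb{C}^{K+1}$; $\mathcal{H}=\mathbb{C}^{N+1}$ with orthonormal basis $(X_0,\dots,X_N)$. A state is a positive operator with trace $1$; $\mathcal{S}$ is the set of states on $\mathcal{H}_0$. $E\cong\mathbb{R}^P$, $P=2(K+1)^2$, is the real vector space of all operators on $\mathcal{H}_0$; $C_c^2(E)$ is the set of real $C^2$ functions with compact support; $D_\rho f$, $D^2_\rho f$ are the first and second differentials. Operators on $\mathcal{H}_0\otimes\mathcal{H}$ are written in blocks $M=\sum_{0\le k,l\le N}M_{kl}\otimes|X_k\rangle\langle X_l|$. **Data.** $L_{00},L_{10},\dots,L_{N0}$ are operators on $\mathcal{H}_0$ such that $n(U_{00}(n)-I)\to L_{00}$ and $\sqrt n\,U_{k0}(n)\to L_{k0}$ ($1\le k\le N$) for some sequence of unitary operators $U(n)=(U_{kl}(n))$ on $\mathcal{H}_0\otimes\mathcal{H}$. $A=\sum_{i=0}^p\lambda_iP_i$ is the spectral decomposition of a self-adjoint operator on $\mathcal{H}$ (orthogonal eigenprojectors $P_i$, $\sum_iP_i=I$), $p^i_{kl}=\langle X_l,P_iX_k\rangle$ (inner product linear in the second variable), numbered so that $p^0_{00}\neq0$; $I=\{i\in\{1,\dots,p\}:p^i_{00}=0\}$, $J=\{1,\dots,p\}\setminus I$. **Coefficients.** For an operator $\rho$ on $\mathcal{H}_0$: $L(\rho)=L_{00}\rho+\rho L_{00}^\star+\sum_{1\le k\le N}L_{k0}\rho L_{k0}^\star$; $v_i(\rho)=\mathrm{Tr}[\sum_{1\le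 k,l\le N}p^i_{kl}L_{k0}\rho L_{l0}^\star]$; $g_i(\rho)=\frac{\sum_{1\le k,l\le N}p^i_{kl}L_{k0}\rho L_{l0}^\star}{v_i(\rho)}-\rho$ when $v_i(\rho)\ne0$; $\tilde g_i(\rho)=\frac{\sum_{1\le k,l\le N}p^i_{kl}L_{k0}\rho L_{l0}^\star}{\mathrm{Re}(v_i(\rho))}-\rho$ when $\mathrm{Re}(v_i(\rho))\neq0$; for $p^i_{00}\neq0$, $h_i(\rho)=\frac1{\sqrt{p^i_{00}}}\big[\sum_{1\le k\le N}(p^i_{k0}L_{k0}\rho+p^i_{0k}\rho L_{k0}^\star)-\mathrm{Tr}[\sum_{1\le k\le N}(p^i_{k0}L_{k0}\rho+p^i_{0k}\rho L_{k0}^\star)]\rho\big]$. **Generators.** For $f\in C_c^2(E)$ and $\rho\in\mathcal{S}$, $$\mathcal{A}^Jf(\rho)=D_\rho f(L(\rho))+\frac12\sum_{i\in J\cup\{0\}}D^2_\rho f(h_i(\rho),h_i(\rho))+\sum_{i\in I}v_i(\rho)\big[f(\rho+g_i(\rho))-f(\rho)-D_\rho f(g_i(\rho))\big],$$ where the second-order sum is absent if $J=\emptyset$ and jump terms with $v_i(\rho)=0$ are $0$. The infinitesimal generator of a solution of $(\ast)$ or $(\ast\ast)$ is $$\tilde{\mathcal{A}}^Jf(\rho)=D_\rho f(L(\rho))+\frac12\sum_{i\in J\cup\{0\}}D^2_\rho f(h_i(\rho),h_i(\rho))+\sum_{i\in I}(\mathrm{Re}\,v_i(\rho))^+\big[f(\rho+\tilde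 g_i(\rho))-f(\rho)-D_\rho f(\tilde g_i(\rho))\big]$$ with the same conventions (second-order sum absent for $(\ast)$), $x^+=\max(0,x)$. **Martingale problem.** A process $(\rho_t)$ with initial value $\rho_0$ is a solution of the martingale problem for $(\mathcal{A}^J,\rho_0)$ if for all $f\in C^2_c(E)$ the process $f(\rho_t)-f(\rho_0)-\int_0^t\mathcal{A}^Jf(\rho_s)ds$, $t\ge0$, is a martingale with respect to $\mathcal{F}^\rho_t=\sigma(\rho_s,s\le t)$. **Noise.** A probability space supports a $(p+1)$-dimensional Brownian motion $(W_0,\dots,W_p)$ and $p$ Poisson point processes $N_1,\dots,N_p$ on $\mathbb{R}\times\mathbb{R}_+$ with intensity $dx\otimes ds$, mutually independent and independent of $W$; solutions are càdlàg processes adapted to the filtration generated by $W$ and the $N_i$. *)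

(* Defs.v *)
(* Conventions: [R] is the field of real numbers and [R[i]] that of complex
   numbers.  Operators on C^(K+1) are matrices acting on column vectors, [M ^t*]
   is the adjoint.  Processes are functions of (t : R) (w : T), only used for 0 <= t. *)
From HB Require Import structures.
From mathcomp Require Import all_boot all_order all_algebra.
From mathcomp Require Import all_classical all_reals all_analysis.
From mathcomp Require Import measurable_realfun.
From mathcomp Require Import complex.
From mathcomp Require mxtens.

Set Implicit Arguments.
Unset Strict Implicit.
Unset Printing Implicit Defensive.

Import Order.TTheory GRing.Theory Num.Theory.
Import numFieldNormedType.Exports.

#[export] Set Warnings "-notation-overridden".

Local Open Scope classical_set_scope.
Local Open Scope complex_scope.
Local Open Scope sesquilinear_scope.
Local Open Scope ring_scope.

(* R x R with its Borel sets, the state space of the Poisson processes. *)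
Notation marked R := (measurableTypeR R * measurableTypeR R)%type.

(* The real vector space E of all operators on C^(K+1), with its real normed
   space structure: an operator is the pair of its real and imaginary parts. *)
Notation opE R K := ('M[R]_K.+1 * 'M[R]_K.+1)%type.

Section operators.
Context {R : realType}.

Definition toE K (M : 'M[R[i]]_K.+1) : opE R K :=
  (map_mx (@complex.Re R) M, map_mx (@complex.Im R) M).

Definition positive_op n (M : 'M[R[i]]_n) : Prop :=
  forall u : 'cV[R[i]]_n, 0 <= (u ^t* *m M *m u) 0 0.

Definition is_state n (M : 'M[R[i]]_n) : Prop :=
  positive_op M /\ \tr M = 1.

Definition orthonormal_basis n (X : 'I_n -> 'cV[R[i]]_n) : Prop :=
  forall k l, (X k) ^t* *m X l = (k == l)%:R%:M.

Definition spectral_decomposition n p (A : 'M[R[i]]_n)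
    (lam : 'I_p.+1 -> R) (P : 'I_p.+1 -> 'M[R[i]]_n) : Prop :=
  [/\ injective lam,
      forall i, P i != 0 /\ (P i) ^t* = P i,
      forall i j, P i *m P j = if i == j then P i else 0,
      \sum_i P i = 1%:M
    & A = \sum_i (lam i)%:C *: P i].

(* The operator  sum_{k,l} U_{kl} (x) |X_k><X_l|  on  H_0 (x) H. *)
Definition block_op K N (X : 'I_N.+1 -> 'cV[R[i]]_N.+1)
    (U : 'I_N.+1 -> 'I_N.+1 -> 'M[R[i]]_K.+1) : 'M[R[i]]_(K.+1 * N.+1) :=
  \sum_k \sum_l mxtens.tensmx (U k l) (X k *m (X l) ^t*).

(* [L ord0] is L_{00}, and [L k] is L_{k0} for k <> 0. *)
Definition scaling_limit K N (X : 'I_N.+1 -> 'cV[R[i]]_N.+1)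
    (L : 'I_N.+1 -> 'M[R[i]]_K.+1) : Prop :=
  exists U : nat -> 'I_N.+1 -> 'I_N.+1 -> 'M[R[i]]_K.+1,
    [/\ forall n, block_op X (U n) \is unitarymx,
        toE (n%:R *: (U n ord0 ord0 - 1%:M)) @[n --> \oo] --> toE (L ord0)
      & forall k, k != ord0 ->
        toE ((Num.sqrt n%:R)%:C *: U n k ord0) @[n --> \oo] --> toE (L k)].

(* p^i_{kl} = <X_l, P_i X_k>, the inner product being linear on the right. *)
Definition pcoef N p (X : 'I_N.+1 -> 'cV[R[i]]_N.+1)
    (P : 'I_p.+1 -> 'M[R[i]]_N.+1) (i : 'I_p.+1) (k l : 'I_N.+1) : R[i] :=
  ((X l) ^t* *m P i *m X k) 0 0.

Definition D1 K (f : opE R K -> R) (rho eta : 'M[R[i]]_K.+1) : R :=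
  'd f (toE rho) (toE eta).

Definition D2 K (f : opE R K -> R) (rho eta xi : 'M[R[i]]_K.+1) : R :=
  'd (fun y => 'd f y (toE eta)) (toE rho) (toE xi).

(* E is finite-dimensional, so f is C^2 iff it is differentiable and the
   evaluations of its first (second) differential at fixed vectors are
   differentiable (continuous). *)
Definition C2c K (f : opE R K -> R) : Prop :=
  [/\ forall x, differentiable f x,
      forall u x, differentiable (fun y => 'd f y u : R) x,
      forall u v, continuous (fun x => 'd (fun y => 'd f y u : R) x v : R)
    & compact (closure [set x | f x != 0])].

Definition left_lim K (u : R -> 'M[R[i]]_K.+1) (s : R) : 'M[R[i]]_K.+1 :=
  \matrix_(a, b) ((lim (complex.Re (u x a b) @[x --> s^'-])) +i*
                   (lim (complex.Im (u x a b) @[x --> s^'-]))).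

Definition cadlag K (u : R -> 'M[R[i]]_K.+1) : Prop :=
  (forall t, 0 <= t -> toE (u x) @[x --> t^'+] --> toE (u t)) /\
  (forall t, 0 < t -> exists l, toE (u x) @[x --> t^'-] --> toE l).

End operators.

Section coefficients.
Context {R : realType} {K N p : nat}.
Variables (L : 'I_N.+1 -> 'M[R[i]]_K.+1)
          (pc : 'I_p.+1 -> 'I_N.+1 -> 'I_N.+1 -> R[i]).
Implicit Types (rho : 'M[R[i]]_K.+1) (i : 'I_p.+1) (f : opE R K -> R).

(* The indices 1, ..., p are the [lift ord0 j] with [j : 'I_p]. *)
Definition idxI : {set 'I_p} :=
  [set j | pc (lift ord0 j) ord0 ord0 == 0]%SET.
Definition idxJ : {set 'I_p} := (~: idxI)%SET.
Definition idxJ0 : {set 'I_p.+1} := (ord0 |: lift ord0 @: idxJ)%SET.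

Definition coefL rho : 'M[R[i]]_K.+1 :=
  L ord0 *m rho + rho *m (L ord0) ^t*
  + \sum_(k | k != ord0) L k *m rho *m (L k) ^t*.

Definition jump_op i rho : 'M[R[i]]_K.+1 :=
  \sum_(k | k != ord0) \sum_(l | l != ord0)
    pc i k l *: (L k *m rho *m (L l) ^t*).

Definition coefv i rho : R[i] := \tr (jump_op i rho).

(* Only meaningful if [coefv i rho] (resp. its real part) is nonzero. *)
Definition coefg i rho : 'M[R[i]]_K.+1 :=
  (coefv i rho)^-1 *: jump_op i rho - rho.
Definition coefgt i rho : 'M[R[i]]_K.+1 :=
  (complex.Re (coefv i rho))%:C^-1 *: jump_op i rho - rho.

Definition diff_op i rho : 'M[R[i]]_K.+1 :=
  \sum_(k | k != ord0)
    (pc i k ord0 *: (L k *m rho) + pc i ord0 k *: (rho *m (L k) ^t*)).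

Definition coefh i rho : 'M[R[i]]_K.+1 :=
  (sqrtC (pc i ord0 ord0))^-1 *:
    (diff_op i rho - \tr (diff_op i rho) *: rho).

Definition second_order f rho : R :=
  if idxJ == finset.set0 then 0
  else 2^-1 * \sum_(i in idxJ0) D2 f rho (coefh i rho) (coefh i rho).

Definition increment f rho (eta : 'M[R[i]]_K.+1) : R :=
  f (toE (rho + eta)) - f (toE rho) - D1 f rho eta.

(* Complex-valued, because [coefv] is; it is the reality of [coefv] on states
   that makes it agree with [gent]. *)
Definition gen f rho : R[i] :=
  (D1 f rho (coefL rho))%:C + (second_order f rho)%:C
  + \sum_(j in idxI)
      (let i := lift ord0 j in
       if coefv i rho == 0 then 0
       else coefv i rho * (increment f rho (coefg i rho))%:C).

Definition gent f rho : R :=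
  D1 f rho (coefL rho) + second_order f rho
  + \sum_(j in idxI)
      (let i := lift ord0 j in
       let v := complex.Re (coefv i rho) in
       if v == 0 then 0
       else Num.max 0 v * increment f rho (coefgt i rho)).

End coefficients.

Definition cintegral d (T : measurableType d) (R : realType)
    (mu : {measure set T -> \bar R}) (D : set T) (F : T -> R[i]) : R[i] :=
  (\int[mu]_(x in D) complex.Re (F x)) +i* (\int[mu]_(x in D) complex.Im (F x)).

Definition mxintegral d (T : measurableType d) (R : realType) (K : nat)
    (mu : {measure set T -> \bar R}) (D : set T) (F : T -> 'M[R[i]]_K.+1) :
    'M[R[i]]_K.+1 :=
  \matrix_(a, b) cintegral mu D (fun x => F x a b).

Section probability.
Context {d : measure_display} {T : measurableType d} {R : realType}.
Variable Pr : probability T R.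
Implicit Types (F : R -> set (set T)) (G : set (set T)) (X Y : T -> R).

Definition measurable_wrt G X : Prop :=
  forall B : set R, measurable B -> G (X @^-1` B).

Definition measurable_op_wrt G K (X : T -> 'M[R[i]]_K.+1) : Prop :=
  forall a b, measurable_wrt G (fun w => complex.Re (X w a b)) /\
              measurable_wrt G (fun w => complex.Im (X w a b)).

Definition is_cond_exp G X Y : Prop :=
  [/\ measurable_wrt G Y, Pr.-integrable setT (EFin \o Y)
    & forall A, G A -> \int[Pr]_(w in A) Y w = \int[Pr]_(w in A) X w].

Definition martingale F (M : R -> T -> R) : Prop :=
  [/\ forall t, 0 <= t -> measurable_wrt (F t) (M t),
      forall t, 0 <= t -> Pr.-integrable setT (EFin \o M t)
    & forall s t, 0 <= s -> s <= t -> is_cond_exp (F s) (M t) (M s)].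

Definition cmartingale F (M : R -> T -> R[i]) : Prop :=
  martingale F (fun t w => complex.Re (M t w)) /\
  martingale F (fun t w => complex.Im (M t w)).

(* The index types are finite; when each [G i] contains [setT] this is the
   usual mutual independence. *)
Definition independent (I : finType) (G : I -> set (set T)) : Prop :=
  forall A : I -> set T, (forall i, G i (A i)) ->
    Pr (\bigcap_i A i) = (\prod_i Pr (A i))%E.

Definition independent2 (G1 G2 : set (set T)) : Prop :=
  forall A B, G1 A -> G2 B -> Pr (A `&` B) = (Pr A * Pr B)%E.

Definition bm_events (W : R -> T -> R) (S : set R) : set (set T) :=
  [set A | exists s (B : set R),
     [/\ S s, measurable B & A = W s @^-1` B]].

Definition brownian (W : R -> T -> R) : Prop :=
  [/\ forall t, 0 <= t -> measurable_fun setT (W t ),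
      {ae Pr, forall w, W 0 w = 0},
      {ae Pr, forall w, {within `[0, +oo[, continuous (W ^~ w)}},
      forall s t, 0 <= s -> s < t -> forall B : set R, measurable B ->
        Pr ((fun w => W t w - W s w) @^-1` B) =
        normal_prob 0 (Num.sqrt (t - s)) B
    & forall s t, 0 <= s -> s < t ->
        independent2 <<s bm_events W `[0, s] >>
          [set A | exists2 B : set R, measurable B &
                     A = (fun w => W t w - W s w) @^-1` B]].

(* Points of the Poisson processes are pairs (x, s), s being the time.  A point
   process is a random measure (kernel) with values in {0, 1, ..., +oo}. *)

Definition leb2 : {measure set (marked R) -> \bar R} :=
  (lebesgue_measure \x lebesgue_measure)%E.

Definition ppp_intensity (C : set (marked R)) : \bar R :=
  leb2 (C `&` [set z | 0 <= z.2]).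

Definition ppp_events (Np : R.-ker T ~> (marked R)) (S : set (marked R)) :
    set (set T) :=
  [set A | exists (C : set (marked R)) (B : set (\bar R)),
     [/\ measurable C, C `<=` S, measurable B & A = (Np ^~ C) @^-1` B]].

Definition poisson_point_process (Np : R.-ker T ~> (marked R)) : Prop :=
  [/\ forall w C, measurable C ->
        Np w C = +oo%E \/ exists n : nat, Np w C = n%:R%:E,
      forall C, measurable C -> (ppp_intensity C < +oo)%E -> forall n : nat,
        let r := fine (ppp_intensity C) in
        Pr [set w | Np w C = n%:R%:E] = (r ^+ n / n`!%:R * expR (- r))%:E
    & forall n (C : 'I_n -> set (marked R)), (forall j, measurable (C j)) ->
        trivIset setT C ->
        independent (fun j => [set A | exists2 B : set (\bar R),
          measurable B & A = (Np ^~ (C j)) @^-1` B])].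

Section noise.
Context {p : nat}.
Variables (W : 'I_p.+1 -> R -> T -> R) (Np : 'I_p -> R.-ker T ~> (marked R)).

(* W = (W_0, ..., W_p); [Np j] is N_(j+1). *)
Definition noise : Prop :=
  [/\ forall i, brownian (W i),
      forall j, poisson_point_process (Np j)
    & independent (fun ij : 'I_p.+1 + 'I_p =>
        match ij with
        | inl i => <<s bm_events (W i) [set s | 0 <= s] >>
        | inr j => <<s ppp_events (Np j) setT >>
        end)].

(* Augmented, as usual, by the null events; an adapted process in the sense of
   the non-augmented filtration is in particular adapted to this one. *)
Definition noise_filtration (t : R) : set (set T) :=
  <<s [set A | [\/ exists i, bm_events (W i) `[0, t] A,
                  exists j, ppp_events (Np j) [set z | 0 <= z.2 <= t] A
                | measurable A /\ Pr A = 0%E]] >>.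

(* The simple process  sum_(k < m) xi_k 1_{]tau_k, tau_(k+1)]}  on [0, t]. *)
Definition simple_process F (t : R) (m : nat) (tau : nat -> R)
    (xi : nat -> T -> R) : Prop :=
  [/\ tau 0 = 0, tau m = t,
      forall k, (k < m)%N -> tau k <= tau k.+1,
      forall k, (k < m)%N -> measurable_wrt (F (tau k)) (xi k)
    & exists c, forall k w, `|xi k w| <= c].

Definition simple_value (m : nat) (tau : nat -> R) (xi : nat -> T -> R)
    (s : R) (w : T) : R :=
  \sum_(k < m) (if tau k < s <= tau k.+1 then xi k w else 0).

Definition simple_integral (B : R -> T -> R) (m : nat) (tau : nat -> R)
    (xi : nat -> T -> R) (w : T) : R :=
  \sum_(k < m) xi k w * (B (tau k.+1) w - B (tau k) w).

(* [Y] is (a version of) the Ito integral  int_0^t H_s dB_s  of a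
   square-integrable integrand: the L^2 limit of the integrals of simple
   adapted processes that converge to H in L^2(Pr (x) ds). *)
Definition is_ito_integral F (B H : R -> T -> R) (t : R) (Y : T -> R) : Prop :=
  measurable_fun setT (Y ) /\
  exists (m : nat -> nat) (tau : nat -> nat -> R) (xi : nat -> nat -> T -> R),
    [/\ forall n, simple_process F t (m n) (tau n) (xi n),
        (\int[Pr]_w \int[lebesgue_measure]_(s in `]0%R, t])
           ((H s w - simple_value (m n) (tau n) (xi n) s w) ^+ 2)%:E)%E
          @[n --> \oo] --> 0%E
      & (\int[Pr]_w
           ((Y w - simple_integral B (m n) (tau n) (xi n) w) ^+ 2)%:E)%E
          @[n --> \oo] --> 0%E].

Definition is_op_ito_integral F (B : R -> T -> R) K
    (H : R -> T -> 'M[R[i]]_K.+1) (t : R) (Y : T -> 'M[R[i]]_K.+1) : Prop :=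
  forall a b,
    is_ito_integral F B (fun s w => complex.Re (H s w a b)) t
      (fun w => complex.Re (Y w a b)) /\
    is_ito_integral F B (fun s w => complex.Im (H s w a b)) t
      (fun w => complex.Im (Y w a b)).

Context {K N : nat}.
Variables (L : 'I_N.+1 -> 'M[R[i]]_K.+1)
          (pc : 'I_p.+1 -> 'I_N.+1 -> 'I_N.+1 -> R[i]).
Implicit Types (rho : R -> T -> 'M[R[i]]_K.+1).

Definition rho_ rho (s : R) (w : T) : 'M[R[i]]_K.+1 := left_lim (rho ^~ w) s.

Definition drift_term rho (t : R) (w : T) : 'M[R[i]]_K.+1 :=
  mxintegral lebesgue_measure `]0, t] (fun s => coefL L (rho_ rho s w)).

Definition jump_integrand j rho (w : T) (z : (marked R)) : 'M[R[i]]_K.+1 :=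
  let i := lift ord0 j in
  if 0 < z.1 < complex.Re (coefv L pc i (rho_ rho z.2 w))
  then coefgt L pc i (rho_ rho z.2 w) else 0.

(* The integral against N_i(dx, ds) - dx ds over R x ]0, t], as a difference of
   two pathwise integrals; for a process with values in the states the
   integrand is bounded and vanishes for x outside a bounded interval, so that
   almost surely both are finite. *)
Definition jump_term j rho (t : R) (w : T) : 'M[R[i]]_K.+1 :=
  mxintegral (Np j w) (setT `*` `]0, t]) (jump_integrand j rho w)
  - mxintegral leb2 (setT `*` `]0, t]) (jump_integrand j rho w).

Definition cadlag_adapted rho : Prop :=
  (forall w, cadlag (rho ^~ w)) /\
  (forall t, 0 <= t -> measurable_op_wrt (noise_filtration t) (rho t)).

Definition solves_jump_sde (rho0 : 'M[R[i]]_K.+1) rho : Prop :=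
  cadlag_adapted rho /\
  forall t, 0 <= t -> {ae Pr, forall w,
    rho t w = rho0 + drift_term rho t w + \sum_j jump_term j rho t w}.

Definition solves_jump_diffusion_sde (rho0 : 'M[R[i]]_K.+1) rho : Prop :=
  cadlag_adapted rho /\
  exists Y : 'I_p.+1 -> R -> T -> 'M[R[i]]_K.+1,
    (forall i t, i \in idxJ0 pc -> 0 <= t ->
       is_op_ito_integral noise_filtration (W i)
         (fun s w => coefh L pc i (rho_ rho s w)) t (Y i t)) /\
    forall t, 0 <= t -> {ae Pr, forall w,
      rho t w = rho0 + drift_term rho t w + \sum_(i in idxJ0 pc) Y i t w
                + \sum_(j in idxI pc) jump_term j rho t w}.

End noise.

Definition natural_filtration K (rho : R -> T -> 'M[R[i]]_K.+1) (t : R) :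
    set (set T) :=
  <<s [set A | exists s a b (B : set R),
        [/\ 0 <= s <= t, measurable B
          & A = (fun w => complex.Re (rho s w a b)) @^-1` B \/
            A = (fun w => complex.Im (rho s w a b)) @^-1` B]] >>.

Definition martingale_problem K (Af : (opE R K -> R) -> 'M[R[i]]_K.+1 -> R[i])
    (rho0 : 'M[R[i]]_K.+1) (rho : R -> T -> 'M[R[i]]_K.+1) : Prop :=
  {ae Pr, forall w, rho 0 w = rho0} /\
  forall f, C2c f ->
    cmartingale (natural_filtration rho)
      (fun t w => (f (toE (rho t w)) - f (toE (rho 0 w)))%:C
        - cintegral lebesgue_measure `[0, t] (fun s => Af f (rho s w))).

End probability.

(* Main.v *)
(* On states the jump operators are positive semidefinite, so the rates are real and
   nonnegative and the generator is real; this gives (c).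
   For the martingale property, fix an event A of the noise filtration at time u and
   compare, over a step of length dt from u, the solution with its Euler scheme, in
   which the coefficients are frozen at time u.  Taylor's formula at rho_u splits
   f(rho_(u+dt)) - f(rho_u) - dt * Af(rho_u) into
   (i) bounded past-measurable factors times increments with vanishing conditional
   expectation: of the Ito integrals, of W_i, of W_i W_k - dt 1_(i=k), and of the
   compensated jump counts of the frozen rates;
   (ii) an error whose expectation is at most
   eps * dt + C_eps * (dt^2 + E int_u^(u+dt) |rho_(s-) - rho_u| ds), by the Ito and
   Poisson isometries and the moments of the noise.
   Summed over a subdivision of [s, t] the errors vanish, because the left limits make
   the subdivision process converge to rho_(s-), and only
   E 1_A (f(rho_t) - f(rho_s) - int_s^t Af(rho_r) dr) = 0 is left.
   The isometries are proved for step processes; the thresholds 0 < x < v(rho_(s-)) of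
   the jump integrands are reached from them by approximating the indicator of
   ]0, +oo[ from below by the continuous [ramp]s. *)

From HB Require Import structures.
Require Import Defs.
From mathcomp Require Import all_boot all_order all_algebra.
From mathcomp Require Import all_classical all_reals all_analysis.
From mathcomp Require Import measurable_realfun.
From mathcomp Require Import complex.
From mathcomp Require Import ring lra.

Set Implicit Arguments.
Unset Strict Implicit.
Unset Printing Implicit Defensive.

Import Order.TTheory GRing.Theory Num.Theory.
Import numFieldNormedType.Exports.

Local Open Scope classical_set_scope.
Local Open Scope complex_scope.
Local Open Scope ring_scope.

(** * Expectations and independence *)

(** Ito integrals are specified only as L^2 limits of integrals of simple processes, so the argument
    works with mean values over small steps. An event of time s stays in the noise filtration at
    every later grid point, which is what allows the step estimates to be added up. Two features of
    the coefficients shape the rest. The jump size g divides by the rate v and may be discontinuous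
    where v vanishes. The Lipschitz bound that survives is that of min(v, v') |g - g'|; it suffices
    because a jump of size g occupies only the marks in ]0, v[. Moreover the left limits of the
    process must stay where the coefficients are controlled, hence the closed condition [nice].
    Products of increments of different noise sources are handled by taking each source relative to
    its own past together with the whole of the other sources ([others]); null events are adjoined
    there because the filtration is augmented. Coefficients and jump sizes are bounded on [nice]
    operators, so square errors are linear in the expected gap between rho_(s-) and rho_u. *)

Section probability_tools.
Context {d : measure_display} {T : measurableType d} {R : realType}.
Variable Pr : probability T R.
Implicit Types (X Y Z : T -> R) (c : R).

(** Dynkin's argument: for a fixed [B], the events that satisfy the product formula with [B] form a
    lambda-system containing the pi-system [G1]. *)
Lemma independent2_sigma (G1 G2 : set (set T)) :
  setI_closed G1 -> G1 `<=` measurable -> G2 `<=` measurable ->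
  independent2 Pr G1 G2 -> independent2 Pr <<s G1 >> G2.
Proof.
move=> GI G1m G2m ind A B + GB; have mB := G2m _ GB.
move: A; suff: <<s G1 >> `<=` [set A | measurable A /\ Pr (A `&` B) = (Pr A * Pr B)%E].
  by move=> h A /h[].
apply: lambda_system_subset => //; last by move=> A GA; split; [exact: G1m|exact: ind].
apply/dynkin_lambda_system; split => /=.
- by split=> //; rewrite setTI probability_setT mul1e.
- move=> A [mA eA]; split; first exact: measurableC.
  rewrite setIC -setDE measureD//; last by rewrite ltey_eq fin_num_measure.
  rewrite [X in (_ - X)%E](_ : _ = (Pr A * Pr B)%E); last by rewrite setIC.
  rewrite probability_setC// muleBl ?mul1e//; first exact: fin_num_measure.
- move=> F tF FH; split; first by apply: bigcupT_measurable => k; case: (FH k).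
  have mF k : measurable (F k) by case: (FH k).
  rewrite setI_bigcupl measure_bigcup//; last 2 first.
  - by move=> k _; exact: measurableI.
  - by apply: trivIset_setIr.
  rewrite measure_bigcup//.
  rewrite (@eq_eseriesr _ _ (fun k => Pr B * Pr (F k))%E); last first.
    by move=> k _; rewrite muleC; case: (FH k).
  by rewrite -(fineK (fin_num_measure Pr _ mB)) nneseriesZl// muleC.
Qed.

Definition mean (X : T -> R) : R := \int[Pr]_w X w.
Definition intg (X : T -> R) : Prop := Pr.-integrable setT (EFin \o X).

Lemma intg_meas X : intg X -> measurable_fun setT X.
Proof. by move=> /measurable_int /measurable_EFinP. Qed.

Lemma EFin_mean X : intg X -> (mean X)%:E = (\int[Pr]_w (X w)%:E)%E.
Proof. by move=> iX; rewrite /mean fineK//; exact: integrable_fin_num. Qed.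

Lemma intgD X Y : intg X -> intg Y -> intg (fun w => X w + Y w).
Proof. by move=> iX iY; exact: (integrableD _ iX iY). Qed.

Lemma intgB X Y : intg X -> intg Y -> intg (fun w => X w - Y w).
Proof. by move=> iX iY; exact: (integrableB _ iX iY). Qed.

Lemma intgZ c X : intg X -> intg (fun w => c * X w).
Proof. by move=> iX; exact: (integrableZl _ _ iX). Qed.

Lemma intg_le X Y : measurable_fun setT X -> intg Y ->
  (forall w, `|X w| <= Y w) -> intg X.
Proof.
move=> mX iY XY; apply: (le_integrable measurableT _ _ iY); first exact/measurable_EFinP.
by move=> w _ /=; rewrite lee_fin (le_trans (XY w))// ler_norm.
Qed.

Lemma intg_cst c : intg (fun=> c).
Proof. exact: (finite_measure_integrable_cst Pr c). Qed.

Lemma intg_bounded X c : measurable_fun setT X -> (forall w, `|X w| <= c) -> intg X.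
Proof. by move=> mX Xc; apply: (intg_le mX (intg_cst c)). Qed.

Lemma intg_sum (I : Type) (s : seq I) (P : pred I) (F : I -> T -> R) :
  (forall i, P i -> intg (F i)) -> intg (fun w => \sum_(i <- s | P i) F i w).
Proof.
move=> h; elim: s => [|i s ih].
  by under eq_fun do rewrite big_nil; exact: intg_cst.
case Pi : (P i); under eq_fun do rewrite big_cons Pi; last exact: ih.
exact: intgD (h _ Pi) ih.
Qed.

Lemma intg_norm X : intg X -> intg (fun w => `|X w|).
Proof. exact: integrable_norm. Qed.

Lemma meanD X Y : intg X -> intg Y -> mean (fun w => X w + Y w) = mean X + mean Y.
Proof. by move=> iX iY; rewrite /mean -RintegralD. Qed.

Lemma meanB X Y : intg X -> intg Y -> mean (fun w => X w - Y w) = mean X - mean Y.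
Proof. by move=> iX iY; rewrite /mean -RintegralB. Qed.

Lemma meanZ c X : intg X -> mean (fun w => c * X w) = c * mean X.
Proof. by move=> iX; rewrite /mean -RintegralZl. Qed.

Lemma mean_cst c : mean (fun=> c) = c.
Proof. by rewrite /mean Rintegral_cst//= probability_setT mulr1. Qed.

Lemma mean_sum (I : Type) (s : seq I) (P : pred I) (F : I -> T -> R) :
  (forall i, P i -> intg (F i)) ->
  mean (fun w => \sum_(i <- s | P i) F i w) = \sum_(i <- s | P i) mean (F i).
Proof.
move=> h; elim: s => [|i s ih].
  by under eq_fun do rewrite big_nil; rewrite mean_cst big_nil.
rewrite big_cons; case Pi : (P i); under eq_fun do rewrite big_cons Pi; last exact: ih.
by rewrite meanD ?ih//; [exact: h|exact: intg_sum].
Qed.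

Lemma mean_ge0 X : (forall w, 0 <= X w) -> 0 <= mean X.
Proof. by move=> h; exact: Rintegral_ge0. Qed.

Lemma le_mean X Y : intg X -> intg Y -> (forall w, X w <= Y w) -> mean X <= mean Y.
Proof. by move=> iX iY XY; exact: le_Rintegral. Qed.

Lemma norm_mean X : intg X -> `|mean X| <= mean (fun w => `|X w|).
Proof. by move=> iX; exact: le_normr_Rintegral. Qed.

Lemma norm_mean_le X Y : measurable_fun setT X -> intg Y ->
  (forall w, `|X w| <= Y w) -> `|mean X| <= mean Y.
Proof.
move=> mX iY XY; have iX := intg_le mX iY XY.
by apply: (le_trans (norm_mean iX)); apply: le_mean => //; exact: intg_norm.
Qed.

Lemma mean_ae X Y : measurable_fun setT X -> measurable_fun setT Y ->
  {ae Pr, forall w, X w = Y w} -> mean X = mean Y.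
Proof.
move=> mX mY XY; rewrite /mean /Rintegral; congr fine; apply: ae_eq_integral => //.
- exact/measurable_EFinP.
- exact/measurable_EFinP.
- by apply: filterS XY => w + _ => ->.
Qed.

Lemma intg_ae X Y : measurable_fun setT Y -> intg X ->
  {ae Pr, forall w, X w = Y w} -> intg Y.
Proof.
move=> mY iX XY; apply/integrableP; split; first exact/measurable_EFinP.
have /integrableP[mX] := iX; rewrite -(@ae_eq_integral _ _ _ Pr setT (fun w => `|(Y w)%:E|)%E (fun w => `|(X w)%:E|)%E)//.
- by apply: measurableT_comp => //; exact/measurable_EFinP.
- by apply: measurableT_comp => //; exact/measurable_EFinP.
- by apply: filterS XY => w + _ => ->.
Qed.

Lemma mean_restrict (A : set T) X : \int[Pr]_(w in A) X w = mean (fun w => \1_A w * X w).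
Proof.
rewrite Rintegral_mkcond /mean; apply: eq_Rintegral => w _.
by rewrite patchE indicE; case: (w \in A); rewrite ?mul1r ?mul0r.
Qed.

Definition sqintg (X : T -> R) : Prop :=
  measurable_fun setT X /\ intg (fun w => X w ^+ 2).

Lemma sqintgM X Y : sqintg X -> sqintg Y -> intg (fun w => X w * Y w).
Proof.
move=> [mX iX] [mY iY]; apply: (@intg_le _ (fun w => X w ^+ 2 + Y w ^+ 2)).
- exact: measurable_funM.
- exact: intgD.
- by move=> w; rewrite ler_norml; apply/andP; split; nra.
Qed.

Lemma sqintg_bounded X c : measurable_fun setT X -> (forall w, `|X w| <= c) -> sqintg X.
Proof.
move=> mX Xc; split=> //; apply: (@intg_bounded _ (c ^+ 2)).
  exact: measurable_funX.
by move=> w; rewrite normrX lerXn2r ?nnegrE// (le_trans _ (Xc w)).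
Qed.

Lemma sqintg_intg X : sqintg X -> intg X.
Proof.
move=> sX; have := sqintgM sX (@sqintg_bounded (fun=> 1) 1 (measurable_cst _) _).
by under eq_fun do rewrite mulr1; apply => w; rewrite normr1.
Qed.

Lemma sqintgMb X Z c : sqintg X -> measurable_fun setT Z -> (forall w, `|Z w| <= c) ->
  sqintg (fun w => Z w * X w).
Proof.
move=> [mX iX] mZ Zc; split; first exact: measurable_funM.
apply: (@intg_le _ (fun w => c ^+ 2 * X w ^+ 2)); last 1 first.
- move=> w; rewrite exprMn normrM !normrX !real_normK ?num_real//.
  by rewrite ler_wpM2r ?sqr_ge0// -[leLHS]real_normK ?num_real// lerXn2r ?nnegrE// (le_trans _ (Zc w)).
- by apply: measurable_funX; exact: measurable_funM.
- exact: intgZ.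
Qed.

Lemma sqintgD X Y : sqintg X -> sqintg Y -> sqintg (fun w => X w + Y w).
Proof.
move=> sX sY; have [mX iX] := sX; have [mY iY] := sY; split; first exact: measurable_funD.
have -> : (fun w => (X w + Y w) ^+ 2) = (fun w => (X w ^+ 2 + 2 * (X w * Y w)) + Y w ^+ 2).
  by apply/funext => w; ring.
by apply: intgD => //; apply: intgD => //; apply: intgZ; exact: sqintgM.
Qed.

Lemma sqintgZ c X : sqintg X -> sqintg (fun w => c * X w).
Proof. by move=> sX; apply: (@sqintgMb _ (fun=> c) `|c|). Qed.

Lemma sqintgB X Y : sqintg X -> sqintg Y -> sqintg (fun w => X w - Y w).
Proof.
move=> sX sY; have := sqintgD sX (sqintgZ (-1) sY).
by under eq_fun do rewrite mulN1r.
Qed.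

Lemma sqintg_sum (I : Type) (s : seq I) (P : pred I) (F : I -> T -> R) :
  (forall i, P i -> sqintg (F i)) -> sqintg (fun w => \sum_(i <- s | P i) F i w).
Proof.
move=> h; elim: s => [|i s ih].
  by under eq_fun do rewrite big_nil; apply: (@sqintg_bounded _ 0) => // w; rewrite normr0.
case Pi : (P i); under eq_fun do rewrite big_cons Pi; last exact: ih.
exact: sqintgD (h _ Pi) ih.
Qed.

Definition indepRV (X Y : T -> R) : Prop :=
  forall A B : set R, measurable A -> measurable B ->
  Pr (X @^-1` A `&` Y @^-1` B) = (Pr (X @^-1` A) * Pr (Y @^-1` B))%E.

(** Tonelli for |x y| under the product of the two laws gives integrability of the product without
    any square integrability; Fubini then gives its mean. *)
Lemma indepRV_mean X Y : indepRV X Y -> intg X -> intg Y ->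
  intg (fun w => X w * Y w) /\ mean (fun w => X w * Y w) = mean X * mean Y.
Proof.
move=> ind iX iY; have mX := intg_meas iX; have mY := intg_meas iY.
have mXY : measurable_fun setT (fun w => (X w, Y w)) by exact: measurable_fun_pair.
pose fX : {mfun T >-> R} := mfun_Sub (mem_set mX).
pose fY : {mfun T >-> R} := mfun_Sub (mem_set mY).
pose mu := (distribution Pr fX \x distribution Pr fY)%E.
have mpr : measurable_fun setT (fun z : R * R => (z.1 * z.2)%:E).
  by apply/measurable_EFinP; apply: measurable_funM.
(* Independence enters here: the joint law agrees with the product of the laws on rectangles, hence
   everywhere. *)
have E0 (f : R * R -> \bar R) : (\int[pushforward Pr (fun w => (X w, Y w))]_z f z =
   \int[mu]_z f z)%E.
  apply: eq_measure_integral => A mA _; symmetry.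
  apply: product_measure_unique => // B C mB mC.
have E1 : (\int[Pr]_w `|(X w * Y w)%:E| = \int[Pr]_w `|(X w)%:E| * \int[Pr]_w `|(Y w)%:E|)%E.
  transitivity (\int[pushforward Pr (fun w => (X w, Y w))]_z `|(z.1 * z.2)%:E|)%E.
    by rewrite ge0_integral_pushforward//; apply: measurableT_comp.
  rewrite E0 fubini_tonelli1//; last exact: measurableT_comp.
  transitivity (\int[distribution Pr fX]_x (`|x%:E| * \int[distribution Pr fY]_y `|y%:E|))%E.
    apply: eq_integral => x _; rewrite /fubini_F/= -ge0_integralZl//.
      by apply: eq_integral => y _; rewrite -EFinM -normrM.
    by apply: measurableT_comp.
  rewrite ge0_integralZr//; last 2 first.
  - by apply: measurableT_comp.
  - exact: integral_ge0.
  by congr (_ * _)%E; rewrite ge0_integral_pushforward//; apply: measurableT_comp.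
have i1 : (\int[Pr]_w `|(X w)%:E| < +oo)%E by have /integrableP[] := iX.
have i2 : (\int[Pr]_w `|(Y w)%:E| < +oo)%E by have /integrableP[] := iY.
have iXY : intg (fun w => X w * Y w).
  apply/integrableP; split.
    by apply/measurable_EFinP; exact: measurable_funM.
  rewrite [ltLHS](_ : _ = (\int[Pr]_w `|(X w)%:E| * \int[Pr]_w `|(Y w)%:E|)%E)//.
  by apply: lte_mul_pinfty => //; [exact: integral_ge0|rewrite ge0_fin_numE// integral_ge0].
split=> //; apply: EFin_inj; rewrite EFinM !EFin_mean//.
have iE1 : (pushforward Pr (fun w => (X w, Y w))).-integrable setT (fun z => (z.1 * z.2)%:E).
  by apply: integrable_pushforward => //.
transitivity (\int[pushforward Pr (fun w => (X w, Y w))]_z (z.1 * z.2)%:E)%E.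
  by rewrite integral_pushforward//.
rewrite E0 -integral12_prod_meas1; last first.
  apply/integrableP; split=> //.
  by rewrite -E0; have /integrableP[] := iE1.
have pX : (distribution Pr fX).-integrable setT (@EFin R) by apply: integrable_pushforward.
have pY : (distribution Pr fY).-integrable setT (@EFin R) by apply: integrable_pushforward.
transitivity (\int[distribution Pr fX]_x (x%:E * \int[distribution Pr fY]_y y%:E))%E.
  by apply: eq_integral => x _; rewrite -integralZl//.
have fY' : (\int[distribution Pr fY]_y y%:E)%E \is a fin_num by exact: integrable_fin_num.
rewrite -(fineK fY') integralZr// (fineK fY').
by congr (_ * _)%E; rewrite integral_pushforward.
Qed.

End probability_tools.

(** * Moments of the normal law *)

Section gaussian_moments.
Context {R : realType}.
Local Notation mu := (@lebesgue_measure R).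
Local Notation pdf := (@normal_pdf R).
Local Notation mR := (measurableTypeR R).

Import HBNNSimple.

(** For indicators this is how [normal_prob] is built from its density; linearity gives simple
    functions, and monotone convergence the rest. *)
Lemma ge0_integral_normal (m s : R) (f : mR -> \bar R) :
  measurable_fun setT f -> (forall x, 0 <= f x)%E ->
  (\int[normal_prob m s]_x f x = \int[mu]_x (f x * (pdf m s x)%:E))%E.
Proof.
move=> mf f0.
have mpdf : measurable_fun (setT : set mR) (fun x => (pdf m s x)%:E).
  by apply/measurable_EFinP; exact: measurable_normal_pdf.
pose f_ := nnsfun_approx measurableT mf.
transitivity (lim (\int[normal_prob m s]_x (f_ n x)%:E @[n --> \oo])%E).
  rewrite -monotone_convergence//=.
  - by apply: eq_integral => x _; apply/esym/cvg_lim => //=; exact: cvg_nnsfun_approx.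
  - by move=> n; exact/measurable_EFinP/measurable_funTS.
  - by move=> n ? _; rewrite lee_fin.
  - by move=> ? _ ? ? mn; rewrite lee_fin; exact/lefP/nd_nnsfun_approx.
transitivity (lim (\int[mu]_x ((f_ n x)%:E * (pdf m s x)%:E) @[n --> \oo])%E); last first.
  rewrite -monotone_convergence//=.
  - apply: eq_integral => x _; apply/cvg_lim => //=.
    under eq_fun do rewrite muleC.
    rewrite muleC; apply: cvgeZl => //; exact: cvg_nnsfun_approx.
  - by move=> n; apply: emeasurable_funM => //; exact/measurable_EFinP/measurable_funTS.
  - by move=> n ? _; rewrite -EFinM lee_fin mulr_ge0// normal_pdf_ge0.
  - move=> x _ ? ? mn; rewrite lee_pmul ?lee_fin ?normal_pdf_ge0//.
    exact/lefP/nd_nnsfun_approx.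
apply: congr_lim; apply/funext => n /=.
under eq_integral do rewrite fimfunE -fsumEFin//.
under [RHS]eq_integral do rewrite fimfunE -fsumEFin//.
rewrite ge0_integral_fsum//; last 2 first.
- by move=> r; apply/measurable_EFinP; apply: measurable_funM => //; exact: measurable_indic.
- by move=> r x _; rewrite EFinM nnfun_muleindic_ge0.
transitivity (\int[mu]_x (\sum_(y \in range (f_ n))
    (y * \1_(f_ n @^-1` [set y]) x)%:E * (pdf m s x)%:E))%E; last first.
  apply: eq_integral => x _; rewrite ge0_mule_fsuml// => r.
  by rewrite EFinM nnfun_muleindic_ge0.
rewrite ge0_integral_fsum//; last 2 first.
- move=> r; apply: emeasurable_funM => //.
  by apply/measurable_EFinP; apply: measurable_funM => //; exact: measurable_indic.
- by move=> r x _; rewrite mule_ge0 ?lee_fin ?normal_pdf_ge0// -lee_fin EFinM nnfun_muleindic_ge0.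
apply: eq_fsbigr => r; rewrite inE => -[x _ <-].
under eq_integral do rewrite EFinM.
rewrite ge0_integralZl//; last 2 first.
- by apply/measurable_EFinP; exact: measurable_indic.
- by rewrite lee_fin.
rewrite integral_indic// setIT.
under [RHS]eq_integral do rewrite EFinM -muleA.
rewrite ge0_integralZl//; last 3 first.
- apply: emeasurable_funM => //.
  by apply/measurable_EFinP; exact: measurable_indic.
- by move=> z _; rewrite mule_ge0 ?lee_fin ?normal_pdf_ge0.
- by rewrite lee_fin.
congr (_ * _)%E.
transitivity (\int[mu]_(z in f_ n @^-1` [set f_ n x]) (pdf m s z)%:E)%E; first by [].
rewrite [LHS]integral_mkcond.
apply: eq_integral => z _; rewrite patchE indicE.
by case: (z \in _); rewrite ?mul1e ?mul0e.
Qed.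

Lemma normal_pdfE0 (m s : R) x : s != 0 -> pdf m s x =
  normal_peak s * expR (- (x - m) ^+ 2 / (s ^+ 2 *+ 2)).
Proof. by move=> s0; rewrite normal_pdfE. Qed.

Lemma normal_peakM (r s : R) : 0 < r -> 0 < s ->
  normal_peak s = r * normal_peak (r * s).
Proof.
move=> r0 s0; rewrite /normal_peak (_ : (r * s) ^+ 2 * pi *+ 2 = r ^+ 2 * (s ^+ 2 * pi *+ 2)); last by ring.
rewrite [in RHS]sqrtrM ?sqr_ge0//.
by rewrite sqrtr_sqr (gtr0_norm r0) invfM mulrA divff ?mul1r// gt_eqF.
Qed.

Variable s : R.
Hypothesis s0 : 0 < s.
Let nu := normal_prob 0 s.

Let sn0 : s != 0. Proof. by rewrite gt_eqF. Qed.

(** The density with standard deviation [s], multiplied by [x ^+ 4], is at most [128 * s ^+ 4] times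
    the density with standard deviation [2 * s], whose integral is 1. The constant is 2 from the
    ratio of the peaks times 64 from [x ^+ 4 = 64 * s ^+ 4 * y ^+ 2]. *)
Lemma normal_pow4 : (\int[nu]_x (x ^+ 4)%:E <= (128 * s ^+ 4)%:E)%E.
Proof.
have m4 : measurable_fun setT (fun x : mR => (x ^+ 4)%:E).
  by apply/measurable_EFinP; exact: measurable_funX.
rewrite /nu ge0_integral_normal//; last by move=> x; rewrite lee_fin exprn_even_ge0.
have s20 : 0 < 2 * s by rewrite mulr_gt0.
apply: (@le_trans _ _ (\int[mu]_x ((128 * s ^+ 4)%:E * (pdf 0 (2 * s) x)%:E))%E); last first.
  rewrite ge0_integralZl//.
  - by rewrite integral_normal_pdf mule1.
  - by apply/measurable_EFinP; exact: measurable_normal_pdf.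
  - by move=> x _; rewrite lee_fin normal_pdf_ge0.
  - by rewrite lee_fin mulr_ge0// exprn_ge0// ltW.
apply: ge0_le_integral => //.
- by move=> x _; rewrite -EFinM lee_fin mulr_ge0 ?normal_pdf_ge0// exprn_even_ge0.
- apply: emeasurable_funM => //.
  by apply/measurable_EFinP; exact: measurable_normal_pdf.
- apply: emeasurable_funM => //.
  by apply/measurable_EFinP; exact: measurable_normal_pdf.
move=> x _; rewrite -!EFinM lee_fin !normal_pdfE0//; last by rewrite gt_eqF.
rewrite subr0 (normal_peakM (_ : 0 < 2) s0)//.
(* In this variable the two exponents are -4 y and -y, and y^2 exp(-4 y) <= exp(-y) is left to
   prove. *)
set y := x ^+ 2 / (8 * s ^+ 2).
have y0 : 0 <= y by rewrite divr_ge0 ?sqr_ge0// mulr_ge0// sqr_ge0.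
have -> : - x ^+ 2 / (s ^+ 2 *+ 2) = - y *+ 4 by rewrite /y; field.
have -> : - x ^+ 2 / ((2 * s) ^+ 2 *+ 2) = - y by rewrite /y; field.
have -> : x ^+ 4 = 64 * s ^+ 4 * y ^+ 2 by rewrite /y; field.
have ey : y <= expR y by rewrite (le_trans _ (expR_ge1Dx y))// lerDr.
have ey2 : y ^+ 2 * expR (- y *+ 4) <= expR (- y).
  rewrite -mulr_natl expRM_natl.
  have e1 : expR (- y) * expR y = 1 by rewrite -expRD addNr expR0.
  set E := expR (- y) in e1 *; set F := expR y in e1 ey.
  have E0 : 0 < E by exact: expR_gt0.
  have E1 : E <= 1 by rewrite -expR0 ler_expR oppr_le0.
  have yE : y * E <= 1 by rewrite -e1 mulrC ler_wpM2l// ltW.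
  have yE0 : 0 <= y * E by rewrite mulr_ge0// ltW.
  have -> : y ^+ 2 * E ^+ 4 = (y * E) ^+ 2 * (E * E) by ring.
  rewrite -[leRHS]mul1r; apply: ler_pM; rewrite ?sqr_ge0 ?mulr_ge0 ?(ltW E0)//.
  - by rewrite expr_le1.
  - by rewrite ler_piMr// ltW.
have := normal_peak_ge0 (2 * s); set P := normal_peak _ => P0.
rewrite [leLHS](_ : _ = 128 * s ^+ 4 * P * (y ^+ 2 * expR (- y *+ 4))); last by ring.
have s4 : 0 <= s ^+ 4 by rewrite exprn_ge0// ltW.
rewrite [leRHS](_ : _ = 128 * s ^+ 4 * P * expR (- y)); last by ring.
by apply: ler_wpM2l ey2; apply: mulr_ge0 => //; apply: mulr_ge0.
Qed.

Let m2 : measurable_fun setT (fun x : mR => (x ^+ 2)%:E).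
Proof. by apply/measurable_EFinP; exact: measurable_funX. Qed.

Lemma normal_pow2_fin : (\int[nu]_x (x ^+ 2)%:E < +oo)%E.
Proof.
apply: (@le_lt_trans _ _ (\int[nu]_x (1 + (x ^+ 4)%:E))%E).
  apply: ge0_le_integral => //.
  - by move=> x _; rewrite lee_fin sqr_ge0.
  - apply: emeasurable_funD => //; apply/measurable_EFinP; exact: measurable_funX.
  - move=> x _; rewrite -EFinD lee_fin; have := sqr_ge0 (x ^+ 2 - 1).
    rewrite -subr_ge0 => h; rewrite -subr_ge0.
    have -> : x ^+ 4 = (x ^+ 2) ^+ 2 by rewrite -exprM.
    by nra.
rewrite ge0_integralD//.
- rewrite integral_cst//= mul1e lte_add_pinfty//.
    by rewrite ltey_eq fin_num_measure.
  by rewrite (le_lt_trans normal_pow4)// ltry.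
- by move=> x _; rewrite lee_fin exprn_even_ge0.
- by apply/measurable_EFinP; exact: measurable_funX.
Qed.

Let mpdf m r : measurable_fun setT (fun x : mR => (pdf m r x)%:E).
Proof. by apply/measurable_EFinP; exact: measurable_normal_pdf. Qed.

Let I2 : (\int[nu]_x (x ^+ 2)%:E = \int[mu]_x ((x ^+ 2)%:E * (pdf 0 s x)%:E))%E.
Proof. by rewrite /nu ge0_integral_normal// => x; rewrite lee_fin sqr_ge0. Qed.

(* Convexity of the exponential in the variance parameter compares the density
   with standard deviation [r * s] to its tangent at [r = 1]; the second moment
   is thereby squeezed, since all densities have integral 1. *)
Lemma normal_pow2 : (\int[nu]_x (x ^+ 2)%:E = (s ^+ 2)%:E)%E.
Proof.
have fin : (\int[nu]_x (x ^+ 2)%:E)%E \is a fin_num.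
  by rewrite ge0_fin_numE ?normal_pow2_fin// integral_ge0// => x _; rewrite lee_fin sqr_ge0.
set V := (\int[nu]_x _)%E in fin *.
rewrite -(fineK fin); congr EFin; set v := fine V.
(* [c * x ^+ 2] is the difference of the two exponents and [r * normal_peak (r * s)] is
   [normal_peak s]; what remains is 1 + z <= exp z. *)
have key r : 0 < r -> forall c, c = (1 - r^-2) / (2 * s ^+ 2) -> forall x,
    pdf 0 s x * (1 + c * x ^+ 2) <= r * pdf 0 (r * s) x.
  move=> r0 c -> x; have rs0 : 0 < r * s by rewrite mulr_gt0.
  rewrite !normal_pdfE0 ?gt_eqF// subr0 (normal_peakM r0 s0).
  have := normal_peak_ge0 (r * s); set P := normal_peak _ => P0.
  have rn0 : r != 0 by rewrite gt_eqF.
  set a := - x ^+ 2 / (s ^+ 2 *+ 2); set b := - x ^+ 2 / ((r * s) ^+ 2 *+ 2).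
  have -> : (1 - r^-2) / (2 * s ^+ 2) * x ^+ 2 = b - a by rewrite /a /b; field; rewrite sn0.
  have -> : expR b = expR a * expR (b - a) by rewrite -expRD; congr expR; ring.
  rewrite [leRHS](_ : _ = (r * P * expR a) * expR (b - a)); last by ring.
  by rewrite ler_wpM2l ?expR_ge1Dx// !mulr_ge0 ?expR_ge0// ltW.
have I1 m r : (\int[mu]_x (pdf m r x)%:E = 1)%E by exact: integral_normal_pdf.
have pe0 m r x : (0 <= (pdf m r x)%:E)%E by rewrite lee_fin normal_pdf_ge0.
(* Integrating [key] gives 1 + c V <= r. Here c > 0, so this bounds V from above, by a quantity that
   tends to [s ^+ 2] as r tends to 1. *)
have ub r : 1 < r -> v <= 2 * s ^+ 2 * r ^+ 2 / (r + 1).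
  move=> r1; have r0 : 0 < r by exact: lt_trans r1.
  set c := (1 - r^-2) / (2 * s ^+ 2).
  have c0 : 0 < c.
    rewrite divr_gt0 ?mulr_gt0 ?exprn_gt0// subr_gt0 invf_lt1 ?exprn_gt0//.
    by rewrite exprn_egt1.
  have : (1 + c%:E * V <= r%:E)%E.
    rewrite /V I2 -{1}(I1 0 s) -ge0_integralZl//; last 3 first.
    - exact: emeasurable_funM.
    - by move=> x _; rewrite mule_ge0// lee_fin sqr_ge0.
    - by rewrite lee_fin ltW.
    rewrite -ge0_integralD//; last 2 first.
    - by move=> x _; rewrite ?adde_ge0// ?mule_ge0// lee_fin ?sqr_ge0// ltW.
    - by apply: emeasurable_funM => //; exact: emeasurable_funM.
    rewrite -[leRHS]mule1 -(I1 0 (r * s)) -ge0_integralZl//; last by rewrite lee_fin ltW.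
    apply: ge0_le_integral => //.
    - by move=> x _; rewrite adde_ge0// ?adde_ge0// ?mule_ge0// lee_fin ?sqr_ge0// ltW.
    - by apply: emeasurable_funD => //; apply: emeasurable_funM => //; exact: emeasurable_funM.
    - exact: emeasurable_funM.
    - move=> x _; rewrite -!EFinM -EFinD lee_fin (le_trans _ (key r r0 c erefl x))//.
      by rewrite [leRHS](_ : _ = pdf 0 s x + c * (x ^+ 2 * pdf 0 s x))//; ring.
  rewrite -(fineK fin) -/v -EFinM -EFinD lee_fin.
  have -> : c = (r - 1) * (r + 1) / (2 * s ^+ 2 * r ^+ 2) by rewrite /c; field; rewrite sn0 gt_eqF.
  move=> h; rewrite ler_pdivlMr ?addr_gt0//.
  have D0 : 0 < 2 * s ^+ 2 * r ^+ 2 by rewrite !mulr_gt0 ?exprn_gt0.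
  have : (r - 1) * (r + 1) / (2 * s ^+ 2 * r ^+ 2) * v <= r - 1 by rewrite lerBrDl.
  set D := 2 * s ^+ 2 * r ^+ 2 in D0 *; have Dn : D != 0 by rewrite gt_eqF.
  rewrite -(ler_pM2r D0) (_ : _ * v * D = (r - 1) * (v * (r + 1))); last by field.
  by rewrite ler_pM2l ?subr_gt0.
(* Now c < 0 and the same inequality bounds V from below; it is written with [e = - c] so that all
   integrands are nonnegative. *)
have lb r : 0 < r < 1 -> 2 * s ^+ 2 * r ^+ 2 / (r + 1) <= v.
  move=> /andP[r0 r1].
  set c := (1 - r^-2) / (2 * s ^+ 2); pose e := - c.
  have e0 : 0 <= e.
    rewrite /e /c -mulNr opprB; apply: divr_ge0; last by rewrite mulr_ge0// sqr_ge0.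
    by rewrite subr_ge0 invf_ge1 ?exprn_gt0// expr_le1// ltW.
  have : (1 <= r%:E + e%:E * V)%E.
    rewrite /V I2 -{1}(I1 0 s) -ge0_integralZl//; last 2 first.
    - exact: emeasurable_funM.
    - by move=> x _; rewrite mule_ge0// lee_fin sqr_ge0.
    rewrite -[r%:E]mule1 -(I1 0 (r * s)) -ge0_integralZl//; last by rewrite lee_fin ltW.
    rewrite -ge0_integralD//; last 4 first.
    - by move=> x _; rewrite mule_ge0// lee_fin ltW.
    - exact: emeasurable_funM.
    - by move=> x _; rewrite mule_ge0// mule_ge0// lee_fin sqr_ge0.
    - by apply: emeasurable_funM => //; exact: emeasurable_funM.
    apply: ge0_le_integral => //.
    - by apply: emeasurable_funD; [exact: emeasurable_funM|apply: emeasurable_funM => //; exact: emeasurable_funM].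
    - move=> x _; rewrite -!EFinM -EFinD lee_fin -lerBlDr (le_trans _ (key r r0 c erefl x))//.
      by rewrite [leRHS](_ : _ = pdf 0 s x - e * (x ^+ 2 * pdf 0 s x))//; rewrite /e; ring.
  rewrite -(fineK fin) -/v -EFinM -EFinD lee_fin.
  have -> : e = (1 - r) * (r + 1) / (2 * s ^+ 2 * r ^+ 2).
    by rewrite /e /c; field; rewrite sn0 gt_eqF.
  move=> h; rewrite ler_pdivrMr ?addr_gt0//.
  have D0 : 0 < 2 * s ^+ 2 * r ^+ 2 by rewrite !mulr_gt0 ?exprn_gt0.
  have : 1 - r <= (1 - r) * (r + 1) / (2 * s ^+ 2 * r ^+ 2) * v by rewrite lerBlDl.
  set D := 2 * s ^+ 2 * r ^+ 2 in D0 *; have Dn : D != 0 by rewrite gt_eqF.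
  rewrite -(ler_pM2r D0) (_ : _ * v * D = (1 - r) * (v * (r + 1))); last by field.
  by rewrite ler_pM2l ?subr_gt0.
have s20 : 0 < s ^+ 2 by rewrite exprn_gt0.
apply/eqP; rewrite eq_le; apply/andP; split; apply/ler_addgt0Pr => e e0.
(* With e = 2 s^2 (r - 1) the bound [ub] is at most s^2 + e, because 2 r^2 <= (r + 1) (2 r - 1) for
   r >= 1. *)
- have r1 : 1 < 1 + e / (2 * s ^+ 2) by rewrite ltrDl divr_gt0// mulr_gt0.
  apply: (le_trans (ub _ r1)); set r := 1 + _ in r1 *.
  have -> : e = s ^+ 2 * (2 * (r - 1)) by rewrite /r; field.
  rewrite ler_pdivrMr; last by rewrite addr_gt0// (lt_trans _ r1).
  have h1 : 0 <= r - 1 by rewrite subr_ge0 ltW.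
  by have := mulr_ge0 (ltW s20) h1; nra.
(* The parameter r = 1 - e / (2 s^2) has to be positive; for e > s^2 the lower bound is trivial, the
   moment being nonnegative. *)
- have [e1|e1] := leP e (s ^+ 2).
    have r1 : 0 < 1 - e / (2 * s ^+ 2) < 1.
      rewrite subr_gt0 ltr_pdivrMr ?mulr_gt0// gtrBl divr_gt0 ?mulr_gt0// andbT mul1r.
      by rewrite (le_lt_trans e1)// ltr_pMl// ltr1n.
    rewrite -lerBlDr; apply: le_trans (lb _ r1); set r := 1 - _ in r1 *.
    have -> : e = s ^+ 2 * (2 * (1 - r)) by rewrite /r; field.
    move/andP: r1 => [r0 r1].
    rewrite ler_pdivlMr; last exact: (addr_gt0 r0 ltr01).
    have h1 : 0 <= 1 - r by rewrite subr_ge0 ltW.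
    by have := mulr_ge0 (ltW s20) h1; nra.
  by rewrite (le_trans (ltW e1))// lerDr fine_ge0// integral_ge0// => x _; rewrite lee_fin sqr_ge0.
Qed.

(* The density with mean [a] lies above its tangent at [a = 0]. *)
Lemma normal_pos_neg : (\int[nu]_x (Num.max x 0)%:E = \int[nu]_x (Num.max (- x) 0)%:E)%E.
Proof.
have mp : measurable_fun setT (fun x : mR => (Num.max x 0)%:E).
  by apply/measurable_EFinP; apply: measurable_maxr.
have mn : measurable_fun setT (fun x : mR => (Num.max (- x) 0)%:E).
  by apply/measurable_EFinP; apply: measurable_maxr.
have M0 (x : R) : 0 <= Num.max x 0 by rewrite le_max lexx orbT.
have fin (f : mR -> R) : measurable_fun setT (fun x : mR => (f x)%:E) ->
    (forall x, 0 <= f x) -> (forall x, f x <= 1 + x ^+ 2) ->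
    (\int[nu]_x (f x)%:E)%E \is a fin_num.
  move=> mf f0 f1; rewrite ge0_fin_numE ?integral_ge0//; last by move=> x _; rewrite lee_fin.
  apply: (@le_lt_trans _ _ (\int[nu]_x (1 + (x ^+ 2)%:E))%E).
    apply: ge0_le_integral => //.
    - by move=> x _; rewrite lee_fin.
    - exact: emeasurable_funD.
    - by move=> x _; rewrite -EFinD lee_fin.
  rewrite ge0_integralD//; last by move=> x _; rewrite lee_fin sqr_ge0.
  rewrite integral_cst//= mul1e lte_add_pinfty ?normal_pow2_fin//.
  by rewrite ltey_eq fin_num_measure.
have finp : (\int[nu]_x (Num.max x 0)%:E)%E \is a fin_num.
  by apply: fin => // x; rewrite ge_max; apply/andP; split; nra.
have finn : (\int[nu]_x (Num.max (- x) 0)%:E)%E \is a fin_num.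
  by apply: fin => // x; rewrite ge_max; apply/andP; split; nra.
have pe0 m r x : (0 <= (pdf m r x)%:E)%E by rewrite lee_fin normal_pdf_ge0.
have key a x : pdf 0 s x * (1 + a * x - a ^+ 2 * s ^+ 2 / 2) <= pdf (a * s ^+ 2) s x.
  rewrite !normal_pdfE0// subr0 -[leLHS]mulrA ler_wpM2l ?normal_peak_ge0//.
  set b := - x ^+ 2 / (s ^+ 2 *+ 2); set c := (X in _ <= expR X).
  have -> : 1 + a * x - a ^+ 2 * s ^+ 2 / 2 = 1 + (c - b) by rewrite /b /c; field.
  have -> : expR c = expR b * expR (c - b) by rewrite -expRD; congr expR; ring.
  by rewrite ler_wpM2l ?expR_ge0 ?expR_ge1Dx.
have gen (f g : mR -> R) (mf : measurable_fun setT (fun x : mR => (f x)%:E))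
    (mg : measurable_fun setT (fun x : mR => (g x)%:E)) (f0 : forall x, 0 <= f x) (g0 : forall x, 0 <= g x)
    (ff : (\int[nu]_x (f x)%:E)%E \is a fin_num) (fg : (\int[nu]_x (g x)%:E)%E \is a fin_num) :
    (exists2 e, e ^+ 2 = 1 & forall x, f x - g x = e * x) ->
    fine (\int[nu]_x (f x)%:E)%E <= fine (\int[nu]_x (g x)%:E)%E.
  case=> e e1 fgx; apply/ler_addgt0Pr => eta eta0.
  set F := fine _; set G := fine _.
  (* Integrating [key] at [e * a] gives a (F - G) <= b with b = a^2 s^2 / 2, and this choice of [a]
     makes b / a equal to [eta]. *)
  pose a := 2 * eta / s ^+ 2.
  have a0 : 0 < a by rewrite divr_gt0 ?mulr_gt0// exprn_gt0.
  pose b := a ^+ 2 * s ^+ 2 / 2.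
  have b0 : 0 <= b by rewrite divr_ge0// mulr_ge0 ?sqr_ge0.
  have : (1 + a%:E * F%:E <= 1 + b%:E + a%:E * G%:E)%E.
    rewrite /F /G !fineK// /nu !ge0_integral_normal//.
    have I1 m r : (\int[mu]_x (pdf m r x)%:E = 1)%E by exact: integral_normal_pdf.
    rewrite -{1}(I1 0 s) -[b%:E]mule1 -{2}(I1 0 s) -(I1 (e * a * s ^+ 2) s).
    have m1 : measurable_fun setT (fun x : mR => (f x)%:E * (pdf 0 s x)%:E)%E by exact: emeasurable_funM.
    have m3 : measurable_fun setT (fun x : mR => (g x)%:E * (pdf 0 s x)%:E)%E by exact: emeasurable_funM.
    have p1 x : (0 <= (f x)%:E * (pdf 0 s x)%:E)%E by rewrite mule_ge0// lee_fin.
    have p2 x : (0 <= (g x)%:E * (pdf 0 s x)%:E)%E by rewrite mule_ge0// lee_fin.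
    have ae0 : (0 <= a%:E)%E by rewrite lee_fin ltW.
    have be0 : (0 <= b%:E)%E by rewrite lee_fin.
    rewrite -!ge0_integralZl//.
    rewrite -!ge0_integralD//.
    + apply: ge0_le_integral => //.
      * by move=> x _; rewrite adde_ge0// mule_ge0.
      * by apply: emeasurable_funD => //; exact: emeasurable_funM.
      * by apply: emeasurable_funD; [apply: emeasurable_funD => //; exact: emeasurable_funM|exact: emeasurable_funM].
      * move=> x _; rewrite -!EFinM -!EFinD lee_fin.
        have := key (e * a) x; rewrite -/b.
        have -> : (e * a) ^+ 2 * s ^+ 2 / 2 = b by rewrite exprMn e1 mul1r.
        have -> : e * a * x = a * (f x - g x) by rewrite fgx; ring.
        by move=> h; nra.
    + by move=> x _; rewrite adde_ge0// mule_ge0.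
    + by apply: emeasurable_funD => //; exact: emeasurable_funM.
    + by move=> x _; rewrite mule_ge0.
    + exact: emeasurable_funM.
    + by move=> x _; rewrite mule_ge0.
    + exact: emeasurable_funM.
    + by move=> x _; rewrite mule_ge0.
    + exact: emeasurable_funM.
  rewrite -!EFinM -!EFinD lee_fin -addrA lerD2l => h.
  have -> : eta = b / a by rewrite /b /a; field; rewrite sn0 gt_eqF.
  by rewrite -(ler_pM2l a0) mulrDr [a * (b / a)]mulrC divfK ?gt_eqF// addrC.
apply/eqP; rewrite -(fineK finp) -(fineK finn) eqe eq_le; apply/andP; split; apply: gen => //.
- exists 1; first by rewrite expr1n.
  by move=> x; rewrite mul1r !maxEle; case: ifP; case: ifP; lra.
- exists (-1); first by rewrite sqrrN expr1n.
  by move=> x; rewrite mulN1r !maxEle; case: ifP; case: ifP; lra.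
Qed.

End gaussian_moments.

(** * Moments of the Poisson law *)

Section poisson_moments.
Context {R : realType}.
Variable r : R.
Hypothesis r0 : 0 <= r.
Let pm n : R := r ^+ n / n`!%:R * expR (- r).

Let pm0 n : 0 <= pm n.
Proof. by rewrite /pm mulr_ge0 ?expR_ge0// divr_ge0// exprn_ge0. Qed.

Lemma poisson_mass : (\sum_(n <oo) (pm n)%:E = 1)%E.
Proof.
rewrite [RHS](_ : _ = (expR (- r))%:E * (expR r)%:E)%E; last first.
  by rewrite -EFinM expRN mulVf ?gt_eqF ?expR_gt0.
under eq_eseriesr do rewrite /pm EFinM muleC.
rewrite /= nneseriesZl/=; last by move=> n _; rewrite lee_fin divr_ge0// exprn_ge0.
congr *%E; rewrite expRE -EFin_lim; last first.
  rewrite /pseries/=; under eq_fun do rewrite mulrC.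
  exact: is_cvg_series_exp_coeff.
apply/congr_lim/funext => n/=; rewrite /pseries/= /series/= -sumEFin//.
by under eq_bigr do rewrite mulrC.
Qed.

(** The Stein-Chen identity, from n [pm n] = r [pm (n - 1)]. Taking [phi] constant and then the
    identity yields the first two moments. *)
Lemma poisson_shift (phi : nat -> R) : (forall n, 0 <= phi n) ->
  (\sum_(n <oo) (n%:R * phi n.-1 * pm n)%:E = r%:E * \sum_(n <oo) (phi n * pm n)%:E)%E.
Proof.
move=> p0; rewrite nneseries_recl//; last by move=> k _; rewrite lee_fin; apply: mulr_ge0 => //; apply: mulr_ge0.
rewrite mul0r mul0r add0e -nneseries_addn; last by move=> k; rewrite lee_fin; apply: mulr_ge0 => //; apply: mulr_ge0.
rewrite -nneseriesZl; last by move=> k _; rewrite lee_fin; apply: mulr_ge0.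
apply: eq_eseriesr => k _; rewrite -EFinM addn1 /=; congr EFin.
rewrite /pm factS natrM exprS.
have h1 : (k.+1)%:R != 0 :> R by rewrite pnatr_eq0.
have h2 : k`!%:R != 0 :> R by rewrite pnatr_eq0 -lt0n fact_gt0.
move: (k.+1%:R : R) (k`!%:R : R) h1 h2 => a b a0 b0.
by field; rewrite ?a0 ?b0.
Qed.

Lemma poisson_moment1 : (\sum_(n <oo) (n%:R * pm n)%:E = r%:E)%E.
Proof.
have := poisson_shift (fun=> ler01).
under eq_eseriesr do rewrite mulr1.
under [X in _ = (_ * X)%E -> _]eq_eseriesr do rewrite mul1r.
by rewrite poisson_mass mule1.
Qed.

Lemma poisson_moment2 : (\sum_(n <oo) (n%:R ^+ 2 * pm n)%:E = (r ^+ 2 + r)%:E)%E.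
Proof.
have := poisson_shift (fun n => ler0n R n).
rewrite poisson_moment1 => h.
transitivity (\sum_(n <oo) ((n%:R * n.-1%:R * pm n)%:E + (n%:R * pm n)%:E))%E.
  apply: eq_eseriesr => -[_|n _]; rewrite -EFinD; congr EFin; first by ring.
  by rewrite /= -[n.+1]addn1 natrD; ring.
rewrite nneseriesD//; last 2 first.
- by move=> n _ _; rewrite lee_fin; apply: mulr_ge0 => //; apply: mulr_ge0.
- by move=> n _ _; rewrite lee_fin; apply: mulr_ge0.
by rewrite h poisson_moment1 -EFinM -EFinD expr2.
Qed.

End poisson_moments.

(** * Conditional means *)

Section measurable_wrt_theory.
Context {d : measure_display} {T : measurableType d} {R : realType}.
Implicit Types (H : set (set T)) (X Y Z : T -> R) (c : R).

(** Generating from a sigma-algebra adds nothing, so closure properties of measurable functions can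
    be read on the generated type. *)
Lemma measurable_wrtP H X : sigma_algebra setT H -> measurable_wrt H X <->
  @measurable_fun _ _ (g_sigma_algebraType H) (measurableTypeR R) setT X.
Proof.
move=> sH; have HE : <<s H >> = H by apply: sigma_algebra_id.
split=> [h _ B mB|h B mB].
  by rewrite setTI -[X in X _]/(<<s H >>) HE; exact: h.
by have := h measurableT B mB; rewrite setTI -[X in X _ -> _]/(<<s H >>) HE.
Qed.

Lemma measurable_wrt_sub H H' X : H `<=` H' -> measurable_wrt H X -> measurable_wrt H' X.
Proof. by move=> HH h B mB; apply: HH; exact: h. Qed.

Lemma measurable_wrt_fun H X : H `<=` measurable -> measurable_wrt H X ->
  measurable_fun setT X.
Proof. by move=> HH h _ B mB; rewrite setTI; apply: HH; exact: h. Qed.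

Section closure.
Variable H : set (set T).
Hypothesis sH : sigma_algebra setT H.

Lemma measurable_wrt_cst c : measurable_wrt H (fun=> c).
Proof. by apply/measurable_wrtP. Qed.

Lemma measurable_wrtD X Y : measurable_wrt H X -> measurable_wrt H Y ->
  measurable_wrt H (fun w => X w + Y w).
Proof.
move=> /(measurable_wrtP _ sH) hX /(measurable_wrtP _ sH) hY.
by apply/(measurable_wrtP _ sH); exact: measurable_funD.
Qed.

Lemma measurable_wrtM X Y : measurable_wrt H X -> measurable_wrt H Y ->
  measurable_wrt H (fun w => X w * Y w).
Proof.
move=> /(measurable_wrtP _ sH) hX /(measurable_wrtP _ sH) hY.
by apply/(measurable_wrtP _ sH); exact: measurable_funM.
Qed.

Lemma measurable_wrt_comp (phi : R -> R) X : measurable_fun setT phi ->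
  measurable_wrt H X -> measurable_wrt H (fun w => phi (X w)).
Proof.
move=> mphi hX B mB; rewrite (_ : _ @^-1` _ = X @^-1` (phi @^-1` B))//.
by apply: hX; rewrite -[_ @^-1` _]setTI; exact: mphi.
Qed.

Lemma measurable_wrtN X : measurable_wrt H X -> measurable_wrt H (fun w => - X w).
Proof. by move=> hX; apply: measurable_wrt_comp => //; exact: oppr_measurable. Qed.

Lemma measurable_wrtB X Y : measurable_wrt H X -> measurable_wrt H Y ->
  measurable_wrt H (fun w => X w - Y w).
Proof. by move=> hX hY; apply: measurable_wrtD => //; exact: measurable_wrtN. Qed.

Lemma measurable_wrt_sum (I : Type) (s : seq I) (P : pred I) (F : I -> T -> R) :
  (forall i, P i -> measurable_wrt H (F i)) ->
  measurable_wrt H (fun w => \sum_(i <- s | P i) F i w).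
Proof.
move=> h; elim: s => [|i s ih].
  by under eq_fun do rewrite big_nil; exact: measurable_wrt_cst.
case Pi : (P i); under eq_fun do rewrite big_cons Pi; last exact: ih.
exact: measurable_wrtD (h _ Pi) ih.
Qed.

Lemma measurable_wrt_cvg (X_ : nat -> T -> R) X :
  (forall n, measurable_wrt H (X_ n)) -> (forall w, X_ n w @[n --> \oo] --> X w) ->
  measurable_wrt H X.
Proof.
move=> hX cX; apply/(measurable_wrtP _ sH).
apply: (@measurable_fun_cvg _ (g_sigma_algebraType H) _ _ X_) => //.
by move=> n; apply/(measurable_wrtP _ sH).
Qed.

Lemma measurable_wrt_indic (A : set T) : H A -> measurable_wrt H (\1_A : T -> R).
Proof.
move=> HA; apply/(measurable_wrtP _ sH); apply: (@measurable_indic _ (g_sigma_algebraType H)).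
exact: sub_sigma_algebra.
Qed.

End closure.

Variable Pr : probability T R.

Definition bounded_wrt H Z := measurable_wrt H Z /\ exists c, forall w, `|Z w| <= c.

Lemma bounded_wrt_cst H c : sigma_algebra setT H -> bounded_wrt H (fun=> c).
Proof. by move=> sH; split; [exact: measurable_wrt_cst|exists `|c|]. Qed.

Lemma bounded_wrtM H X Y : sigma_algebra setT H -> bounded_wrt H X -> bounded_wrt H Y ->
  bounded_wrt H (fun w => X w * Y w).
Proof.
move=> sH [hX [c Xc]] [hY [c' Yc]]; split; first exact: measurable_wrtM.
by exists (c * c') => w; rewrite normrM ler_pM.
Qed.

Lemma bounded_wrt_sub H H' X : H `<=` H' -> bounded_wrt H X -> bounded_wrt H' X.
Proof. by move=> HH [hX cX]; split=> //; exact: measurable_wrt_sub hX. Qed.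

Lemma bounded_wrt_indic H (A : set T) : sigma_algebra setT H -> H A ->
  bounded_wrt H (\1_A : T -> R).
Proof.
move=> sH HA; split; first exact: measurable_wrt_indic.
by exists 1 => w; rewrite indicE; case: (w \in A); rewrite ?normr1 ?normr0.
Qed.

(* [X] is integrable with vanishing conditional expectation given [H]. *)
Definition mean_zero_wrt H X :=
  intg Pr X /\ forall Z, bounded_wrt H Z -> mean Pr (fun w => Z w * X w) = 0.

Lemma bounded_intg H Z X : H `<=` measurable -> bounded_wrt H Z -> intg Pr X ->
  intg Pr (fun w => Z w * X w).
Proof.
move=> Hm [hZ [c Zc]] iX; apply: (@intg_le _ _ _ Pr _ (fun w => c * `|X w|)).
- by apply: measurable_funM; [exact: measurable_wrt_fun hZ|exact: intg_meas iX].
- by apply: intgZ; exact: intg_norm.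
- by move=> w; rewrite normrM ler_wpM2r.
Qed.

Lemma mean_zero_wrtM H Z X : sigma_algebra setT H -> H `<=` measurable ->
  bounded_wrt H Z -> mean_zero_wrt H X -> mean_zero_wrt H (fun w => Z w * X w).
Proof.
move=> sH Hm bZ [iX hX]; split; first exact: (bounded_intg Hm).
move=> Z' bZ'; have := hX _ (bounded_wrtM sH bZ' bZ).
by under eq_fun do rewrite -mulrA.
Qed.

Lemma mean_zero_wrtD H X Y : H `<=` measurable ->
  mean_zero_wrt H X -> mean_zero_wrt H Y -> mean_zero_wrt H (fun w => X w + Y w).
Proof.
move=> Hm [iX hX] [iY hY]; split; first exact: intgD.
move=> Z bZ; under eq_fun do rewrite mulrDr.
by rewrite meanD ?hX ?hY ?addr0//; exact: (bounded_intg Hm).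
Qed.

Lemma mean_zero_wrt0 H : mean_zero_wrt H (fun=> 0).
Proof.
split; first exact: intg_cst.
by move=> Z _; under eq_fun do rewrite mulr0; rewrite mean_cst.
Qed.

Lemma mean_zero_wrt_sum H (I : Type) (s : seq I) (P : pred I) (F : I -> T -> R) :
  H `<=` measurable -> (forall i, P i -> mean_zero_wrt H (F i)) ->
  mean_zero_wrt H (fun w => \sum_(i <- s | P i) F i w).
Proof.
move=> Hm h; elim: s => [|i s ih].
  by under eq_fun do rewrite big_nil; exact: mean_zero_wrt0.
case Pi : (P i); under eq_fun do rewrite big_cons Pi; last exact: ih.
exact: mean_zero_wrtD (h _ Pi) ih.
Qed.

Definition law_events X : set (set T) :=
  [set A | exists2 B : set R, measurable B & A = X @^-1` B].

Lemma independent2_mean H X Y : independent2 Pr H (law_events X) ->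
  measurable_wrt H Y -> intg Pr X -> intg Pr Y ->
  intg Pr (fun w => Y w * X w) /\ mean Pr (fun w => Y w * X w) = mean Pr Y * mean Pr X.
Proof.
move=> ind hY iX iY; apply: indepRV_mean => // A B mA mB.
by apply: ind; [exact: hY|exists B].
Qed.

Lemma independent2_mean_zero H X : H `<=` measurable ->
  independent2 Pr H (law_events X) -> intg Pr X -> mean Pr X = 0 -> mean_zero_wrt H X.
Proof.
move=> Hm ind iX X0; split=> // Z [hZ [c Zc]].
have iZ : intg Pr Z by apply: intg_bounded Zc; exact: measurable_wrt_fun hZ.
by have [_ ->] := independent2_mean ind hZ iX iZ; rewrite X0 mulr0.
Qed.

Lemma law_events_comp X (phi : R -> R) : measurable_fun setT phi ->
  law_events (fun w => phi (X w)) `<=` law_events X.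
Proof.
move=> mphi A [B mB ->]; exists (phi @^-1` B) => //.
by rewrite -[_ @^-1` _]setTI; exact: mphi.
Qed.

Lemma independent2_subr (G1 G2 G2' : set (set T)) : G2' `<=` G2 ->
  independent2 Pr G1 G2 -> independent2 Pr G1 G2'.
Proof. by move=> s h A B GA GB; apply: h => //; exact: s. Qed.

Lemma independent2_subl (G1 G1' G2 : set (set T)) : G1' `<=` G1 ->
  independent2 Pr G1 G2 -> independent2 Pr G1' G2.
Proof. by move=> s h A B GA GB; apply: h => //; exact: s. Qed.

End measurable_wrt_theory.

(** * Independence of the sources of noise *)

Section poisson_point_process_theory.
Context {d : measure_display} {T : measurableType d} {R : realType}.
Variable Pr : probability T R.
Variable Np : R.-ker T ~> (marked R).
Implicit Types (C : set (marked R)) (u : R).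
Hypothesis ppp : poisson_point_process Pr Np.

Definition count_events (C : set (marked R)) : set (set T) :=
  [set A | exists2 B : set (\bar R), measurable B & A = (Np ^~ C) @^-1` B].

Lemma count_measurable C : measurable C -> measurable_fun setT (Np ^~ C).
Proof. by move=> mC; exact: measurable_kernel. Qed.

Lemma count_events_measurable C : measurable C -> count_events C `<=` measurable.
Proof.
by move=> mC A [B mB ->]; rewrite -[_ @^-1` _]setTI; exact: count_measurable.
Qed.

Lemma ppp_independent (I : finType) (C : I -> set (marked R)) :
  (forall i, measurable (C i)) -> trivIset setT C ->
  independent Pr (fun i => count_events (C i)).
Proof.
move=> mC tC A AC; have [_ _ ind] := ppp.
have tC' : trivIset setT (fun j : 'I_#|I| => C (enum_val j)).
  move=> i j _ _ ij; apply: enum_val_inj; exact: tC.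
have := ind _ (fun j : 'I_#|I| => C (enum_val j)) (fun j => mC _) tC'
  (fun j => A (enum_val j)) (fun j => AC _).
rewrite (_ : \bigcap_i A (enum_val i) = \bigcap_i A i); last first.
  apply/seteqP; split=> w /= h i _; last exact: h.
  by have := h (enum_rank i) Logic.I; rewrite enum_rankK.
move=> ->; rewrite -(@big_enum_val _ _ _ _ predT (fun i => Pr (A i)))//=.
Qed.

Definition past_cells (u : R) : set (marked R) := [set z | 0 <= z.2 <= u].

Lemma measurable_past_cells u : measurable (past_cells u).
Proof.
rewrite (_ : past_cells u = setT `*` `[0, u]); last first.
  by apply/seteqP; split=> -[x s] /=; rewrite in_itv/=; [|case].
exact: measurableX.
Qed.

(** The counts of disjoint sets are independent by definition, but the sets that define the past may
    overlap. Finitely many of them are cut into the atoms of the algebra they generate; their counts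
    are sums of counts of atoms, and the atoms are disjoint from each other and from [C]. Dynkin's
    argument is used twice, for finite families of past counts and for the events determined by the
    atoms. *)
Lemma ppp_future_independent u C : measurable C -> C `<=` [set z : marked R | u < z.2] ->
  independent2 Pr <<s ppp_events Np (past_cells u) >> (count_events C).
Proof.
move=> mC Cu.
pose good (x : set (marked R) * set (\bar R)) :=
  [/\ measurable x.1, x.1 `<=` past_cells u & measurable x.2].
pose G : set (set T) := [set A | exists n (c : 'I_n -> set (marked R) * set (\bar R)),
   (forall i, good (c i)) /\ A = \bigcap_i ((Np ^~ (c i).1) @^-1` (c i).2)].
have sub : ppp_events Np (past_cells u) `<=` G.
  move=> A [C' [B [mC' C'u mB ->]]]; exists 1%N, (fun=> (C', B)); split=> //.
  by apply/seteqP; split=> w /=; [move=> h ? _|move=> h; exact: (h ord0 Logic.I)].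
apply: (@independent2_subl _ _ _ Pr <<s G >>); first exact: sub_smallest2r.
apply: independent2_sigma.
- move=> _ _ [m [c [gc ->]]] [n [e [ge ->]]].
  exists (m + n)%N, (fun i => match fintype.split i with inl j => c j | inr j => e j end).
  split; first by move=> i; case: (fintype.split i).
  apply/seteqP; split=> w.
    by case=> hc he i _ /=; case: (fintype.split i) => j; [exact: hc|exact: he].
  move=> h; split=> i _ /=.
    by have := h (lshift n i) Logic.I; rewrite /= (unsplitK (inl i)).
  by have := h (rshift m i) Logic.I; rewrite /= (unsplitK (inr i)).
- move=> _ [n [c [gc ->]]]; apply: fin_bigcap_measurable => [|i _]; first exact: finite_finset.
  have [mc _ mB] := gc i; rewrite -[_ @^-1` _]setTI; exact: count_measurable.
- exact: count_events_measurable.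
move=> A' D [n [c [gc ->]]] hD.
pose atom (e : {ffun 'I_n -> bool}) : set (marked R) :=
  past_cells u `&` \bigcap_i (if e i then (c i).1 else ~` (c i).1).
have matom e : measurable (atom e).
  apply: measurableI; first exact: measurable_past_cells.
  apply: fin_bigcap_measurable => [|i _]; first exact: finite_finset.
  by have [mc _ _] := gc i; case: (e i) => //; exact: measurableC.
(* The summand [unit] stands for the future set [C], so that [C] and all atoms form one disjoint
   family. *)
pose I := (unit + {ffun 'I_n -> bool})%type.
pose F (i : I) := match i with inl _ => C | inr e => atom e end.
have mF i : measurable (F i) by case: i => [?|e] //=; exact: matom.
have tatom : trivIset setT atom.
  move=> e e' _ _ [z [[_ h] [_ h']]]; apply/ffunP => i.
  have := h i Logic.I; have := h' i Logic.I.
  by case: (e i); case: (e' i).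
have tF : trivIset setT F.
  move=> [[]|e] [[]|e'] _ _ //=.
  - by case=> z [/Cu/= zu [/= /andP[_ /le_lt_trans/(_ zu)]]]; rewrite ltxx.
  - by case=> z [[/= /andP[_ uz] _] /Cu/= /(le_lt_trans uz)]; rewrite ltxx.
  - by move=> h; congr inr; exact: tatom.
have ind := ppp_independent mF tF.
pose Gat : set (set T) := [set A | exists B : {ffun 'I_n -> bool} -> set (\bar R),
  (forall e, measurable (B e)) /\ A = \bigcap_e ((Np ^~ (atom e)) @^-1` (B e))].
have indG : independent2 Pr <<s Gat >> (count_events C).
  apply: independent2_sigma.
  - move=> _ _ [B [mB ->]] [B' [mB' ->]]; exists (fun e => B e `&` B' e).
    split; first by move=> e; exact: measurableI.
    by rewrite -bigcapI; apply: eq_bigcapr => e _; rewrite preimage_setI.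
  - move=> _ [B [mB ->]]; apply: fin_bigcap_measurable => [|e _]; first exact: finite_finset.
    rewrite -[_ @^-1` _]setTI; exact: count_measurable.
  - exact: count_events_measurable.
  move=> _ D' [B [mB ->]] [B' mB' ->].
  pose A1 (i : I) : set T := match i with inl _ => (Np ^~ C) @^-1` B' | inr e => (Np ^~ (atom e)) @^-1` (B e) end.
  (* The same family with the condition on [C] removed: its product formula gives the probability of
     the past event alone. *)
  pose A2 (i : I) : set T := match i with inl _ => setT | inr e => (Np ^~ (atom e)) @^-1` (B e) end.
  have e1 : Pr (\bigcap_i A1 i) = (\prod_i Pr (A1 i))%E.
    apply: ind => -[x|e]; [by exists B'|by exists (B e)].
  have e2 : Pr (\bigcap_i A2 i) = (\prod_i Pr (A2 i))%E.
    apply: ind => -[x|e]; [|by exists (B e)].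
    by exists setT => //; rewrite preimage_setT.
  rewrite [X in _ = (Pr X * _)%E](_ : _ = \bigcap_i A2 i); last first.
    apply/seteqP; split=> w.
      by move=> h1 [x|e] _ //=; exact: h1.
    by move=> h e _; exact: (h (inr e)).
  rewrite (_ : _ `&` _ = \bigcap_i A1 i); last first.
    apply/seteqP; split=> w.
      by case=> h1 h2 [x|e] _ //=; exact: h1.
    by move=> h; split=> [e _|]; [exact: (h (inr e))|exact: (h (inl tt))].
  have bu (f : unit -> \bar R) : (\prod_i f i = f tt)%E by rewrite (big_pred1 tt)// => -[].
  rewrite e1 e2 !big_sumType/= !bu /=.
  by rewrite probability_setT mul1e muleC.
apply: indG => //.
have sG : sigma_algebra setT <<s Gat >> by exact: smallest_sigma_algebra.
apply: (@fin_bigcap_measurable _ (g_sigma_algebraType Gat)) => [|i _]; first exact: finite_finset.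
have [mc cS mB] := gc i.
(* [(c i).1] is the disjoint union of the atoms inside it, so its count is measurable for the counts
   of the atoms. *)
have NE : (Np ^~ (c i).1) = (fun w => \sum_(e \in [set e : {ffun 'I_n -> bool} | e i]) Np w (atom e))%E.
  apply/funext => w; rewrite -measure_fin_bigcup//; last 2 first.
  - exact: finite_finset.
  - by apply: sub_trivIset tatom.
  have {1}-> // : (c i).1 = \bigcup_(e in [set e : {ffun 'I_n -> bool} | e i]) atom e.
  apply/seteqP; split=> z.
    move=> cz; exists [ffun k => z \in (c k).1]; first by rewrite /= ffunE inE.
    split; first exact: cS.
    move=> k _; rewrite ffunE; case: ifPn; rewrite ?inE// notin_setE.
    by [].
  by case=> e /= ei [_ h]; have := h i Logic.I; rewrite ei.
rewrite NE.
have mNE : @measurable_fun _ _ (g_sigma_algebraType Gat) _ setT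
    (fun w => \sum_(e \in [set e : {ffun 'I_n -> bool} | e i]) Np w (atom e))%E.
  apply: emeasurable_fsum => [|e]; first exact: finite_finset.
  move=> _ B mB'; rewrite setTI; apply: sub_sigma_algebra.
  exists (fun e' => if e' == e then B else setT); split; first by move=> e'; case: ifP.
  apply/seteqP; split=> w.
    by move=> h e' _ /=; case: eqVneq => // ->.
  by move=> /(_ e Logic.I) /=; rewrite eqxx.
by rewrite -[_ @^-1` _]setTI; exact: mNE.
Qed.

End poisson_point_process_theory.

Section noise_independence.
Context {d : measure_display} {T : measurableType d} {R : realType} {p : nat}.
Variable Pr : probability T R.
Variables (W : 'I_p.+1 -> R -> T -> R) (Np : 'I_p -> R.-ker T ~> (marked R)).
Hypothesis hnoise : noise Pr W Np.
Local Notation src := ('I_p.+1 + 'I_p)%type.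
Implicit Types (k : src) (u t : R).

Definition source_events k : set (set T) :=
  match k with
  | inl i => <<s bm_events (W i) [set s | 0 <= s] >>
  | inr j => <<s ppp_events (Np j) setT >>
  end.

Definition source_past k u : set (set T) :=
  match k with
  | inl i => <<s bm_events (W i) `[0, u] >>
  | inr j => <<s ppp_events (Np j) (past_cells u) >>
  end.

Lemma source_past_sub k u : source_past k u `<=` source_events k.
Proof.
case: k => [i|j] /=; apply: sub_smallest2r; try exact: smallest_sigma_algebra; move=> A.
  move=> [s [B [su mB ->]]]; exists s, B; split=> //.
  by move: su; rewrite /= in_itv/= => /andP[].
by move=> [C [B [mC Cu mB ->]]]; exists C, B; split.
Qed.

Lemma source_events_measurable k : source_events k `<=` measurable.
Proof.
have [bW pN _] := hnoise.
case: k => [i|j] /=; apply: smallest_sub; try exact: sigma_algebra_measurable.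
  move=> A [s [B [s0 mB ->]]]; rewrite -[_ @^-1` _]setTI.
  by have [mW _ _ _ _] := bW i; exact: mW.
move=> A [C [B [mC _ mB ->]]]; rewrite -[_ @^-1` _]setTI.
exact: count_measurable.
Qed.

(* The past of every source and the whole of every source but [k], augmented by
   the null events. *)
Definition others_gen k u : set (set T) :=
  [set A | exists (B : src -> set T) (M : set T),
    [/\ forall k', k' != k -> source_events k' (B k'), source_past k u (B k),
        measurable M, Pr M = 0%E \/ Pr M = 1%E & A = (\bigcap_k' B k') `&` M]].

Definition others k u : set (set T) := <<s others_gen k u >>.

Lemma others_sigma k u : sigma_algebra setT (others k u).
Proof. exact: smallest_sigma_algebra. Qed.

Lemma source_sigma k : sigma_algebra setT (source_events k).
Proof. by case: k => [i|j]; exact: smallest_sigma_algebra. Qed.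

Lemma past_sigma k u : sigma_algebra setT (source_past k u).
Proof. by case: k => [i|j]; exact: smallest_sigma_algebra. Qed.

Let sigmaT (G : set (set T)) : sigma_algebra setT G -> G setT.
Proof. by case=> G0 GC _; rewrite -(setD0 setT); exact: GC. Qed.

Let sigmaI (G : set (set T)) A B : sigma_algebra setT G -> G A -> G B -> G (A `&` B).
Proof.
move=> sG GA GB; have HE : <<s G >> = G by apply: sigma_algebra_id.
rewrite -HE; apply: (@measurableI _ (g_sigma_algebraType G)); apply: sub_sigma_algebra => //.
Qed.

Lemma others_genE k u B M : (forall k', k' != k -> source_events k' (B k')) ->
  source_past k u (B k) -> measurable M -> Pr M = 0%E \/ Pr M = 1%E ->
  others k u ((\bigcap_k' B k') `&` M).
Proof. by move=> hB hk mM M01; apply: sub_sigma_algebra; exists B, M. Qed.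

Lemma others_measurable k u : others k u `<=` measurable.
Proof.
apply: smallest_sub; first exact: sigma_algebra_measurable.
move=> A [B [M [hB hk mM _ ->]]]; apply: measurableI => //.
apply: fin_bigcap_measurable => [|k' _]; first exact: finite_finset.
apply: (@source_events_measurable k'); have [->|/hB//] := eqVneq k' k.
exact: source_past_sub hk.
Qed.

Lemma source_sub_others k k' u : k' != k -> source_events k' `<=` others k u.
Proof.
move=> kk' A hA.
have := @others_genE k u (fun l => if l == k' then A else setT) setT.
rewrite setIT (_ : \bigcap__ _ = A); last first.
  apply/seteqP; split=> w; first by move=> /(_ k' Logic.I); rewrite eqxx.
  by move=> Aw l _; case: ifP.
apply => //.
- by move=> l lk; case: eqVneq => [->//|_]; exact: (sigmaT (source_sigma _)).
- by rewrite eq_sym (negbTE kk'); exact: (sigmaT (past_sigma _ _)).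
- by right; exact: probability_setT.
Qed.

Lemma past_sub_others k k' u : source_past k' u `<=` others k u.
Proof.
have [->|kk'] := eqVneq k' k; last first.
  by apply: subset_trans (@source_sub_others k k' u kk'); exact: source_past_sub.
move=> A hA.
have := @others_genE k u (fun l => if l == k then A else setT) setT.
rewrite setIT (_ : \bigcap__ _ = A); last first.
  apply/seteqP; split=> w; first by move=> /(_ k Logic.I); rewrite eqxx.
  by move=> Aw l _; case: ifP.
apply => //.
- by move=> l lk; rewrite (negbTE lk); exact: (sigmaT (source_sigma _)).
- by rewrite eqxx.
- by right; exact: probability_setT.
Qed.

Lemma noise_filtration_sub_others k u : noise_filtration Pr W Np u `<=` others k u.
Proof.
apply: smallest_sub; first exact: others_sigma.
move=> A /= [[i hA]|[j hA]|[mA A0]].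
- by apply: (@past_sub_others k (inl i)); exact: sub_sigma_algebra.
- by apply: (@past_sub_others k (inr j)); exact: sub_sigma_algebra.
- have := @others_genE k u (fun=> setT) A.
  rewrite (_ : \bigcap__ _ = setT) ?setTI; last by rewrite bigcapT.
  apply => //; [|exact: (sigmaT (past_sigma _ _))|by left].
  by move=> l _; exact: (sigmaT (source_sigma _)).
Qed.

Lemma noise_filtration_sigma u : sigma_algebra setT (noise_filtration Pr W Np u).
Proof. exact: smallest_sigma_algebra. Qed.

Lemma noise_filtration_measurable u : noise_filtration Pr W Np u `<=` measurable.
Proof.
by apply: subset_trans (@others_measurable (inl ord0) u); exact: noise_filtration_sub_others.
Qed.

Lemma noise_filtration_le u t : u <= t ->
  noise_filtration Pr W Np u `<=` noise_filtration Pr W Np t.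
Proof.
move=> ut; apply: sub_smallest2r; first exact: smallest_sigma_algebra.
move=> A /= [[i [s [B [su mB ->]]]]|[j [C [B [mC Cu mB ->]]]]|hA].
- constructor 1; exists i, s, B; split=> //.
  by move: su; rewrite /= !in_itv/= => /andP[-> /le_trans->].
- constructor 2; exists j, C, B; split=> //.
  by move=> z /Cu /= /andP[-> /le_trans->].
- by constructor 3.
Qed.

Lemma others_independent k u (D : set (set T)) : D `<=` source_events k ->
  independent2 Pr (source_past k u) D -> independent2 Pr (others k u) D.
Proof.
move=> Dk ind; have [_ _ hind] := hnoise.
apply: independent2_sigma.
- move=> _ _ [B [M [hB hk mM M01 ->]]] [B' [M' [hB' hk' mM' M01' ->]]].
  exists (fun l => B l `&` B' l), (M `&` M'); split.
  + by move=> l lk; apply: sigmaI; [exact: source_sigma|exact: hB|exact: hB'].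
  + by apply: sigmaI => //; exact: past_sigma.
  + exact: measurableI.
  + case: M01 => [M0|M1].
      by left; apply: (subset_measure0 _ _ _ M0) => //; exact: measurableI.
    case: M01' => [M0'|M1'].
      by left; apply: (subset_measure0 _ _ _ M0') => //; exact: measurableI.
    have c0 N : measurable N -> Pr N = 1%E -> Pr (~` N) = 0%E.
      by move=> mN N1; rewrite probability_setC// N1 subee.
    right; rewrite -[M]setCK -[M']setCK -setCU probability_setC; last first.
      by apply: measurableU; exact: measurableC.
    rewrite [X in (_ - X)%E](_ : _ = 0%E) ?sube0//.
    transitivity (Pr (~` M)); last exact: c0.
    by apply: measureU0; [exact: measurableC|exact: measurableC|exact: c0].
  + by rewrite bigcapI setIACA.
- move=> A hA; apply: (@others_measurable k u); exact: sub_sigma_algebra.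
- by apply: subset_trans Dk _; exact: source_events_measurable.
move=> _ D' [B [M [hB hk mM M01 ->]]] hD'.
have mB l : measurable (B l).
  apply: (@source_events_measurable l); have [->|/hB//] := eqVneq l k.
  exact: source_past_sub hk.
have mD' : measurable D' by apply: (@source_events_measurable k); exact: Dk.
have mX : measurable (\bigcap_l B l).
  by apply: fin_bigcap_measurable => [|l _]; [exact: finite_finset|exact: mB].
case: M01 => [M0|M1].
  rewrite (_ : Pr (_ `&` _ `&` _) = 0%E); last first.
    apply: (subset_measure0 _ _ _ M0) => //; last by move=> w [[]].
    by apply: measurableI => //; exact: measurableI.
  rewrite (_ : Pr (_ `&` _) = 0%E) ?mul0e//.
  by apply: (subset_measure0 _ _ _ M0) => //; exact: measurableI.
have PM X : measurable X -> Pr (X `&` M) = Pr X.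
  move=> mX'; rewrite -[in RHS](setIT X) -(setUv M) setIUr measureU; last 3 first.
  - exact: measurableI.
  - by apply: measurableI => //; exact: measurableC.
  - by rewrite setIACA setICr setI0.
  rewrite [X in (_ + X)%E](_ : _ = 0%E) ?adde0//.
  apply: (@subset_measure0 _ _ _ Pr _ (~` M)) => //.
  - by apply: measurableI => //; exact: measurableC.
  - exact: measurableC.
  - by apply: (eq_trans (probability_setC _ mM)); rewrite M1 subee.
rewrite setIAC !PM//; last exact: measurableI.
pose B' l := if l == k then B l `&` D' else B l.
have sB l : source_events l (B l).
  by have [->|/hB//] := eqVneq l k; exact: source_past_sub hk.
have e1 : Pr (\bigcap_l B l) = (\prod_l Pr (B l))%E.
  by apply: hind => l; have := sB l; case: l.
have e2 : Pr (\bigcap_l B' l) = (\prod_l Pr (B' l))%E.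
  apply: hind => l; suff : source_events l (B' l) by case: l.
  rewrite /B'; case: eqVneq => [->|_]; last exact: sB.
  by apply: sigmaI; [exact: source_sigma|exact: sB|exact: Dk].
rewrite (_ : _ `&` _ = \bigcap_l B' l); last first.
  apply/seteqP; split=> w.
    by case=> h1 h2 l _; rewrite /B'; case: ifP => _; [split=> //|]; exact: h1.
  move=> h; split; last by have := h k Logic.I; rewrite /B' eqxx => -[].
  by move=> l _; have := h l Logic.I; rewrite /B'; case: ifP => // _ [].
rewrite e1 e2 (bigD1 k)//= [in RHS](bigD1 k)//= {1}/B' eqxx ind//.
rewrite muleAC; congr (_ * _ * _)%E; apply: eq_bigr => l lk.
by rewrite /B' (negbTE lk).
Qed.

Lemma increment_independent i u t : 0 <= u -> u < t ->
  independent2 Pr (others (inl i) u) (law_events (fun w => W i t w - W i u w)).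
Proof.
move=> u0 ut; have [bW _ _] := hnoise; have [_ _ _ _ ind] := bW i.
apply: others_independent; last exact: ind.
have sS := source_sigma (inl i).
have mW s : 0 <= s -> measurable_wrt (source_events (inl i)) (W i s).
  by move=> s0 B mB; apply: sub_sigma_algebra; exists s, B.
move=> A [B mB ->].
by apply: (measurable_wrtB sS (mW t _) (mW u u0)) => //; exact: le_trans (ltW ut).
Qed.

Lemma count_independent j u C : measurable C -> C `<=` [set z : marked R | u < z.2] ->
  independent2 Pr (others (inr j) u) (count_events (Np j) C).
Proof.
move=> mC Cu; have [_ pN _] := hnoise.
apply: others_independent; last exact: ppp_future_independent.
by move=> A [B mB ->]; apply: sub_sigma_algebra; exists C, B.
Qed.

End noise_independence.

(** * Moments of variables with normal or Poisson law *)

Section increment_moments.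
Context {d : measure_display} {T : measurableType d} {R : realType}.
Variable Pr : probability T R.

Section gaussian.
Variables (X : T -> R) (s : R).
Hypothesis mX : measurable_fun setT X.
Hypothesis s0 : 0 < s.
Hypothesis lawX : forall B : set R, measurable B -> Pr (X @^-1` B) = normal_prob 0 s B.

Lemma gaussian_integral (phi : measurableTypeR R -> \bar R) :
  measurable_fun setT phi -> (forall x, 0 <= phi x)%E ->
  (\int[Pr]_w phi (X w) = \int[normal_prob 0 s]_x phi x)%E.
Proof.
move=> mphi phi0; rewrite -[LHS](@ge0_integral_pushforward _ _ T (measurableTypeR R) R X _ Pr setT phi)//.
by apply: eq_measure_integral => A mA _; exact: lawX.
Qed.

Let mpow n : measurable_fun setT (fun x : measurableTypeR R => (x ^+ n)%:E).
Proof. by apply/measurable_EFinP; exact: measurable_funX. Qed.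

Lemma gaussian_sqintg : sqintg Pr X.
Proof.
split=> //; apply/integrableP; split.
  by apply/measurable_EFinP; exact: measurable_funX.
under eq_integral do rewrite /= ger0_norm ?sqr_ge0//.
rewrite (gaussian_integral (mpow 2)); last by move=> x; rewrite lee_fin sqr_ge0.
by rewrite normal_pow2// ltry.
Qed.

Lemma gaussian_mean2 : mean Pr (fun w => X w ^+ 2) = s ^+ 2.
Proof.
rewrite /mean /Rintegral (gaussian_integral (mpow 2)); last by move=> x; rewrite lee_fin sqr_ge0.
by rewrite normal_pow2.
Qed.

Lemma gaussian_intg4 : intg Pr (fun w => X w ^+ 4).
Proof.
apply/integrableP; split.
  by apply/measurable_EFinP; exact: measurable_funX.
under eq_integral do rewrite /= ger0_norm ?exprn_even_ge0//.
rewrite (gaussian_integral (mpow 4)); last by move=> x; rewrite lee_fin exprn_even_ge0.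
by rewrite (le_lt_trans (normal_pow4 s0))// ltry.
Qed.

Lemma gaussian_mean4 : mean Pr (fun w => X w ^+ 4) <= 128 * s ^+ 4.
Proof.
rewrite -lee_fin EFin_mean; last exact: gaussian_intg4.
rewrite (gaussian_integral (mpow 4)); last by move=> x; rewrite lee_fin exprn_even_ge0.
exact: normal_pow4.
Qed.

Lemma gaussian_mean0 : mean Pr X = 0.
Proof.
have iX := sqintg_intg gaussian_sqintg.
have mp : measurable_fun setT (fun x : measurableTypeR R => (Num.max x 0)%:E).
  by apply/measurable_EFinP; apply: measurable_maxr.
have mn : measurable_fun setT (fun x : measurableTypeR R => (Num.max (- x) 0)%:E).
  by apply/measurable_EFinP; apply: measurable_maxr.
have M0 (x : R) : 0 <= Num.max x 0 by rewrite le_max lexx orbT.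
have ip : intg Pr (fun w => Num.max (X w) 0).
  apply: (intg_le _ (intg_norm iX)).
    by apply: measurable_maxr.
  by move=> w; rewrite ger0_norm// ge_max normr_ge0 ler_norm.
have iN : intg Pr (fun w => Num.max (- X w) 0).
  apply: (intg_le _ (intg_norm iX)).
    by apply: measurable_maxr => //; exact: measurable_funN.
  by move=> w; rewrite ger0_norm// ge_max normr_ge0 -normrN ler_norm.
have -> : X = fun w => Num.max (X w) 0 - Num.max (- X w) 0.
  by apply/funext => w; rewrite !maxEle; case: ifP; case: ifP; lra.
rewrite meanB//; apply/eqP; rewrite subr_eq0; apply/eqP; apply: EFin_inj.
rewrite !EFin_mean//.
have := normal_pos_neg s0.
rewrite -(gaussian_integral mp); last by move=> x; rewrite lee_fin.
by rewrite -(gaussian_integral mn)// => x; rewrite lee_fin.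
Qed.

End gaussian.

Section poisson.
Variables (N : T -> \bar R) (r : R).
Hypothesis mN : measurable_fun setT N.
Hypothesis valN : forall w, N w = +oo%E \/ exists n : nat, N w = n%:R%:E.
Hypothesis r0 : 0 <= r.
Hypothesis lawN : forall n : nat,
  Pr [set w | N w = n%:R%:E] = (r ^+ n / n`!%:R * expR (- r))%:E.

Let lev n := [set w | N w = n%:R%:E].

Let mlev n : measurable (lev n).
Proof.
rewrite (_ : lev n = N @^-1` [set n%:R%:E])// -[_ @^-1` _]setTI.
by apply: mN => //; exact: emeasurable_set1.
Qed.

Let tlev : trivIset setT lev.
Proof.
move=> i j _ _ [w [e1 e2]]; have : N w = i%:R%:E by exact: e1.
rewrite (_ : N w = j%:R%:E); last exact: e2.
by move=> /eqP; rewrite eqe eqr_nat => /eqP ->.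
Qed.

Let fin_set : \bigcup_n lev n = [set w | N w < +oo]%E.
Proof.
apply/seteqP; split=> w /=; first by case=> n _ /= ->; rewrite ltry.
by case: (valN w) => [->|[n Nn] _]; [rewrite ltxx|exists n].
Qed.

(** [lawN] speaks of the finite values only; by [poisson_mass] their probabilities already add up to
    1. *)
Lemma poisson_fin : {ae Pr, forall w, (N w < +oo)%E}.
Proof.
have m1 : measurable [set w | N w < +oo]%E.
  by rewrite -fin_set; exact: bigcupT_measurable.
exists (~` [set w | N w < +oo]%E); split=> //; first exact: measurableC.
rewrite probability_setC// -fin_set measure_bigcup//.
rewrite (_ : (\sum_(n <oo | n \in _) _ = 1)%E) ?subee//.
rewrite -(poisson_mass r0) (eq_eseriesl (Q := xpredT)); last by move=> n; rewrite in_setT.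
by apply: eq_eseriesr => n _; exact: lawN.
Qed.

Lemma poisson_integral (phi : nat -> R) : (forall n, 0 <= phi n) ->
  forall Y : T -> R, measurable_fun setT Y -> (forall n w, N w = n%:R%:E -> Y w = phi n) ->
  (forall w, 0 <= Y w) ->
  (\int[Pr]_w (Y w)%:E = \sum_(n <oo) (phi n * (r ^+ n / n`!%:R * expR (- r)))%:E)%E.
Proof.
move=> phi0 Y mY YE Y0.
have mY' (D : set T) : measurable_fun D (EFin \o Y).
  by apply/measurable_EFinP; exact: measurable_funTS.
transitivity (\int[Pr]_(w in \bigcup_n lev n) (Y w)%:E)%E.
  rewrite [RHS]integral_mkcond; apply: ge0_ae_eq_integral => //.
  - apply/(measurable_restrictT (EFin \o Y)) => //; exact: bigcupT_measurable.
  - by move=> w _; rewrite lee_fin.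
  - by move=> w _; rewrite patchE; case: ifP => _; rewrite ?lee_fin.
  - apply: filterS poisson_fin => w fw _; rewrite patchE fin_set.
    by rewrite (_ : w \in _)// inE.
rewrite ge0_integral_bigcup//; last by move=> w _; rewrite lee_fin.
apply: eq_eseriesr => n _.
rewrite (eq_integral (fun=> (phi n)%:E)); last first.
  by move=> w; rewrite inE => /= Nn; rewrite (YE n).
rewrite integral_cst// EFinM; congr (_ * _)%E; exact: lawN.
Qed.

Let X w := fine (N w).

Let mX : measurable_fun setT X.
Proof. exact: measurableT_comp. Qed.

Let XE n w : N w = n%:R%:E -> X w = n%:R.
Proof. by rewrite /X => ->. Qed.

Let X0 w : 0 <= X w.
Proof. by rewrite /X; case: (valN w) => [->//|[n ->]]. Qed.

Lemma poisson_sqintg : sqintg Pr X.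
Proof.
split=> //; apply/integrableP; split.
  by apply/measurable_EFinP; exact: measurable_funX.
under eq_integral do rewrite /= ger0_norm ?sqr_ge0//.
rewrite (poisson_integral (phi := fun n => n%:R ^+ 2)).
- by rewrite poisson_moment2// ltry.
- by move=> n; rewrite sqr_ge0.
- exact: measurable_funX.
- by move=> n w /XE ->.
- by move=> w; rewrite sqr_ge0.
Qed.

Lemma poisson_mean : mean Pr X = r.
Proof.
rewrite /mean /Rintegral (poisson_integral (phi := fun n => n%:R))//.
by rewrite poisson_moment1.
Qed.

Lemma poisson_mean2 : mean Pr (fun w => X w ^+ 2) = r ^+ 2 + r.
Proof.
rewrite /mean /Rintegral (poisson_integral (phi := fun n => n%:R ^+ 2))//.
- by rewrite poisson_moment2.
- exact: measurable_funX.
- by move=> n w /XE ->.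
- by move=> w; rewrite sqr_ge0.
Qed.

End poisson.

End increment_moments.

(** * Stochastic integrals of elementary processes *)

Section elementary_integrals.
Context {d d' : measure_display} {T : measurableType d} {Z : measurableType d'}
  {R : realType}.
Variables (Pr : probability T R) (mu : {measure set Z -> \bar R}).
Variable F : R -> set (set T).
Hypothesis sF : forall u, sigma_algebra setT (F u).
Hypothesis mF : forall u, F u `<=` measurable.
Hypothesis leF : forall u t, u <= t -> F u `<=` F t.

(* An [integrator] assigns to the cell [D a b c], which lies in the time interval
   ]a, b], a square integrable random variable [M a b c] revealed at time [b] and
   orthogonal to the past of [a]; [mu] is its covariance measure. *)
Record integrator (Mk : Type) (ok : Mk -> Prop) (D : R -> R -> Mk -> set Z)
    (M : R -> R -> Mk -> T -> R) : Prop := Integrator {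
  itg_meas : forall a b c, ok c -> measurable (D a b c);
  itg_fin : forall a b c, ok c -> (mu (D a b c) < +oo)%E;
  itg_cap : forall a b c a' b' c', D a b c `&` D a' b' c' =
    D (Num.max a a') (Num.min b b') c `&` D (Num.max a a') (Num.min b b') c';
  itg_empty : forall a b c, b <= a -> D a b c = set0;
  itg_wrt : forall a b c, 0 <= a -> a <= b -> ok c -> measurable_wrt (F b) (M a b c);
  itg_sq : forall a b c, 0 <= a -> a <= b -> ok c -> sqintg Pr (M a b c);
  itg_add : forall a b e c, 0 <= a -> a <= b -> b <= e -> ok c ->
    {ae Pr, forall w, M a e c w = M a b c w + M b e c w};
  itg_mean : forall a b c xi, 0 <= a -> a <= b -> ok c ->
    measurable_wrt (F a) xi -> intg Pr xi ->
    mean Pr (fun w => xi w * M a b c w) = 0;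
  itg_cov : forall a b c c' xi, 0 <= a -> a <= b -> ok c -> ok c' ->
    bounded_wrt (F a) xi ->
    mean Pr (fun w => xi w * (M a b c w * M a b c' w)) =
    mean Pr xi * fine (mu (D a b c `&` D a b c'))
}.

Variables (Mk : Type) (ok : Mk -> Prop) (D : R -> R -> Mk -> set Z)
  (M : R -> R -> Mk -> T -> R).
Hypothesis itg : integrator ok D M.

Record cell := Cell { cxi : T -> R; cstart : R; cend : R; cmark : Mk }.
Implicit Types (x y : cell) (u t : R).

Definition wf u t x : Prop :=
  [/\ u <= cstart x, cstart x <= cend x, cend x <= t, ok (cmark x)
    & bounded_wrt (F (cstart x)) (cxi x)].

Definition cset x : set Z := D (cstart x) (cend x) (cmark x).
Definition crv x : T -> R := M (cstart x) (cend x) (cmark x).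

Definition elem_process (I : finType) (x : I -> cell) (z : Z) (w : T) : R :=
  \sum_i cxi (x i) w * \1_(cset (x i)) z.
Definition elem_integral (I : finType) (x : I -> cell) (w : T) : R :=
  \sum_i cxi (x i) w * crv (x i) w.

Let sq_term u t x : 0 <= u -> wf u t x -> sqintg Pr (fun w => cxi x w * crv x w).
Proof.
move=> u0 [ux xx xt okx [hx [c hc]]]; apply: (@sqintgMb _ _ _ _ _ _ c) => //.
- by apply: (itg_sq itg) => //; exact: le_trans ux.
- exact: measurable_wrt_fun (@mF _) hx.
Qed.

Lemma elem_integral_sqintg u t (I : finType) (x : I -> cell) : 0 <= u ->
  (forall i, wf u t (x i)) -> sqintg Pr (elem_integral x).
Proof. by move=> u0 h; apply: sqintg_sum => i _; exact: sq_term (h i). Qed.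

Lemma elem_integral_mean_zero u t (I : finType) (x : I -> cell) : 0 <= u ->
  (forall i, wf u t (x i)) -> mean_zero_wrt Pr (F u) (elem_integral x).
Proof.
move=> u0 h; apply: mean_zero_wrt_sum => // i _.
have [ux xx xt okx bx] := h i; have x0 := le_trans u0 ux.
have sM := itg_sq itg x0 xx okx.
split; first by apply: (bounded_intg (@mF _) bx); exact: sqintg_intg.
move=> Y bY; under eq_fun do rewrite mulrA.
have bYx : bounded_wrt (F (cstart (x i))) (fun w => Y w * cxi (x i) w).
  by apply: bounded_wrtM => //; exact: bounded_wrt_sub (leF ux) bY.
apply: (itg_mean itg) => //; first by case: bYx.
case: bYx => hYx [c Yc]; apply: intg_bounded Yc.
exact: measurable_wrt_fun (@mF _) hYx.
Qed.

Let mean_ext (X Y : T -> R) : X =1 Y -> mean Pr X = mean Pr Y.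
Proof. by move=> /funext ->. Qed.

Let intg_bM2 u xi a b c a' b' c' : bounded_wrt (F u) xi ->
  0 <= a -> a <= b -> ok c -> 0 <= a' -> a' <= b' -> ok c' ->
  intg Pr (fun w => xi w * (M a b c w * M a' b' c' w)).
Proof.
move=> bxi a0 ab okc a0' ab' okc'; apply: (bounded_intg (@mF _) bxi).
by apply: sqintgM; apply: (itg_sq itg).
Qed.

Let fwd_zero u xi a b c b' e c' : bounded_wrt (F u) xi -> u <= b' ->
  0 <= a -> a <= b -> ok c -> b <= b' -> b' <= e -> ok c' ->
  mean Pr (fun w => xi w * (M a b c w * M b' e c' w)) = 0.
Proof.
move=> bxi ub' a0 ab okc bb' be okc'.
under eq_fun do rewrite mulrA.
have sM := itg_sq itg a0 ab okc.
apply: (itg_mean itg) => //.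
- exact: le_trans a0 (le_trans ab bb').
- apply: measurable_wrtM => //.
    by case: bxi => h _; apply: measurable_wrt_sub h; exact: leF.
  by apply: measurable_wrt_sub (leF bb') _; exact: (itg_wrt itg).
- by apply: (bounded_intg (@mF _) bxi); exact: sqintg_intg.
Qed.

Let cov_split u xi a b c b' c' : bounded_wrt (F u) xi -> u <= a ->
  0 <= a -> a <= b -> b <= b' -> ok c -> ok c' ->
  mean Pr (fun w => xi w * (M a b c w * M a b' c' w)) =
  mean Pr (fun w => xi w * (M a b c w * M a b c' w)).
Proof.
move=> bxi ua a0 ab bb' okc okc'.
have ab' := le_trans ab bb'; have b0 := le_trans a0 ab.
have i1 := intg_bM2 bxi a0 ab okc a0 ab okc'.
have i2 := intg_bM2 bxi a0 ab okc b0 bb' okc'.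
have i3 := intg_bM2 bxi a0 ab okc a0 ab' okc'.
transitivity (mean Pr (fun w => xi w * (M a b c w * M a b c' w) + xi w * (M a b c w * M b b' c' w))).
  apply: mean_ae; [exact: intg_meas i3|exact: intg_meas (intgD i1 i2)|].
  apply: filterS (itg_add itg a0 ab bb' okc') => w ->; ring.
rewrite meanD// [X in _ + X](fwd_zero (u := u)) ?addr0//.
exact: le_trans ab.
Qed.

(** Both variables are reduced to the common time interval. The part of the first before [a'] is
    past for the second, and the overhang of whichever ends later is future for the other, so both
    are orthogonal by [fwd_zero]; [itg_cov] evaluates what is left. [itg_cap] trims the intersection
    of the cells in the same way. *)
Let cov_le u xi a b c a' b' c' : bounded_wrt (F u) xi -> u <= a' ->
  0 <= a -> a <= b -> ok c -> a <= a' -> a' <= b' -> ok c' ->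
  mean Pr (fun w => xi w * (M a b c w * M a' b' c' w)) =
  mean Pr xi * fine (mu (D a b c `&` D a' b' c')).
Proof.
move=> bxi ua' a0 ab okc aa' ab' okc'; have a0' := le_trans a0 aa'.
rewrite (itg_cap itg) (max_idPr aa').
have [ba'|a'b] := leP b a'.
  rewrite (fwd_zero (u := u))// (itg_empty itg); last by rewrite ge_min ba'.
  by rewrite set0I measure0 mulr0.
have a'bW := ltW a'b.
transitivity (mean Pr (fun w => xi w * (M a' b c w * M a' b' c' w))).
  have i1 := intg_bM2 bxi a0 aa' okc a0' ab' okc'.
  have i2 := intg_bM2 bxi a0' a'bW okc a0' ab' okc'.
  have i3 := intg_bM2 bxi a0 ab okc a0' ab' okc'.
  transitivity (mean Pr (fun w => xi w * (M a a' c w * M a' b' c' w) + xi w * (M a' b c w * M a' b' c' w))).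
    apply: mean_ae; [exact: intg_meas i3|exact: intg_meas (intgD i1 i2)|].
    apply: filterS (itg_add itg a0 aa' a'bW okc) => w ->; ring.
  by rewrite meanD// [X in X + _](fwd_zero (u := u)) ?add0r.
have bxi' : bounded_wrt (F a') xi by apply: bounded_wrt_sub (leF ua') bxi.
have [bb'|b'b] := leP b b'.
  by rewrite (cov_split (u := u))// (itg_cov itg).
have b'bW := ltW b'b.
under eq_fun do rewrite [M a' b c _ * _]mulrC.
rewrite (cov_split (u := u))//.
under eq_fun do rewrite [M a' b' c' _ * _]mulrC.
by rewrite (itg_cov itg).
Qed.

Lemma cell_cov u t x y : 0 <= u -> wf u t x -> wf u t y ->
  mean Pr (fun w => (cxi x w * crv x w) * (cxi y w * crv y w)) =
  mean Pr (fun w => cxi x w * cxi y w) * fine (mu (cset x `&` cset y)).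
Proof.
move=> u0; wlog xy : x y / cstart x <= cstart y.
  move=> wl hx hy; have [|/ltW] := leP (cstart x) (cstart y); first by move=> xy; exact: wl.
  move=> yx; have := wl y x yx hy hx; rewrite setIC => h.
  rewrite (mean_ext (fun w => mulrC (cxi x w * crv x w) (cxi y w * crv y w))).
  by rewrite [in RHS](mean_ext (fun w => mulrC (cxi x w) (cxi y w))).
move=> [ux xx xt okx bx] [uy yy yt oky bY].
have x0 := le_trans u0 ux.
have bxy : bounded_wrt (F (cstart y)) (fun w => cxi x w * cxi y w).
  by apply: bounded_wrtM => //; exact: bounded_wrt_sub (leF xy) bx.
rewrite -(cov_le bxy)//.
by apply: mean_ext => w; rewrite /crv; ring.
Qed.

Lemma mu_cell_fin u t x : wf u t x -> mu (cset x) \is a fin_num.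
Proof. by case=> *; rewrite ge0_fin_numE ?measure_ge0// (itg_fin itg). Qed.

Lemma cset_measurable u t x : wf u t x -> measurable (cset x).
Proof. by case=> *; exact: (itg_meas itg). Qed.

Lemma elem_integral_sq u t (I : finType) (x : I -> cell) : 0 <= u ->
  (forall i, wf u t (x i)) ->
  mean Pr (fun w => elem_integral x w ^+ 2) =
  \sum_i \sum_j mean Pr (fun w => cxi (x i) w * cxi (x j) w) *
    fine (mu (cset (x i) `&` cset (x j))).
Proof.
move=> u0 h.
have it i j : intg Pr (fun w => (cxi (x i) w * crv (x i) w) * (cxi (x j) w * crv (x j) w)).
  by apply: sqintgM; exact: sq_term (h _).
rewrite (mean_ext (Y := fun w => \sum_i \sum_j (cxi (x i) w * crv (x i) w) * (cxi (x j) w * crv (x j) w))); last first.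
  by move=> w; rewrite expr2 /elem_integral big_distrlr.
rewrite mean_sum; last by move=> i _; exact: intg_sum.
apply: eq_bigr => i _; rewrite mean_sum//.
by apply: eq_bigr => j _; exact: cell_cov (h i) (h j).
Qed.

Lemma elem_process_sq u t (I : finType) (x : I -> cell) w :
  (forall i, wf u t (x i)) ->
  (\int[mu]_z ((elem_process x z w) ^+ 2)%:E)%E =
  (\sum_i \sum_j cxi (x i) w * cxi (x j) w * fine (mu (cset (x i) `&` cset (x j))))%:E.
Proof.
move=> h.
have mc i j : measurable (cset (x i) `&` cset (x j)).
  by apply: measurableI; exact: cset_measurable (h _).
have fc i j : (mu (cset (x i) `&` cset (x j)) < +oo)%E.
  apply: (le_lt_trans (le_measure _ _ _ (@subIsetl _ _ _))); rewrite ?inE//.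
  - exact: cset_measurable (h _).
  - by rewrite -ge0_fin_numE ?measure_ge0// (mu_cell_fin (h i)).
pose f i j z := ((cxi (x i) w * cxi (x j) w)%:E * (\1_(cset (x i) `&` cset (x j)) z)%:E)%E.
have ii i j : mu.-integrable setT (fun z => (\1_(cset (x i) `&` cset (x j)) z)%:E).
  apply/integrableP; split; first exact/measurable_EFinP/measurable_indic.
  under eq_integral do rewrite gee0_abs ?lee_fin//.
  by rewrite integral_indic// setIT.
have int_f i j : mu.-integrable setT (f i j).
  exact: integrableZl.
under eq_integral.
  move=> z _.
  rewrite (_ : _%:E = (\sum_i \sum_j f i j z)%E); last first.
    rewrite expr2 /elem_process big_distrlr/= -sumEFin; apply: eq_bigr => i _.
    rewrite -sumEFin; apply: eq_bigr => j _.
    by rewrite /f -EFinM indicI/=; congr EFin; ring.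
  over.
rewrite integral_sum//; last by move=> i; apply: integrable_sum.
rewrite -sumEFin; apply: eq_bigr => i _.
rewrite integral_sum// -sumEFin; apply: eq_bigr => j _.
rewrite integralZl//.
by rewrite integral_indic// setIT [RHS]EFinM fineK// ge0_fin_numE ?measure_ge0.
Qed.

(** Both sides expand into the same double sum over pairs of cells, which may overlap. Differences
    of elementary processes on different subdivisions are thus covered without a common
    refinement. *)
Lemma elem_isometry u t (I : finType) (x : I -> cell) : 0 <= u ->
  (forall i, wf u t (x i)) ->
  (mean Pr (fun w => elem_integral x w ^+ 2))%:E =
  (\int[Pr]_w \int[mu]_z ((elem_process x z w) ^+ 2)%:E)%E.
Proof.
move=> u0 h; rewrite (elem_integral_sq u0 h).
under eq_integral do rewrite (elem_process_sq _ h).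
have ic i j : intg Pr (fun w => cxi (x i) w * cxi (x j) w).
  have [_ _ _ _ bi] := h i; have [_ _ _ _ [mj [c cj]]] := h j.
  apply: (bounded_intg (@mF _) bi); apply: intg_bounded cj.
  exact: measurable_wrt_fun (@mF _) mj.
have ic2 i j : intg Pr (fun w => cxi (x i) w * cxi (x j) w * fine (mu (cset (x i) `&` cset (x j)))).
  under eq_fun do rewrite mulrC; exact: intgZ.
rewrite -EFin_mean; last by apply: intg_sum => i _; exact: intg_sum.
congr EFin; rewrite mean_sum; last by move=> i _; exact: intg_sum.
apply: eq_bigr => i _; rewrite mean_sum//; apply: eq_bigr => j _.
under [in RHS]eq_fun do rewrite mulrC.
by rewrite meanZ// mulrC.
Qed.

End elementary_integrals.

(** * Square norms *)

Section square_norm.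
Context {d : measure_display} {T : measurableType d} {R : realType}.
Variable mu : {measure set T -> \bar R}.
Implicit Types f g : T -> R.

Definition sqn f : \bar R := (\int[mu]_x ((f x) ^+ 2)%:E)%E.

Lemma sqn_ge0 f : (0 <= sqn f)%E.
Proof. by apply: integral_ge0 => x _; rewrite lee_fin sqr_ge0. Qed.

Lemma sqn_measurable f : measurable_fun setT f ->
  measurable_fun setT (fun x => ((f x) ^+ 2)%:E).
Proof. by move=> mf; apply/measurable_EFinP; exact: measurable_funX. Qed.

Lemma le_sqn f g : measurable_fun setT f -> measurable_fun setT g ->
  (forall x, f x ^+ 2 <= g x ^+ 2) -> (sqn f <= sqn g)%E.
Proof.
move=> mf mg fg; apply: ge0_le_integral => //.
- by move=> x _; rewrite lee_fin sqr_ge0.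
- exact: sqn_measurable.
- exact: sqn_measurable.
- by move=> x _; rewrite lee_fin.
Qed.

Lemma sqnD f g : measurable_fun setT f -> measurable_fun setT g ->
  (sqn (fun x => (f x + g x)%R) <= 2%:E * sqn f + 2%:E * sqn g)%E.
Proof.
move=> mf mg; rewrite /sqn -!ge0_integralZl//; last 4 first.
- exact: sqn_measurable.
- by move=> x _; rewrite lee_fin sqr_ge0.
- exact: sqn_measurable.
- by move=> x _; rewrite lee_fin sqr_ge0.
rewrite -ge0_integralD//; last 4 first.
- by move=> x _; rewrite -EFinM lee_fin mulr_ge0 ?sqr_ge0.
- by apply: emeasurable_funM => //; exact: sqn_measurable.
- by move=> x _; rewrite -EFinM lee_fin mulr_ge0 ?sqr_ge0.
- by apply: emeasurable_funM => //; exact: sqn_measurable.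
apply: ge0_le_integral => //.
- by move=> x _; rewrite lee_fin sqr_ge0.
- by apply: sqn_measurable; exact: measurable_funD.
- by apply: emeasurable_funD; apply: emeasurable_funM => //; exact: sqn_measurable.
- by move=> x _; rewrite -!EFinM -EFinD lee_fin; have := sqr_ge0 (f x - g x); nra.
Qed.

Lemma sqnN f : sqn (fun x => - f x) = sqn f.
Proof. by apply: eq_integral => x _; rewrite sqrrN. Qed.

Lemma sqnB f g : measurable_fun setT f -> measurable_fun setT g ->
  (sqn (fun x => (f x - g x)%R) <= 2%:E * sqn f + 2%:E * sqn g)%E.
Proof.
by move=> mf mg; rewrite -(sqnN g); apply: sqnD => //; exact: measurable_funN.
Qed.

Lemma cvg_sqn0 (a : nat -> \bar R) : (forall n, 0 <= a n)%E ->
  a n @[n --> \oo] --> 0%E <-> (forall e, 0 < e -> \forall n \near \oo, (a n <= e%:E)%E).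
Proof.
move=> a0; split=> [/fine_cvgP[fa ca] e e0|h].
  move/cvgrPdist_le: ca => /(_ e e0); apply: filterS2 fa => n fn.
  by rewrite sub0r normrN /= ger0_norm ?fine_ge0// -lee_fin fineK.
apply/fine_cvgP; split.
  apply: filterS (h 1 ltr01) => n an.
  by rewrite ge0_fin_numE// (le_lt_trans an)// ltry.
apply/cvgrPdist_le => e e0; apply: filterS (h e e0) => n an.
rewrite sub0r normrN /= ger0_norm ?fine_ge0// -lee_fin fineK//.
by rewrite ge0_fin_numE// (le_lt_trans an)// ltry.
Qed.

End square_norm.

Section sqn_probability.
Context {d : measure_display} {T : measurableType d} {R : realType}.
Variable Pr : probability T R.
Implicit Types X Y : T -> R.

Lemma sqintg_sqn X : measurable_fun setT X -> (sqn Pr X < +oo)%E -> sqintg Pr X.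
Proof.
move=> mX h; split=> //; apply/integrableP; split.
  by apply/measurable_EFinP; exact: measurable_funX.
by under eq_integral do rewrite /= ger0_norm ?sqr_ge0//.
Qed.

Lemma sqnE X : sqintg Pr X -> sqn Pr X = (mean Pr (fun w => X w ^+ 2))%:E.
Proof. by case=> _ iX; rewrite EFin_mean. Qed.

(** From |X| <= e + X^2 / e. *)
Lemma mean_norm_sqn X e : sqintg Pr X -> 0 < e -> (sqn Pr X <= (e ^+ 2)%:E)%E ->
  mean Pr (fun w => `|X w|) <= 2 * e.
Proof.
move=> sX e0; rewrite sqnE// lee_fin => h.
have [mX iX] := sX; have iX1 := sqintg_intg sX.
have : mean Pr (fun w => `|X w|) <= mean Pr (fun w => e + e^-1 * X w ^+ 2).
  apply: le_mean; [exact: intg_norm|by apply: intgD; [exact: intg_cst|exact: intgZ]|].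
  move=> w; rewrite -subr_ge0 -(pmulr_rge0 _ e0) mulrBr mulrDr mulrA divff ?gt_eqF// mul1r.
  rewrite -[X w ^+ 2]real_normK ?num_real//; nra.
move=> /le_trans; apply; rewrite meanD; [|exact: intg_cst|exact: intgZ].
rewrite mean_cst meanZ// mulr2n mulrDl mul1r lerD2l mulrC ler_pdivrMr//.
Qed.

End sqn_probability.

(** * Limits of elementary stochastic integrals *)

Section stochastic_integral_limit.
Context {d d' : measure_display} {T : measurableType d} {Z : measurableType d'}
  {R : realType}.
Variables (Pr : probability T R) (mu : {sigma_finite_measure set Z -> \bar R}).
Variable F : R -> set (set T).
Hypothesis sF : forall u, sigma_algebra setT (F u).
Hypothesis mF : forall u, F u `<=` measurable.
Hypothesis leF : forall u t, u <= t -> F u `<=` F t.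
Variables (Mk : Type) (ok : Mk -> Prop) (D : R -> R -> Mk -> set Z)
  (M : R -> R -> Mk -> T -> R).
Hypothesis itg : integrator Pr mu F ok D M.

Local Notation nu := (Pr \x mu)%E.
Local Notation cell := (@cell d T R Mk).
Local Notation EP x := (fun wz : T * Z => elem_process D x wz.2 wz.1).

Lemma elem_process_measurable u t (I : finType) (x : I -> cell) :
  (forall i, wf F ok u t (x i)) -> measurable_fun setT (EP x).
Proof.
move=> h; rewrite /elem_process; apply: measurable_sum => i.
have [_ _ _ okx [hx _]] := h i.
apply: measurable_funM.
  by apply: measurableT_comp => //; exact: measurable_wrt_fun (@mF _) hx.
apply: measurableT_comp => //; apply: measurable_indic.
exact: (itg_meas itg).
Qed.

Lemma elem_isometry_prod u t (I : finType) (x : I -> cell) : 0 <= u ->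
  (forall i, wf F ok u t (x i)) -> sqn Pr (elem_integral M x) = sqn nu (EP x).
Proof.
move=> u0 h; have sI := elem_integral_sqintg mF itg u0 h.
rewrite sqnE// (elem_isometry sF mF leF itg u0 h) /sqn fubini_tonelli1//.
- by apply: sqn_measurable; exact: elem_process_measurable h.
- by move=> x'; rewrite lee_fin sqr_ge0.
Qed.

Section limit.
Variables (u t : R) (G : T * Z -> R) (X : T -> R) (I : nat -> finType)
  (x : forall n, I n -> cell).
Hypothesis u0 : 0 <= u.
Hypothesis mG : measurable_fun setT G.
Hypothesis mX : measurable_fun setT X.
Hypothesis wfx : forall n i, wf F ok u t (@x n i).
Hypothesis cvgG : sqn nu (fun wz => (G wz - elem_process D (@x n) wz.2 wz.1)%R) @[n --> \oo] --> 0%E.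
Hypothesis cvgX : sqn Pr (fun w => (X w - elem_integral M (@x n) w)%R) @[n --> \oo] --> 0%E.

Let sI n : sqintg Pr (elem_integral M (@x n)).
Proof. exact: (elem_integral_sqintg mF itg u0 (@wfx n)). Qed.
Let mI n : measurable_fun setT (elem_integral M (@x n)). Proof. by case: (sI n). Qed.
Let mS n : measurable_fun setT (EP (@x n)).
Proof. exact: elem_process_measurable (@wfx n). Qed.

(** The isometry of the approximations passes to the limit; the factor 4 comes from two uses of (a +
    b)^2 <= 2 a^2 + 2 b^2, once for [X] and once for [G]. *)
Lemma limit_sqn : (sqn Pr X <= 4%:E * sqn nu G)%E.
Proof.
apply/lee_addgt0Pr => e e0.
have [n [h1 h2]] : exists n,
    (sqn nu (fun wz => (G wz - elem_process D (@x n) wz.2 wz.1)%R) <= (e / 8)%:E)%E /\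
    (sqn Pr (fun w => (X w - elem_integral M (@x n) w)%R) <= (e / 8)%:E)%E.
  have e8 : 0 < e / 8 by rewrite divr_gt0.
  have h1 := (cvg_sqn0 (fun n => sqn_ge0 _ _)).1 cvgG _ e8.
  have h2 := (cvg_sqn0 (fun n => sqn_ge0 _ _)).1 cvgX _ e8.
  near \oo => n; exists n; split; near: n; [exact: h1|exact: h2].
have mXI : measurable_fun setT (fun w => (X w - elem_integral M (@x n) w)%R).
  exact: measurable_funB.
have mGS : measurable_fun setT (fun wz => (G wz - elem_process D (@x n) wz.2 wz.1)%R).
  exact: measurable_funB.
have : (sqn Pr X <= 2%:E * sqn Pr (fun w => (X w - elem_integral M (@x n) w)%R) +
    2%:E * sqn Pr (elem_integral M (@x n)))%E.
  by apply: le_trans (sqnD _ mXI (mI n)); rewrite le_eqVlt; apply/orP; left; apply/eqP; apply: eq_integral => w _; rewrite subrK.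
move=> /le_trans; apply.
rewrite (elem_isometry_prod u0 (@wfx n)).
have : (sqn nu (EP (@x n)) <= 2%:E * sqn nu G + 2%:E * sqn nu (fun wz => (G wz - elem_process D (@x n) wz.2 wz.1)%R))%E.
  apply: le_trans (sqnB nu mG mGS); rewrite le_eqVlt /sqn.
  by apply/orP; left; apply/eqP; apply: eq_integral => z _; rewrite opprB addrC subrK.
move=> h3; have : (2%:E * sqn Pr (fun w => (X w - elem_integral M (@x n) w)%R) +
    2%:E * sqn nu (EP (@x n)) <= 2%:E * (e / 8)%:E + 2%:E * (2%:E * sqn nu G + 2%:E * (e / 8)%:E))%E.
  apply: leeD; first by rewrite lee_pmul2l.
  rewrite lee_pmul2l// (le_trans h3)// leeD2l// lee_pmul2l//.
move=> /le_trans; apply.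
case: (sqn nu G) (sqn_ge0 nu G) => [r| |] //= r0.
  by rewrite -!EFinM -!EFinD lee_fin; lra.
by rewrite !gt0_muley// ?lte_fin// addye// leey.
Unshelve. all: by end_near. Qed.

Lemma limit_mean_zero : (sqn nu G < +oo)%E -> mean_zero_wrt Pr (F u) X /\ sqintg Pr X.
Proof.
move=> Gfin.
have sX : sqintg Pr X.
  apply: sqintg_sqn => //; apply: (le_lt_trans limit_sqn).
  by rewrite lte_mul_pinfty.
split=> //; split; first exact: sqintg_intg.
move=> xi bxi; have [hxi [c cxi]] := bxi.
have c0 : 0 <= c by apply: le_trans (cxi point).
apply/eqP; rewrite -normr_le0; apply/ler_addgt0Pr => e e0; rewrite add0r.
pose e' := e / (2 * (c + 1)).
have e'0 : 0 < e' by rewrite divr_gt0// mulr_gt0// ltr_wpDl.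
have [n hn] : exists n, (sqn Pr (fun w => (X w - elem_integral M (@x n) w)%R) <= (e' ^+ 2)%:E)%E.
  have h2 := (cvg_sqn0 (fun n => sqn_ge0 _ _)).1 cvgX (e' ^+ 2) (exprn_gt0 _ e'0).
  near \oo => n; exists n; near: n; exact: h2.
have [iI hI] := elem_integral_mean_zero sF mF leF itg u0 (@wfx n).
have sXI := sqintgB sX (sI n).
have iXI := sqintg_intg sXI.
have -> : mean Pr (fun w => xi w * X w) = mean Pr (fun w => xi w * (X w - elem_integral M (@x n) w)).
  under [in RHS]eq_fun do rewrite mulrBr.
  rewrite meanB ?hI ?subr0//.
    by apply: (bounded_intg (@mF _) bxi); exact: sqintg_intg.
  exact: (bounded_intg (@mF _) bxi).
apply: (@le_trans _ _ (mean Pr (fun w => c * `|X w - elem_integral M (@x n) w|))).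
  apply: norm_mean_le.
  - by apply: measurable_funM; [exact: measurable_wrt_fun (@mF _) hxi|exact: intg_meas iXI].
  - by apply: intgZ; exact: intg_norm.
  - by move=> w; rewrite normrM ler_wpM2r.
rewrite meanZ; last exact: intg_norm.
apply: (@le_trans _ _ (c * (2 * e'))); first by rewrite ler_wpM2l// mean_norm_sqn.
rewrite /e' mulrCA mulrA -[2 * c]mulrC -mulrA.
rewrite (_ : c * _ = e * (c / (c + 1))); last by field; rewrite gt_eqF// ltr_wpDl.
by rewrite ler_piMr ?(ltW e0)// ler_pdivrMr ?mul1r ?lerDl// ltr_wpDl.
Unshelve. all: by end_near. Qed.

End limit.
End stochastic_integral_limit.

(** * Ito integrals *)

Section noise_integrators.
Context {d : measure_display} {T : measurableType d} {R : realType} {p : nat}.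
Variable Pr : probability T R.
Variables (W : 'I_p.+1 -> R -> T -> R) (Np : 'I_p -> R.-ker T ~> (marked R)).
Hypothesis hnoise : noise Pr W Np.
Implicit Types (u t a b : R) (i : 'I_p.+1) (j : 'I_p).

Local Notation F := (noise_filtration Pr W Np).
Local Notation mR := (measurableTypeR R).
Local Notation leb := (@lebesgue_measure R).

Let sF u : sigma_algebra setT (F u). Proof. exact: noise_filtration_sigma. Qed.
Let mF u : F u `<=` measurable. Proof. exact: (noise_filtration_measurable hnoise). Qed.
Let leF u t : u <= t -> F u `<=` F t. Proof. exact: noise_filtration_le. Qed.

Definition incr i a b (w : T) : R := W i b w - W i a w.

Lemma W_measurable i t : 0 <= t -> measurable_fun setT (W i t).
Proof. by case: hnoise => bW _ _; case: (bW i) => + _ _ _ _; exact. Qed.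

Lemma W_wrt i s t : 0 <= s -> s <= t -> measurable_wrt (F t) (W i s).
Proof.
move=> s0 st B mB; apply: sub_sigma_algebra; constructor 1.
by exists i, s, B; split=> //=; rewrite in_itv/= s0.
Qed.

Lemma incr_measurable i a b : 0 <= a -> a <= b -> measurable_fun setT (incr i a b).
Proof.
by move=> a0 ab; apply: measurable_funB; apply: W_measurable => //; exact: le_trans ab.
Qed.

Section positive_increment.
Variables (i : 'I_p.+1) (a b : R).
Hypotheses (a0 : 0 <= a) (ab : a < b).

Let s := Num.sqrt (b - a).
Let s0 : 0 < s. Proof. by rewrite sqrtr_gt0 subr_gt0. Qed.
Let s2 : s ^+ 2 = b - a. Proof. by rewrite sqr_sqrtr// subr_ge0 ltW. Qed.
Let mX := incr_measurable i a0 (ltW ab).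
Let lawX : forall B : set R, measurable B -> Pr (incr i a b @^-1` B) = normal_prob 0 s B.
Proof. by case: hnoise => bW _ _; case: (bW i) => _ _ _ h _; exact: h. Qed.

Lemma incr_sqintg : sqintg Pr (incr i a b).
Proof. exact: (gaussian_sqintg mX s0 lawX). Qed.

Lemma incr_mean : mean Pr (incr i a b) = 0.
Proof. exact: (gaussian_mean0 mX s0 lawX). Qed.

Lemma incr_mean2 : mean Pr (fun w => incr i a b w ^+ 2) = b - a.
Proof. by rewrite (gaussian_mean2 mX s0 lawX) s2. Qed.

Lemma incr_intg4 : intg Pr (fun w => incr i a b w ^+ 4).
Proof. exact: (gaussian_intg4 mX s0 lawX). Qed.

Lemma incr_mean4 : mean Pr (fun w => incr i a b w ^+ 4) <= 128 * (b - a) ^+ 2.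
Proof.
have := gaussian_mean4 mX s0 lawX.
by rewrite (_ : s ^+ 4 = (b - a) ^+ 2)// -s2 -exprM.
Qed.

Lemma incr_indep : independent2 Pr (others Pr W Np (inl i) a) (law_events (incr i a b)).
Proof. exact: (increment_independent hnoise). Qed.

End positive_increment.

Lemma incr_aa i a : incr i a a = fun=> 0.
Proof. by apply/funext => w; rewrite /incr subrr. Qed.

Lemma incr_sqintg_le i a b : 0 <= a -> a <= b -> sqintg Pr (incr i a b).
Proof.
move=> a0; rewrite le_eqVlt => /predU1P[<-|]; last exact: incr_sqintg.
by rewrite incr_aa; apply: (@sqintg_bounded _ _ _ _ _ 0) => // w; rewrite normr0.
Qed.

Definition bm_cell a b (_ : unit) : set mR := `]a, b]%classic.
Definition bm_rv i a b (_ : unit) : T -> R := incr i a b.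

Lemma itv_oc_cap (a b a' b' : R) : `]a, b]%classic `&` `]a', b']%classic =
  `]Num.max a a', Num.min b b']%classic :> set R.
Proof.
apply/seteqP; split=> x /=; rewrite !in_itv/= gt_max le_min.
  by move=> [/andP[-> ->] /andP[-> ->]].
by move=> /andP[/andP[-> ->] /andP[-> ->]].
Qed.

Lemma fine_lebesgue_itv (a b : R) : a <= b -> fine (leb `]a, b]%classic) = b - a.
Proof.
rewrite lebesgue_measure_itv/= lte_fin le_eqVlt => /predU1P[->|->//].
by rewrite ltxx subrr.
Qed.

Lemma brownian_integrator i : integrator Pr leb F (fun=> True) bm_cell (bm_rv i).
Proof.
split.
- by move=> a b c _; exact: measurable_itv.
- move=> a b c _; have h : (leb `]a, b]%classic < +oo)%E.
    by rewrite lebesgue_measure_itv/=; case: ifP => _ //; rewrite -EFinD ltry.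
  exact: h.
- by move=> a b c a' b' c'; rewrite /bm_cell itv_oc_cap setIid.
- move=> a b c ba; rewrite /bm_cell; apply/seteqP; split=> x //=.
  by rewrite in_itv/= => /andP[ax xb]; have := lt_le_trans ax (le_trans xb ba); rewrite ltxx.
- move=> a b c a0 ab _; apply: measurable_wrtB => //; apply: W_wrt => //.
  exact: le_trans ab.
- by move=> a b c a0 ab _; exact: incr_sqintg_le.
- by move=> a b e c _ _ _ _; apply: aeW => w; rewrite /bm_rv /incr; ring.
- move=> a b c xi a0 + _ hxi ixi; rewrite le_eqVlt => /predU1P[<-|ab].
    by rewrite /bm_rv incr_aa; under eq_fun do rewrite mulr0; rewrite mean_cst.
  have hxi' := measurable_wrt_sub (@noise_filtration_sub_others _ _ _ _ Pr W Np (inl i) a) hxi.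
  have [_ ->] := independent2_mean (@incr_indep i a b a0 ab) hxi' (sqintg_intg (@incr_sqintg i a b a0 ab)) ixi.
  by rewrite incr_mean// mulr0.
- move=> a b c c' xi a0 + _ _ bxi; rewrite /bm_cell setIid le_eqVlt => /predU1P[<-|ab].
    rewrite /bm_rv incr_aa; under eq_fun do rewrite !mulr0; rewrite mean_cst.
    by rewrite fine_lebesgue_itv// subrr mulr0.
  rewrite fine_lebesgue_itv ?(ltW ab)// -(@incr_mean2 i a b a0 ab).
  have [hxi [c1 hc1]] := bxi.
  have hxi' := measurable_wrt_sub (@noise_filtration_sub_others _ _ _ _ Pr W Np (inl i) a) hxi.
  have [_ i2] := @incr_sqintg i a b a0 ab.
  have ind2 : independent2 Pr (others Pr W Np (inl i) a) (law_events (fun w => incr i a b w ^+ 2)).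
    apply: independent2_subr (@incr_indep i a b a0 ab).
    by apply: (law_events_comp (phi := fun x => x ^+ 2)); exact: exprn_measurable.
  have ixi : intg Pr xi by apply: intg_bounded hc1; exact: measurable_wrt_fun (@mF _) hxi.
  by have [_ <-] := independent2_mean ind2 hxi' i2 ixi.
Qed.

Definition oc_ind (a b z : R) : R := (a < z <= b)%R%:R.

Lemma oc_indE (a b z : R) : \1_(`]a, b]%classic) z = oc_ind a b z.
Proof. by rewrite indicE /oc_ind; congr (nat_of_bool _)%:R; apply/idP/idP; rewrite inE/= in_itv. Qed.

Section ito_increment.
Variables (i : 'I_p.+1) (H : R -> T -> R) (u t : R) (Y Y' zeta : T -> R).
Hypotheses (u0 : 0 <= u) (ut : u < t).
Hypothesis mH : measurable_fun setT (fun wz : T * mR => oc_ind 0 t wz.2 * H wz.2 wz.1).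
Hypothesis itoY : is_ito_integral Pr F (W i) H t Y.
Hypothesis itoY' : is_ito_integral Pr F (W i) H u Y'.
Hypothesis bzeta : bounded_wrt (F u) zeta.

Local Notation nu := (Pr \x leb)%E.
Local Notation ind := oc_ind.
Local Notation cell := (@cell d T R unit).

Let X w := Y w - Y' w - zeta w * incr i u t w.
Let G (wz : T * mR) := ind u t wz.2 * (H wz.2 wz.1 - zeta wz.1).

Let indE (a b z : R) : ind a b z = (a < z <= b)%R%:R. Proof. by []. Qed.

Let mind (a b : R) : measurable_fun setT (fun wz : T * mR => ind a b wz.2).
Proof.
rewrite (_ : (fun _ => _) = fun wz : T * mR => \1_(`]a, b]%classic) wz.2); last first.
  by apply/funext => wz; rewrite oc_indE.
by apply: measurableT_comp => //; apply: measurable_indic; exact: measurable_itv.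
Qed.

Let mG : measurable_fun setT G.
Proof.
have -> : G = fun wz => ind u t wz.2 * (ind 0 t wz.2 * H wz.2 wz.1) - ind u t wz.2 * zeta wz.1.
  apply/funext => wz; rewrite /G mulrA mulrBr; congr (_ * _ - _).
  rewrite !indE; case: (boolP (u < wz.2 <= t)) => [/andP[h1 h2]|]; last by rewrite mul0r.
  by rewrite (le_lt_trans u0 h1) h2 mulr1.
apply: measurable_funB; apply: measurable_funM => //.
apply: measurableT_comp => //; case: bzeta => + _; exact: measurable_wrt_fun.
Qed.

Let simple_cells (m : nat) (tau : nat -> R) (xi : nat -> T -> R) (k : 'I_m) : cell :=
  Cell (xi k) (tau k) (tau k.+1) tt.

Let tau_le (m : nat) (tau : nat -> R) : (forall k, (k < m)%N -> tau k <= tau k.+1) ->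
  forall l k, (k + l <= m)%N -> tau k <= tau (k + l)%N.
Proof.
move=> hk; elim=> [|l ih] k kl; first by rewrite addn0.
rewrite addnS in kl *; apply: le_trans (hk _ kl); exact: ih (ltnW kl).
Qed.

Let tau_mono (m : nat) (tau : nat -> R) (r : R) : tau 0 = 0 -> tau m = r ->
  (forall k, (k < m)%N -> tau k <= tau k.+1) ->
  forall k, (k <= m)%N -> 0 <= tau k <= r.
Proof.
move=> t0 tm hk k km; rewrite -t0 -tm; apply/andP; split.
  by have := tau_le hk (l := k) (k := 0); rewrite add0n; exact.
by have := tau_le hk (l := (m - k)%N) (k := k); rewrite subnKC//; exact.
Qed.

Let simple_wf r (m : nat) (tau : nat -> R) (xi : nat -> T -> R) : simple_process F r m tau xi ->
  forall k : 'I_m, wf F (fun=> True) 0 r (simple_cells tau xi k).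
Proof.
case=> t0 tm hk hxi [c hc] k; have km := ltn_ord k.
have /andP[h1 _] := tau_mono t0 tm hk (ltnW km).
have /andP[_ h2] := tau_mono t0 tm hk km.
by split=> //=; [exact: hk|split; [exact: hxi|exists c => w]].
Qed.

Let simple_processE (m : nat) tau xi z w :
  elem_process bm_cell (@simple_cells m tau xi) z w = simple_value m tau xi z w.
Proof.
apply: eq_bigr => k _; rewrite /cset /bm_cell/= (oc_indE (tau k)) indE.
by case: ifP => _; rewrite ?mulr1 ?mulr0.
Qed.

Let sqn_itv (f : R -> T -> R) (r : R) :
  measurable_fun setT (fun wz : T * mR => ind 0 r wz.2 * f wz.2 wz.1) ->
  (\int[Pr]_w \int[leb]_(s in `]0%R, r]) ((f s w) ^+ 2)%:E)%E =
  sqn nu (fun wz => ind 0 r wz.2 * f wz.2 wz.1).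
Proof.
move=> mf; rewrite /sqn fubini_tonelli1; last 2 first.
- exact: sqn_measurable.
- by move=> x; rewrite lee_fin sqr_ge0.
apply: eq_integral => w _; rewrite integral_mkcond; apply: eq_integral => s _.
rewrite patchE /= indE exprMn mem_setE in_itv/=.
by case: ifP => _; rewrite ?expr1n ?mul1r// expr0n/= mul0r.
Qed.

(** [Y] and [Y'] are given as limits along unrelated sequences of simple processes. The cells [z n]
    restrict the approximation of [Y] to ]u, t] and subtract [zeta] there, so they start after [u]
    and approximate [G]. Their integral differs from [X] by the two approximation errors and by the
    integral of [c n]. *)
Lemma ito_increment : (sqn nu G < +oo)%E ->
  [/\ mean_zero_wrt Pr (F u) X, sqintg Pr X & (sqn Pr X <= 4%:E * sqn nu G)%E].
Proof.
move=> Gfin.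
have [mY [m [tau [xi [sp cH cY]]]]] := itoY.
have [mY' [m' [tau' [xi' [sp' cH' cY']]]]] := itoY'.
have wfx n := simple_wf (sp n).
have wfy n := simple_wf (sp' n).
pose x n := @simple_cells (m n) (tau n) (xi n).
pose y n := @simple_cells (m' n) (tau' n) (xi' n).
(* The cells are cut at [u]; those that end before [u] become empty. *)
pose xr n (k : 'I_(m n)) : cell := Cell (xi n k) (Num.max u (tau n k)) (Num.max u (tau n k.+1)) tt.
have utW := ltW ut.
have wfr n k : wf F (fun=> True) u t (xr n k).
  have [h1 h2 h3 _ [h5 h6]] := wfx n k; split=> //=.
  - by rewrite le_max lexx.
  - by rewrite ge_max !le_max lexx/= h2 orbT.
  - by rewrite ge_max utW.
  - by split=> //; apply: measurable_wrt_sub h5; apply: leF; rewrite le_max lexx orbT.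
pose z n (k : 'I_(m n) + unit) : cell := match k with inl k => xr n k | inr _ => Cell (fun w => - zeta w) u t tt end.
have wfz n k : wf F (fun=> True) u t (z n k).
  case: k => [k|[]] //=; split=> //=.
  have [h1 [c hc]] := bzeta; split; first exact: measurable_wrtN.
  by exists c => w; rewrite normrN.
(* What is left on ]0, u]: the approximation of [Y] minus that of [Y']. Both approximate [H] there,
   so the integral of the difference tends to 0 by the isometry. *)
pose c n (k : 'I_(m n) + 'I_(m' n) + 'I_(m n)) : cell :=
  match k with inl (inl k) => x n k | inl (inr k) => Cell (fun w => - xi' n k w) (tau' n k) (tau' n k.+1) tt
  | inr k => Cell (fun w => - xi n k w) (Num.max u (tau n k)) (Num.max u (tau n k.+1)) tt end.
have bN r (f : T -> R) : bounded_wrt (F r) f -> bounded_wrt (F r) (fun w => - f w).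
  by case=> h1 [c1 hc]; split; [exact: measurable_wrtN|exists c1 => w; rewrite normrN].
have wfc n k : wf F (fun=> True) 0 t (c n k).
  case: k => [[k|k]|k] /=; first exact: wfx.
    have [h1 h2 h3 _ h5] := wfy n k; split=> //=; [exact: le_trans h3 utW|exact: bN].
  have [h1 h2 h3 _ h5] := wfr n k; split=> //=; [exact: le_trans h1|exact: bN].
have mSx n : measurable_fun setT (fun wz : T * mR => simple_value (m n) (tau n) (xi n) wz.2 wz.1).
  have := elem_process_measurable mF (brownian_integrator i) (wfx n).
  by under eq_fun do rewrite simple_processE.
have mSy n : measurable_fun setT (fun wz : T * mR => simple_value (m' n) (tau' n) (xi' n) wz.2 wz.1).
  have := elem_process_measurable mF (brownian_integrator i) (wfy n).
  by under eq_fun do rewrite simple_processE.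
have mHu : measurable_fun setT (fun wz : T * mR => ind 0 u wz.2 * H wz.2 wz.1).
  rewrite (_ : (fun _ => _) = fun wz : T * mR => ind 0 u wz.2 * (ind 0 t wz.2 * H wz.2 wz.1)).
    exact: measurable_funM.
  apply/funext => wz; rewrite mulrA; congr (_ * _); rewrite !indE.
  case: (boolP (0 < wz.2 <= u)) => [/andP[h1 h2]|_]; last by rewrite mul0r.
  by rewrite h1 (le_trans h2 utW) mulr1.
have mHx n : measurable_fun setT (fun wz : T * mR => ind 0 t wz.2 * (H wz.2 wz.1 - simple_value (m n) (tau n) (xi n) wz.2 wz.1)).
  by under eq_fun do rewrite mulrBr; apply: measurable_funB => //; exact: measurable_funM.
have mHxu n : measurable_fun setT (fun wz : T * mR => ind 0 u wz.2 * (H wz.2 wz.1 - simple_value (m n) (tau n) (xi n) wz.2 wz.1)).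
  by under eq_fun do rewrite mulrBr; apply: measurable_funB => //; exact: measurable_funM.
have mHy n : measurable_fun setT (fun wz : T * mR => ind 0 u wz.2 * (H wz.2 wz.1 - simple_value (m' n) (tau' n) (xi' n) wz.2 wz.1)).
  by under eq_fun do rewrite mulrBr; apply: measurable_funB => //; exact: measurable_funM.
have cX : sqn nu (fun wz => ind 0 t wz.2 * (H wz.2 wz.1 - simple_value (m n) (tau n) (xi n) wz.2 wz.1)) @[n --> \oo] --> 0%E.
  rewrite (_ : (fun n => _) = (fun n => (\int[Pr]_w \int[leb]_(s in `]0%R, t])
     ((H s w - simple_value (m n) (tau n) (xi n) s w) ^+ 2)%:E)%E)); first exact: cH.
  apply/funext => n; symmetry.
  exact: (@sqn_itv (fun s w => H s w - simple_value (m n) (tau n) (xi n) s w) _ (mHx n)).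
have cY1 : sqn nu (fun wz => ind 0 u wz.2 * (H wz.2 wz.1 - simple_value (m' n) (tau' n) (xi' n) wz.2 wz.1)) @[n --> \oo] --> 0%E.
  rewrite (_ : (fun n => _) = (fun n => (\int[Pr]_w \int[leb]_(s in `]0%R, u])
     ((H s w - simple_value (m' n) (tau' n) (xi' n) s w) ^+ 2)%:E)%E)); first exact: cH'.
  apply/funext => n; symmetry.
  exact: (@sqn_itv (fun s w => H s w - simple_value (m' n) (tau' n) (xi' n) s w) _ (mHy n)).
have sub_ind (a1 b1 a2 b2 : R) (f : T * mR -> R) (wz : T * mR) : a2 <= a1 -> b1 <= b2 ->
    (ind a1 b1 wz.2 * f wz) ^+ 2 <= (ind a2 b2 wz.2 * f wz) ^+ 2.
  move=> h1 h2; rewrite !indE !exprMn; case: (boolP (a1 < wz.2 <= b1)) => [/andP[h3 h4]|_].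
    by rewrite (le_lt_trans h1 h3) (le_trans h4 h2).
  by rewrite expr0n/= mul0r mulr_ge0// sqr_ge0.
have zE n wz : elem_process bm_cell (z n) wz.2 wz.1 =
    ind u t wz.2 * (simple_value (m n) (tau n) (xi n) wz.2 wz.1 - zeta wz.1).
  rewrite /elem_process big_sumType/= (big_pred1 tt)//.
  rewrite /cset /bm_cell/= !oc_indE mulrBr mulNr [zeta _ * _]mulrC; congr (_ - _).
  rewrite /simple_value big_distrr/=; apply: eq_bigr => k _.
  have [_ h2 h3 _ _] := wfx n k; rewrite /= in h2 h3.
  rewrite ?oc_indE !indE gt_max le_max.
  case: (boolP (u < wz.2)) => /= h4; last first.
    by rewrite mulr0 mul0r.
  case: (boolP (wz.2 <= u)) => /= h5; first by have := lt_le_trans h4 h5; rewrite ltxx.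
  case: (boolP (tau n k < wz.2 <= tau n k.+1)) => [/andP[h7 h6]|_]; last by rewrite !mulr0.
  by rewrite (le_trans h6 h3) mulr1 mul1r.
have cE n wz : elem_process bm_cell (c n) wz.2 wz.1 =
    ind 0 u wz.2 * (H wz.2 wz.1 - simple_value (m' n) (tau' n) (xi' n) wz.2 wz.1) -
    ind 0 u wz.2 * (H wz.2 wz.1 - simple_value (m n) (tau n) (xi n) wz.2 wz.1).
  rewrite /elem_process !big_sumType/= /cset /bm_cell/=.
  rewrite (_ : _ - _ = ind 0 u wz.2 * simple_value (m n) (tau n) (xi n) wz.2 wz.1 -
     ind 0 u wz.2 * simple_value (m' n) (tau' n) (xi' n) wz.2 wz.1); last by ring.
  rewrite addrAC; congr (_ + _).
    rewrite -big_split/= /simple_value big_distrr/=; apply: eq_bigr => k _.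
    have [h1 h2 h3 _ _] := wfx n k; rewrite /= in h1 h2 h3.
    rewrite ?oc_indE !indE gt_max le_max.
    case: (boolP (tau n k < wz.2)) => /= h4; last by rewrite !mulr0 andbF mulr0 addr0.
    rewrite (le_lt_trans h1 h4) /=.
    case: (boolP (wz.2 <= u)) => /= h5.
      rewrite ltNge h5/= mulr0 addr0 mul1r.
      by case: ifP => _; rewrite ?mulr1 ?mulr0.
    by rewrite ltNge h5/= mul0r mulNr subrr.
  rewrite /simple_value big_distrr/= -sumrN; apply: eq_bigr => k _.
  have [h1 h2 h3 _ _] := wfy n k; rewrite /= in h1 h2 h3.
  rewrite ?oc_indE !indE.
  case: (boolP (tau' n k < wz.2 <= tau' n k.+1)) => [/andP[h4 h5]|_]; last by rewrite !mulr0 oppr0.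
  by rewrite (le_lt_trans h1 h4) (le_trans h5 h3) mulr1 mul1r.
have rvadd n w : X w - elem_integral (bm_rv i) (z n) w =
   (Y w - simple_integral (W i) (m n) (tau n) (xi n) w) -
   (Y' w - simple_integral (W i) (m' n) (tau' n) (xi' n) w) + elem_integral (bm_rv i) (c n) w.
  rewrite /X /elem_integral !big_sumType/= (big_pred1 tt)//.
  rewrite /crv /bm_rv /= /simple_integral /incr.
  have sN l (f g : 'I_l -> R) : \sum_k (- f k) * g k = - \sum_k f k * g k.
    by rewrite -sumrN; apply: eq_bigr => k _; rewrite mulNr.
  rewrite (sN _ (fun k : 'I_(m n) => xi n k w) (fun k => W i (Num.max u (tau n k.+1)) w - W i (Num.max u (tau n k)) w)).
  rewrite (sN _ (fun k : 'I_(m' n) => xi' n k w) (fun k => W i (tau' n k.+1) w - W i (tau' n k) w)).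
  ring.
have wfz' n k := wfz n k.
have cG : sqn nu (fun wz => (G wz - elem_process bm_cell (z n) wz.2 wz.1)%R) @[n --> \oo] --> 0%E.
  apply: (squeeze_cvge _ (cvg_cst 0%E) cX); apply: nearW => n; rewrite sqn_ge0/=.
  apply: le_sqn => //.
    apply: measurable_funB => //; exact: (elem_process_measurable mF (brownian_integrator i) (wfz n)).
  move=> wz; rewrite zE /G -mulrBr opprB addrA subrK.
  exact: (sub_ind _ _ _ _ (fun wz => H wz.2 wz.1 - simple_value (m n) (tau n) (xi n) wz.2 wz.1)).
have mX : measurable_fun setT X.
  apply: measurable_funB; first exact: measurable_funB.
  apply: measurable_funM; last exact: incr_measurable.
  by case: bzeta => + _; exact: measurable_wrt_fun.
have mIx n : measurable_fun setT (simple_integral (W i) (m n) (tau n) (xi n)).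
  by have [+ _] := elem_integral_sqintg mF (brownian_integrator i) (lexx 0) (wfx n).
have mIy n : measurable_fun setT (simple_integral (W i) (m' n) (tau' n) (xi' n)).
  by have [+ _] := elem_integral_sqintg mF (brownian_integrator i) (lexx 0) (wfy n).
have mIc n : measurable_fun setT (elem_integral (bm_rv i) (c n)).
  by have [+ _] := elem_integral_sqintg mF (brownian_integrator i) (lexx 0) (wfc n).
have cXI : sqn Pr (fun w => (X w - elem_integral (bm_rv i) (z n) w)%R) @[n --> \oo] --> 0%E.
  apply/(cvg_sqn0 (fun n => sqn_ge0 _ _)) => e e0.
  (* There are four errors, and each is doubled twice. *)
  have e16 : 0 < e / 16 by rewrite divr_gt0.
  have n1 := (cvg_sqn0 (fun n => sqn_ge0 _ _)).1 cY _ e16.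
  have n2 := (cvg_sqn0 (fun n => sqn_ge0 _ _)).1 cY' _ e16.
  have n3 := (cvg_sqn0 (fun n => sqn_ge0 _ _)).1 cX _ e16.
  have n4 := (cvg_sqn0 (fun n => sqn_ge0 _ _)).1 cY1 _ e16.
  near=> n.
  under eq_fun do rewrite rvadd.
  apply: le_trans (sqnD _ _ (mIc n)) _; first by apply: measurable_funB; exact: measurable_funB.
  have h1 : (sqn Pr (fun w => (Y w - simple_integral (W i) (m n) (tau n) (xi n) w)%R) <= (e / 16)%:E)%E by near: n; exact: n1.
  have h2 : (sqn Pr (fun w => (Y' w - simple_integral (W i) (m' n) (tau' n) (xi' n) w)%R) <= (e / 16)%:E)%E by near: n; exact: n2.
  have h3 : (sqn nu (fun wz => (ind 0 t wz.2 * (H wz.2 wz.1 - simple_value (m n) (tau n) (xi n) wz.2 wz.1))%R) <= (e / 16)%:E)%E by near: n; exact: n3.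
  have h4 : (sqn nu (fun wz => (ind 0 u wz.2 * (H wz.2 wz.1 - simple_value (m' n) (tau' n) (xi' n) wz.2 wz.1))%R) <= (e / 16)%:E)%E by near: n; exact: n4.
  rewrite (elem_isometry_prod sF mF leF (brownian_integrator i) (lexx 0) (wfc n)).
  have h5 : (sqn nu (fun wz => elem_process bm_cell (c n) wz.2 wz.1) <= (e / 4)%:E)%E.
    under eq_fun do rewrite cE.
    apply: le_trans (sqnB _ (mHy n) (mHxu n)) _.
    have h6 : (sqn nu (fun wz => (ind 0 u wz.2 * (H wz.2 wz.1 - simple_value (m n) (tau n) (xi n) wz.2 wz.1))%R) <= (e / 16)%:E)%E.
      apply: le_trans h3; apply: le_sqn => // wz.
      exact: (sub_ind _ _ _ _ (fun wz => H wz.2 wz.1 - simple_value (m n) (tau n) (xi n) wz.2 wz.1)).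
    apply: (@le_trans _ _ (2%:E * (e / 16)%:E + 2%:E * (e / 16)%:E)%E).
      by apply: leeD; rewrite lee_pmul2l.
    by rewrite -!EFinM -EFinD lee_fin; lra.
  have h7 : (sqn Pr (fun w => (Y w - simple_integral (W i) (m n) (tau n) (xi n) w -
       (Y' w - simple_integral (W i) (m' n) (tau' n) (xi' n) w))%R) <= (e / 4)%:E)%E.
    apply: le_trans (sqnB _ _ _) _; [exact: measurable_funB|exact: measurable_funB|].
    apply: (@le_trans _ _ (2%:E * (e / 16)%:E + 2%:E * (e / 16)%:E)%E).
      by apply: leeD; rewrite lee_pmul2l.
    by rewrite -!EFinM -EFinD lee_fin; lra.
  apply: (@le_trans _ _ (2%:E * (e / 4)%:E + 2%:E * (e / 4)%:E)%E).
    by apply: leeD; rewrite lee_pmul2l.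
  by rewrite -!EFinM -EFinD lee_fin; lra.
have [h1 h2] := limit_mean_zero sF mF leF (brownian_integrator i) u0 mG mX wfz cG cXI Gfin.
by split=> //; exact: (limit_sqn sF mF leF (brownian_integrator i) u0 mG mX wfz cG cXI).
Unshelve. all: by end_near. Qed.

End ito_increment.

End noise_integrators.

(** * Compensated Poisson integrals *)

Section poisson_integrator.
Context {d : measure_display} {T : measurableType d} {R : realType} {p : nat}.
Variable Pr : probability T R.
Variables (W : 'I_p.+1 -> R -> T -> R) (Np : 'I_p -> R.-ker T ~> (marked R)).
Hypothesis hnoise : noise Pr W Np.
Variable j : 'I_p.
Implicit Types (u t a b : R) (C : set (marked R)).

Local Notation F := (noise_filtration Pr W Np).
Local Notation mR := (measurableTypeR R).
Local Notation leb := (@lebesgue_measure R).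
Local Notation mu2 := (leb \x leb)%E.

Let sF u : sigma_algebra setT (F u). Proof. exact: noise_filtration_sigma. Qed.
Let mF u : F u `<=` measurable. Proof. exact: (noise_filtration_measurable hnoise). Qed.
Let leF u t : u <= t -> F u `<=` F t. Proof. exact: noise_filtration_le. Qed.

Let pppj : poisson_point_process Pr (Np j). Proof. by case: hnoise. Qed.

(** [fine] sends an infinite count to 0; for a future set of finite measure this happens on a null
    event only. *)
Definition count C (w : T) : R := fine (Np j w C).
Definition comp C (w : T) : R := count C w - fine (mu2 C).

Definition after u C : Prop :=
  [/\ measurable C, C `<=` [set z : marked R | u < z.2] & (mu2 C < +oo)%E].

Lemma after_sub u C C' : after u C -> measurable C' -> C' `<=` C -> after u C'.
Proof.
move=> [mC Cu fC] mC' CC'; split => //; first exact: subset_trans CC' Cu.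
by apply: le_lt_trans fC; apply: le_measure; rewrite ?inE.
Qed.

Section one_set.
Variables (u : R) (C : set (marked R)).
Hypotheses (u0 : 0 <= u) (hC : after u C).

Let mC : measurable C. Proof. by case: hC. Qed.

Let intC : ppp_intensity C = mu2 C.
Proof.
have [_ Cu _] := hC; rewrite /ppp_intensity (_ : C `&` _ = C)//.
by apply/seteqP; split=> z; [case|move=> Cz; split=> //=; exact: ltW (le_lt_trans u0 (Cu _ Cz))].
Qed.

Let r := fine (mu2 C).
Let r0 : 0 <= r. Proof. by rewrite fine_ge0. Qed.
Let mN : measurable_fun setT (fun w => Np j w C). Proof. exact: count_measurable. Qed.
Let valN w : Np j w C = +oo%E \/ exists n : nat, Np j w C = n%:R%:E.
Proof. by case: pppj => h _ _; exact: h. Qed.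
Let lawN (n : nat) : Pr [set w | Np j w C = n%:R%:E] = (r ^+ n / n`!%:R * expR (- r))%:E.
Proof. by case: pppj => _ h _; rewrite h ?intC//; case: hC. Qed.

Lemma count_fin : {ae Pr, forall w, (Np j w C < +oo)%E}.
Proof. exact: (poisson_fin mN valN r0 lawN). Qed.

Lemma count_sqintg : sqintg Pr (count C).
Proof. exact: (poisson_sqintg mN valN r0 lawN). Qed.

Lemma count_mean : mean Pr (count C) = r.
Proof. exact: (poisson_mean mN valN r0 lawN). Qed.

Lemma count_mean2 : mean Pr (fun w => count C w ^+ 2) = r ^+ 2 + r.
Proof. exact: (poisson_mean2 mN valN r0 lawN). Qed.

Lemma count_nat w : exists n : nat, count C w = n%:R.
Proof.
by rewrite /count; case: (valN w) => [->|[n ->]]; [exists 0%N|exists n].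
Qed.

Lemma count_law_others : law_events (count C) `<=` count_events (Np j) C.
Proof.
move=> A [B mB ->]; exists (fine @^-1` B) => //.
by rewrite -[_ @^-1` _]setTI; exact: fine_measurable.
Qed.

Lemma count_indep : independent2 Pr (others Pr W Np (inr j) u) (law_events (count C)).
Proof.
apply: independent2_subr count_law_others _.
by case: hC => ? ? _; exact: (count_independent hnoise).
Qed.

Lemma comp_sqintg : sqintg Pr (comp C).
Proof.
apply: sqintgB; first exact: count_sqintg.
by apply: (@sqintg_bounded _ _ _ _ _ `|r|).
Qed.

Lemma comp_mean : mean Pr (comp C) = 0.
Proof.
rewrite meanB ?count_mean ?mean_cst ?subrr//; last exact: intg_cst.
exact: sqintg_intg count_sqintg.
Qed.

Lemma comp_mean2 : mean Pr (fun w => comp C w ^+ 2) = r.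
Proof.
have [_ i2] := count_sqintg; have i1 := sqintg_intg count_sqintg.
have -> : (fun w => comp C w ^+ 2) = (fun w => count C w ^+ 2 - 2 * r * count C w + r ^+ 2).
  by apply/funext => w; rewrite /comp -/r; ring.
have iz := intgZ (2 * r) i1.
rewrite (meanD (intgB i2 iz) (intg_cst Pr _)) (meanB i2 iz) meanZ// mean_cst.
by rewrite count_mean count_mean2; ring.
Qed.

Lemma comp_indep : independent2 Pr (others Pr W Np (inr j) u) (law_events (comp C)).
Proof.
apply: independent2_subr count_indep.
apply: (law_events_comp (phi := fun x => x - r)).
exact: measurable_funB.
Qed.

Let Fsub : F u `<=` others Pr W Np (inr j) u.
Proof. exact: noise_filtration_sub_others. Qed.

Lemma comp_mean_zero xi : measurable_wrt (F u) xi -> intg Pr xi ->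
  mean Pr (fun w => xi w * comp C w) = 0.
Proof.
move=> hxi ixi.
have [_ ->] := independent2_mean comp_indep (measurable_wrt_sub Fsub hxi) (sqintg_intg comp_sqintg) ixi.
by rewrite comp_mean mulr0.
Qed.

Lemma comp_var xi : bounded_wrt (F u) xi ->
  mean Pr (fun w => xi w * comp C w ^+ 2) = mean Pr xi * r.
Proof.
move=> [hxi [c hc]]; have [_ i2] := comp_sqintg.
have ixi : intg Pr xi by apply: intg_bounded hc; exact: measurable_wrt_fun (@mF _) hxi.
have ind2 : independent2 Pr (others Pr W Np (inr j) u) (law_events (fun w => comp C w ^+ 2)).
  apply: independent2_subr comp_indep.
  by apply: (law_events_comp (phi := fun x => x ^+ 2)); exact: exprn_measurable.
have [_ ->] := independent2_mean ind2 (measurable_wrt_sub Fsub hxi) i2 ixi.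
by rewrite comp_mean2.
Qed.

End one_set.

Lemma fine_mu2U u A B : after u A -> after u B -> A `&` B = set0 ->
  fine (mu2 (A `|` B)) = fine (mu2 A) + fine (mu2 B).
Proof.
move=> [mA _ fA] [mB _ fB] AB; rewrite measureU//.
have nA : mu2 A \is a fin_num by rewrite ge0_fin_numE.
have nB : mu2 B \is a fin_num by rewrite ge0_fin_numE.
exact: (fineD nA nB).
Qed.

Lemma comp_add u A B : 0 <= u -> after u A -> after u B -> A `&` B = set0 ->
  {ae Pr, forall w, comp (A `|` B) w = comp A w + comp B w}.
Proof.
move=> u0 hA hB AB; have [mA Au fA] := hA; have [mB Bu fB] := hB.
apply: filterS2 (count_fin u0 hA) (count_fin u0 hB) => w fAw fBw.
have nA : Np j w A \is a fin_num by rewrite ge0_fin_numE.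
have nB : Np j w B \is a fin_num by rewrite ge0_fin_numE.
rewrite /comp /count (measureU _ mA mB AB) (fineD nA nB) (fine_mu2U hA hB AB).
by rewrite opprD addrACA.
Qed.

Lemma after_U u A B : after u A -> after u B -> after u (A `|` B).
Proof.
move=> [mA Au fA] [mB Bu fB]; split; first exact: measurableU.
  by move=> z [/Au|/Bu].
by apply: (le_lt_trans (measureU2 _ mA mB)); rewrite lte_add_pinfty.
Qed.

Let mean_ext (X Y : T -> R) : X =1 Y -> mean Pr X = mean Pr Y.
Proof. by move=> /funext ->. Qed.

Let icomp u xi A B : 0 <= u -> bounded_wrt (F u) xi -> after u A -> after u B ->
  intg Pr (fun w => xi w * (comp A w * comp B w)).
Proof.
move=> u0 bxi hA hB; apply: (bounded_intg (@mF _) bxi).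
exact: (sqintgM (comp_sqintg u0 hA) (comp_sqintg u0 hB)).
Qed.

Let polar (m a b z : R) : m * (a + b) = m * a + 2 * z + m * b -> z = 0.
Proof. by move=> e; lra. Qed.

(* Polarization of [comp_var]. *)
Lemma comp_cov0 u xi A B : 0 <= u -> bounded_wrt (F u) xi -> after u A -> after u B ->
  A `&` B = set0 -> mean Pr (fun w => xi w * (comp A w * comp B w)) = 0.
Proof.
move=> u0 bxi hA hB AB; have hU := after_U hA hB.
have [mA Au fA] := hA; have [mB Bu fB] := hB.
have sq C : after u C -> mean Pr (fun w => xi w * (comp C w * comp C w)) = mean Pr xi * fine (mu2 C).
  by move=> hC; rewrite -(comp_var u0 hC bxi); apply: mean_ext => w; rewrite expr2.
have eU := sq _ hU; have eA := sq _ hA; have eB := sq _ hB.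
have iA := icomp u0 bxi hA hA; have iB := icomp u0 bxi hB hB.
have iAB := icomp u0 bxi hA hB; have iU := icomp u0 bxi hU hU.
have : mean Pr (fun w => xi w * (comp (A `|` B) w * comp (A `|` B) w)) =
   mean Pr (fun w => (xi w * (comp A w * comp A w) + 2 * (xi w * (comp A w * comp B w))) + xi w * (comp B w * comp B w)).
  apply: mean_ae.
  - exact: intg_meas iU.
  - by apply: intg_meas (intgD (intgD iA (intgZ 2 iAB)) iB).
  - by apply: filterS (comp_add u0 hA hB AB) => w ->; ring.
have i2 := intgZ 2 iAB.
rewrite (meanD (intgD iA i2) iB) (meanD iA i2) meanZ// eU eA eB (fine_mu2U hA hB AB).
set z := mean Pr (fun w => xi w * (comp A w * comp B w)).
exact: polar.
Qed.

(** After splitting both sets along their intersection, only the common piece contributes: disjoint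
    pieces are orthogonal by [comp_cov0]. *)
Lemma comp_cov u xi A B : 0 <= u -> bounded_wrt (F u) xi -> after u A -> after u B ->
  mean Pr (fun w => xi w * (comp A w * comp B w)) = mean Pr xi * fine (mu2 (A `&` B)).
Proof.
move=> u0 bxi hA hB; have [mA Au fA] := hA; have [mB Bu fB] := hB.
have hI : after u (A `&` B) by apply: (after_sub hA); [exact: measurableI|exact: subIsetl].
have hA' : after u (A `\` B) by apply: (after_sub hA); [exact: measurableD|exact: subDsetl].
have hB' : after u (B `\` A) by apply: (after_sub hB); [exact: measurableD|exact: subDsetl].
have d1 : (A `\` B) `&` (A `&` B) = set0 by apply/seteqP; split=> z //= [[? ?] [? ?]].
have d2 : (B `\` A) `&` (A `&` B) = set0 by apply/seteqP; split=> z //= [[? ?] [? ?]].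
have d3 : (A `\` B) `&` (B `\` A) = set0 by apply/seteqP; split=> z //= [[? ?] [? ?]].
have eA : A = (A `\` B) `|` (A `&` B).
  by apply/seteqP; split=> z /=; [have [] := pselect (B z); [right|left]|move=> [[]|[]]].
have eB : B = (B `\` A) `|` (A `&` B).
  by apply/seteqP; split=> z /=; [have [] := pselect (A z); [right|left]|move=> [[]|[]]].
have i1 := icomp u0 bxi hA' hB'; have i2 := icomp u0 bxi hA' hI.
have i3 := icomp u0 bxi hB' hI; have i4 := icomp u0 bxi hI hI.
transitivity (mean Pr (fun w => xi w * (comp (A `\` B) w * comp (B `\` A) w) +
   xi w * (comp (A `\` B) w * comp (A `&` B) w) + xi w * (comp (B `\` A) w * comp (A `&` B) w) +
   xi w * (comp (A `&` B) w * comp (A `&` B) w))).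
  apply: mean_ae.
  - exact: intg_meas (icomp u0 bxi hA hB).
  - exact: intg_meas (intgD (intgD (intgD i1 i2) i3) i4).
  - have a1 := comp_add u0 hA' hI d1; have a2 := comp_add u0 hB' hI d2.
    rewrite -eA in a1; rewrite -eB in a2.
    by apply: filterS2 a1 a2 => w -> ->; ring.
have i12 := intgD i1 i2; have i123 := intgD i12 i3.
rewrite (meanD i123 i4) (meanD i12 i3) (meanD i1 i2).
rewrite (comp_cov0 u0 bxi hA' hB' d3) (comp_cov0 u0 bxi hA' hI d1) (comp_cov0 u0 bxi hB' hI d2) !add0r.
rewrite -(comp_var u0 hI bxi); apply: mean_ext => w; ring.
Qed.

Variable c : R.

(** The bound [c] on the marks makes every cell of finite measure; it will be a bound of the jump
    rates. *)
Definition pp_ok (C : set R) : Prop := measurable C /\ C `<=` `]0, c]%classic.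
Definition pp_cell a b (C : set R) : set (marked R) := C `*` `]a, b]%classic.
Definition pp_rv a b (C : set R) : T -> R := comp (pp_cell a b C).

Lemma pp_cellP a b (C : set R) z : pp_cell a b C z <-> C z.1 /\ a < z.2 /\ z.2 <= b.
Proof.
rewrite /pp_cell /= in_itv /=; split=> [[Cz /andP[h1 h2]]|[Cz [h1 h2]]] //.
by split=> //; rewrite h1.
Qed.

Lemma pp_cell_measurable a b (C : set R) : measurable C -> measurable (pp_cell a b C).
Proof. by move=> mC; apply: measurableX => //; exact: measurable_itv. Qed.

Lemma pp_cell_fin a b (C : set R) : pp_ok C -> (mu2 (pp_cell a b C) < +oo)%E.
Proof.
move=> [mC Cc]; rewrite /pp_cell (product_measure1E leb leb mC (measurable_itv _)).
have h : (leb C < +oo)%E.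
  apply: (@le_lt_trans _ _ (leb `]0, c]%classic)); first by apply: le_measure; rewrite ?inE//; exact: measurable_itv.
  by rewrite lebesgue_measure_itv/=; case: ifP => _ //; rewrite -EFinD ltry.
have h' : (leb `]a, b]%classic < +oo)%E.
  by rewrite lebesgue_measure_itv/=; case: ifP => _ //; rewrite -EFinD ltry.
by apply: lte_mul_pinfty => //; rewrite ge0_fin_numE.
Qed.

Lemma pp_cell_after a b (C : set R) : pp_ok C -> after a (pp_cell a b C).
Proof.
move=> okC; split; first by case: okC => ? _; exact: pp_cell_measurable.
  by move=> z [_ /=]; rewrite in_itv/= => /andP[].
exact: pp_cell_fin.
Qed.

Lemma pp_integrator : integrator Pr mu2 F pp_ok pp_cell pp_rv.
Proof.
split.
- by move=> a b C [mC _]; exact: pp_cell_measurable.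
- by move=> a b C; exact: pp_cell_fin.
- move=> a b C a' b' C'; rewrite /pp_cell -!setXI itv_oc_cap setIid//.
- move=> a b C ba; rewrite /pp_cell (_ : `]a, b]%classic = set0) ?setX0//.
  apply/seteqP; split=> x //=.
  by rewrite in_itv/= => /andP[ax xb]; have := lt_le_trans ax (le_trans xb ba); rewrite ltxx.
- move=> a b C a0 ab okC B mB; apply: sub_sigma_algebra; constructor 2; exists j.
  exists (pp_cell a b C), ((fun x => fine x - fine (mu2 (pp_cell a b C))) @^-1` B); split=> //.
  + by case: okC => mC _; exact: pp_cell_measurable.
  + move=> z [_ /=]; rewrite in_itv/= => /andP[az ->]; rewrite andbT.
    exact: ltW (le_lt_trans a0 az).
  + rewrite -[_ @^-1` _]setTI.
    have : measurable_fun setT (fun x : \bar R => fine x - fine (mu2 (pp_cell a b C))).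
      by apply: measurable_funB => //; exact: fine_measurable.
    by apply.
- by move=> a b C a0 ab okC; apply: (comp_sqintg a0); exact: pp_cell_after.
- move=> a b e C a0 ab be okC.
  have -> : pp_rv a e C = comp (pp_cell a b C `|` pp_cell b e C).
    rewrite /pp_rv; congr comp; apply/seteqP; split=> z.
      move/pp_cellP => [Cx [as_ se]]; have [sb|bs] := leP z.2 b; [left|right]; exact/pp_cellP.
    move=> [|] /pp_cellP[Cx [h1 h2]]; apply/pp_cellP; split=> //; split=> //.
      exact: le_trans be.
    exact: le_lt_trans h1.
  apply: (comp_add a0).
  + exact: pp_cell_after.
  + have [h1 h2 h3] := @pp_cell_after b e C okC; split=> // z /h2 /=; exact: le_lt_trans.
  + apply/seteqP; split=> // z [/pp_cellP[_ [_ h1]] /pp_cellP[_ [h2 _]]].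
    by have := le_lt_trans h1 h2; rewrite ltxx.
- move=> a b C xi a0 ab okC hxi ixi.
  by apply: (comp_mean_zero a0) => //; exact: pp_cell_after.
- move=> a b C C' xi a0 ab okC okC' bxi.
  by apply: (comp_cov a0) => //; exact: pp_cell_after.
Qed.

End poisson_integrator.

(** * Dominated convergence for real integrals *)

Section dominated.
Context {d : measure_display} {Z : measurableType d} {R : realType}.
Variable m : {measure set Z -> \bar R}.
Implicit Types (f g : Z -> R) (B : R).

Definition integ (f : Z -> R) : Prop := m.-integrable setT (EFin \o f).

Lemma integ_le f g : measurable_fun setT f -> integ g -> (forall z, `|f z| <= g z) -> integ f.
Proof.
move=> mf ig fg; apply: (le_integrable measurableT _ _ ig); first exact/measurable_EFinP.
by move=> z _; rewrite /= lee_fin (le_trans (fg z))// ler_norm.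
Qed.

Lemma Rintegral_dominated (f_ : nat -> Z -> R) f g :
  (forall n, measurable_fun setT (f_ n)) -> (forall z, f_ n z @[n --> \oo] --> f z) ->
  integ g -> (forall n z, `|f_ n z| <= g z) ->
  (\int[m]_z f_ n z) @[n --> \oo] --> \int[m]_z f z.
Proof.
move=> mf_ cf ig fg.
have mf : measurable_fun setT f by apply: (measurable_fun_cvg mf_) => z _; exact: cf.
have fgl z : `|f z| <= g z.
  by apply: (cvgr_to_le (cvg_norm (cf z))); apply: nearW => n; exact: fg.
have fi : integ f by exact: integ_le fgl.
apply: fine_cvg; rewrite fineK; last exact: integrable_fin_num.
apply: (@dominated_cvg _ _ _ m _ measurableT (fun n => EFin \o f_ n) (EFin \o f) (EFin \o g)) => //.
- by move=> n; exact/measurable_EFinP.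
- by move=> z _; apply: cvg_EFin; [exact: nearW|exact: cf].
- by move=> n z _; rewrite lee_fin.
Qed.

Lemma integ_indic B (D : set Z) : measurable D -> (m D < +oo)%E -> integ (fun z => B * \1_D z).
Proof.
move=> mD fD; apply: (@integrableZl _ _ _ m _ measurableT B (EFin \o \1_D)) => //.
apply/integrableP; split; first by apply/measurable_EFinP.
rewrite (eq_integral (fun z => (\1_D z)%:E)) ?integral_indic ?setIT//.
by move=> z _; rewrite /= ger0_norm.
Qed.

Lemma integ_bounded_supp f (D : set Z) B : measurable D -> (m D < +oo)%E ->
  measurable_fun setT f -> (forall z, `|f z| <= B) -> (forall z, ~ D z -> f z = 0) -> integ f.
Proof.
move=> mD fD mf fB f0; apply: (@integ_le _ (fun z => B * \1_D z)) => //.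
  exact: integ_indic.
move=> z; rewrite indicE; have [Dz|nDz] := pselect (D z).
  by rewrite mem_set// mulr1.
by rewrite memNset// mulr0 f0// normr0.
Qed.

Lemma Rintegral_bounded_supp (f_ : nat -> Z -> R) f (D : set Z) B :
  measurable D -> (m D < +oo)%E ->
  (forall n, measurable_fun setT (f_ n)) -> (forall z, f_ n z @[n --> \oo] --> f z) ->
  (forall n z, `|f_ n z| <= B) -> (forall n z, ~ D z -> f_ n z = 0) ->
  (\int[m]_z f_ n z) @[n --> \oo] --> \int[m]_z f z.
Proof.
move=> mD fD mf cf fB f0; apply: (@Rintegral_dominated _ _ (fun z => B * \1_D z)) => //.
  exact: integ_indic.
move=> n z; rewrite indicE; have [Dz|nDz] := pselect (D z).
  by rewrite mem_set// mulr1.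
by rewrite memNset// mulr0 f0// normr0.
Qed.

Lemma Rintegral_norm_bounded_supp f (D : set Z) B : measurable D -> (m D < +oo)%E ->
  measurable_fun setT f -> (forall z, `|f z| <= B) -> (forall z, ~ D z -> f z = 0) ->
  `|\int[m]_z f z| <= B * fine (m D).
Proof.
move=> mD fD mf fB f0; have fi := integ_bounded_supp mD fD mf fB f0.
apply: (le_trans (le_normr_Rintegral measurableT fi)).
have -> : B * fine (m D) = \int[m]_z (B * \1_D z).
  rewrite RintegralZl//; last by have := integ_indic 1 mD fD; under eq_fun do rewrite mul1r.
  by rewrite /Rintegral integral_indic// setIT.
apply: le_Rintegral => //.
- exact: integrable_norm.
- exact: integ_indic.
move=> z _; rewrite indicE; have [Dz|nDz] := pselect (D z).
  by rewrite mem_set// mulr1.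
by rewrite memNset// mulr0 f0// normr0.
Qed.

End dominated.

(** * Uniform grids *)

Section grid.
Context {R : realType}.
Implicit Types (a b s : R) (n k : nat) (phi : R -> R).

Definition gpt a b n k : R := a + (b - a) * (k%:R / n.+1%:R).

(** Each cell carries the value of [phi] at its left end, so that for an adapted process the value
    is known when the cell begins. *)
Definition gsum a b n phi s : R :=
  \sum_(k < n.+1) phi (gpt a b n k) * oc_ind (gpt a b n k) (gpt a b n k.+1) s.

Lemma gpt0 a b n : gpt a b n 0 = a.
Proof. by rewrite /gpt mul0r mulr0 addr0. Qed.

Lemma gptn a b n : gpt a b n n.+1 = b.
Proof. by rewrite /gpt divff ?pnatr_eq0// mulr1; ring. Qed.

Lemma le_gpt a b n k l : a <= b -> (k <= l)%N -> gpt a b n k <= gpt a b n l.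
Proof.
by move=> ab kl; rewrite lerD2l ler_wpM2l ?subr_ge0// ler_pM2r ?ler_nat// invr_gt0.
Qed.

Lemma gpt_ge a b n k : a <= b -> a <= gpt a b n k.
Proof. by move=> ab; rewrite -[leLHS](gpt0 a b n) le_gpt. Qed.

Lemma gpt_le a b n k : a <= b -> (k <= n.+1)%N -> gpt a b n k <= b.
Proof. by move=> ab kn; rewrite -[leRHS](gptn a b n) le_gpt. Qed.

Lemma gptS a b n k : gpt a b n k.+1 - gpt a b n k = (b - a) / n.+1%:R.
Proof. by rewrite /gpt -natr1 mulrDl; ring. Qed.

Lemma gsum_out a b n phi s : a <= b -> ~~ (a < s <= b) -> gsum a b n phi s = 0.
Proof.
move=> ab h; rewrite /gsum big1// => k _; rewrite /oc_ind.
suff -> : (gpt a b n k < s <= gpt a b n k.+1) = false by rewrite mulr0.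
apply: contraNF h => /andP[h1 h2].
by rewrite (le_lt_trans _ h1) ?gpt_ge// (le_trans h2)// gpt_le.
Qed.

Lemma gsum_in a b n s : a < s <= b -> exists2 r, a <= r < s /\ s - r <= (b - a) / n.+1%:R &
  forall phi, gsum a b n phi s = phi r.
Proof.
move=> /andP[as_ sb]; have ab := ltW (lt_le_trans as_ sb).
have ex : exists k, s <= gpt a b n k by exists n.+1; rewrite gptn.
have [[|k] sk kmin] := ex_minnP ex; first by move: sk; rewrite gpt0 leNgt as_.
have ks : gpt a b n k < s.
  by rewrite ltNge; apply/negP => /kmin; rewrite ltnn.
have kn : (k < n.+1)%N by apply: kmin; rewrite gptn.
exists (gpt a b n k).
  by rewrite gpt_ge//= ks; split=> //; rewrite -(gptS a b n k) lerD2r.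
move=> phi; rewrite /gsum (bigD1 (Ordinal kn))//= big1 => [|i ik].
  by rewrite addr0 /oc_ind ks sk mulr1.
rewrite /oc_ind; case: ltngtP (ik : i != k :> nat) => // [ik'|ki] _.
  by rewrite [s <= _]leNgt (le_lt_trans (le_gpt _ ab ik') ks) andbF mulr0.
by rewrite ltNge (le_trans sk (le_gpt _ ab ki)) mulr0.
Qed.

Lemma gsum_seq a b s : a < s <= b -> exists r : nat -> R,
  [/\ forall n, a <= r n < s, r n @[n --> \oo] --> s
    & forall phi n, gsum a b n phi s = phi (r n)].
Proof.
move=> asb; have /choice[r hr] : forall n, exists r, [/\ a <= r < s, s - r <= (b - a) / n.+1%:R &
    forall phi, gsum a b n phi s = phi r].
  by move=> n; have [r [h1 h2] h3] := gsum_in n asb; exists r.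
exists r; split; [by move=> n; case: (hr n)| |by move=> phi n; case: (hr n)].
apply: (@squeeze_cvgr _ _ _ _ (fun n => s - (b - a) / n.+1%:R) (fun=> s)).
- apply: nearW => n; have [/andP[_ h1] h2 _] := hr n.
  by rewrite (ltW h1) andbT lerBlDr -lerBlDl.
- rewrite -[X in _ --> X]subr0; apply: cvgB; first exact: cvg_cst.
  rewrite -[X in _ --> X](mulr0 (b - a)); apply: cvgM; first exact: cvg_cst.
  exact: cvg_harmonic.
- exact: cvg_cst.
Qed.

End grid.

(** * Continuous approximations of the indicator of the positive numbers *)

Section ramp.
Context {R : realType}.
Implicit Types (y : R) (m : nat).

(* [ramp m y] is [min (1, m * max (y, 0))]. *)
Definition ramp m y : R :=
  let q := m%:R * ((y + `|y|) / 2) in (1 + q - `|1 - q|) / 2.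

Lemma ramp_itv m y : 0 <= ramp m y <= 1.
Proof.
rewrite /ramp; set q := m%:R * _.
have q0 : 0 <= q by rewrite mulr_ge0// divr_ge0//; have := ler_norm (- y); rewrite normrN; lra.
have [h|h] := leP q 1; first by rewrite ger0_norm ?subr_ge0//; apply/andP; split; lra.
by rewrite ltr0_norm ?subr_lt0//; apply/andP; split; lra.
Qed.

Lemma ramp_norm m y : `|ramp m y| <= 1.
Proof. by have /andP[h1 h2] := ramp_itv m y; rewrite ger0_norm. Qed.

Lemma ramp_neg m y : y <= 0 -> ramp m y = 0.
Proof. by move=> y0; rewrite /ramp ler0_norm// subrr mul0r mulr0 addr0 subr0 normr1 subrr mul0r. Qed.

Lemma ramp_cvg m (U : Type) (G : set_system U) (FG : Filter G) (y_ : U -> R) y :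
  y_ n @[n --> G] --> y -> ramp m (y_ n) @[n --> G] --> ramp m y.
Proof.
move=> cy; have cq : m%:R * ((y_ n + `|y_ n|) / 2) @[n --> G] --> m%:R * ((y + `|y|) / 2).
  apply: cvgM; first exact: cvg_cst.
  by apply: cvgM; [apply: cvgD => //; exact: cvg_norm|exact: cvg_cst].
apply: cvgM; last exact: cvg_cst.
apply: cvgB; first by apply: cvgD => //; exact: cvg_cst.
by apply: cvg_norm; apply: cvgB => //; exact: cvg_cst.
Qed.

Lemma ramp_lim y : ramp m y @[m --> \oo] --> ((0 < y)%R%:R : R).
Proof.
have [y0|y0] := ltP 0 y; last first.
  by apply: cvg_near_cst; apply: nearW => m; rewrite ramp_neg.
apply: cvg_near_cst; near=> m.
have q1 : 1 <= m%:R * y.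
  rewrite -ler_pdivrMr// div1r; near: m; exact: nbhs_infty_ger.
rewrite /ramp gtr0_norm// (_ : (y + y) / 2 = y); last by field.
rewrite ler0_norm ?subr_le0// (_ : true%:R = 1 :> R)//; lra.
Unshelve. all: by end_near. Qed.

End ramp.

(** * Lebesgue measure on the plane as a sigma-finite measure *)

Section lebesgue_plane.
Context {R : realType}.
Local Notation leb := (@lebesgue_measure R).

Let sfin : sigma_finite setT (@leb2 R).
Proof.
pose I (n : nat) : set (measurableTypeR R) := `]- n%:R, n%:R]%classic.
exists (fun n => I n `*` I n).
  apply/seteqP; split=> // -[x y] _.
  exists (Num.truncn (`|x| + `|y|)).+1 => //.
  have xy : `|x| + `|y| < (Num.truncn (`|x| + `|y|)).+1%:R by exact: truncnS_gt.
  have hx := normr_ge0 x; have hy := normr_ge0 y; have := ler_norm x; have := ler_norm y.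
  have := ler_norm (- x); have := ler_norm (- y); rewrite !normrN => h1 h2 h3 h4.
  by split; rewrite /I /= in_itv/=; apply/andP; split; lra.
move=> n; have mI : measurable (I n) by exact: measurable_itv.
have fI : (leb (I n) < +oo)%E.
  by rewrite lebesgue_measure_itv/=; case: ifP => _ //; rewrite -EFinD ltry.
split; first exact: measurableX.
have e : leb2 (I n `*` I n) = (leb (I n) * leb (I n))%E := product_measure1E leb leb mI mI.
by apply: (@eq_ind_r _ _ (fun x => (x < +oo)%E) _ _ e); rewrite lte_mul_pinfty// ge0_fin_numE.
Qed.

Definition lebs : {sigma_finite_measure set (marked R) -> \bar R} :=
  HB.pack (@leb2 R : set (marked R) -> \bar R) (Measure_isSigmaFinite.Build _ _ _ (@leb2 R) sfin) (Measure.class (@leb2 R)).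
End lebesgue_plane.

(** * Integrals against a compensated Poisson process *)

Section jump_integral.
Context {d : measure_display} {T : measurableType d} {R : realType} {p : nat}.
Variable Pr : probability T R.
Variables (W : 'I_p.+1 -> R -> T -> R) (Np : 'I_p -> R.-ker T ~> (marked R)).
Hypothesis hnoise : noise Pr W Np.
Variable j : 'I_p.
Variables (c u t : R).
Hypotheses (c0 : 0 <= c) (u0 : 0 <= u) (ut : u < t).

Local Notation F := (noise_filtration Pr W Np).
Local Notation leb := (@lebesgue_measure R).
Local Notation mu2 := (@lebs R).
Local Notation nu := (Pr \x mu2)%E.
Local Notation M := (measurableTypeR R * measurableTypeR R)%type.
Local Notation cell := (@cell d T R (set R)).
Local Notation EP x := (fun (w : T) (z : M) => elem_process pp_cell x z w).

Let sF r : sigma_algebra setT (F r). Proof. exact: noise_filtration_sigma. Qed.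
Let mF r : F r `<=` measurable. Proof. exact: (noise_filtration_measurable hnoise). Qed.
Let leF r r' : r <= r' -> F r `<=` F r'. Proof. exact: noise_filtration_le. Qed.

Let itg : integrator Pr mu2 F (pp_ok c) pp_cell (pp_rv Np j) := pp_integrator hnoise j c.

Definition jdom : set M := pp_cell u t `]0, c]%classic.

Let okc : pp_ok c `]0, c]%classic. Proof. by split=> //; exact: measurable_itv. Qed.
Let mD : measurable jdom. Proof. by apply: pp_cell_measurable; case: okc. Qed.
Let fD : (mu2 jdom < +oo)%E. Proof. exact: (pp_cell_fin u t okc). Qed.
Let afD : after u jdom. Proof. exact: (pp_cell_after u t okc). Qed.
Let finN : {ae Pr, forall w, (Np j w jdom < +oo)%E}. Proof. exact: (count_fin hnoise j u0 afD). Qed.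
Let lam := fine (mu2 jdom).
Definition jint (w : T) (h : M -> R) : R := \int[Np j w]_z h z - \int[mu2]_z h z.

(* Cut off on the null event where there are infinitely many points, for measurability. *)
Definition jintf (H : T -> M -> R) (w : T) : R :=
  if (Np j w jdom < +oo)%E then jint w (H w) else 0.

(** A class that contains the elementary processes and is closed under uniformly bounded pointwise
    limits. The isometry is kept as the inequality [good_le], which is the form that the estimates
    use. [good_off] confines the integrand to [jdom], of finite measure, so that constants serve as
    dominating functions. *)
Record good (H : T -> M -> R) : Prop := Good {
  good_meas : measurable_fun setT (fun wz : T * M => H wz.1 wz.2);
  good_off : forall w z, ~ jdom z -> H w z = 0;
  good_bdd : exists B, forall w z, `|H w z| <= B;
  good_mJ : measurable_fun setT (jintf H);
  good_mz : mean_zero_wrt Pr (F u) (jintf H);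
  good_le : mean Pr (fun w => jintf H w ^+ 2) <= \int[nu]_wz (H wz.1 wz.2 ^+ 2)
}.

Let mNu : measurable (setT `*` jdom : set (T * M)).
Proof. exact: measurableX. Qed.

Let fNu : (nu (setT `*` jdom) < +oo)%E.
Proof. by rewrite (product_measure1E Pr mu2 measurableT mD); rewrite [X in (X * _)%E](_ : _ = 1%E) ?mul1e//; exact: probability_setT. Qed.

Let section_meas (H : T -> M -> R) (w : T) : measurable_fun setT (fun wz : T * M => H wz.1 wz.2) ->
  measurable_fun setT (H w : M -> R).
Proof. by move=> mH; exact: (measurableT_comp mH (measurable_pair1 _)). Qed.

Section bound.
Variables (H : T -> M -> R) (B : R).
Hypotheses (mH : measurable_fun setT (fun wz : T * M => H wz.1 wz.2))
  (H0 : forall w z, ~ jdom z -> H w z = 0) (HB : forall w z, `|H w z| <= B).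

Lemma jintf_bound w : `|jintf H w| <= B * (count Np j jdom w + lam).
Proof.
have B0 : 0 <= B by apply: le_trans (HB w (0, 0)).
rewrite /jintf; case: ifP => [fNw|_]; last first.
  by rewrite normr0 mulr_ge0// addr_ge0// fine_ge0.
apply: (le_trans (ler_normB _ _)); rewrite mulrDr; apply: lerD.
  exact: (Rintegral_norm_bounded_supp mD fNw (section_meas w mH) (HB w) (H0 w)).
exact: (Rintegral_norm_bounded_supp mD fD (section_meas w mH) (HB w) (H0 w)).
Qed.

Lemma bound_sqintg : sqintg Pr (fun w => B * (count Np j jdom w + lam)).
Proof.
apply: sqintgZ; apply: sqintgD; first exact: (count_sqintg hnoise j u0 afD).
by apply: (@sqintg_bounded _ _ _ _ _ `|lam|).
Qed.

End bound.

Lemma good_sqintg H : good H -> sqintg Pr (jintf H).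
Proof.
case=> mH H0 [B HB] mJ _ _; split=> //.
have [_ iB] := bound_sqintg B; apply: (intg_le _ iB); first exact: measurable_funX.
by move=> w; rewrite normrX lerXn2r ?nnegrE ?(le_trans _ (jintf_bound mH H0 HB w))// jintf_bound.
Qed.

(** Dominated convergence on two levels: for each outcome against the point measure and its
    intensity, both finite on [jdom], and then under [Pr], where [B] times the count plus its mean
    is a square integrable bound. *)
Lemma good_lim (H_ : nat -> T -> M -> R) (H : T -> M -> R) B :
  (forall n, good (H_ n)) -> (forall n w z, `|H_ n w z| <= B) ->
  (forall w z, H_ n w z @[n --> \oo] --> H w z) -> good H.
Proof.
move=> gH HB cH.
have m_ n := good_meas (gH n); have o_ n := good_off (gH n).
have mH : measurable_fun setT (fun wz : T * M => H wz.1 wz.2).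
  by apply: (measurable_fun_cvg m_) => wz _; exact: cH.
have H0 w z : ~ jdom z -> H w z = 0.
  move=> nz; have := cH w z; under eq_fun do rewrite (o_ _ _ _ nz).
  by move=> /cvg_lim <-//; rewrite lim_cst.
have HB' w z : `|H w z| <= B.
  by apply: (cvgr_to_le (cvg_norm (cH w z))); exact: nearW.
have cJ w : jintf (H_ n) w @[n --> \oo] --> jintf H w.
  rewrite /jintf; case: ifP => [fNw|_]; last exact: cvg_cst.
  apply: cvgB.
    exact: (Rintegral_bounded_supp mD fNw (fun n => section_meas w (m_ n)) (cH w) (fun n => HB n w) (fun n => o_ n w)).
  exact: (Rintegral_bounded_supp mD fD (fun n => section_meas w (m_ n)) (cH w) (fun n => HB n w) (fun n => o_ n w)).
have bJ n w : `|jintf (H_ n) w| <= B * (count Np j jdom w + lam).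
  exact: (jintf_bound (m_ n) (o_ n) (HB n)).
have sB := bound_sqintg B; have [_ iB2] := sB; have iB := sqintg_intg sB.
have mJ : measurable_fun setT (jintf H).
  by apply: (measurable_fun_cvg (fun n => good_mJ (gH n))) => w _; exact: cJ.
have bJ' w : `|jintf H w| <= B * (count Np j jdom w + lam) by exact: (jintf_bound mH H0 HB').
split=> //; first by exists B.
- split; first exact: (intg_le mJ iB).
  move=> Z [mZ [k Zk]]; have mZ' := measurable_wrt_fun (@mF _) mZ.
  have c1 : mean Pr (fun w => Z w * jintf (H_ n) w) @[n --> \oo] --> mean Pr (fun w => Z w * jintf H w).
    apply: (@Rintegral_dominated _ _ _ Pr _ _ (fun w => k * (B * (count Np j jdom w + lam)))).
    + by move=> n; apply: measurable_funM => //; exact: good_mJ (gH n).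
    + by move=> w; apply: cvgM; [exact: cvg_cst|exact: cJ].
    + exact: intgZ.
    + by move=> n w; rewrite normrM ler_pM.
  apply: (cvg_unique _ c1) => //.
  rewrite (_ : (fun n => _) = fun=> 0); first exact: cvg_cst.
  by apply/funext => n; have [_ h] := good_mz (gH n); apply: h; split=> //; exists k.
- have c1 : mean Pr (fun w => jintf (H_ n) w ^+ 2) @[n --> \oo] --> mean Pr (fun w => jintf H w ^+ 2).
    apply: (@Rintegral_dominated _ _ _ Pr _ _ (fun w => (B * (count Np j jdom w + lam)) ^+ 2)) => //.
    + by move=> n; apply: measurable_funX; exact: good_mJ (gH n).
    + by move=> w; rewrite expr2; apply: cvgM; exact: cJ.
    + by move=> n w; rewrite normrX lerXn2r ?nnegrE ?(le_trans _ (bJ n w)).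
  have c2 : \int[nu]_wz (H_ n wz.1 wz.2 ^+ 2) @[n --> \oo] --> \int[nu]_wz (H wz.1 wz.2 ^+ 2).
    apply: (Rintegral_bounded_supp mNu fNu (B := B ^+ 2)).
    + by move=> n; apply: measurable_funX; exact: m_.
    + by move=> z; rewrite expr2; apply: cvgM; exact: cH.
    + by move=> n z; rewrite normrX lerXn2r ?nnegrE ?(le_trans _ (HB n z.1 z.2)).
    + by move=> n z h; rewrite o_ ?expr0n// => Dz; apply: h.
  by apply: (ler_cvg_to c1 c2); apply: nearW => n; exact: good_le (gH n).
Qed.

Section elementary.
Variables (I : finType) (x : I -> cell).
Hypothesis wfx : forall i, wf F (pp_ok c) u t (x i).

Let mc i : measurable (cset pp_cell (x i)).
Proof. by have [_ _ _ [mk _] _] := wfx i; exact: pp_cell_measurable. Qed.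

Let subD i : cset pp_cell (x i) `<=` jdom.
Proof.
have [us _ et [mk kc] _] := wfx i; move=> z /pp_cellP[kz [h1 h2]]; apply/pp_cellP.
by split; [exact: kc|split; [exact: le_lt_trans h1|exact: le_trans et]].
Qed.

Let Rint_elem (m : {measure set M -> \bar R}) w : (m jdom < +oo)%E ->
  \int[m]_z EP x w z = \sum_i cxi (x i) w * fine (m (cset pp_cell (x i))).
Proof.
move=> fm; have fi i : (m (cset pp_cell (x i)) < +oo)%E.
  by apply: le_lt_trans fm; apply: le_measure; rewrite ?inE.
have ii i : integ m (fun z => cxi (x i) w * \1_(cset pp_cell (x i)) z) by exact: integ_indic.
have ei i : \int[m]_z (cxi (x i) w * \1_(cset pp_cell (x i)) z) = cxi (x i) w * fine (m (cset pp_cell (x i))).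
  rewrite RintegralZl//; first by rewrite /Rintegral integral_indic// setIT.
  by have := integ_indic 1 (mc i) (fi i); under eq_fun do rewrite mul1r.
rewrite /elem_process.
suff h (s : seq I) : integ m (fun z => \sum_(i <- s) cxi (x i) w * \1_(cset pp_cell (x i)) z) /\
    \int[m]_z \sum_(i <- s) cxi (x i) w * \1_(cset pp_cell (x i)) z =
    \sum_(i <- s) cxi (x i) w * fine (m (cset pp_cell (x i))) by have [] := h (index_enum I).
elim: s => [|i s [ih1 ih2]].
  have e0 : (fun z : M => \sum_(i <- [::]) cxi (x i) w * \1_(cset pp_cell (x i)) z) = fun=> 0.
    by apply/funext => z; rewrite big_nil.
  rewrite e0 big_nil; split; last by rewrite /Rintegral integral0.
  by apply: (integ_bounded_supp mD fm (B := 0)) => // z; rewrite normr0.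
have e1 : (fun z : M => \sum_(i <- i :: s) cxi (x i) w * \1_(cset pp_cell (x i)) z) =
  fun z => cxi (x i) w * \1_(cset pp_cell (x i)) z + \sum_(i <- s) cxi (x i) w * \1_(cset pp_cell (x i)) z.
  by apply/funext => z; rewrite big_cons.
rewrite e1 big_cons; split; first exact: (integrableD _ (ii i) ih1).
by rewrite (RintegralD measurableT (ii i) ih1) ei ih2.
Qed.

Lemma elem_jint w : (Np j w jdom < +oo)%E ->
  jint w (EP x w) = elem_integral (pp_rv Np j) x w.
Proof.
move=> fNw; rewrite /jint !Rint_elem// /elem_integral -sumrB.
by apply: eq_bigr => i _; rewrite /crv /pp_rv /comp /count mulrBr.
Qed.

Lemma elem_good : good (EP x).
Proof.
have sI := elem_integral_sqintg mF itg u0 wfx; have [mI _] := sI.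
have eJ : {ae Pr, forall w, elem_integral (pp_rv Np j) x w = jintf (fun w z => EP x w z) w}.
  by apply: filterS finN => w fNw; rewrite /jintf fNw elem_jint.
have mfin : measurable [set w | (Np j w jdom < +oo)%E].
  by rewrite -[X in measurable X]setTI; apply: emeasurable_fun_infty_o => //; exact: count_measurable.
have mJ : measurable_fun setT (jintf (fun w z => EP x w z)).
  rewrite (_ : jintf _ = fun w => \1_[set w | (Np j w jdom < +oo)%E] w * elem_integral (pp_rv Np j) x w).
    by apply: measurable_funM => //; exact: measurable_indic.
  apply/funext => w; rewrite /jintf indicE; case: ifP => h.
    by rewrite mem_set// mul1r elem_jint.
  by rewrite memNset ?mul0r//= h.
have mS := elem_process_measurable mF itg wfx.
split=> //.
- move=> w z nz; rewrite /elem_process big1// => i _; rewrite indicE memNset ?mulr0//.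
  by move=> /subD.
- have /choice[B hB] : forall i, exists B, forall w, `|cxi (x i) w| <= B.
    by move=> i; have [_ _ _ _ [_ [B hB]]] := wfx i; exists B.
  exists (\sum_i B i) => w z; apply: (le_trans (ler_norm_sum _ _ _)); apply: ler_sum => i _.
  rewrite normrM indicE; apply: (@le_trans _ _ (`|cxi (x i) w| * 1)); last by rewrite mulr1.
  by rewrite ler_wpM2l//; case: (z \in _); rewrite ?normr1 ?normr0.
- have [iI zI] := elem_integral_mean_zero sF mF leF itg u0 wfx.
  split; first exact: intg_ae mJ iI eJ.
  move=> Z bZ; rewrite -(zI Z bZ); apply: mean_ae.
  + by have [mZ _] := bZ; apply: measurable_funM => //; exact: measurable_wrt_fun mZ.
  + by have [mZ _] := bZ; apply: measurable_funM => //; exact: measurable_wrt_fun mZ.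
  + by apply: filterS eJ => w ->.
- have := elem_isometry_prod sF mF leF itg u0 wfx; rewrite (sqnE sI) => e.
  rewrite /Rintegral -/(sqn nu _) -e /=.
  rewrite le_eqVlt; apply/orP; left; apply/eqP; apply: mean_ae.
  + exact: measurable_funX.
  + exact: measurable_funX.
  + by apply: filterS eJ => w ->.
Qed.

End elementary.

Section grid_limit.
Variables (Phi : R -> R -> T -> R) (H : T -> M -> R) (B : R).
Hypotheses (PhiF : forall x r, u <= r <= t -> measurable_wrt (F r) (Phi x r))
  (PhiB : forall x r w, u <= r <= t -> `|Phi x r w| <= B)
  (H0 : forall w z, ~ jdom z -> H w z = 0)
  (PhiH : forall w z, jdom z -> forall x_ r_ : nat -> R,
     (forall n, 0 <= x_ n < z.1) -> x_ n @[n --> \oo] --> z.1 ->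
     (forall n, u <= r_ n < z.2) -> r_ n @[n --> \oo] --> z.2 ->
     Phi (x_ n) (r_ n) w @[n --> \oo] --> H w z).

Let gcell n (kl : 'I_n.+1 * 'I_n.+1) : cell :=
  Cell (Phi (gpt 0 c n kl.1) (gpt u t n kl.2)) (gpt u t n kl.2) (gpt u t n kl.2.+1)
    `]gpt 0 c n kl.1, gpt 0 c n kl.1.+1]%classic.

Let gcell_wf n kl : wf F (pp_ok c) u t (@gcell n kl).
Proof.
have ut' := ltW ut; have h1 := gpt_ge n kl.2 ut'; have h2 := gpt_le ut' (ltn_ord kl.2).
have h3 := le_gpt n ut' (leqnSn kl.2).
have hr : u <= gpt u t n kl.2 <= t by rewrite h1 (le_trans h3).
split=> //=.
- split; first exact: measurable_itv.
  move=> x /=; rewrite !in_itv/= => /andP[k1 k2].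
  by rewrite (le_lt_trans (gpt_ge n kl.1 c0) k1) (le_trans k2)// gpt_le.
- by split; [exact: PhiF|exists B => w; exact: PhiB].
Qed.

Let gproc n w z : EP (@gcell n) w z =
  gsum u t n (fun r => gsum 0 c n (fun x => Phi x r w) z.1) z.2.
Proof.
rewrite /elem_process /gsum; under [RHS]eq_bigr do rewrite mulr_suml.
rewrite exchange_big pair_big/=; apply: eq_bigr => -[k l] _ /=.
rewrite -mulrA; congr (_ * _); rewrite /cset /= /oc_ind indicE.
set b := z \in _; have -> : b = (gpt 0 c n k < z.1 <= gpt 0 c n k.+1) && (gpt u t n l < z.2 <= gpt u t n l.+1).
  apply/idP/idP; rewrite /b inE.
    by move=> /pp_cellP[/=]; rewrite in_itv/= => -> [-> ->].
  by move=> /andP[h1 /andP[h2 h3]]; apply/pp_cellP; rewrite /= in_itv/=.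
by case: (gpt 0 c n k < z.1 <= _); rewrite ?mul1r ?mul0r.
Qed.

(** Sampling on a double grid, in the mark and in time. The coefficient of a cell is taken at its
    left end in time, hence known when the cell begins; accordingly [PhiH] asks for convergence
    along sequences from the left only. *)
Lemma grid_good : good H.
Proof.
have ut' := ltW ut.
have B0 : 0 <= B by apply: le_trans (PhiB 0 point (_ : u <= u <= t)); rewrite ?lexx.
apply: (@good_lim (fun n w z => EP (@gcell n) w z) _ B).
- by move=> n; apply: elem_good => kl; exact: gcell_wf.
- move=> n w z; rewrite gproc.
  have [h|h] := boolP (u < z.2 <= t); last by rewrite gsum_out// normr0.
  have [r [/andP[h1 h2] _] ->] := gsum_in n h.
  have [h'|h'] := boolP (0 < z.1 <= c); last by rewrite gsum_out// normr0.
  have [y _ ->] := gsum_in n h'; apply: PhiB; rewrite h1/= (ltW (lt_le_trans h2 _))//.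
  by case/andP: h.
- move=> w z; under eq_fun do rewrite gproc.
  have [Dz|nD] := pselect (jdom z); last first.
    rewrite H0//; apply: cvg_near_cst; apply: nearW => n.
    have [h|h] := boolP (u < z.2 <= t); last by rewrite gsum_out.
    have [h'|h'] := boolP (0 < z.1 <= c).
      by exfalso; apply: nD; apply/pp_cellP; rewrite /= in_itv/= h'; case/andP: h.
    by have [r _ ->] := gsum_in n h; rewrite gsum_out.
  have /pp_cellP[] := Dz; rewrite /= in_itv/= => h' [h1 h2].
  have h : u < z.2 <= t by rewrite h1 h2.
  have [r [hr cr er]] := gsum_seq h; have [y [hy cy ey]] := gsum_seq h'.
  rewrite (_ : (fun n => _) = fun n => Phi (y n) (r n) w); first exact: PhiH.
  by apply/funext => n; rewrite er ey.
Qed.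

End grid_limit.

(* [al] and [vl] are the left limits of [a] and [v]; where [vl] vanishes, [a] need not
   have a left limit. *)
Record threshold (a v al vl : R -> T -> R) B : Prop := Threshold {
  thr_a : forall r, u <= r <= t -> measurable_wrt (F r) (a r);
  thr_v : forall r, u <= r <= t -> measurable_wrt (F r) (v r);
  thr_aB : forall r w, u <= r <= t -> `|a r w| <= B;
  thr_alB : forall s w, u < s <= t -> `|al s w| <= B;
  thr_vlim : forall s w, u < s <= t -> forall r_ : nat -> R, (forall n, u <= r_ n < s) ->
    r_ n @[n --> \oo] --> s -> v (r_ n) w @[n --> \oo] --> vl s w;
  thr_alim : forall s w, u < s <= t -> 0 < vl s w ->
    forall r_ : nat -> R, (forall n, u <= r_ n < s) ->
    r_ n @[n --> \oo] --> s -> a (r_ n) w @[n --> \oo] --> al s w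
}.

Definition thr_proc (al vl : R -> T -> R) (w : T) (z : M) : R :=
  al z.2 w * (0 < vl z.2 w - z.1)%R%:R.

Let ramp_wrt m (v : R -> T -> R) x r : measurable_wrt (F r) (v r) ->
  measurable_wrt (F r) (fun w => ramp m (v r w - x)).
Proof.
move=> hv; apply: (measurable_wrt_comp (phi := fun y => ramp m (y - x))) hv.
have mr : measurable_fun setT (ramp m : R -> R).
  by apply: continuous_measurable_fun => y; apply: (@ramp_cvg R m R (nbhs y) _ id y); exact: cvg_id.
by apply: (measurableT_comp mr); exact: measurable_funB.
Qed.

(** This is [PhiH] for a threshold softened by a ramp; at a sharp threshold the sampled indicators
    need not converge where the mark equals the rate. *)
Let thr_ramp_lim a v al vl B m w z (x_ r_ : nat -> R) : threshold a v al vl B -> jdom z ->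
  (forall n, 0 <= x_ n < z.1) -> x_ n @[n --> \oo] --> z.1 ->
  (forall n, u <= r_ n < z.2) -> r_ n @[n --> \oo] --> z.2 ->
  a (r_ n) w * ramp m (v (r_ n) w - x_ n) @[n --> \oo] --> al z.2 w * ramp m (vl z.2 w - z.1).
Proof.
move=> h /pp_cellP[z1 [z2 z2t]] hx cx hr cr; move: z1; rewrite /= in_itv/= => /andP[z10 _].
have hs : u < z.2 <= t by rewrite z2.
have cR : ramp m (v (r_ n) w - x_ n) @[n --> \oo] --> ramp m (vl z.2 w - z.1).
  by apply: ramp_cvg; apply: cvgB => //; exact: (thr_vlim h).
have [v0|v0] := ltP 0 (vl z.2 w); first by apply: cvgM => //; exact: (thr_alim h).
(* Here [a] need not converge, but it is bounded and the ramp tends to 0, because the mark [z.1] is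
   positive. *)
have e0 : ramp m (vl z.2 w - z.1) = 0 by apply: ramp_neg; lra.
rewrite e0 in cR *; rewrite mulr0.
apply/norm_cvg0P; apply: (@squeeze_cvgr _ _ _ _ (fun=> 0) (fun n => B * `|ramp m (v (r_ n) w - x_ n)|)).
- apply: nearW => n; rewrite normr_ge0/= normrM ler_wpM2r//.
  by apply: (thr_aB h); have /andP[-> h2] := hr n; exact: ltW (lt_le_trans h2 z2t).
- exact: cvg_cst.
- rewrite -(mulr0 B); apply: cvgM; first exact: cvg_cst.
  by rewrite -(normr0 R); exact: cvg_norm.
Qed.

(** Two limits in succession: the grid at a fixed ramp by [grid_good], and then the ramps, which
    increase to the indicator of the strict inequality. The lemma is about a difference because it
    is applied to the jump integrand minus its frozen version. *)
Lemma threshold_good a1 v1 al1 vl1 a2 v2 al2 vl2 B :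
  threshold a1 v1 al1 vl1 B -> threshold a2 v2 al2 vl2 B ->
  good (fun w z => \1_jdom z * (thr_proc al1 vl1 w z - thr_proc al2 vl2 w z)).
Proof.
move=> h1 h2.
pose P m x r w := a1 r w * ramp m (v1 r w - x) - a2 r w * ramp m (v2 r w - x).
pose Hm (m : nat) w z := \1_jdom z * (al1 z.2 w * ramp m (vl1 z.2 w - z.1) - al2 z.2 w * ramp m (vl2 z.2 w - z.1)).
have bnd (a b x y : R) : `|a| <= B -> `|b| <= B -> `|x| <= 1 -> `|y| <= 1 ->
    `|a * x - b * y| <= B + B.
  move=> ha hb hx hy; apply: (le_trans (ler_normB _ _)); rewrite !normrM.
  by apply: lerD; [rewrite -[B]mulr1|rewrite -[leRHS]mulr1]; exact: ler_pM.
apply: (@good_lim Hm _ (B + B)).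
- move=> m; apply: (@grid_good (P m) _ (B + B)).
  + move=> x r hr; apply: measurable_wrtB => //; apply: measurable_wrtM => //.
    * exact: (thr_a h1).
    * by apply: ramp_wrt; exact: (thr_v h1).
    * exact: (thr_a h2).
    * by apply: ramp_wrt; exact: (thr_v h2).
  + move=> x r w hr; apply: bnd; rewrite ?ramp_norm//; [exact: (thr_aB h1)|exact: (thr_aB h2)].
  + by move=> w z nz; rewrite /Hm indicE memNset// mul0r.
  + move=> w z Dz x_ r_ hx cx hr cr; rewrite /Hm indicE mem_set// mul1r.
    by apply: cvgB; [exact: (thr_ramp_lim h1)|exact: (thr_ramp_lim h2)].
- move=> m w z; rewrite /Hm indicE; have [Dz|nz] := pselect (jdom z); last first.
    by rewrite memNset// mul0r normr0; apply: le_trans (bnd 0 0 0 0 _ _ _ _); rewrite ?normr0//;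
      apply: le_trans (thr_aB h1 point (_ : u <= u <= t)); rewrite // lexx ltW.
  rewrite mem_set// mul1r; have /pp_cellP[_ [k1 k2]] := Dz.
  by apply: bnd; rewrite ?ramp_norm//; [apply: (thr_alB h1)|apply: (thr_alB h2)]; rewrite k1.
- move=> w z; apply: cvgM; first exact: cvg_cst.
  by apply: cvgB; (apply: cvgM; [exact: cvg_cst|exact: ramp_lim]).
Qed.

End jump_integral.

(** * Taylor's formula *)

Section line.
Context {R : realType} {V : normedModType R}.
Implicit Types (f g : V -> R) (x y z : V).

Lemma line_derive f x y (s : R) : differentiable f (x + s *: y) ->
  is_derive s 1 (fun s : R => f (x + s *: y)) ('d f (x + s *: y) y).
Proof.
move=> df; pose g (s : R) := x + s *: y.
have dg : is_diff s g (fun h => 0 + h *: y) by apply: is_diffD.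
have dgs : differentiable g s by exact: ex_diff.
have dfg : differentiable (f \o g) s by exact: differentiable_comp.
apply: DeriveDef; first exact/derivable1_diffP.
have eg : 'd g s = (fun h => 0 + h *: y) :> (R -> V) by rewrite diff_val.
by rewrite (deriveE _ dfg) diff_comp//= eg add0r scale1r.
Qed.

Lemma MVT_line f x y : (forall z, differentiable f z) ->
  exists2 th : R, 0 <= th <= 1 & f (x + y) - f x = 'd f (x + th *: y) y.
Proof.
move=> df.
have [|th] := @MVT_segment R (fun s : R => f (x + s *: y)) (fun s => 'd f (x + s *: y) y) 0 1 ler01 (fun s _ => line_derive (df _)).
  apply: continuous_subspaceT => s; apply: differentiable_continuous.
  by apply/derivable1_diffP; have [] := line_derive (df (x + s *: y)).
rewrite in_itv/= => hth; rewrite scale1r scale0r addr0 subr0 mulr1 => e.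
by exists th.
Qed.

End line.

Section compact_support.
Context {R : realType} {V : normedModType R}.
Variables (g : V -> R) (S : set V).
Hypotheses (cg : continuous g) (cS : compact S) (gS : forall x, ~ S x -> g x = 0).

Lemma compact_support_bounded : exists2 C : R, 0 <= C & forall x, `|g x| <= C.
Proof.
have /compact_bounded[C [_ hC]] : compact (g @` S).
  by apply: continuous_compact => //; exact: continuous_subspaceT.
exists (`|C| + 1); first by rewrite addr_ge0.
move=> x; have [Sx|/gS->] := pselect (S x); last by rewrite normr0 addr_ge0.
by apply: (hC (`|C| + 1)); [rewrite (le_lt_trans (ler_norm _))// ltrDl|exists x].
Qed.

(** For base points in [S] the bound is uniform by compactness. If only [x + y] lies in [S], it
    becomes the base point and the shift is [- y]; if neither does, both values vanish. *)
Lemma compact_support_unif (eps : R) : 0 < eps ->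
  exists2 eta : R, 0 < eta & forall x y, `|y| < eta -> `|g (x + y) - g x| <= eps.
Proof.
move=> e0.
have h : \forall y \near (0 : V), S `<=` (fun x => `|g (x + y) - g x| <= eps).
  apply: (compact_near_coveringP _).1 => // x Sx.
  have c1 : (fun z : V * V => g (z.1 + z.2) - g z.1) z @[z --> (x, 0 : V)] --> g (x + 0) - g x.
    apply: cvgB; last by apply: continuous_comp; [exact: cvg_fst|exact: cg].
    apply: (@continuous_comp _ _ _ (fun z : V * V => z.1 + z.2)); last exact: cg.
    exact: add_continuous.
  rewrite addr0 subrr in c1; move/cvgr0_norm_le : c1 => /(_ _ e0).
  by [].
have /nbhs_ballP[eta /= eta0 heta] := h; exists eta => // x y yeta.
have hy z : `|z| < eta -> S `<=` (fun x => `|g (x + z) - g x| <= eps).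
  by move=> zeta; apply: heta; rewrite -ball_normE /= sub0r normrN.
have [Sx|nSx] := pselect (S x); first exact: hy.
have [Sxy|nSxy] := pselect (S (x + y)); last by rewrite !gS// subrr normr0 ltW.
by have := hy (- y); rewrite normrN => /(_ yeta _ Sxy); rewrite addrK distrC.
Qed.

End compact_support.

Section taylor.
Context {R : realType} {V : normedModType R} (I : finType).
Variables (e : I -> V) (cx : I -> V -> R).
Hypotheses (cxL : forall i (a : R) y z, cx i (a *: y + z) = a * cx i y + cx i z)
  (cxE : forall y, y = \sum_i cx i y *: e i).
Implicit Types (x y z u v w : V).

(** The l^1 norm in the coordinates [cx]; the increments of the process are controlled coordinate by
    coordinate. *)
Definition n1 y : R := \sum_i `|cx i y|.

Lemma n1_ge0 y : 0 <= n1 y. Proof. by apply: sumr_ge0. Qed.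

Lemma cxD i y z : cx i (y + z) = cx i y + cx i z.
Proof. by have := cxL i 1 y z; rewrite scale1r mul1r. Qed.

Lemma cx0 i : cx i 0 = 0.
Proof. by have := cxL i 1 0 0; rewrite scaler0 addr0 mul1r; lra. Qed.

Lemma cxZ i a y : cx i (a *: y) = a * cx i y.
Proof. by have := cxL i a y 0; rewrite !addr0 cx0 addr0. Qed.

Lemma cxN i y : cx i (- y) = - cx i y.
Proof. by rewrite -scaleN1r cxZ mulN1r. Qed.

Lemma n1D y z : n1 (y + z) <= n1 y + n1 z.
Proof. by rewrite /n1 -big_split/=; apply: ler_sum => i _; rewrite cxD ler_normD. Qed.

Lemma n1Z a y : n1 (a *: y) = `|a| * n1 y.
Proof. by rewrite /n1 mulr_sumr; apply: eq_bigr => i _; rewrite cxZ normrM. Qed.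

Lemma n1_sum (J : Type) (s : seq J) (F : J -> V) : n1 (\sum_(j <- s) F j) <= \sum_(j <- s) n1 (F j).
Proof.
elim: s => [|j s ih]; first by rewrite !big_nil /n1 big1// => i _; rewrite cx0 normr0.
by rewrite !big_cons (le_trans (n1D _ _))// lerD2l.
Qed.

Definition basis_bound : R := \sum_i `|e i|.

Lemma norm_n1 y : `|y| <= basis_bound * n1 y.
Proof.
rewrite {1}(cxE y) (le_trans (ler_norm_sum _ _ _))// /n1 mulr_sumr; apply: ler_sum => i _.
rewrite normrZ mulrC ler_wpM2r// /basis_bound (bigD1 i)//= lerDl.
by apply: sumr_ge0.
Qed.

Lemma linear_expand (l : {linear V -> R}) y : l y = \sum_i cx i y * l (e i).
Proof. by rewrite {1}(cxE y) linear_sum; apply: eq_bigr => i _; rewrite linearZ. Qed.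

Lemma diff_lincomb (J : finType) (a : J -> R) (G : J -> V -> R) x v : (forall i, differentiable (G i) x) ->
  'd (fun w => \sum_i a i * G i w) x v = \sum_i a i * 'd (G i) x v.
Proof.
move=> dG.
have h (s : seq J) : is_diff x (fun w => \sum_(i <- s) a i * G i w) (fun v => \sum_(i <- s) a i * 'd (G i) x v).
  elim: s => [|i s ih].
    rewrite (_ : (fun w => _) = cst 0); last by apply/funext => w; rewrite big_nil.
    rewrite (_ : (fun v => _) = 0); last by apply/funext => w; rewrite big_nil.
    exact: is_diff_cst.
  have -> : (fun w => \sum_(i <- i :: s) a i * G i w) = a i *: G i + (fun w => \sum_(i <- s) a i * G i w).
    by apply/funext => w; rewrite big_cons.
  have -> : (fun v => \sum_(i <- i :: s) a i * 'd (G i) x v) =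
      a i *: ('d (G i) x : V -> R) + (fun v => \sum_(i <- s) a i * 'd (G i) x v).
    by apply/funext => w; rewrite big_cons.
  by have /differentiableP di := dG i; exact: is_diffD.
have hI := h (index_enum J).
by have -> : 'd (fun w => \sum_i a i * G i w) x = (fun v => \sum_i a i * 'd (G i) x v) :> (V -> R) by rewrite diff_val.
Qed.

Variable f : V -> R.
Hypotheses (df : forall x, differentiable f x)
  (ddf : forall u x, differentiable (fun y => 'd f y u : R) x)
  (cddf : forall u v, continuous (fun x => 'd (fun y => 'd f y u : R) x v : R))
  (csf : compact (closure [set x | f x != 0])).

Let S := closure [set x | f x != 0].

Let near0 (g : V -> R) : (forall x, ~ S x -> g x = 0) -> (forall x, differentiable g x) ->
  forall u x, ~ S x -> 'd g x u = 0.
Proof.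
move=> g0 dg u x nSx; rewrite -deriveE// (@near_eq_derive _ _ _ g (cst 0)) ?derive_cst//.
have oS : open (~` S) by apply: closed_openC; exact: closed_closure.
by move: (open_nbhs_nbhs (conj oS nSx)); apply: filterS => y /= /g0.
Qed.

Let f0 x : ~ S x -> f x = 0.
Proof.
by move=> nS; apply/eqP; apply: contra_notT nS => fx; exact: subset_closure.
Qed.

Let df0 u x : ~ S x -> 'd f x u = 0. Proof. exact: near0. Qed.

Definition hess u v x : R := 'd (fun y => 'd f y u : R) x v.

Let ddf0 u v x : ~ S x -> hess u v x = 0.
Proof. by apply: near0 => // y; exact: df0. Qed.

Lemma f_bounded : exists2 C : R, 0 <= C & forall x, `|f x| <= C.
Proof.
by apply: (compact_support_bounded _ csf f0) => x; exact: differentiable_continuous.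
Qed.

Let df_cont u : continuous (fun x => 'd f x u : R).
Proof. by move=> x; exact: differentiable_continuous (ddf u x). Qed.

Lemma df_bounded : exists2 C : R, 0 <= C & forall x u, `|'d f x u| <= C * n1 u.
Proof.
have /choice[C hC] : forall i, exists C : R, 0 <= C /\ forall x, `|'d f x (e i)| <= C.
  by move=> i; have [C C0 hC] := compact_support_bounded (@df_cont (e i)) csf (@df0 (e i)); exists C.
exists (\sum_i C i) => [|x u]; first by apply: sumr_ge0 => i _; have [] := hC i.
rewrite linear_expand (le_trans (ler_norm_sum _ _ _))// /n1 mulr_sumr; apply: ler_sum => i _.
rewrite normrM mulrC ler_wpM2r//; have [_ h] := hC i; apply: (le_trans (h x)).
by rewrite (bigD1 i)//= lerDl; apply: sumr_ge0 => k _; have [] := hC k.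
Qed.

Lemma hessZ u v x a : hess u (a *: v) x = a * hess u v x.
Proof. exact: linearZ. Qed.

Lemma hess_expand u v x : hess u v x = \sum_i \sum_j cx i u * cx j v * hess (e i) (e j) x.
Proof.
rewrite /hess (_ : (fun y => 'd f y u : R) = fun y => \sum_i cx i u * 'd f y (e i)); last first.
  by apply/funext => y; rewrite linear_expand.
rewrite diff_lincomb; last by move=> i; exact: ddf.
apply: eq_bigr => i _; rewrite linear_expand mulr_sumr; apply: eq_bigr => j _.
by rewrite mulrA.
Qed.

Let hess_le (a : R) (H : I -> I -> R) u v : (forall i j, `|H i j| <= a) ->
  `|\sum_i \sum_j cx i u * cx j v * H i j| <= a * (n1 u * n1 v).
Proof.
move=> Ha; rewrite (le_trans (ler_norm_sum _ _ _))// /n1 mulr_suml mulr_sumr; apply: ler_sum => i _.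
rewrite (le_trans (ler_norm_sum _ _ _))// !mulr_sumr; apply: ler_sum => j _.
by rewrite !normrM mulrC ler_wpM2r// mulr_ge0.
Qed.

Lemma hess_bounded : exists2 C : R, 0 <= C & forall x u v, `|hess u v x| <= C * (n1 u * n1 v).
Proof.
have /choice[C hC] : forall ij : I * I, exists C : R, 0 <= C /\ forall x, `|hess (e ij.1) (e ij.2) x| <= C.
  move=> ij; have [C C0 hC] := compact_support_bounded (@cddf (e ij.1) (e ij.2)) csf (@ddf0 (e ij.1) (e ij.2)).
  by exists C.
exists (\sum_ij C ij) => [|x u v]; first by apply: sumr_ge0 => i _; have [] := hC i.
rewrite hess_expand; apply: hess_le => // i j; have [_ h] := hC (i, j); apply: (le_trans (h x)).
by rewrite (bigD1 (i, j))//= lerDl; apply: sumr_ge0 => k _; have [] := hC k.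
Qed.

Lemma hess_unif eps : 0 < eps -> exists2 eta : R, 0 < eta & forall x y u v, n1 y < eta ->
  `|hess u v (x + y) - hess u v x| <= eps * (n1 u * n1 v).
Proof.
move=> e0.
have /choice[eta heta] : forall ij : I * I, exists eta : R, 0 < eta /\
    forall x y, `|y| < eta -> `|hess (e ij.1) (e ij.2) (x + y) - hess (e ij.1) (e ij.2) x| <= eps.
  move=> ij; have [eta h1 h2] := compact_support_unif (@cddf (e ij.1) (e ij.2)) csf (@ddf0 (e ij.1) (e ij.2)) e0.
  by exists eta.
pose m := \big[Num.min/1]_ij eta ij.
have m0 : 0 < m 
  by apply: (big_ind (fun z : R => 0 < z)) => // [a b a0 b0|ij _]; [rewrite lt_min a0|case: (heta ij)].
have bb : 0 <= basis_bound by apply: sumr_ge0.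
exists (m / (basis_bound + 1)) => [|x y u v hy]; first by rewrite divr_gt0// ltr_wpDl.
have ym : `|y| < m.
  apply: (le_lt_trans (norm_n1 y)); rewrite ltr_pdivlMr ?ltr_wpDl// in hy.
  by apply: le_lt_trans hy; rewrite mulrC ler_wpM2l ?n1_ge0// lerDl.
rewrite !(hess_expand u v) -sumrB; under eq_bigr do rewrite -sumrB.
under eq_bigr do under eq_bigr do rewrite -mulrBr.
apply: hess_le => // i j; have [_ h] := heta (i, j); apply: h; apply: (lt_le_trans ym).
by rewrite /m (bigD1 (i, j))//= ge_min lexx.
Qed.

(** The first-order remainder, which is at the same time the bracket in the jump part of the
    generator. *)
Definition rem1 x y : R := f (x + y) - f x - 'd f x y.

Lemma rem1_lip : exists2 C : R, 0 <= C & forall x y z,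
  `|rem1 x (y + z) - rem1 x y| <= C * n1 z * (n1 y + n1 z) /\
  `|rem1 x (y + z) - rem1 x y| <= C * n1 z.
Proof.
have [C1 C10 h1] := df_bounded; have [C2 C20 h2] := hess_bounded.
exists (C1 + C1 + C2) => [|x y z]; first by rewrite !addr_ge0.
have e1 : rem1 x (y + z) - rem1 x y = f (x + y + z) - f (x + y) - 'd f x z.
  by rewrite /rem1 linearD/= addrA; lra.
have [th /andP[th0 th1] e2] := MVT_line (x + y) z df.
have nz := n1_ge0 z; have ny := n1_ge0 y.
split.
  rewrite e1 e2.
  have [th' /andP[t0 t1] e3] := MVT_line x (y + th *: z) (ddf z).
  rewrite -addrA e3 -/(hess _ _ _); apply: (le_trans (h2 _ _ _)).
  have h3 : n1 (y + th *: z) <= n1 y + n1 z.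
    by rewrite (le_trans (n1D _ _))// lerD2l n1Z ger0_norm// ler_piMl.
  rewrite mulrA; apply: ler_pM => //; rewrite ?mulr_ge0 ?n1_ge0//.
  by rewrite ler_wpM2r// lerDr addr_ge0.
rewrite e1 e2.
apply: (le_trans (ler_normB _ _)); apply: (le_trans (lerD (h1 _ _) (h1 _ _))).
by rewrite -mulrDl ler_wpM2r// lerDl.
Qed.

Let arith (a b q d0 d1 r : R) : a - 2^-1 * q - b = d1 - q * r ->
  a - b - d0 - 2^-1 * q = d1 - d0 - r * q.
Proof. by move=> h; lra. Qed.

(** For [n1 y < eta] the Hessian moves by at most [eps]. Otherwise both terms are of order
    [n1 y ^+ 2], which is at most [n1 y ^+ 4 / eta ^+ 2]. *)
Lemma rem2 eps : 0 < eps -> exists2 C : R, 0 <= C & forall x y,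
  `|rem1 x y - 2^-1 * hess y y x| <= eps * n1 y ^+ 2 + C * n1 y ^+ 4.
Proof.
move=> e0; have [C2 C20 h2] := hess_bounded; have [eta eta0 heta] := hess_unif e0.
exists ((C2 + C2) / eta ^+ 2) => [|x y]; first by rewrite divr_ge0 ?addr_ge0 ?sqr_ge0.
pose Q := hess y y x.
(* Subtracting the quadratic term before the mean value theorem leaves a difference of first
   derivatives, to which the theorem applies once more. *)
have hk (s : R) : is_derive s 1 (fun s : R => f (x + s *: y) - 2^-1 * Q * s ^+ 2) ('d f (x + s *: y) y - Q * s).
  apply: is_deriveB; first exact: line_derive.
  by apply: is_derive_eq; rewrite /GRing.scale/=; field.
have [|th] := @MVT_segment R _ _ 0 1 ler01 (fun s _ => hk s).
  apply: continuous_subspaceT => s; apply: differentiable_continuous.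
  by apply/derivable1_diffP; have [] := hk s.
rewrite in_itv/= => /andP[t0 t1].
rewrite scale1r scale0r addr0 subr0 !mulr1 expr1n expr0n/= mulr0 subr0 mulr1 => e1.
have [th' /andP[t0' t1'] e3] := MVT_line x (th *: y) (ddf y).
have e4 : rem1 x y - 2^-1 * Q = th * (hess y y (x + (th' * th) *: y) - Q).
  move: e3; rewrite scalerA -/(hess _ _ _) hessZ => e3.
  by rewrite /rem1 mulrBr -e3; exact: arith e1.
have ny := n1_ge0 y.
have tt : 0 <= th' * th <= 1 by rewrite mulr_ge0//= mulr_ile1.
have h3 : n1 ((th' * th) *: y) <= n1 y.
  by case/andP: tt => *; rewrite n1Z ger0_norm// ler_piMl.
rewrite -/Q e4 normrM ger0_norm//.
have [ye|ye] := ltP (n1 y) eta.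
  apply: (@le_trans _ _ (eps * n1 y ^+ 2)); last by rewrite lerDl mulr_ge0 ?divr_ge0 ?addr_ge0 ?exprn_ge0// ltW.
  apply: (@le_trans _ _ (1 * (eps * n1 y ^+ 2))); last by rewrite mul1r.
  by apply: ler_pM => //; rewrite expr2; apply: heta; exact: le_lt_trans ye.
apply: (@le_trans _ _ ((C2 + C2) / eta ^+ 2 * n1 y ^+ 4)); last by rewrite lerDr mulr_ge0 ?sqr_ge0// ltW.
apply: (@le_trans _ _ (1 * ((C2 + C2) * n1 y ^+ 2))).
  apply: ler_pM => //; apply: (le_trans (ler_normB _ _)); rewrite mulrDl.
  by apply: lerD; rewrite expr2; exact: h2.
rewrite mul1r -mulrA; apply: ler_wpM2l; first exact: addr_ge0.
rewrite (_ : eta ^- 2 * n1 y ^+ 4 = n1 y ^+ 2 * (n1 y ^+ 2 / eta ^+ 2)); last first.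
  by field; exact: lt0r_neq0.
rewrite ler_peMr ?sqr_ge0// ler_pdivlMr ?exprn_gt0// mul1r lerXn2r// nnegrE ltW//.
Qed.

Lemma sqr_sum_le (J : finType) (a : J -> R) :
  (\sum_j a j) ^+ 2 <= #|J|%:R * \sum_j a j ^+ 2.
Proof.
have h : 0 <= \sum_i \sum_j (a i - a j) ^+ 2.
  by apply: sumr_ge0 => i _; apply: sumr_ge0 => j _; exact: sqr_ge0.
have e1 : \sum_i \sum_j (a i - a j) ^+ 2 =
    \sum_(i : J) \sum_(j : J) a i ^+ 2 + \sum_(i : J) \sum_(j : J) a j ^+ 2 - 2 * \sum_i \sum_j a i * a j.
  rewrite mulr_sumr -big_split -sumrB; apply: eq_bigr => i _.
  by rewrite mulr_sumr -big_split -sumrB; apply: eq_bigr => j _ /=; ring.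
have e2 : \sum_(i : J) \sum_(j : J) a i ^+ 2 = #|J|%:R * \sum_j a j ^+ 2.
  by rewrite mulr_sumr; apply: eq_bigr => i _; rewrite sumr_const mulr_natl.
have e3 : \sum_(i : J) \sum_(j : J) a j ^+ 2 = #|J|%:R * \sum_j a j ^+ 2.
  by rewrite sumr_const mulr_natl.
have e4 : \sum_i \sum_j a i * a j = (\sum_j a j) ^+ 2.
  by rewrite expr2 mulr_suml; apply: eq_bigr => i _; rewrite mulr_sumr.
by move: h; rewrite e1 e2 e3 e4; move: (_ * _) (_ ^+ 2) => x y; lra.
Qed.

Lemma hess_suml (J : finType) (a : J -> R) (h : J -> V) v x :
  hess (\sum_j a j *: h j) v x = \sum_j a j * hess (h j) v x.
Proof.
rewrite /hess (_ : (fun y => 'd f y (\sum_j a j *: h j) : R) = fun y => \sum_j a j * 'd f y (h j)).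
  by rewrite diff_lincomb// => j; exact: ddf.
by apply/funext => y; rewrite linear_sum; apply: eq_bigr => j _; rewrite linearZ.
Qed.

Lemma hess_sum (J : finType) (a : J -> R) (h : J -> V) x :
  hess (\sum_j a j *: h j) (\sum_j a j *: h j) x =
  \sum_i \sum_j a i * a j * hess (h i) (h j) x.
Proof.
rewrite hess_suml; apply: eq_bigr => i _; rewrite {1}/hess linear_sum mulr_sumr.
by apply: eq_bigr => j _; rewrite linearZ/= /GRing.scale/= mulrA.
Qed.

Let young (eta q p : R) : 0 < eta -> q * p <= eta * p ^+ 2 + q ^+ 2 / eta.
Proof.
move=> e0; have h : 0 <= (eta * p - q) ^+ 2 + (eta * p) ^+ 2 + q ^+ 2 by rewrite !addr_ge0 ?sqr_ge0.
have -> : eta * p ^+ 2 + q ^+ 2 / eta = ((eta * p) ^+ 2 + q ^+ 2) / eta by field; exact: lt0r_neq0.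
by rewrite ler_pdivlMr//; move: h; nra.
Qed.

Let half_le (a b c : R) : 0 <= a -> a <= b -> b <= c -> 2^-1 * a <= c.
Proof. by move=> *; lra. Qed.

Let parts (a b c d : R) : 0 <= a -> 0 <= b -> 0 <= c -> 0 <= d ->
  [/\ a <= a + b + c + d, b <= a + b + c + d, c <= a + b + c + d & d <= a + b + c + d].
Proof. by move=> *; split; lra. Qed.

Let total (c1 c2 c3 c4 c5 z t1 t2 t3 t4 t5 e1 e2 k : R) :
  t1 <= c1 * z -> t2 <= c2 * z -> t3 <= c3 * z -> t4 <= c4 * z -> t5 <= c5 * z ->
  e1 + e2 <= k ->
  e1 + t1 + t2 + (e2 + t3 + t4 + t5) <= k + (c1 + c2 + c3 + c4 + c5) * z.
Proof. by move=> *; lra. Qed.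

Section step.
Variables (J1 J2 : finType) (B : R).
Hypothesis B0 : 0 <= B.

Let m := #|J1|%:R : R.

(* Of several jumps only the first order in their expected number matters, and one jump
   together with a Brownian increment is negligible. *)
Lemma rem1_step eps : 0 < eps -> exists2 C : R, 0 <= C &
  forall x (h : J1 -> V) (g : J2 -> V) (w : J1 -> R) (k : J2 -> nat) D q n,
  (forall i, n1 (h i) <= B) -> (forall j, n1 (g j) <= B) ->
  n1 (D - (\sum_i w i *: h i + \sum_j (k j)%:R *: g j)) = q -> (\sum_j k j)%N = n ->
  `|rem1 x D - 2^-1 * (\sum_i \sum_i' w i * w i' * hess (h i) (h i') x)
     - \sum_j (k j)%:R * rem1 x (g j)| <=
  eps * (\sum_i w i ^+ 2 + n%:R) +
  C * (q ^+ 2 + \sum_i w i ^+ 4 + n%:R * (\sum_i w i ^+ 2) + n%:R * (n%:R - 1)).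
Proof.
move=> e0; have [C0 C00 hC0] := rem1_lip; have [C2 C20 hC2] := hess_bounded.
have m0 : 0 <= m by rewrite ler0n.
(* [K] collects the coefficients of the terms of first order in [w2] and [N], so that their weight
   [eta * K] is [eps]. *)
pose K := 2 * B ^+ 2 * (m + 1) + B ^+ 2 * m + C0 * B + 1.
have K0 : 0 < K by rewrite ltr_wpDl// !addr_ge0// !mulr_ge0// ?addr_ge0// sqr_ge0.
pose eta := eps / K; have eta0 : 0 < eta by rewrite divr_gt0.
have [Ce Ce0 hCe] := rem2 eta0.
pose c1 := 2 * B ^+ 2 * eta; pose c2 := C0 + C0 ^+ 2 / eta.
pose c3 := Ce * (B ^+ 4 * m ^+ 3); pose c4 := (C0 * B / eta + C2 * B ^+ 2) * m.
pose c5 := 2 * (C0 * B).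
have BB : 0 <= B ^+ 2 by rewrite sqr_ge0.
have CB : 0 <= C0 * B by rewrite mulr_ge0.
have c10 : 0 <= c1 by rewrite /c1 mulr_ge0 ?(ltW eta0)// mulr_ge0.
have c20 : 0 <= c2 by rewrite addr_ge0// divr_ge0 ?sqr_ge0// ltW.
have c30 : 0 <= c3 by rewrite !mulr_ge0// exprn_ge0.
have c40 : 0 <= c4 by rewrite mulr_ge0// addr_ge0 ?mulr_ge0// invr_ge0 ltW.
have c50 : 0 <= c5 by rewrite mulr_ge0.
exists (c1 + c2 + c3 + c4 + c5) => [|x h g w k D q n hB gB eq en].
  by do 4 (apply: addr_ge0 => //).
set y1 := \sum_i w i *: h i; set y2 := \sum_j (k j)%:R *: g j.
set w2 := \sum_i w i ^+ 2; set w4 := \sum_i w i ^+ 4; set Sg := \sum_j (k j)%:R * rem1 x (g j).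
pose a := \sum_i `|w i|; pose N := n%:R : R; pose N2 := N * (N - 1).
have a0 : 0 <= a by apply: sumr_ge0.
have w20 : 0 <= w2 by apply: sumr_ge0 => i _; exact: sqr_ge0.
have w40 : 0 <= w4 by apply: sumr_ge0 => i _; rewrite exprn_even_ge0.
have N0 : 0 <= N by rewrite ler0n.
have N20 : 0 <= N2.
  rewrite /N2 /N; case: (n) => [|n']; first by rewrite mul0r.
  by rewrite -natr1 addrK mulr_ge0// addr_ge0.
have q0 : 0 <= q by rewrite -eq n1_ge0.
have aw2 : a ^+ 2 <= m * w2.
  apply: (le_trans (sqr_sum_le _)); rewrite le_eqVlt; apply/orP; left; apply/eqP; congr (_ * _).
  by apply: eq_bigr => i _; rewrite real_normK// num_real.
have aw4 : a ^+ 4 <= m ^+ 3 * w4.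
  rewrite (_ : a ^+ 4 = (a ^+ 2) ^+ 2); last by rewrite -exprM.
  apply: (@le_trans _ _ ((m * w2) ^+ 2)); first by rewrite lerXn2r ?nnegrE ?sqr_ge0// mulr_ge0.
  rewrite exprMn (_ : m ^+ 3 * w4 = m ^+ 2 * (m * w4)); last by ring.
  apply: ler_wpM2l; first exact: sqr_ge0.
  apply: (le_trans (sqr_sum_le _)); rewrite le_eqVlt; apply/orP; left; apply/eqP; congr (_ * _).
  by apply: eq_bigr => i _; rewrite -exprM.
have ny1 : n1 y1 <= B * a.
  apply: (le_trans (n1_sum _ _)); rewrite /a mulr_sumr; apply: ler_sum => i _.
  by rewrite n1Z mulrC ler_wpM2r.
have ny2 : n1 y2 <= B * N.
  apply: (le_trans (n1_sum _ _)); rewrite /N -en natr_sum mulr_sumr; apply: ler_sum => j _.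
  by rewrite n1Z ger0_norm// mulrC ler_wpM2r.
rewrite -hess_sum -/y1.
(* Replacing [D] by its main part costs a product of [q] with the size of that part; Young's
   inequality with weight [eta] separates the two. *)
have T1 : `|rem1 x D - rem1 x (y1 + y2)| <= c1 * (m * w2 + N + N2) + c2 * q ^+ 2.
  have [h1 _] := hC0 x (y1 + y2) (D - (y1 + y2)); rewrite [_ + (D - _)]addrC subrK in h1.
  apply: (le_trans h1); rewrite eq mulrDr; set p := n1 (y1 + y2).
  have p0 : 0 <= p := n1_ge0 _.
  have hp : p <= B * (a + N) by rewrite mulrDr (le_trans (n1D _ _))// lerD.
  have hp2 : p ^+ 2 <= 2 * B ^+ 2 * (m * w2 + N + N2).
    apply: (@le_trans _ _ ((B * (a + N)) ^+ 2)); first by rewrite lerXn2r ?nnegrE// mulr_ge0// addr_ge0.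
    rewrite exprMn (_ : 2 * B ^+ 2 * (m * w2 + N + N2) = B ^+ 2 * (2 * (m * w2 + N + N2))); last by ring.
    apply: ler_wpM2l => //.
    have := sqr_ge0 (a - N); rewrite /N2; move: aw2; nra.
  have := young (C0 * q) p eta0.
  have : eta * p ^+ 2 <= eta * (2 * B ^+ 2 * (m * w2 + N + N2)) by rewrite ler_wpM2l// ltW.
  rewrite /c1 /c2 => h2 h3; have -> : (C0 + C0 ^+ 2 / eta) * q ^+ 2 = C0 * q * q + (C0 * q) ^+ 2 / eta by field; exact: lt0r_neq0.
  have -> : 2 * B ^+ 2 * eta * (m * w2 + N + N2) = eta * (2 * B ^+ 2 * (m * w2 + N + N2)) by ring.
  by move: h2 h3; lra.
have T2 : `|rem1 x (y1 + y2) - 2^-1 * hess y1 y1 x - Sg| <=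
    eta * (B ^+ 2 * m + C0 * B) * (w2 + N) + c3 * w4 + c4 * (N * w2) + c5 * N2.
  have y12 : n1 y1 ^+ 2 <= B ^+ 2 * (m * w2).
    apply: (@le_trans _ _ ((B * a) ^+ 2)); first by rewrite lerXn2r ?nnegrE ?n1_ge0// mulr_ge0.
    by rewrite exprMn ler_wpM2l.
  have t1 : eta * n1 y1 ^+ 2 <= eta * (B ^+ 2 * m * w2) by rewrite -(mulrA _ m) ler_wpM2l// ltW.
  have p1 : 0 <= eta * (B ^+ 2 * m * w2) by rewrite mulr_ge0 ?(ltW eta0)// !mulr_ge0.
  have p2 : 0 <= eta * (C0 * B) * (w2 + N) by apply: mulr_ge0; [apply: mulr_ge0 => //; exact: ltW|exact: addr_ge0].
  have p3 : 0 <= eta * (B ^+ 2 * m * N) by rewrite mulr_ge0 ?(ltW eta0)// !mulr_ge0.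
  have p4 : 0 <= c3 * w4 by rewrite mulr_ge0.
  have p5 : 0 <= c4 * (N * w2) by rewrite mulr_ge0// mulr_ge0.
  have p6 : 0 <= c5 * N2 by rewrite mulr_ge0.
  have eE : eta * (B ^+ 2 * m + C0 * B) * (w2 + N) =
      eta * (B ^+ 2 * m * w2) + eta * (B ^+ 2 * m * N) + eta * (C0 * B) * (w2 + N) by ring.
  (* Without a jump this is the second-order formula. With at least one, N >= 1, so that the Hessian
     term is absorbed by [N * w2], and [rem1] at the whole displacement is compared with the jump
     terms alone. *)
  case: (posnP n) => [n0|npos].
    have k0 j : k j = 0%N by move/eqP: en; rewrite n0 sum_nat_eq0 => /forallP/(_ j)/eqP.
    have -> : Sg = 0 by rewrite /Sg big1// => j _; rewrite k0 mul0r.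
    have -> : y2 = 0 by rewrite /y2 big1// => j _; rewrite k0 scale0r.
    rewrite addr0 subr0; apply: (le_trans (hCe x y1)).
    have t2 : Ce * n1 y1 ^+ 4 <= c3 * w4.
      rewrite /c3 -mulrA; apply: ler_wpM2l => //.
      apply: (@le_trans _ _ ((B * a) ^+ 4)); first by rewrite lerXn2r ?nnegrE ?n1_ge0// mulr_ge0.
      by rewrite exprMn -mulrA ler_wpM2l// exprn_ge0.
    by rewrite eE; lra.
  have hy : `|2^-1 * hess y1 y1 x| <= C2 * (B ^+ 2 * m) * (N * w2).
    have N1 : 1 <= N by rewrite ler1n.
    have Cm : 0 <= C2 * (B ^+ 2 * m) by rewrite mulr_ge0// mulr_ge0.
    apply: (@le_trans _ _ (C2 * (B ^+ 2 * m) * w2)); last by rewrite ler_wpM2l// ler_peMl.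
    rewrite normrM gtr0_norm ?invr_gt0//; have hh := hC2 x y1 y1.
    have h3 : C2 * (n1 y1 * n1 y1) <= C2 * (B ^+ 2 * m) * w2.
      by rewrite -(mulrA C2) -(mulrA (B ^+ 2)) ler_wpM2l// -expr2.
    exact: half_le (normr_ge0 _) hh h3.
  (* The mixed term a N is traded by Young's inequality for a small multiple of N and a multiple of
     N w2. *)
  have an : C0 * B * (a * N) <= eta * (C0 * B) * N + C0 * B / eta * m * (N * w2).
    have hh := young a 1 eta0; rewrite mulr1 expr1n mulr1 in hh.
    have h2 : a <= eta + m * w2 / eta.
      by apply: (le_trans hh); rewrite lerD2l ler_wpM2r// invr_ge0 ltW.
    have -> : eta * (C0 * B) * N + C0 * B / eta * m * (N * w2) = C0 * B * ((eta + m * w2 / eta) * N).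
      by field; exact: lt0r_neq0.
    by rewrite ler_wpM2l// ler_wpM2r.
  have p7 : 0 <= eta * (C0 * B) * w2 by apply: mulr_ge0 => //; apply: mulr_ge0 => //; exact: ltW.
  have eE2 : eta * (C0 * B) * (w2 + N) = eta * (C0 * B) * w2 + eta * (C0 * B) * N by ring.
  have eE3 : c4 * (N * w2) = C0 * B / eta * m * (N * w2) + C2 * (B ^+ 2 * m) * (N * w2).
    by rewrite /c4; ring.
  rewrite eE eE2 eE3.
  suff main : `|rem1 x (y1 + y2) - Sg| <= C0 * B * (a * N) + c5 * N2.
    rewrite addrAC; apply: (le_trans (ler_normB _ _)); apply: (le_trans (lerD main hy)).
    by lra.
  (* For a single jump, adding the Brownian part to it is controlled by the linear bound of
     [rem1_lip]. For several jumps N <= N (N - 1), and bounding each term separately is enough. *)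
  have [n1|n2] : n = 1%N \/ (2 <= n)%N by move: npos; case: (n) => [|[|n']] //; [left|right].
    have [j kj] : exists j, k j != 0%N.
      apply/existsP; rewrite -negb_forall; apply/negP => /forallP hh.
      by move: npos; rewrite -en big1// => j _; exact/eqP.
    move: en; rewrite n1 (bigD1 j)//= => en.
    have kj1 : k j = 1%N by move: kj en; case: (k j) => [|[|?]].
    have k0 i : i != j -> k i = 0%N.
      move=> ij; have : (\sum_(i | i != j) k i)%N == 0%N by move: en; rewrite kj1 add1n => -[->].
      by rewrite sum_nat_eq0 => /forallP/(_ i); rewrite ij/= => /eqP.
    have -> : Sg = rem1 x (g j).
      by rewrite /Sg (bigD1 j)//= kj1 mul1r big1 ?addr0// => i /k0 ->; rewrite mul0r.
    have -> : y2 = g j.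
      by rewrite /y2 (bigD1 j)//= kj1 scale1r big1 ?addr0// => i /k0 ->; rewrite scale0r.
    have [_ hh] := hC0 x (g j) y1; rewrite [y1 + _]addrC; apply: (le_trans hh).
    have -> : N = 1 by rewrite /N n1.
    rewrite mulr1; apply: (@le_trans _ _ (C0 * B * a)); first by rewrite -mulrA ler_wpM2l.
    by rewrite lerDl.
  have NN2 : N <= N2.
    by rewrite /N2 ler_peMr// lerBrDr -[1 + 1]/(2%:R) ler_nat.
  have r0 : rem1 x 0 = 0 by rewrite /rem1 addr0 subrr linear0 subr0.
  have rl z : `|rem1 x z| <= C0 * n1 z.
    by have [_ hh] := hC0 x 0 z; rewrite add0r r0 subr0 in hh.
  have h1 : `|rem1 x (y1 + y2)| <= C0 * B * (a * N) + C0 * B * N2.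
    apply: (le_trans (rl _)); rewrite -!(mulrA C0) -mulrDr; apply: ler_wpM2l => //.
    apply: (le_trans (n1D _ _)); apply: lerD.
      apply: (le_trans ny1); rewrite ler_wpM2l// ler_peMr//.
      by rewrite ler1n (leq_trans _ n2).
    by apply: (le_trans ny2); rewrite ler_wpM2l.
  have h2 : `|Sg| <= C0 * B * N2.
    apply: (@le_trans _ _ (C0 * B * N)); last by rewrite ler_wpM2l.
    apply: (le_trans (ler_norm_sum _ _ _)); rewrite /N -en natr_sum mulr_sumr; apply: ler_sum => j _.
    rewrite normrM ger0_norm// mulrC ler_wpM2r//; apply: (le_trans (rl _)).
    by rewrite ler_wpM2l.
  apply: (le_trans (ler_normB _ _)); apply: (le_trans (lerD h1 h2)).
  by rewrite /c5; lra.
have Nw : 0 <= N * w2 by rewrite mulr_ge0.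
have q2 : 0 <= q ^+ 2 by rewrite sqr_ge0.
rewrite (_ : rem1 x D - _ - Sg = (rem1 x D - rem1 x (y1 + y2)) + (rem1 x (y1 + y2) - 2^-1 * hess y1 y1 x - Sg)); last by ring.
apply: (le_trans (ler_normD _ _)); apply: (le_trans (lerD T1 T2)).
rewrite (_ : eps = eta * K); last by rewrite divfK// lt0r_neq0.
have [z2 z3 z4 z5] := parts q2 w40 Nw N20.
have k1 : c1 * (m * w2 + N) + eta * (B ^+ 2 * m + C0 * B) * (w2 + N) <= eta * K * (w2 + N).
  rewrite -subr_ge0 (_ : _ - _ = eta * (2 * B ^+ 2 * (w2 + m * N) + (w2 + N))); last by rewrite /c1 /K; ring.
  by rewrite mulr_ge0 ?(ltW eta0)// !addr_ge0// mulr_ge0// ?addr_ge0 ?mulr_ge0.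
rewrite [c1 * (m * w2 + N + N2)]mulrDr.
by apply: total k1; apply: ler_wpM2l.
Qed.

End step.
End taylor.

(** * Coordinates and coefficients *)

Section coordinates.
Context {R : realType} {K : nat}.
Local Notation op := 'M[R[i]]_K.+1.

(** The Boolean is [true] for imaginary parts and [false] for real parts. *)
Definition coord : finType := (bool * 'I_K.+1 * 'I_K.+1)%type.
Implicit Types (c : coord) (M : op).

Definition ebasis c : opE R K :=
  if c.1.1 then (0, delta_mx c.1.2 c.2) else (delta_mx c.1.2 c.2, 0).
Definition ecoord c (y : opE R K) : R :=
  if c.1.1 then y.2 c.1.2 c.2 else y.1 c.1.2 c.2.
Definition co c M : R := ecoord c (toE M).

Lemma ecoord_linear c (a : R) y z : ecoord c (a *: y + z) = a * ecoord c y + ecoord c z.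
Proof. by rewrite /ecoord; case: c => [[[] i] j]; rewrite /= !mxE. Qed.

Lemma ecoord_inj (y z : opE R K) : (forall c, ecoord c y = ecoord c z) -> y = z.
Proof.
move=> h; case: y z h => [y1 y2] [z1 z2] h; congr (_, _); apply/matrixP => i j.
  exact: (h ((false, i), j)).
exact: (h ((true, i), j)).
Qed.

Lemma ecoord_basis c c' : ecoord c (ebasis c') = (c == c')%:R.
Proof.
case: c c' => [[b i] j] [[b' i'] j']; rewrite /ecoord /ebasis /=.
rewrite !xpair_eqE; case: b; case: b'; rewrite /= !mxE //; by case: (i == i').
Qed.

Lemma ecoord_sum c (J : Type) (s : seq J) (a : J -> R) (F : J -> opE R K) :
  ecoord c (\sum_(j <- s) a j *: F j) = \sum_(j <- s) a j * ecoord c (F j).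
Proof.
elim: s => [|j s ih]; last by rewrite !big_cons ecoord_linear ih.
by rewrite !big_nil /ecoord; case: ifP; rewrite mxE.
Qed.

Lemma ecoord_expand y : y = \sum_c ecoord c y *: ebasis c.
Proof.
apply: ecoord_inj => c; rewrite ecoord_sum (bigD1 c)//= big1 => [|c' cc'].
  by rewrite ecoord_basis eqxx mulr1 addr0.
by rewrite ecoord_basis eq_sym (negbTE cc') mulr0.
Qed.

Lemma toED M M' : toE (M + M') = toE M + toE M'.
Proof. by congr (_, _); apply/matrixP => i j; rewrite !mxE; case: (M i j) (M' i j) => ? ? []. Qed.

Lemma toEN M : toE (- M) = - toE M.
Proof. by congr (_, _); apply/matrixP => i j; rewrite !mxE; case: (M i j). Qed.

Lemma coRe M i j : complex.Re (M i j) = co ((false, i), j) M.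
Proof. by rewrite /co /ecoord /= mxE. Qed.

Lemma coIm M i j : complex.Im (M i j) = co ((true, i), j) M.
Proof. by rewrite /co /ecoord /= mxE. Qed.

Lemma coD c M M' : co c (M + M') = co c M + co c M'.
Proof. by rewrite /co toED -[X in ecoord _ (X + _)]scale1r ecoord_linear mul1r. Qed.

Lemma coN c M : co c (- M) = - co c M.
Proof. by rewrite /co toEN /ecoord; case: ifP; rewrite mxE. Qed.

Lemma coB c M M' : co c (M - M') = co c M - co c M'.
Proof. by rewrite coD coN. Qed.

Lemma co_sum c (J : Type) (s : seq J) (P : pred J) (F : J -> op) :
  co c (\sum_(j <- s | P j) F j) = \sum_(j <- s | P j) co c (F j).
Proof.
elim: s => [|j s ih]; last by rewrite !big_cons; case: ifP; rewrite ?coD ih.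
by rewrite !big_nil /co /ecoord; case: ifP; rewrite !mxE.
Qed.

Lemma coZ c (a : R) M : co c (a%:C *: M) = a * co c M.
Proof.
rewrite /co (_ : toE _ = a *: toE M + 0); last first.
  by rewrite addr0; congr (_, _); apply/matrixP => i j; rewrite !mxE; case: (M i j) => x y /=; ring.
rewrite ecoord_linear (_ : ecoord c 0 = 0) ?addr0//.
by rewrite /ecoord; case: ifP; rewrite mxE.
Qed.

Lemma co_inj M M' : (forall c, co c M = co c M') -> M = M'.
Proof.
move=> h; apply/matrixP => i j; have := h ((false, i), j); have := h ((true, i), j).
by rewrite -!coRe -!coIm; case: (M i j) (M' i j) => ? ? [? ?] /= -> ->.
Qed.

Definition dist M M' : R := \sum_c `|co c M - co c M'|.

Lemma dist_ge0 M M' : 0 <= dist M M'. Proof. by apply: sumr_ge0. Qed.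

Lemma le_dist c M M' : `|co c M - co c M'| <= dist M M'.
Proof. by rewrite /dist (bigD1 c)//= lerDl; apply: sumr_ge0. Qed.

(** A bounded set that contains the states; polynomials are bounded and Lipschitz on it. *)
Definition cube M : Prop := forall c, `|co c M| <= 1.

Lemma dist_le M M' : cube M -> cube M' -> dist M M' <= 2 * #|coord|%:R.
Proof.
move=> h h'; apply: (@le_trans _ _ (\sum_(c : coord) (2 : R))).
  apply: ler_sum => c _; apply: (le_trans (ler_normB _ _)).
  by have := h c; have := h' c; lra.
by rewrite sumr_const mulr_natr.
Qed.

(* Polynomial functions of the real coordinates are used through these properties only. *)
Record pol (psi : op -> R) : Prop := Pol {
  pol_cvg : forall (M_ : nat -> op) M, (forall c, co c (M_ n) @[n --> \oo] --> co c M) ->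
    psi (M_ n) @[n --> \oo] --> psi M;
  pol_meas : forall d (T : measurableType d) (H : set (set T)) (X : T -> op),
    sigma_algebra setT H -> (forall c, measurable_wrt H (fun w => co c (X w))) ->
    measurable_wrt H (fun w => psi (X w));
  pol_lip : exists2 B : R, 0 <= B & (forall M, cube M -> `|psi M| <= B) /\
    (forall M M', cube M -> cube M' -> `|psi M - psi M'| <= B * dist M M')
}.

Lemma pol_cst (a : R) : pol (fun=> a).
Proof.
split.
- by move=> M_ M _; exact: cvg_cst.
- by move=> d T H X sH _; exact: measurable_wrt_cst.
- exists `|a| => //; split => // M M' _ _; rewrite subrr normr0.
  by rewrite mulr_ge0// dist_ge0.
Qed.

Lemma pol_co c : pol (co c).
Proof.
split=> [M_ M h|d T H X sH h|]; [exact: h|exact: h|].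
exists 1 => //; split=> [M h|M M' _ _]; first exact: h.
by rewrite mul1r le_dist.
Qed.

Lemma polD psi phi : pol psi -> pol phi -> pol (fun M => psi M + phi M).
Proof.
move=> [c1 m1 [B1 B10 [b1 l1]]] [c2 m2 [B2 B20 [b2 l2]]]; split.
- by move=> M_ M h; apply: cvgD; [exact: c1|exact: c2].
- by move=> d T H X sH h; apply: measurable_wrtD => //; [exact: m1|exact: m2].
- exists (B1 + B2); first exact: addr_ge0.
  split=> [M h|M M' h h'].
    by rewrite (le_trans (ler_normD _ _))// lerD ?b1 ?b2.
  rewrite opprD addrACA (le_trans (ler_normD _ _))// mulrDl.
  by rewrite lerD ?l1 ?l2.
Qed.

Lemma polM psi phi : pol psi -> pol phi -> pol (fun M => psi M * phi M).
Proof.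
move=> [c1 m1 [B1 B10 [b1 l1]]] [c2 m2 [B2 B20 [b2 l2]]]; split.
- by move=> M_ M h; apply: cvgM; [exact: c1|exact: c2].
- by move=> d T H X sH h; apply: measurable_wrtM => //; [exact: m1|exact: m2].
- exists (B1 * B2 + B1 * B2); first by rewrite addr_ge0// mulr_ge0.
  split=> [M h|M M' h h'].
    rewrite normrM; apply: (@le_trans _ _ (B1 * B2)); last by rewrite lerDl mulr_ge0.
    by rewrite ler_pM ?b1 ?b2.
  have -> : psi M * phi M - psi M' * phi M' = psi M * (phi M - phi M') + (psi M - psi M') * phi M' by ring.
  rewrite (le_trans (ler_normD _ _))// !normrM mulrDl; apply: lerD.
    by rewrite -mulrA; apply: ler_pM; rewrite ?b1 ?l2.
  by rewrite mulrAC; apply: ler_pM; rewrite ?l1 ?b2.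
Qed.

Lemma polN psi : pol psi -> pol (fun M => - psi M).
Proof.
move=> h; have := polM (pol_cst (-1)) h.
by under eq_fun do rewrite mulN1r.
Qed.

Lemma polB psi phi : pol psi -> pol phi -> pol (fun M => psi M - phi M).
Proof. by move=> h1 h2; apply: polD => //; exact: polN. Qed.

Definition cpol (phi : op -> R[i]) : Prop :=
  pol (fun M => complex.Re (phi M)) /\ pol (fun M => complex.Im (phi M)).

Lemma cpol_cst a : cpol (fun=> a). Proof. by split; exact: pol_cst. Qed.

Lemma cpolD f g : cpol f -> cpol g -> cpol (fun M => f M + g M).
Proof.
move=> [f1 f2] [g1 g2]; split.
  rewrite (_ : (fun M => _) = fun M => complex.Re (f M) + complex.Re (g M)); first exact: polD.
  by apply/funext => M; case: (f M) (g M) => ? ? [].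
rewrite (_ : (fun M => _) = fun M => complex.Im (f M) + complex.Im (g M)); first exact: polD.
by apply/funext => M; case: (f M) (g M) => ? ? [].
Qed.

Lemma cpolM f g : cpol f -> cpol g -> cpol (fun M => f M * g M).
Proof.
move=> [f1 f2] [g1 g2]; split.
  rewrite (_ : (fun M => _) = fun M => complex.Re (f M) * complex.Re (g M) - complex.Im (f M) * complex.Im (g M)).
    by apply: polB; exact: polM.
  by apply/funext => M; case: (f M) (g M) => ? ? [].
rewrite (_ : (fun M => _) = fun M => complex.Re (f M) * complex.Im (g M) + complex.Im (f M) * complex.Re (g M)).
  by apply: polD; exact: polM.
by apply/funext => M; case: (f M) (g M) => ? ? [].
Qed.

Lemma cpol_sum (J : Type) (s : seq J) (P : pred J) (F : J -> op -> R[i]) :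
  (forall j, P j -> cpol (F j)) -> cpol (fun M => \sum_(j <- s | P j) F j M).
Proof.
move=> h; elim: s => [|j s ih].
  by under eq_fun do rewrite big_nil; exact: cpol_cst.
case Pj : (P j); under eq_fun do rewrite big_cons Pj; last exact: ih.
exact: cpolD (h _ Pj) ih.
Qed.

Definition mpol m n (Phi : op -> 'M[R[i]]_(m, n)) : Prop := forall a b, cpol (fun M => Phi M a b).

Lemma mpol_id : mpol (fun M => M).
Proof.
by move=> a b; split; [under eq_fun do rewrite coRe|under eq_fun do rewrite coIm]; exact: pol_co.
Qed.

Lemma mpol_cst m n (A : 'M[R[i]]_(m, n)) : mpol (fun=> A).
Proof. by move=> a b; exact: cpol_cst. Qed.

Lemma mpolD m n (F G : op -> 'M[R[i]]_(m, n)) : mpol F -> mpol G -> mpol (fun M => F M + G M).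
Proof. by move=> hF hG a b; under eq_fun do rewrite mxE; exact: cpolD. Qed.

Lemma mpolZ m n f (F : op -> 'M[R[i]]_(m, n)) : cpol f -> mpol F -> mpol (fun M => f M *: F M).
Proof. by move=> hf hF a b; under eq_fun do rewrite mxE; exact: cpolM. Qed.

Lemma mpolN m n (F : op -> 'M[R[i]]_(m, n)) : mpol F -> mpol (fun M => - F M).
Proof. by move=> hF; under eq_fun do rewrite -scaleN1r; apply: mpolZ => //; exact: cpol_cst. Qed.

Lemma mpolM m n k (F : op -> 'M[R[i]]_(m, n)) (G : op -> 'M[R[i]]_(n, k)) :
  mpol F -> mpol G -> mpol (fun M => F M *m G M).
Proof.
move=> hF hG a b; under eq_fun do rewrite mxE.
by apply: cpol_sum => j _; exact: cpolM.
Qed.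

Lemma mpol_sum m n (J : Type) (s : seq J) (P : pred J) (F : J -> op -> 'M[R[i]]_(m, n)) :
  (forall j, P j -> mpol (F j)) -> mpol (fun M => \sum_(j <- s | P j) F j M).
Proof.
move=> h a b; under eq_fun do rewrite summxE.
by apply: cpol_sum => j Pj; exact: h.
Qed.

Lemma cpol_tr n (F : op -> 'M[R[i]]_n) : mpol F -> cpol (fun M => \tr (F M)).
Proof. by move=> hF; rewrite /mxtrace; apply: cpol_sum => i _; exact: hF. Qed.

Lemma mpol_co c (F : op -> op) : mpol F -> pol (fun M => co c (F M)).
Proof.
move=> hF; case: c => [[[] i] j]; [under eq_fun do rewrite -coIm|under eq_fun do rewrite -coRe].
  by have [] := hF i j.
by have [] := hF i j.
Qed.

End coordinates.

(** * The coefficients of the equation as polynomials *)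

Section coefficient_polynomials.
Context {R : realType} {K N p : nat}.
Variables (L : 'I_N.+1 -> 'M[R[i]]_K.+1)
          (pc : 'I_p.+1 -> 'I_N.+1 -> 'I_N.+1 -> R[i]).

Lemma coefL_mpol : mpol (coefL L).
Proof.
rewrite /coefL; apply: mpolD; first by apply: mpolD; apply: mpolM; (exact: mpol_cst || exact: mpol_id).
apply: mpol_sum => k _; apply: mpolM; last exact: mpol_cst.
by apply: mpolM; [exact: mpol_cst|exact: mpol_id].
Qed.

Lemma jump_op_mpol i : mpol (jump_op L pc i).
Proof.
rewrite /jump_op; apply: mpol_sum => k _; apply: mpol_sum => l _.
apply: mpolZ; first exact: cpol_cst.
apply: mpolM; last exact: mpol_cst.
by apply: mpolM; [exact: mpol_cst|exact: mpol_id].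
Qed.

Lemma coefv_cpol i : cpol (coefv L pc i).
Proof. exact: cpol_tr (jump_op_mpol i). Qed.

Lemma diff_op_mpol i : mpol (diff_op L pc i).
Proof.
rewrite /diff_op; apply: mpol_sum => k _; apply: mpolD; apply: mpolZ; try exact: cpol_cst.
  by apply: mpolM; [exact: mpol_cst|exact: mpol_id].
by apply: mpolM; [exact: mpol_id|exact: mpol_cst].
Qed.

Lemma coefh_mpol i : mpol (coefh L pc i).
Proof.
rewrite /coefh; apply: mpolZ; first exact: cpol_cst.
apply: mpolD; first exact: diff_op_mpol.
apply: mpolN; apply: mpolZ; last exact: mpol_id.
exact: cpol_tr (diff_op_mpol i).
Qed.

End coefficient_polynomials.

(** * Adjoints *)

Section adjoint.
Context {R : realType}.
Local Open Scope sesquilinear_scope.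

Lemma adjE m n (A : 'M[R[i]]_(m, n)) i j : (A ^t*) i j = (A j i)^*.
Proof. by rewrite !mxE. Qed.

Lemma adjD m n (A B : 'M[R[i]]_(m, n)) : (A + B) ^t* = A ^t* + B ^t*.
Proof. by apply/matrixP => i j; rewrite !mxE rmorphD. Qed.

Lemma adjZ m n x (A : 'M[R[i]]_(m, n)) : (x *: A) ^t* = x^* *: A ^t*.
Proof. by apply/matrixP => i j; rewrite !mxE rmorphM. Qed.

Lemma adjK m n (A : 'M[R[i]]_(m, n)) : (A ^t*) ^t* = A.
Proof. by apply/matrixP => i j; rewrite !mxE conjCK. Qed.

Lemma adjM m n k (A : 'M[R[i]]_(m, n)) (B : 'M[R[i]]_(n, k)) :
  (A *m B) ^t* = B ^t* *m A ^t*.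
Proof.
apply/matrixP => i j; rewrite !mxE rmorph_sum; apply: eq_bigr => l _.
by rewrite rmorphM mulrC !mxE.
Qed.

Lemma adj_sum m n (J : finType) (Q : pred J) (F : J -> 'M[R[i]]_(m, n)) :
  (\sum_(j | Q j) F j) ^t* = \sum_(j | Q j) (F j) ^t*.
Proof.
apply: (big_morph (fun A => A ^t*)) => [A B|]; first exact: adjD.
by apply/matrixP => i j; rewrite !mxE rmorph0.
Qed.

End adjoint.

(** * Positive operators *)

Section positive_operators.
Context {R : realType} {n : nat}.
Local Open Scope sesquilinear_scope.
Implicit Types (M : 'M[R[i]]_n) (a b : 'I_n) (x y : R[i]).

Let e (M : 'M[R[i]]_n) c c' : ((delta_mx c ord0 : 'cV[R[i]]_n) ^t* *m M *m delta_mx c' ord0) = (M c c')%:M.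
Proof.
rewrite trmx_delta map_delta_mx -rowE -colE; apply/matrixP => i j.
by rewrite !mxE !ord1 eqxx mulr1n.
Qed.

Let q M (u v : 'cV[R[i]]_n) : R[i] := (u ^t* *m M *m v) 0 0.

Let qDl M x y u u' v : q M (x *: u + y *: u') v = x^* * q M u v + y^* * q M u' v.
Proof. by rewrite /q adjD !adjZ !mulmxDl -!scalemxAl mxE; congr (_ + _); rewrite mxE. Qed.

Let qDr M x y u v v' : q M u (x *: v + y *: v') = x * q M u v + y * q M u v'.
Proof. by rewrite /q mulmxDr -!scalemxAr mxE; congr (_ + _); rewrite mxE. Qed.

Lemma quad2 M a b x y :
  let u : 'cV[R[i]]_n := x *: delta_mx a ord0 + y *: delta_mx b ord0 in
  (u ^t* *m M *m u) 0 0 =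
  x^* * x * M a a + x^* * y * M a b + y^* * x * M b a + y^* * y * M b b.
Proof.
move=> u; rewrite -/(q M u u) /u qDl !qDr /q !e !mxE eqxx !mulr1n !mulrDr !mulrA !addrA.
by [].
Qed.

Lemma complex_ge0 x : 0 <= x <-> 0 <= complex.Re x /\ complex.Im x = 0.
Proof.
by rewrite lecE /=; split=> [/andP[/eqP -> ->]|[-> ->]]//; rewrite eqxx.
Qed.

Lemma psd_pair M a b : positive_op M ->
  [/\ complex.Im (M a a) = 0, 0 <= complex.Re (M a a),
      `|2 * complex.Re (M a b)| <= complex.Re (M a a) + complex.Re (M b b)
    & `|2 * complex.Im (M a b)| <= complex.Re (M a a) + complex.Re (M b b)].
Proof.
move=> h; have hq x y : 0 <= x^* * x * M a a + x^* * y * M a b + y^* * x * M b a + y^* * y * M b b.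
  by rewrite -quad2; exact: h.
have := hq 1 0; have := hq 0 1; have := hq 1 1; have := hq 1 (-1); have := hq 1 'i; have := hq 1 (- 'i).
rewrite !complex_ge0.
case: (M a a) (M a b) (M b a) (M b b) => a1 a2 [b1 b2] [c1 c2] [d1 d2] /=.
move=> [h1 h2] [h3 h4] [h5 h6] [h7 h8] [h9 h10] [h11 h12].
by split; rewrite ?ler_norml; lra.
Qed.

Lemma psd_diag M a : positive_op M -> 0 <= complex.Re (M a a) /\ complex.Im (M a a) = 0.
Proof. by move=> /(psd_pair a a)[]. Qed.

Let Re_sum (F : 'I_n -> R[i]) : complex.Re (\sum_k F k) = \sum_k complex.Re (F k).
Proof. by apply: big_morph => // -[? ?] [? ?]. Qed.

Let Im_sum (F : 'I_n -> R[i]) : complex.Im (\sum_k F k) = \sum_k complex.Im (F k).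
Proof. by apply: big_morph => // -[? ?] [? ?]. Qed.

Lemma psd_trace M : positive_op M -> 0 <= complex.Re (\tr M) /\ complex.Im (\tr M) = 0.
Proof.
move=> h; rewrite /mxtrace Re_sum Im_sum; split.
  by apply: sumr_ge0 => k _; have [] := psd_diag k h.
by rewrite big1// => k _; have [] := psd_diag k h.
Qed.

Lemma psd_entry M a b : positive_op M ->
  `|complex.Re (M a b)| <= complex.Re (\tr M) /\ `|complex.Im (M a b)| <= complex.Re (\tr M).
Proof.
move=> h; have [_ _ h1 h2] := psd_pair a b h.
have d k : complex.Re (M k k) <= complex.Re (\tr M).
  rewrite /mxtrace Re_sum (bigD1 k)//= lerDl; apply: sumr_ge0 => l _.
  by have [] := psd_diag l h.
have := d a; have := d b; rewrite !normrM ger0_norm// in h1 h2.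
by move: (normr_ge0 (complex.Re (M a b))) (normr_ge0 (complex.Im (M a b))); lra.
Qed.

Lemma psd_conj m (B : 'M[R[i]]_(m, n)) M : positive_op M -> positive_op (B *m M *m B ^t*).
Proof.
move=> h u; have := h (B ^t* *m u).
by rewrite adjM adjK !mulmxA.
Qed.

Lemma psd_sum (J : finType) (F : J -> 'M[R[i]]_n) : (forall j, positive_op (F j)) ->
  positive_op (\sum_j F j).
Proof.
move=> h u; rewrite mulmx_sumr mulmx_suml summxE; apply: sumr_ge0 => j _; exact: h.
Qed.

End positive_operators.

(** * Positivity of the jump operators *)

Section jump_operators.
Context {R : realType} {K N p : nat}.
Local Open Scope sesquilinear_scope.
Variables (X : 'I_N.+1 -> 'cV[R[i]]_N.+1) (L : 'I_N.+1 -> 'M[R[i]]_K.+1)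
  (P : 'I_p.+1 -> 'M[R[i]]_N.+1).
Hypotheses (Psa : forall i, (P i) ^t* = P i) (Pid : forall i, P i *m P i = P i).

Lemma pcoef_gram i k l : pcoef X P i k l = \sum_m (P i *m X k) m 0 * ((P i *m X l) m 0)^*.
Proof.
rewrite /pcoef -{1}(Pid i) -{1}(Psa i) mulmxA -(mulmxA _ (P i)) mxE.
apply: eq_bigr => m _; rewrite mulrC; congr (_ * _).
by rewrite -adjM adjE.
Qed.

(** A Kraus form. Since P_i is a self-adjoint idempotent, the coefficients form a Gram matrix, and
    the double sum splits into conjugations of [rho], which preserve positivity. *)
Lemma jump_op_sum i rho : jump_op L (pcoef X P) i rho =
  \sum_m let B := \sum_(k | k != ord0) (P i *m X k) m 0 *: L k in B *m rho *m B ^t*.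
Proof.
rewrite /jump_op /=; transitivity (\sum_m \sum_(k | k != ord0) \sum_(l | l != ord0)
   ((P i *m X k) m 0 * ((P i *m X l) m 0)^*) *: (L k *m rho *m (L l) ^t*)).
  rewrite [RHS]exchange_big; apply: eq_bigr => k _; rewrite [RHS]exchange_big; apply: eq_bigr => l _.
  by rewrite pcoef_gram scaler_suml.
apply: eq_bigr => m _; rewrite adj_sum.
rewrite !mulmx_suml; apply: eq_bigr => k _; rewrite mulmx_sumr; apply: eq_bigr => l _.
by rewrite adjZ -!scalemxAl -scalemxAr scalerA.
Qed.

Lemma jump_op_psd i rho : positive_op rho -> positive_op (jump_op L (pcoef X P) i rho).
Proof. by move=> h; rewrite jump_op_sum; apply: psd_sum => m; exact: psd_conj. Qed.

Lemma coefv_ge0 i rho : positive_op rho ->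
  0 <= complex.Re (coefv L (pcoef X P) i rho) /\ complex.Im (coefv L (pcoef X P) i rho) = 0.
Proof. by move=> h; exact: psd_trace (jump_op_psd i h). Qed.

End jump_operators.

(** * Functions that can be evaluated along the process *)

Section admissible_functions.
Context {R : realType} {K : nat}.
Local Notation op := 'M[R[i]]_K.+1.
Implicit Types (M : op) (c : coord (K := K)).

(** The continuous functions x / (x^2 + 1 / (n + 1)) converge to the inverse, including at 0, where
    both sides are 0 by convention. *)
Lemma inv_measurable : measurable_fun setT (fun x : R => x^-1).
Proof.
pose f (n : nat) (x : R) := x / (x ^+ 2 + n.+1%:R^-1).
have pos (n : nat) (x : R) : 0 < x ^+ 2 + n.+1%:R^-1 by rewrite ltr_wpDl ?sqr_ge0// invr_gt0.
apply: (@measurable_fun_cvg _ _ _ _ f) => [n|x _].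
  apply: continuous_measurable_fun => x; apply: cvgM; first exact: cvg_id.
  apply: cvgV; first exact: lt0r_neq0.
  by apply: cvgD; [exact: exprn_continuous|exact: cvg_cst].
have [->|x0] := eqVneq x 0.
  by rewrite invr0 /f; under eq_fun do rewrite mul0r; exact: cvg_cst.
rewrite (_ : x^-1 = x / (x ^+ 2 + 0)); last by rewrite addr0; field.
apply: cvgM; first exact: cvg_cst.
apply: cvgV; first by rewrite addr0 expf_neq0.
by apply: cvgD; [exact: cvg_cst|exact: cvg_harmonic].
Qed.

Lemma cvg_bigsum (V : normedModType R) (J : Type) (s : seq J) (F : J -> nat -> V) (l : J -> V) :
  (forall j, F j n @[n --> \oo] --> l j) ->
  \sum_(j <- s) F j n @[n --> \oo] --> \sum_(j <- s) l j.
Proof.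
move=> h; elim: s => [|j s ih].
  by under eq_fun do rewrite big_nil; rewrite big_nil; exact: cvg_cst.
by under eq_fun do rewrite big_cons; rewrite big_cons; apply: cvgD.
Qed.

Lemma toE_expand M : toE M = \sum_c co c M *: ebasis c.
Proof. exact: ecoord_expand. Qed.

Lemma toE_cvg (M_ : nat -> op) M : (forall c, co c (M_ n) @[n --> \oo] --> co c M) ->
  toE (M_ n) @[n --> \oo] --> toE M.
Proof.
move=> h; rewrite toE_expand (_ : (fun n => _) = fun n => \sum_c co c (M_ n) *: ebasis c); last first.
  by apply/funext => n; rewrite toE_expand.
apply: (cvg_bigsum (F := fun c n => co c (M_ n) *: ebasis c)) => c; apply: cvgZr_tmp; exact: h.
Qed.

Lemma gsum_cvg_cont a b (phi : R -> R) s : a < s <= b -> continuous phi ->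
  gsum a b n phi s @[n --> \oo] --> phi s.
Proof.
move=> asb cphi; have [r [_ cr e]] := gsum_seq asb.
by under eq_fun do rewrite e; exact: (cvg_comp _ _ cr (cphi s)).
Qed.

Section measurability.
Context {d : measure_display} {T : measurableType d}.
Variable H : set (set T).
Hypothesis sH : sigma_algebra setT H.

Let oc_wrt (a b : R) (Y : T -> R) : measurable_wrt H Y ->
  measurable_wrt H (fun w => oc_ind a b (Y w)).
Proof.
move=> hY; under eq_fun do rewrite -oc_indE.
apply: (measurable_wrt_comp (phi := \1_(`]a, b]%classic))) hY.
by apply: measurable_indic; exact: measurable_itv.
Qed.

(** Induction on the coordinates still to be inserted. In the current coordinate a continuous
    function is the limit of its grid step functions, which involve [psi] only with that coordinate
    fixed at grid points. *)
Let cont_sum (s : seq (coord (K := K))) (psi : opE R K -> R) (Y : coord -> T -> R) z :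
  continuous psi -> (forall c w, `|Y c w| <= 1) -> (forall c, measurable_wrt H (Y c)) ->
  measurable_wrt H (fun w => psi (z + \sum_(c <- s) Y c w *: ebasis c)).
Proof.
move=> cpsi hY mY; elim: s z => [|c s ih] z.
  by under eq_fun do rewrite big_nil; exact: measurable_wrt_cst.
pose phi w (x : R) := psi (z + x *: ebasis c + \sum_(c <- s) Y c w *: ebasis c).
have cphi w : continuous (phi w).
  move=> x; apply: continuous_comp; last exact: cpsi.
  apply: cvgD; last exact: cvg_cst.
  by apply: cvgD; [exact: cvg_cst|apply: cvgZr_tmp; exact: cvg_id].
(* Grids cover left-open intervals, hence ]-2, 2] for coordinates in [-1, 1]. *)
apply: (measurable_wrt_cvg sH (X_ := fun n w => gsum (-2) 2 n (phi w) (Y c w))).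
  move=> n; rewrite /gsum; apply: measurable_wrt_sum => // k _.
  by apply: measurable_wrtM => //; [exact: ih|exact: oc_wrt].
move=> w; rewrite big_cons addrA; apply: gsum_cvg_cont => //.
by have := hY c w; rewrite ler_norml => /andP[h1 h2]; apply/andP; split; lra.
Qed.

Lemma measurable_wrt_cont (psi : opE R K -> R) (X : T -> op) : continuous psi ->
  (forall w, cube (X w)) -> (forall c, measurable_wrt H (fun w => co c (X w))) ->
  measurable_wrt H (fun w => psi (toE (X w))).
Proof.
move=> cpsi hX mX; have := @cont_sum (index_enum _) psi (fun c w => co c (X w)) 0 cpsi (fun c w => hX w c) mX.
by under eq_fun do rewrite add0r -toE_expand.
Qed.

End measurability.

Variable st : op -> Prop.
Hypothesis st_cube : forall M, st M -> cube M.

(** What left limits and time integrals along the process rely on. Unlike [pol] this is required on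
    [st] only, which admits [f], its differentials and the jump part of the generator. *)
Record adm (psi : op -> R) : Prop := Adm {
  adm_bdd : exists B : R, forall M, st M -> `|psi M| <= B;
  adm_cvg : forall (M_ : nat -> op) M, (forall n, st (M_ n)) -> st M ->
    (forall c, co c (M_ n) @[n --> \oo] --> co c M) -> psi (M_ n) @[n --> \oo] --> psi M;
  adm_meas : forall d (T : measurableType d) (H : set (set T)) (X : T -> op),
    sigma_algebra setT H -> (forall w, st (X w)) ->
    (forall c, measurable_wrt H (fun w => co c (X w))) ->
    measurable_wrt H (fun w => psi (X w))
}.

Lemma adm_pol psi : pol psi -> adm psi.
Proof.
move=> [h1 h2 [B _ [h3 _]]]; split.
- by exists B => M /st_cube; exact: h3.
- by move=> M_ M _ _; exact: h1.
- by move=> d T H X sH _; exact: h2.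
Qed.

Lemma admD psi phi : adm psi -> adm phi -> adm (fun M => psi M + phi M).
Proof.
move=> [[B1 b1] c1 m1] [[B2 b2] c2 m2]; split.
- by exists (B1 + B2) => M h; rewrite (le_trans (ler_normD _ _))// lerD ?b1 ?b2.
- by move=> M_ M h h' h2; apply: cvgD; [exact: c1|exact: c2].
- by move=> d T H X sH h h'; apply: measurable_wrtD => //; [exact: m1|exact: m2].
Qed.

Lemma admM psi phi : adm psi -> adm phi -> adm (fun M => psi M * phi M).
Proof.
move=> [[B1 b1] c1 m1] [[B2 b2] c2 m2]; split.
- by exists (B1 * B2) => M h; rewrite normrM ler_pM ?b1 ?b2.
- by move=> M_ M h h' h2; apply: cvgM; [exact: c1|exact: c2].
- by move=> d T H X sH h h'; apply: measurable_wrtM => //; [exact: m1|exact: m2].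
Qed.

Lemma adm_sum (J : Type) (s : seq J) (P : pred J) (F : J -> op -> R) :
  (forall j, P j -> adm (F j)) -> adm (fun M => \sum_(j <- s | P j) F j M).
Proof.
move=> h; elim: s => [|j s ih].
  by under eq_fun do rewrite big_nil; exact/adm_pol/pol_cst.
case Pj : (P j); under eq_fun do rewrite big_cons Pj; last exact: ih.
exact: admD (h _ Pj) ih.
Qed.

Lemma adm_cont (psi : opE R K -> R) B : continuous psi -> (forall y, `|psi y| <= B) ->
  adm (fun M => psi (toE M)).
Proof.
move=> cpsi hB; split; first by exists B.
- by move=> M_ M _ _ /toE_cvg h; exact: (cvg_comp _ _ h (cpsi _)).
- by move=> d T H X sH hX; apply: measurable_wrt_cont => // w; exact: st_cube.
Qed.

End admissible_functions.

(** * Rates and jump sizes on states *)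

Section coefficients_on_states.
Context {R : realType} {K N p : nat}.
Local Open Scope sesquilinear_scope.
Variables (X : 'I_N.+1 -> 'cV[R[i]]_N.+1) (L : 'I_N.+1 -> 'M[R[i]]_K.+1)
  (P : 'I_p.+1 -> 'M[R[i]]_N.+1).
Hypotheses (Psa : forall i, (P i) ^t* = P i) (Pid : forall i, P i *m P i = P i).
Local Notation op := 'M[R[i]]_K.+1.
Local Notation pc := (pcoef X P).
Local Notation coord := (coord (K := K)).
Implicit Types (rho : op) (c : coord) (j : 'I_p).

Definition rate j rho : R := complex.Re (coefv L pc (lift ord0 j) rho).
Definition jumpc j c rho : R := co c (jump_op L pc (lift ord0 j) rho).
Definition jumpt j rho : op := coefgt L pc (lift ord0 j) rho.

(* A substitute for positivity which is obviously stable under limits. *)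
Definition nice rho : Prop := cube rho /\
  forall j, 0 <= rate j rho /\ forall c, `|jumpc j c rho| <= rate j rho.

Lemma nice_cube rho : nice rho -> cube rho. Proof. by case. Qed.

Lemma rate_pol j : pol (rate j). Proof. by have [] := coefv_cpol L pc (lift ord0 j). Qed.
Lemma jumpc_pol j c : pol (jumpc j c). Proof. exact: mpol_co (jump_op_mpol _ _ _). Qed.

Lemma psd_co (M : op) c : positive_op M -> `|co c M| <= complex.Re (\tr M).
Proof.
move=> h; case: c => [[[] i] k]; rewrite -?coRe -?coIm; by have [] := psd_entry i k h.
Qed.

Lemma state_nice rho : is_state rho -> nice rho.
Proof.
move=> [h tr1]; split=> [c|j]; first by have := psd_co c h; rewrite tr1.
have hJ := jump_op_psd X L Psa Pid (lift ord0 j) h.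
by split=> [|c]; [have [] := coefv_ge0 X L Psa Pid (lift ord0 j) h|exact: psd_co].
Qed.

Lemma nice_lim (M_ : nat -> op) rho : (forall n, nice (M_ n)) ->
  (forall c, co c (M_ n) @[n --> \oo] --> co c rho) -> nice rho.
Proof.
move=> h cM; split=> [c|j].
  by apply: (cvgr_to_le (cvg_norm (cM c))); apply: nearW => n; have [] := h n.
have cv := pol_cvg (rate_pol j) cM; split=> [|c].
  by apply: (cvgr_to_ge cv); apply: nearW => n; have [_ /(_ j)[]] := h n.
apply: (ler_cvg_to (cvg_norm (pol_cvg (jumpc_pol j c) cM)) cv).
by apply: nearW => n; have [_ /(_ j)[]] := h n.
Qed.

Lemma rate_max : exists2 cm : R, 0 <= cm & forall j rho, cube rho -> rate j rho <= cm.
Proof.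
have /choice[B hB] : forall j, exists B : R, 0 <= B /\ forall rho, cube rho -> rate j rho <= B.
  move=> j; have [B B0 [h _]] := pol_lip (rate_pol j); exists B; split=> // rho hr.
  exact: le_trans (ler_norm _) (h _ hr).
exists (\sum_j B j) => [|j rho hr]; first by apply: sumr_ge0 => j _; have [] := hB j.
have [_ h] := hB j; apply: (le_trans (h _ hr)).
by rewrite (bigD1 j)//= lerDl; apply: sumr_ge0 => k _; have [] := hB k.
Qed.

Lemma co_jumpt j c rho : co c (jumpt j rho) = (rate j rho)^-1 * jumpc j c rho - co c rho.
Proof.
by rewrite /jumpt /coefgt coB /jumpc -coZ /rate fmorphV.
Qed.

Let ratio_le j c rho : nice rho -> `|(rate j rho)^-1 * jumpc j c rho| <= 1.
Proof.
move=> [_ /(_ j)[v0 h]]; have [->|vn0] := eqVneq (rate j rho) 0.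
  by rewrite invr0 mul0r normr0.
have vp : 0 < rate j rho by rewrite lt_def vn0.
by rewrite normrM gtr0_norm ?invr_gt0// mulrC ler_pdivrMr// mul1r.
Qed.

Lemma jumpt_le j c rho : nice rho -> `|co c (jumpt j rho)| <= 2.
Proof.
move=> h; rewrite co_jumpt; apply: (le_trans (ler_normB _ _)).
by have := ratio_le j c h; have [/(_ c) h1 _] := h; lra.
Qed.

Lemma jumpt_cvg j c (M_ : nat -> op) rho : (forall c, co c (M_ n) @[n --> \oo] --> co c rho) ->
  rate j rho != 0 -> co c (jumpt j (M_ n)) @[n --> \oo] --> co c (jumpt j rho).
Proof.
move=> cM v0; rewrite co_jumpt; under eq_fun do rewrite co_jumpt.
apply: cvgB; last exact: cM.
apply: cvgM; last exact: (pol_cvg (jumpc_pol j c) cM).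
by apply: cvgV => //; exact: (pol_cvg (rate_pol j) cM).
Qed.

Lemma jumpt_wrt d (T : measurableType d) (H : set (set T)) (Y : T -> op) j c :
  sigma_algebra setT H -> (forall c, measurable_wrt H (fun w => co c (Y w))) ->
  measurable_wrt H (fun w => co c (jumpt j (Y w))).
Proof.
move=> sH hY; under eq_fun do rewrite co_jumpt.
apply: measurable_wrtB => //; apply: measurable_wrtM => //; last exact: pol_meas (jumpc_pol j c) _ _ _ _ sH hY.
apply: (measurable_wrt_comp (phi := GRing.inv)); first exact: inv_measurable.
exact: pol_meas (rate_pol j) _ _ _ _ sH hY.
Qed.

Lemma jump_target_cube j rho : nice rho -> cube (rho + jumpt j rho).
Proof. by move=> h c; rewrite coD co_jumpt addrC subrK ratio_le. Qed.

(* Where the rate is small the jump size may vary a lot, but then it matters little. *)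
Lemma jumpt_lip : exists2 B : R, 0 <= B & forall j c rho rho', nice rho -> nice rho' ->
  Num.min (rate j rho) (rate j rho') * `|co c (jumpt j rho) - co c (jumpt j rho')| <= B * dist rho rho' /\
  `|rate j rho - rate j rho'| <= B * dist rho rho'.
Proof.
have [cm cm0 hcm] := rate_max.
have /choice[B hB] : forall jc : 'I_p * coord, exists B : R, 0 <= B /\ forall rho rho', cube rho -> cube rho' ->
    `|rate jc.1 rho - rate jc.1 rho'| <= B * dist rho rho' /\
    `|jumpc jc.1 jc.2 rho - jumpc jc.1 jc.2 rho'| <= B * dist rho rho'.
  move=> [j c] /=; have [B1 B10 [_ h1]] := pol_lip (rate_pol j).
  have [B2 B20 [_ h2]] := pol_lip (jumpc_pol j c).
  exists (B1 + B2); split=> [|rho rho' h h']; first exact: addr_ge0.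
  have d0 := dist_ge0 rho rho'.
  split; [apply: le_trans (h1 _ _ h h') _|apply: le_trans (h2 _ _ h h') _]; apply: ler_wpM2r => //.
    by rewrite lerDl.
  by rewrite lerDr.
pose S := \sum_jc B jc; have S0 : 0 <= S by apply: sumr_ge0 => jc _; have [] := hB jc.
have hS jc : B jc <= S by rewrite /S (bigD1 jc)//= lerDl; apply: sumr_ge0 => k _; have [] := hB k.
exists (S + S + cm) => [|j c rho rho' h h']; first by rewrite !addr_ge0.
have d0 := dist_ge0 rho rho'.
have [_ /(_ _ _ (nice_cube h) (nice_cube h')) [h1 h2]] := hB (j, c).
have Sd : B (j, c) * dist rho rho' <= S * dist rho rho' by exact: ler_wpM2r.
have {}h1 := le_trans h1 Sd; have {}h2 := le_trans h2 Sd.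
split; last by apply: (le_trans h1); rewrite ler_wpM2r// -addrA lerDl addr_ge0.
have main (v v' J J' r r' : R) : 0 <= v -> v <= v' -> v <= cm -> `|J| <= v -> `|J'| <= v' ->
    `|v - v'| <= S * dist rho rho' -> `|J - J'| <= S * dist rho rho' -> `|r - r'| <= dist rho rho' ->
    v * `|v^-1 * J - r - (v'^-1 * J' - r')| <= (S + S + cm) * dist rho rho'.
  move=> v0 vv' vc Jv Jv' hv hJ hr; rewrite -{1}(ger0_norm v0) -normrM.
  (* Multiplication by the smaller rate removes the quotient: v (J / v - J' / v') = (J - J') + (J' /
     v') (v' - v), where |J'| <= v'. If v = 0 then J = 0 as well. *)
  have -> : v * (v^-1 * J - r - (v'^-1 * J' - r')) = (J - J') + v'^-1 * J' * (v' - v) - v * (r - r').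
    have [e0|vn] := eqVneq v 0.
      have -> : J = 0 by apply/eqP; rewrite -normr_le0 -e0.
      have [e0'|vn'] := eqVneq v' 0.
        have -> : J' = 0 by apply/eqP; rewrite -normr_le0 -e0'.
        by rewrite e0 e0'; ring.
      by rewrite e0 sub0r subr0 !mul0r subr0 mulrAC mulVf// mul1r addNr.
    have vp : 0 < v by rewrite lt_def vn.
    have vn' : v' != 0 := lt0r_neq0 (lt_le_trans vp vv').
    by field; rewrite vn vn'.
  apply: (le_trans (ler_normB _ _)); rewrite !mulrDl; apply: lerD.
    apply: (le_trans (ler_normD _ _)); apply: lerD => //.
    rewrite normrM distrC; apply: le_trans hv; rewrite ler_piMl//.
    have [->|vn'] := eqVneq v' 0; first by rewrite invr0 mul0r normr0.
    have vp : 0 < v' by rewrite lt_def vn' (le_trans v0).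
    by rewrite normrM gtr0_norm ?invr_gt0// mulrC ler_pdivrMr// mul1r.
  by rewrite normrM ger0_norm//; exact: ler_pM.
rewrite !co_jumpt.
have [v0 hJ] := h.2 j; have [v0' hJ'] := h'.2 j.
have [vv|vv] := leP (rate j rho) (rate j rho').
  exact: (main _ _ _ _ _ _ v0 vv (hcm j _ (nice_cube h)) (hJ c) (hJ' c) h1 h2 (le_dist c rho rho')).
have h1' : `|rate j rho' - rate j rho| <= S * dist rho rho' by rewrite distrC.
have h2' : `|jumpc j c rho' - jumpc j c rho| <= S * dist rho rho' by rewrite distrC.
have h3' : `|co c rho' - co c rho| <= dist rho rho' by rewrite distrC; exact: le_dist.
rewrite [`|_ - _|]distrC.
exact: (main _ _ _ _ _ _ v0' (ltW vv) (hcm j _ (nice_cube h')) (hJ' c) (hJ c) h1' h2' h3').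
Qed.

End coefficients_on_states.

(** * The generator in real form *)

Section generator.
Context {R : realType} {K N p : nat}.
Local Open Scope sesquilinear_scope.
Variables (X : 'I_N.+1 -> 'cV[R[i]]_N.+1) (L : 'I_N.+1 -> 'M[R[i]]_K.+1)
  (P : 'I_p.+1 -> 'M[R[i]]_N.+1).
Hypotheses (Psa : forall i, (P i) ^t* = P i) (Pid : forall i, P i *m P i = P i).
Variable f : opE R K -> R.
Hypothesis hf : C2c f.
Local Notation op := 'M[R[i]]_K.+1.
Local Notation pc := (pcoef X P).
Local Notation coord := (coord (K := K)).
Local Notation rate := (rate X L P).
Local Notation jumpt := (jumpt X L P).
Local Notation nice := (nice X L P).
Implicit Types (rho : op) (c : coord) (j : 'I_p).

Let df x : differentiable f x. Proof. by case: hf. Qed.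
Let ddf u x : differentiable (fun y => 'd f y u : R) x. Proof. by case: hf. Qed.
Let cddf u v : continuous (fun x => 'd (fun y => 'd f y u : R) x v : R). Proof. by case: hf. Qed.
Let csf : compact (closure [set x | f x != 0]). Proof. by case: hf. Qed.
Let lin := @ecoord_linear R K.
Let expd := @ecoord_expand R K.

Definition fder c rho : R := 'd f (toE rho) (ebasis c).
Definition fhess (eta xi : op) rho : R := hess f (toE eta) (toE xi) (toE rho).
Definition frem rho (eta : op) : R := rem1 f (toE rho) (toE eta).

(** A common form of both generators. The factor [rate] takes over the conventions for vanishing
    rates, and an empty [I0] expresses the absence of the second-order sum. *)
Definition genR (I0 : {set 'I_p.+1}) (QI : {set 'I_p}) rho : R :=
  \sum_c co c (coefL L rho) * fder c rho
  + 2^-1 * \sum_(i in I0) fhess (coefh L pc i rho) (coefh L pc i rho) rho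
  + \sum_(j in QI) rate j rho * frem rho (jumpt j rho).

Lemma D1_sum rho eta : D1 f rho eta = \sum_c co c eta * fder c rho.
Proof. exact: (linear_expand expd). Qed.

Lemma frem_increment rho eta : increment f rho eta = frem rho eta.
Proof. by rewrite /increment /frem /rem1 toED. Qed.

Let second_orderE rho (I0 : {set 'I_p.+1}) :
  I0 = (if idxJ pc == finset.set0 then finset.set0 else idxJ0 pc) ->
  second_order L pc f rho = 2^-1 * \sum_(i in I0) fhess (coefh L pc i rho) (coefh L pc i rho) rho.
Proof. by move=> ->; rewrite /second_order; case: ifP => _ //; rewrite big_set0 mulr0. Qed.

Lemma gen_genR rho (I0 : {set 'I_p.+1}) : is_state rho ->
  I0 = (if idxJ pc == finset.set0 then finset.set0 else idxJ0 pc) ->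
  gen L pc f rho = (genR I0 (idxI pc) rho)%:C /\ gent L pc f rho = genR I0 (idxI pc) rho.
Proof.
move=> [psd tr1] hI0; rewrite /gen /gent /genR D1_sum (second_orderE _ hI0).
have v_ j : coefv L pc (lift ord0 j) rho = (rate j rho)%:C.
  have [_] := coefv_ge0 X L Psa Pid (lift ord0 j) psd.
  by rewrite /rate; case: (coefv _ _ _ _) => a b /= ->.
have v0 j : 0 <= rate j rho by have [] := coefv_ge0 X L Psa Pid (lift ord0 j) psd.
split.
  rewrite !rmorphD/=; congr (_ + _); rewrite rmorph_sum; apply: eq_bigr => j _ /=.
  have -> : coefg L pc (lift ord0 j) rho = jumpt j rho by rewrite /coefg /jumpt /coefgt v_.
  rewrite v_ frem_increment rmorphM/=; case: eqP => // ->; by rewrite mul0r.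
congr (_ + _); apply: eq_bigr => j _ /=.
rewrite -/(rate j rho) frem_increment; case: eqP => [->|_]; first by rewrite mul0r.
by rewrite (max_idPr (v0 j)).
Qed.

Lemma fder_bounded : exists2 B : R, 0 <= B & forall c rho, `|fder c rho| <= B.
Proof.
have [B B0 hB] := df_bounded expd df ddf csf; exists B => // c rho.
apply: (le_trans (hB _ _)); rewrite /n1 (bigD1 c)//= ecoord_basis eqxx normr1 big1 => [|c' cc'].
  by rewrite addr0 mulr1.
by rewrite ecoord_basis (negbTE cc') normr0.
Qed.

Lemma fder_adm c : adm nice (fder c).
Proof.
have [B _ hB] := df_bounded expd df ddf csf.
apply: (adm_cont (@nice_cube _ _ _ _ X L P) (psi := fun y => 'd f y (ebasis c)) _ (fun y => hB y (ebasis c))).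
by move=> x; exact: differentiable_continuous (ddf (ebasis c) x).
Qed.

Lemma f_adm : adm nice (fun rho => f (toE rho)).
Proof.
have [B _ hB] := f_bounded df csf.
apply: (adm_cont (@nice_cube _ _ _ _ X L P) _ hB) => x.
exact: differentiable_continuous.
Qed.

Let nc := @nice_cube _ _ _ _ X L P.

Lemma fhess_adm (F G : op -> op) : mpol F -> mpol G -> adm nice (fun rho => fhess (F rho) (G rho) rho).
Proof.
move=> hF hG; rewrite /fhess; under eq_fun do rewrite (hess_expand expd ddf).
have [B _ hB] := hess_bounded expd df ddf cddf csf.
apply: (adm_sum nc) => c _; apply: (adm_sum nc) => c' _; apply: admM.
  by apply: admM; apply: (adm_pol nc); exact: mpol_co.
exact: (adm_cont nc (@cddf (ebasis c) (ebasis c')) (fun y => hB y (ebasis c) (ebasis c'))).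
Qed.

Lemma frem_jump_bounded : exists2 B : R, 0 <= B & forall j rho, nice rho -> `|frem rho (jumpt j rho)| <= B.
Proof.
have [B B0 hB] := rem1_lip lin expd df ddf cddf csf.
exists (B * (2 * #|coord|%:R)) => [|j rho h]; first by rewrite !mulr_ge0.
have [_] := hB (toE rho) 0 (toE (jumpt j rho)).
rewrite add0r {2}/rem1 addr0 subrr linear0 subr0 subr0 => h1.
apply: (le_trans h1); rewrite ler_wpM2l// mulrC mulr_natl -sumr_const.
by apply: ler_sum => c _; exact: jumpt_le.
Qed.

Let frem_jumpE rho j : frem rho (jumpt j rho) = f (toE (rho + jumpt j rho)) - f (toE rho)
   - \sum_c co c (jumpt j rho) * fder c rho.
Proof. by rewrite /frem /rem1 -toED -D1_sum. Qed.

Lemma frem_jump_wrt d (T : measurableType d) (H : set (set T)) (Y : T -> op) j :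
  sigma_algebra setT H -> (forall w, nice (Y w)) -> (forall c, measurable_wrt H (fun w => co c (Y w))) ->
  measurable_wrt H (fun w => frem (Y w) (jumpt j (Y w))).
Proof.
move=> sH nY mY; under eq_fun do rewrite frem_jumpE.
have cf : continuous f by move=> x; exact: differentiable_continuous.
have mJ c : measurable_wrt H (fun w => co c (jumpt j (Y w))) by exact: jumpt_wrt.
apply: measurable_wrtB => //; first apply: measurable_wrtB => //.
- apply: (measurable_wrt_cont sH cf) => [w|c]; first exact: jump_target_cube.
  by under eq_fun do rewrite coD; exact: measurable_wrtD.
- exact: (adm_meas f_adm sH nY mY).
- apply: measurable_wrt_sum => // c _; apply: measurable_wrtM => //.
  exact: (adm_meas (fder_adm c) sH nY mY).
Qed.

(** The jump size may be discontinuous where the rate vanishes, but there a bounded factor is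
    multiplied by a rate that tends to 0. *)
Lemma rate_frem_adm j : adm nice (fun rho => rate j rho * frem rho (jumpt j rho)).
Proof.
have [B B0 hB] := frem_jump_bounded; have [Bv Bv0 [hv _]] := pol_lip (rate_pol X L P j).
split.
- by exists (Bv * B) => rho h; rewrite normrM ler_pM ?hB ?hv//; case: h.
- move=> M_ M nM_ nM cM; have cv := pol_cvg (rate_pol X L P j) cM.
  have [v0|v0] := eqVneq (rate j M) 0.
    rewrite v0 in cv *; rewrite mul0r; apply/norm_cvg0P.
    apply: (@squeeze_cvgr _ _ _ _ (fun=> 0) (fun n => `|rate j (M_ n)| * B)).
    + by apply: nearW => n; rewrite normr_ge0/= normrM; apply: ler_wpM2l; [exact: normr_ge0|exact: (hB j _ (nM_ n))].
    + exact: cvg_cst.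
    + by rewrite -(mul0r B) -(normr0 R); apply: cvgM; [exact: cvg_norm|exact: cvg_cst].
  apply: cvgM => //; rewrite frem_jumpE; under eq_fun do rewrite frem_jumpE.
  have cg c : co c (jumpt j (M_ n)) @[n --> \oo] --> co c (jumpt j M) by exact: jumpt_cvg.
  apply: cvgB; first apply: cvgB.
  + apply: (cvg_comp (fun n => toE (M_ n + jumpt j (M_ n))) f); last exact: differentiable_continuous.
    by apply: toE_cvg => c; rewrite coD; under eq_fun do rewrite coD; apply: cvgD; [exact: cM|exact: cg].
  + exact: (adm_cvg f_adm nM_ nM cM).
  + apply: (cvg_bigsum (V := R) (F := fun c n => co c (jumpt j (M_ n)) * fder c (M_ n))) => c.
    by apply: cvgM; [exact: cg|exact: (adm_cvg (fder_adm c) nM_ nM cM)].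
- move=> d T H Y sH nY mY; apply: measurable_wrtM => //; last exact: frem_jump_wrt.
  exact: (pol_meas (rate_pol X L P j) sH mY).
Qed.

Lemma genR_adm I0 QI : adm nice (genR I0 QI).
Proof.
apply: admD; first apply: admD.
- apply: (adm_sum nc) => c _; apply: admM; last exact: fder_adm.
  by apply: (adm_pol nc); apply: mpol_co; exact: coefL_mpol.
- apply: admM; first by apply: (adm_pol nc); exact: pol_cst.
  by apply: (adm_sum nc) => i _; apply: fhess_adm; exact: coefh_mpol.
- by apply: (adm_sum nc) => j _; exact: rate_frem_adm.
Qed.

End generator.

(** * Fubini's theorem for bounded real functions *)

Section real_fubini.
Context {d1 d2 : measure_display} {T1 : measurableType d1} {T2 : measurableType d2} {R : realType}.
Variables (m1 : {sigma_finite_measure set T1 -> \bar R}) (m2 : {sigma_finite_measure set T2 -> \bar R}).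
Variables (f : T1 * T2 -> R) (D1 : set T1) (D2 : set T2) (B : R).
Hypotheses (mf : measurable_fun setT f) (fB : forall z, `|f z| <= B)
  (mD1 : measurable D1) (mD2 : measurable D2) (fD1 : (m1 D1 < +oo)%E) (fD2 : (m2 D2 < +oo)%E)
  (f0 : forall z, ~ (D1 z.1 /\ D2 z.2) -> f z = 0).

Let mD : measurable (D1 `*` D2). Proof. exact: measurableX. Qed.

Let fD : ((m1 \x m2)%E (D1 `*` D2) < +oo)%E.
Proof. by rewrite (product_measure1E m1 m2 mD1 mD2) lte_mul_pinfty// ge0_fin_numE. Qed.

Lemma integ_bounded_prod : integ (m1 \x m2)%E f.
Proof. exact: (integ_bounded_supp mD fD mf fB). Qed.

Let sec1 x : integ m2 (fun y => f (x, y)).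
Proof.
apply: (integ_bounded_supp mD2 fD2 (B := B)) => //.
  exact: (measurableT_comp mf (measurable_pair1 x)).
by move=> y nD; apply: f0 => -[].
Qed.

Let sec2 y : integ m1 (fun x => f (x, y)).
Proof.
apply: (integ_bounded_supp mD1 fD1 (B := B)) => //.
  exact: (measurableT_comp mf (measurable_pair2 y)).
by move=> x nD; apply: f0 => -[].
Qed.

Let F x : (fubini_F m2 (EFin \o f) x) = (\int[m2]_y f (x, y))%:E.
Proof. by rewrite /fubini_F /Rintegral fineK//; exact: integrable_fin_num (sec1 x). Qed.

Let G y : (fubini_G m1 (EFin \o f) y) = (\int[m1]_x f (x, y))%:E.
Proof. by rewrite /fubini_G /Rintegral fineK//; exact: integrable_fin_num (sec2 y). Qed.

Lemma fubini_bounded1 : \int[(m1 \x m2)%E]_z f z = \int[m1]_x \int[m2]_y f (x, y).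
Proof.
rewrite /Rintegral -(integral12_prod_meas1 integ_bounded_prod); congr fine.
by apply: eq_integral => x _; rewrite F.
Qed.

Lemma fubini_bounded2 : \int[(m1 \x m2)%E]_z f z = \int[m2]_y \int[m1]_x f (x, y).
Proof.
rewrite /Rintegral -(integral21_prod_meas1 integ_bounded_prod); congr fine.
by apply: eq_integral => x _; rewrite G.
Qed.

Lemma fubini_bounded_integ : integ m1 (fun x => \int[m2]_y f (x, y)).
Proof.
have := integrable_fubini_F integ_bounded_prod; by apply: eq_integrable => // x _; rewrite /= -F.
Qed.

Lemma fubini_bounded_integ2 : integ m2 (fun y => \int[m1]_x f (x, y)).
Proof.
apply: (integ_bounded_supp mD2 fD2 (B := B * fine (m1 D1))).
- apply/measurable_EFinP; have := measurable_fubini_G integ_bounded_prod.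
  by apply: eq_measurable_fun => y _; rewrite G.
- move=> y; apply: (Rintegral_norm_bounded_supp mD1 fD1) => [|x|x h].
  + exact: (measurableT_comp mf (measurable_pair2 y)).
  + exact: fB.
  + by apply: f0 => -[].
- move=> y h; rewrite /Rintegral (eq_integral (cst 0%E)) ?integral0// => x _.
  by rewrite f0// => -[].
Qed.

End real_fubini.

(** * Coordinates of right-continuous paths with left limits *)

Section cadlag_paths.
Context {R : realType} {K : nat}.
Local Notation op := 'M[R[i]]_K.+1.
Implicit Types (c : coord (K := K)) (u : R -> op).

Lemma ecoord_cvg (U : Type) (G : set_system U) (FG : Filter G) (y_ : U -> opE R K) (y : opE R K) c :
  y_ x @[x --> G] --> y -> ecoord c (y_ x) @[x --> G] --> ecoord c y.
Proof.
move=> h; apply: (cvg_comp _ _ h); case: c => [[[] a] b]; rewrite /ecoord /=.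
  apply: (@continuous_comp _ _ _ snd (fun M : 'M[R]_K.+1 => M a b)); last exact: coord_continuous.
  exact: cvg_snd.
apply: (@continuous_comp _ _ _ fst (fun M : 'M[R]_K.+1 => M a b)); last exact: coord_continuous.
exact: cvg_fst.
Qed.

Lemma cadlag_left u s c : cadlag u -> 0 < s ->
  co c (u x) @[x --> s^'-] --> co c (left_lim u s).
Proof.
move=> [_ h] s0; have [l hl] := h s s0.
have cl c' : co c' (u x) @[x --> s^'-] --> co c' l by exact: ecoord_cvg.
suff -> : left_lim u s = l by [].
apply: co_inj => -[[[] a] b]; rewrite -?coRe -?coIm mxE /=.
  by rewrite coIm; have := cl ((true, a), b); under eq_fun do rewrite -coIm; exact: cvg_lim.
by rewrite coRe; have := cl ((false, a), b); under eq_fun do rewrite -coRe; exact: cvg_lim.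
Qed.

Lemma cadlag_left_seq u s c (r : nat -> R) : cadlag u -> 0 < s -> (forall n, r n < s) ->
  r n @[n --> \oo] --> s -> co c (u (r n)) @[n --> \oo] --> co c (left_lim u s).
Proof. by move=> hu s0 rs cr; have /cvg_at_leftP := cadlag_left (c := c) hu s0; apply. Qed.

Lemma cadlag_right_seq u s c (r : nat -> R) : cadlag u -> 0 <= s -> (forall n, s <= r n) ->
  r n @[n --> \oo] --> s -> co c (u (r n)) @[n --> \oo] --> co c (u s).
Proof.
move=> [h _] s0 rs cr.
have cl : co c (u x) @[x --> s^'+] --> co c (u s) by apply: ecoord_cvg; exact: h.
apply/cvgrPdist_le => e e0; move/cvgrPdist_le: cl => /(_ e e0).
rewrite near_withinE => -[eta /= eta0 he].
move/cvgrPdist_lt: cr => /(_ eta eta0); apply: filterS => n hn.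
have := rs n; rewrite le_eqVlt => /predU1P[<-|sr]; first by rewrite subrr normr0 ltW.
exact: (he (r n)).
Qed.

End cadlag_paths.

(** * Left limits and time integrals *)

Section time_integrals.
Context {R : realType}.
Local Notation mR := (measurableTypeR R).
Local Notation leb := (@lebesgue_measure R).

Lemma Rintegral_bigsum d (Z : measurableType d) (m : {measure set Z -> \bar R}) (J : Type)
    (s : seq J) (F : J -> Z -> R) : (forall j, integ m (F j)) ->
  integ m (fun z => \sum_(j <- s) F j z) /\
  \int[m]_z \sum_(j <- s) F j z = \sum_(j <- s) \int[m]_z F j z.
Proof.
move=> iF; elim: s => [|j s [ih1 ih2]].
  have e0 : (fun z : Z => \sum_(j <- [::]) F j z) = fun=> 0 by apply/funext => z; rewrite big_nil.
  rewrite e0 big_nil; split; last by rewrite /Rintegral integral0.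
  exact: integrable0.
have e1 : (fun z : Z => \sum_(j <- j :: s) F j z) = fun z => F j z + \sum_(j <- s) F j z.
  by apply/funext => z; rewrite big_cons.
rewrite e1 big_cons; split; first exact: (integrableD _ (iF j) ih1).
by rewrite (RintegralD measurableT (iF j) ih1) ih2.
Qed.

Lemma lebesgue_oc_fin (a b : R) : (leb `]a, b]%classic < +oo)%E.
Proof. by rewrite lebesgue_measure_itv/=; case: ifP => _ //; rewrite -EFinD ltry. Qed.

Lemma oc_ind_measurable (a b : R) : measurable_fun setT (oc_ind a b : mR -> R).
Proof.
rewrite (_ : oc_ind a b = \1_(`]a, b]%classic)); last by apply/funext => z; rewrite oc_indE.
by apply: measurable_indic; exact: measurable_itv.
Qed.

Lemma oc_ind_out (a b z : R) : ~ (`]a, b]%classic : set R) z -> oc_ind a b z = 0.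
Proof. by rewrite -oc_indE indicE => h; rewrite memNset. Qed.

Lemma integ_oc (a b e : R) : integ leb (fun s : mR => e * oc_ind a b s).
Proof.
rewrite (_ : (fun s => _) = fun s : mR => e * \1_(`]a, b]%classic) s).
  by apply: integ_indic; [exact: measurable_itv|exact: lebesgue_oc_fin].
by apply/funext => s; rewrite oc_indE.
Qed.

Lemma Rintegral_oc (a b e : R) : a <= b -> \int[leb]_(s in setT) (e * oc_ind a b s) = e * (b - a).
Proof.
move=> ab; rewrite RintegralZl//; last by have := integ_oc a b 1; under eq_fun do rewrite mul1r.
congr (_ * _); rewrite -(fine_lebesgue_itv ab) /Rintegral.
under eq_integral do rewrite -oc_indE.
by rewrite integral_indic// ?setIT//; exact: measurable_itv.
Qed.

Lemma gsum_measurable a b n (phi : R -> R) : measurable_fun setT (gsum a b n phi : mR -> R).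
Proof.
rewrite /gsum; apply: measurable_sum => k; apply: measurable_funM => //.
exact: oc_ind_measurable.
Qed.

Lemma Rintegral_gsum a b n (phi : R -> R) : a <= b ->
  \int[leb]_(s in setT) gsum a b n phi s = \sum_(k < n.+1) (b - a) / n.+1%:R * phi (gpt a b n k).
Proof.
move=> ab; have [_ ->] := @Rintegral_bigsum _ _ leb _ (index_enum _) (fun (k : 'I_n.+1) (s : mR) =>
  phi (gpt a b n k) * oc_ind (gpt a b n k) (gpt a b n k.+1) s) (fun k => integ_oc _ _ _).
apply: eq_bigr => k _; rewrite Rintegral_oc; last exact: le_gpt.
by rewrite gptS mulrC.
Qed.

(* The same grid with the values taken at the right end points. *)
Definition gsumr a b n (phi : R -> R) s : R :=
  \sum_(k < n.+1) phi (gpt a b n k.+1) * oc_ind (gpt a b n k) (gpt a b n k.+1) s.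

Lemma gsumrE a b n phi s : gsumr a b n phi s = gsum a b n (fun r => phi (r + (b - a) / n.+1%:R)) s.
Proof. by apply: eq_bigr => k _; congr (phi _ * _); rewrite -(gptS a b n k) addrC subrK. Qed.

End time_integrals.

Section left_limit_process.
Context {d : measure_display} {T : measurableType d} {R : realType} {K : nat}.
Local Notation op := 'M[R[i]]_K.+1.
Local Notation mR := (measurableTypeR R).
Local Notation leb := (@lebesgue_measure R).
Variables (rho : R -> T -> op) (st : op -> Prop).
Hypotheses (hcad : forall w, cadlag (rho ^~ w)) (hst : forall t w, 0 <= t -> st (rho t w))
  (st_cube : forall M, st M -> cube M)
  (st_lim : forall (M_ : nat -> op) M, (forall n, st (M_ n)) ->
     (forall c, co c (M_ n) @[n --> \oo] --> co c M) -> st M)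
  (hmeas : forall t c, 0 <= t -> measurable_fun setT (fun w => co c (rho t w))).
Local Notation rhom := (rho_ rho).
Implicit Types (u t s : R) (w : T) (c : coord (K := K)) (psi : op -> R).

Lemma left_seq u s w c (r : nat -> R) : 0 <= u -> (forall n, u <= r n < s) ->
  r n @[n --> \oo] --> s -> co c (rho (r n) w) @[n --> \oo] --> co c (rhom s w).
Proof.
move=> u0 hr cr; have s0 : 0 < s by have /andP[h1 h2] := hr 0%N; apply: le_lt_trans h2; exact: le_trans h1.
by apply: (cadlag_left_seq (c := c) (hcad w) s0) => // n; case/andP: (hr n).
Qed.

Let approx s : 0 < s -> exists r : nat -> R, (forall n, 0 <= r n < s) /\ r n @[n --> \oo] --> s.
Proof.
move=> s0; have [|r [h1 h2 _]] := @gsum_seq R 0 s s; first by rewrite s0 lexx.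
by exists r.
Qed.

Lemma left_st s w : 0 < s -> st (rhom s w).
Proof.
move=> /approx[r [hr cr]]; apply: (@st_lim (fun n => rho (r n) w)).
  by move=> n; apply: hst; case/andP: (hr n).
by move=> c; exact: (left_seq (w := w) (c := c) (lexx 0) hr cr).
Qed.

Lemma adm_left_seq psi u s w (r : nat -> R) : adm st psi -> 0 <= u -> (forall n, u <= r n < s) ->
  r n @[n --> \oo] --> s -> psi (rho (r n) w) @[n --> \oo] --> psi (rhom s w).
Proof.
move=> hpsi u0 hr cr; apply: (adm_cvg hpsi) => [n||c].
- by apply: hst; have /andP[h _] := hr n; exact: le_trans h.
- by apply: left_st; have /andP[h1 h2] := hr 0%N; apply: le_lt_trans h2; exact: le_trans h1.
- exact: (left_seq (w := w) (c := c) u0 hr cr).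
Qed.

Let meas_wrt : @sigma_algebra T setT d.-measurable.
Proof. exact: sigma_algebra_measurable. Qed.

Lemma adm_measurable psi t : adm st psi -> 0 <= t -> measurable_fun setT (fun w => psi (rho t w)).
Proof.
move=> hpsi t0; apply: (@measurable_wrt_fun _ _ _ d.-measurable) => //.
apply: (adm_meas hpsi) => // [w|c]; first exact: hst.
by move=> B mB; rewrite -[_ @^-1` _]setTI; exact: hmeas.
Qed.

Let grid_cvg psi u t w s : adm st psi -> 0 <= u -> u < t ->
  gsum u t n (fun r => psi (rho r w)) s @[n --> \oo] --> oc_ind u t s * psi (rhom s w).
Proof.
move=> hpsi u0 ut; have [h|h] := boolP (u < s <= t); last first.
  rewrite /oc_ind (negbTE h) mul0r; apply: cvg_near_cst; apply: nearW => n.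
  by rewrite gsum_out// ltW.
have [r [hr cr e]] := gsum_seq h; rewrite /oc_ind h mul1r; under eq_fun do rewrite e.
exact: adm_left_seq hr cr.
Qed.

(** The process of left limits is the pointwise limit of the step processes sampled at left end
    points, and these are jointly measurable. *)
Lemma left_joint psi u t : adm st psi -> 0 <= u -> u < t ->
  measurable_fun setT (fun wz : T * mR => oc_ind u t wz.2 * psi (rhom wz.2 wz.1)).
Proof.
move=> hpsi u0 ut; have ut' := ltW ut.
apply: (@measurable_fun_cvg _ _ _ _ (fun n (wz : T * mR) => gsum u t n (fun r => psi (rho r wz.1)) wz.2)).
  move=> n; rewrite /gsum; apply: measurable_sum => k; apply: measurable_funM.
    apply: (measurableT_comp (f := fun w => psi (rho (gpt u t n k) w))); last exact: measurable_fst.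
    by apply: adm_measurable => //; apply: le_trans u0 _; exact: gpt_ge.
  by apply: (measurableT_comp (f := oc_ind _ _ : mR -> R)); [exact: oc_ind_measurable|exact: measurable_snd].
by move=> wz _; exact: grid_cvg.
Qed.

(** The integrand is taken along left limits: this is the limit of the Riemann sums at left end
    points, which is what adding up the steps produces. *)
Definition tint psi u t w : R := \int[leb]_(s in setT) (oc_ind u t s * psi (rhom s w)).

Lemma tint_riemann psi u t w : adm st psi -> 0 <= u -> u < t ->
  \sum_(k < n.+1) (t - u) / n.+1%:R * psi (rho (gpt u t n k) w) @[n --> \oo] --> tint psi u t w.
Proof.
move=> hpsi u0 ut; have ut' := ltW ut; have [B hB] := adm_bdd hpsi.
under eq_fun do rewrite -(Rintegral_gsum _ (fun r => psi (rho r w)) ut').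
apply: (@Rintegral_bounded_supp _ _ _ leb _ _ `]u, t]%classic `|B|).
- exact: measurable_itv.
- exact: lebesgue_oc_fin.
- by move=> n; exact: gsum_measurable.
- by move=> s; exact: grid_cvg.
- move=> n s; have [h|h] := boolP (u < s <= t); last by rewrite gsum_out// normr0.
  have [r [/andP[hr _] _] ->] := gsum_in n h; apply: le_trans (ler_norm B).
  by apply: hB; apply: hst; exact: le_trans hr.
- move=> n s hs; rewrite gsum_out//; apply/negP => h; apply: hs; by rewrite /= in_itv.
Qed.

Let rgrid_cvg psi u t w s : adm st psi -> 0 <= u -> u < t ->
  gsumr u t n (fun r => psi (rho r w)) s @[n --> \oo] --> oc_ind u t s * psi (rho s w).
Proof.
move=> hpsi u0 ut; have [h|h] := boolP (u < s <= t); last first.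
  rewrite /oc_ind (negbTE h) mul0r; apply: cvg_near_cst; apply: nearW => n.
  by rewrite gsumrE gsum_out// ltW.
have s0 : 0 <= s by case/andP: h => /ltW h1 _; exact: le_trans h1.
have /choice[r hr] : forall n, exists r, [/\ s <= r, r - s <= (t - u) / n.+1%:R &
    gsumr u t n (fun r => psi (rho r w)) s = psi (rho r w)].
  move=> n; have [r [/andP[_ h1] h2] e] := gsum_in n h.
  exists (r + (t - u) / n.+1%:R); rewrite gsumrE e; split=> //.
    by rewrite -lerBlDl.
  by rewrite addrAC gerDr subr_le0 ltW.
have cr : r n @[n --> \oo] --> s.
  apply: (@squeeze_cvgr _ _ _ _ (fun=> s) (fun n => s + (t - u) / n.+1%:R)).
  - by apply: nearW => n; have [h1 h2 _] := hr n; rewrite h1/= -lerBlDl.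
  - exact: cvg_cst.
  - rewrite -[X in _ --> X]addr0; apply: cvgD; first exact: cvg_cst.
    rewrite -[X in _ --> X](mulr0 (t - u)); apply: cvgM; first exact: cvg_cst.
    exact: cvg_harmonic.
rewrite /oc_ind h mul1r (_ : (fun n => _) = fun n => psi (rho (r n) w)); last first.
  by apply/funext => n; have [_ _ ->] := hr n.
have rs n : s <= r n by have [] := hr n.
apply: (adm_cvg hpsi) => [n||c]; [|exact: hst|exact: (cadlag_right_seq (c := c) (hcad w) s0 rs cr)].
by apply: hst; exact: le_trans (rs n).
Qed.

(** Riemann sums at right end points converge to the integral of the process by right continuity,
    those at left end points to the integral of its left limits. Their difference telescopes to a
    single increment times the mesh. No count of the jumps of a path is involved. *)
Lemma tint_right psi u t w : adm st psi -> 0 <= u -> u < t ->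
  \int[leb]_(s in setT) (oc_ind u t s * psi (rho s w)) = tint psi u t w.
Proof.
move=> hpsi u0 ut; have ut' := ltW ut; have [B hB] := adm_bdd hpsi.
have c1 := tint_riemann (w := w) hpsi u0 ut.
have c2 : \int[leb]_(s in setT) gsumr u t n (fun r => psi (rho r w)) s @[n --> \oo] -->
    \int[leb]_(s in setT) (oc_ind u t s * psi (rho s w)).
  apply: (@Rintegral_bounded_supp _ _ _ leb _ _ `]u, t]%classic `|B|).
  - exact: measurable_itv.
  - exact: lebesgue_oc_fin.
  - move=> n; rewrite (_ : gsumr _ _ _ _ = gsum u t n (fun r => psi (rho (r + (t - u) / n.+1%:R) w))).
      exact: gsum_measurable.
    by apply/funext => s; exact: gsumrE.
  - by move=> s; exact: rgrid_cvg.
  - move=> n s; rewrite gsumrE; have [h|h] := boolP (u < s <= t); last by rewrite gsum_out// normr0.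
    have [r [/andP[hr _] _] ->] := gsum_in n h; apply: le_trans (ler_norm B).
    apply: hB; apply: hst; apply: addr_ge0; first exact: le_trans hr.
    by rewrite divr_ge0// subr_ge0.
  - move=> n s hs; rewrite gsumrE gsum_out//; apply/negP => h; apply: hs; by rewrite /= in_itv.
have c3 : \int[leb]_(s in setT) gsumr u t n (fun r => psi (rho r w)) s -
    \sum_(k < n.+1) (t - u) / n.+1%:R * psi (rho (gpt u t n k) w) @[n --> \oo] --> (0 : R).
  rewrite (_ : (fun n => _) = fun n => (t - u) / n.+1%:R * (psi (rho t w) - psi (rho u w))); last first.
    apply/funext => n; rewrite (_ : gsumr _ _ _ _ = gsum u t n (fun r => psi (rho (r + (t - u) / n.+1%:R) w))); last first.
      by apply/funext => s; exact: gsumrE.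
    rewrite Rintegral_gsum// -sumrB.
    transitivity (\sum_(k < n.+1) (t - u) / n.+1%:R * (psi (rho (gpt u t n k.+1) w) - psi (rho (gpt u t n k) w))).
      apply: eq_bigr => k _; rewrite mulrBr.
      by have -> : gpt u t n k + (t - u) / n.+1%:R = gpt u t n k.+1 by rewrite -(gptS u t n k) addrC subrK.
    rewrite -mulr_sumr; congr (_ * _).
    rewrite -(big_mkord predT (fun k => psi (rho (gpt u t n k.+1) w) - psi (rho (gpt u t n k) w))).
    by rewrite (telescope_sumr (fun k => psi (rho (gpt u t n k) w)))// gptn gpt0.
  rewrite -[X in _ --> X](mul0r (psi (rho t w) - psi (rho u w))); apply: cvgM; last exact: cvg_cst.
  rewrite -[X in _ --> X](mulr0 (t - u)); apply: cvgM; first exact: cvg_cst.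
  exact: cvg_harmonic.
apply/eqP; rewrite -subr_eq0; apply/eqP.
by apply: (cvg_unique _ (cvgB c2 c1) c3).
Qed.

Lemma right_measurable psi u t w : adm st psi -> 0 <= u -> u < t ->
  measurable_fun setT (fun s : mR => oc_ind u t s * psi (rho s w)).
Proof.
move=> hpsi u0 ut; apply: (@measurable_fun_cvg _ _ _ _ (fun n (s : mR) => gsumr u t n (fun r => psi (rho r w)) s)).
  move=> n; rewrite (_ : (fun s : mR => _) = gsum u t n (fun r => psi (rho (r + (t - u) / n.+1%:R) w))).
    exact: gsum_measurable.
  by apply/funext => s; exact: gsumrE.
by move=> s _; exact: rgrid_cvg.
Qed.

Lemma tint_wrt psi u t (H : set (set T)) : adm st psi -> 0 <= u -> u < t ->
  sigma_algebra setT H -> (forall r c, u <= r <= t -> measurable_wrt H (fun w => co c (rho r w))) ->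
  measurable_wrt H (tint psi u t).
Proof.
move=> hpsi u0 ut sH hH; have ut' := ltW ut.
apply: (measurable_wrt_cvg sH (X_ := fun n w => \sum_(k < n.+1) (t - u) / n.+1%:R * psi (rho (gpt u t n k) w))).
  move=> n; apply: measurable_wrt_sum => // k _; apply: measurable_wrtM => //; first exact: measurable_wrt_cst.
  have h1 := gpt_ge n k ut'; have h2 := gpt_le ut' (ltnW (ltn_ord k)).
  apply: (adm_meas hpsi) => // [w|c]; first by apply: hst; exact: le_trans h1.
  by apply: hH; rewrite h1.
by move=> w; exact: tint_riemann.
Qed.

Lemma tint_norm psi u t w B : (forall M, st M -> `|psi M| <= B) -> adm st psi -> 0 <= u -> u < t ->
  `|tint psi u t w| <= B * (t - u).
Proof.
move=> hB hpsi u0 ut; have ut' := ltW ut.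
apply: (cvgr_to_le (cvg_norm (tint_riemann (w := w) hpsi u0 ut))); apply: nearW => n.
apply: (le_trans (ler_norm_sum _ _ _)).
apply: (@le_trans _ _ (\sum_(k < n.+1) (t - u) / n.+1%:R * B)).
  apply: ler_sum => k _; rewrite normrM ger0_norm; last by rewrite divr_ge0// subr_ge0.
  apply: ler_wpM2l; first by rewrite divr_ge0// subr_ge0.
  by apply: hB; apply: hst; apply: le_trans u0 _; exact: gpt_ge.
rewrite sumr_const card_ord le_eqVlt; apply/orP; left; apply/eqP.
by rewrite -mulr_natl; field.
Qed.

Let oc_adm_integ psi a b w : adm st psi -> 0 <= a -> a < b ->
  integ leb (fun s : mR => oc_ind a b s * psi (rhom s w)).
Proof.
move=> hpsi a0 ab; have [B hB] := adm_bdd hpsi.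
apply: (@integ_bounded_supp _ _ _ leb _ `]a, b]%classic `|B|).
- exact: measurable_itv.
- exact: lebesgue_oc_fin.
- exact: (measurableT_comp (left_joint hpsi a0 ab) (measurable_pair1 w)).
- move=> s; have [h|h] := boolP (a < s <= b); last by rewrite /oc_ind (negbTE h) mul0r normr0.
  rewrite /oc_ind h mul1r; apply: le_trans (ler_norm B); apply: hB; apply: left_st.
  by case/andP: h => h1 _; exact: le_lt_trans h1.
- by move=> s h; rewrite oc_ind_out// mul0r.
Qed.

Lemma tint_split psi u t w : adm st psi -> 0 < u -> u < t ->
  tint psi 0 t w = tint psi 0 u w + tint psi u t w.
Proof.
move=> hpsi u0 ut; rewrite /tint -RintegralD//; last 2 first.
- exact: oc_adm_integ.
- by apply: oc_adm_integ => //; exact: ltW.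
apply: eq_Rintegral => s _; rewrite -mulrDl; congr (_ * _); rewrite /oc_ind.
have [su|us] := leP s u.
  by rewrite andbT /= addr0 (le_trans su (ltW ut)) andbT.
by rewrite andbF add0r /= (lt_trans u0 us).
Qed.

Lemma tint0 psi w u : tint psi u u w = 0.
Proof.
rewrite /tint; under eq_Rintegral => s _.
  rewrite /oc_ind (_ : (u < s <= u) = false); last by apply/negP => /andP[h1 h2]; have := lt_le_trans h1 h2; rewrite ltxx.
  by rewrite mul0r; over.
by rewrite /Rintegral integral0.
Qed.

End left_limit_process.

(** * Moments of the noise over one step *)

Section noise_moments.
Context {d : measure_display} {T : measurableType d} {R : realType} {p : nat}.
Variable Pr : probability T R.
Variables (W : 'I_p.+1 -> R -> T -> R) (Np : 'I_p -> R.-ker T ~> (marked R)).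
Hypothesis hnoise : noise Pr W Np.
Variables (cm u t : R).
Hypotheses (cm0 : 0 <= cm) (u0 : 0 <= u) (ut : u < t).

Local Notation F := (noise_filtration Pr W Np).
Local Notation dl := (t - u).
Local Notation B i := (incr W i u t).
Local Notation cnt j := (count Np j (jdom cm u t)).

Let sF r : sigma_algebra setT (F r). Proof. exact: noise_filtration_sigma. Qed.
Let mF r : F r `<=` measurable. Proof. exact: (noise_filtration_measurable hnoise). Qed.
Let dl0 : 0 <= dl. Proof. by rewrite subr_ge0 ltW. Qed.

Let csum n (a : R) : \sum_(i < n) a = n%:R * a.
Proof. by rewrite sumr_const card_ord mulr_natl. Qed.

Let okc : pp_ok cm `]0, cm]%classic. Proof. by split=> //; exact: measurable_itv. Qed.

Lemma jdom_after : after u (jdom cm u t). Proof. exact: (pp_cell_after u t okc). Qed.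

Lemma fine_jdom : fine (lebs (jdom cm u t)) = cm * dl.
Proof.
have e : lebs (jdom cm u t) = (lebesgue_measure `]0%R, cm]%classic * lebesgue_measure `]u, t]%classic)%E.
  exact: (product_measure1E (@lebesgue_measure R) (@lebesgue_measure R) (measurable_itv `]0, cm]) (measurable_itv `]u, t])).
rewrite e fineM ?fine_lebesgue_itv ?subr0// ?ltW//.
  by rewrite ge0_fin_numE// lebesgue_oc_fin.
by rewrite ge0_fin_numE// lebesgue_oc_fin.
Qed.

Let Fsub k : F u `<=` others Pr W Np k u. Proof. exact: noise_filtration_sub_others. Qed.

Let sqB i : sqintg Pr (B i). Proof. exact: (incr_sqintg hnoise i u0 ut). Qed.

Lemma incr_mean_zero i : mean_zero_wrt Pr (F u) (B i).
Proof.
apply: independent2_mean_zero => //; [|exact: sqintg_intg|exact: (incr_mean hnoise i u0 ut)].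
exact: (independent2_subl (@Fsub (inl i)) (incr_indep hnoise u0 ut)).
Qed.

Let incr_wrt_others i k : k != inl i -> measurable_wrt (others Pr W Np k u) (B i).
Proof.
move=> ik; apply: measurable_wrtB; first exact: others_sigma.
  apply: (measurable_wrt_sub (@source_sub_others _ _ _ _ Pr W Np k (inl i) u _)); first by rewrite eq_sym.
  move=> C mC; apply: sub_sigma_algebra; exists t, C; split=> //=.
  exact: le_trans u0 (ltW ut).
apply: (measurable_wrt_sub (@source_sub_others _ _ _ _ Pr W Np k (inl i) u _)); first by rewrite eq_sym.
by move=> C mC; apply: sub_sigma_algebra; exists u, C; split.
Qed.

(** For equal indices the variance is subtracted. For different ones the increment of [W i'] is
    measurable for [others] at source i, so it joins the factor against which the increment of [W i]
    has mean zero. *)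
Lemma incr_prod_mean_zero i i' :
  mean_zero_wrt Pr (F u) (fun w => B i w * B i' w - dl * (i == i')%:R).
Proof.
have [<-|ii] := eqVneq i i'.
  rewrite mulr1; apply: independent2_mean_zero => //.
  - apply: (independent2_subl (@Fsub (inl i))).
    apply: (independent2_subr _ (incr_indep hnoise u0 ut)).
    apply: (law_events_comp (phi := fun x => x * x - dl)).
    by apply: measurable_funB => //; exact: measurable_funM.
  - by apply: intgB; [exact: sqintgM|exact: intg_cst].
  - have i2 : intg Pr (fun w => B i w * B i w) by exact: sqintgM.
    rewrite (meanB i2 (intg_cst Pr _)) mean_cst.
    have := incr_mean2 hnoise i u0 ut; under eq_fun do rewrite expr2.
    by move=> ->; rewrite subrr.
rewrite mulr0; under eq_fun do rewrite subr0.
split=> [|Z bZ]; first exact: sqintgM.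
have iZ : intg Pr (fun w => Z w * B i' w) by apply: (bounded_intg (@mF u) bZ); exact: sqintg_intg.
have mZ : measurable_wrt (others Pr W Np (inl i) u) (fun w => Z w * B i' w).
  apply: measurable_wrtM; first exact: others_sigma.
    by have [hZ _] := bZ; exact: measurable_wrt_sub hZ.
  by apply: incr_wrt_others; apply: contra ii => /eqP[->].
have [_] := independent2_mean (incr_indep hnoise u0 ut) mZ (sqintg_intg (sqB i)) iZ.
rewrite (incr_mean hnoise i u0 ut) mulr0 => <-; congr mean; apply/funext => w; ring.
Qed.

Let sqN j : sqintg Pr (cnt j). Proof. exact: (count_sqintg hnoise j u0 jdom_after). Qed.

Let mB2 i : intg Pr (fun w => B i w ^+ 2). Proof. by case: (sqB i). Qed.

Let cross1 i j : intg Pr (fun w => B i w ^+ 2 * cnt j w) /\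
  mean Pr (fun w => B i w ^+ 2 * cnt j w) = dl * (cm * dl).
Proof.
have mB : measurable_wrt (others Pr W Np (inr j) u) (fun w => B i w ^+ 2).
  apply: (measurable_wrt_comp (phi := fun x => x ^+ 2)); first exact: exprn_measurable.
  exact: incr_wrt_others.
have [h1 h2] := independent2_mean (count_indep hnoise jdom_after) mB (sqintg_intg (sqN j)) (mB2 i).
split=> //; rewrite h2 (incr_mean2 hnoise i u0 ut) (count_mean hnoise j u0 jdom_after).
by rewrite -fine_jdom.
Qed.

Let cross2 j k : mean Pr (fun w => cnt j w * cnt k w) = (cm * dl) ^+ 2 + (cm * dl) * (j == k)%:R.
Proof.
have [<-|jk] := eqVneq j k.
  have := count_mean2 hnoise j u0 jdom_after; under eq_fun do rewrite expr2.
  by move=> ->; rewrite mulr1 -fine_jdom.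
rewrite mulr0 addr0.
have mN : measurable_wrt (others Pr W Np (inr k) u) (cnt j).
  apply: (measurable_wrt_sub (@source_sub_others _ _ _ _ Pr W Np (inr k) (inr j) u _)).
    by apply: contra jk => /eqP[->].
  move=> C mC; apply: sub_sigma_algebra; exists (jdom cm u t), (fine @^-1` C); split=> //.
    by have [] := jdom_after.
  by rewrite -[_ @^-1` _]setTI; exact: fine_measurable.
have [_ ->] := independent2_mean (count_indep hnoise jdom_after) mN (sqintg_intg (sqN k)) (sqintg_intg (sqN j)).
by rewrite !(count_mean hnoise _ u0 jdom_after) -fine_jdom expr2.
Qed.

Definition sumB2 w : R := \sum_i B i w ^+ 2.
Definition sumB4 w : R := \sum_i B i w ^+ 4.
Definition sumN w : R := \sum_j cnt j w.

Let iB2 : intg Pr sumB2. Proof. by apply: intg_sum => i _; exact: mB2. Qed.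
Let iN : intg Pr sumN. Proof. by apply: intg_sum => j _; exact: sqintg_intg. Qed.
Let iB4 : intg Pr sumB4.
Proof. by apply: intg_sum => i _; exact: (incr_intg4 hnoise i u0 ut). Qed.

Let sqsumN : sqintg Pr sumN. Proof. by apply: sqintg_sum => j _; exact: sqN. Qed.

Let iNB : intg Pr (fun w => sumN w * sumB2 w) /\
  mean Pr (fun w => sumN w * sumB2 w) = p%:R * p.+1%:R * (dl * (cm * dl)).
Proof.
have -> : (fun w => sumN w * sumB2 w) = fun w => \sum_j \sum_i B i w ^+ 2 * cnt j w.
  apply/funext => w; rewrite /sumN /sumB2 mulr_suml; apply: eq_bigr => j _.
  by rewrite mulr_sumr; apply: eq_bigr => i _; rewrite mulrC.
have ij j : intg Pr (fun w => \sum_i B i w ^+ 2 * cnt j w).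
  by apply: intg_sum => i _; have [] := cross1 i j.
split; first by apply: intg_sum => j _; exact: ij.
rewrite mean_sum; last by move=> j _; exact: ij.
rewrite (eq_bigr (fun _ => p.+1%:R * (dl * (cm * dl)))) => [|j _].
  by rewrite csum mulrA.
rewrite mean_sum; last by move=> i _; have [] := cross1 i j.
rewrite (eq_bigr (fun _ => dl * (cm * dl))) => [|i _]; last by have [_ ->] := cross1 i j.
by rewrite csum.
Qed.

(** The factorial moment: the terms linear in the step length cancel, so that two or more points in
    a step cost only its square. *)
Let mN2 : mean Pr (fun w => sumN w * (sumN w - 1)) = (p%:R * (cm * dl)) ^+ 2.
Proof.
have -> : (fun w => sumN w * (sumN w - 1)) = fun w => \sum_j \sum_k cnt j w * cnt k w - sumN w.
  apply/funext => w; rewrite mulrBr mulr1 {1}/sumN mulr_suml; congr (_ - _); apply: eq_bigr => j _.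
  by rewrite mulr_sumr.
have ijk j k : intg Pr (fun w => cnt j w * cnt k w) by exact: sqintgM.
have ij j : intg Pr (fun w => \sum_k cnt j w * cnt k w) by apply: intg_sum => k _; exact: ijk.
rewrite meanB//; last by apply: intg_sum => j _; exact: ij.
rewrite !mean_sum; last 2 first.
- by move=> j _; exact: sqintg_intg.
- by move=> j _; exact: ij.
rewrite -sumrB (eq_bigr (fun _ => p%:R * (cm * dl) ^+ 2)) => [|j _].
  by rewrite csum; ring.
rewrite mean_sum; last by move=> k _; exact: ijk.
rewrite (count_mean hnoise j u0 jdom_after) (_ : fine _ = cm * dl) ?fine_jdom//.
under eq_bigr do rewrite cross2.
rewrite big_split/= csum (bigD1 j)//= eqxx mulr1 big1; first by rewrite addr0 addrK.
move=> k kj; by rewrite eq_sym (negbTE kj) mulr0.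
Qed.

Lemma noise_remainder (eps C : R) : 0 <= eps -> 0 <= C ->
  let X w := eps * (sumB2 w + sumN w) +
    C * (sumB4 w + sumN w * sumB2 w + sumN w * (sumN w - 1)) in
  intg Pr X /\ mean Pr X <= eps * (p.+1%:R + p%:R * cm) * dl
    + C * (128 * p.+1%:R + p%:R * p.+1%:R * cm + (p%:R * cm) ^+ 2) * dl ^+ 2.
Proof.
move=> e0 C0 X.
have [i1 m1] := iNB.
have i2 : intg Pr (fun w => sumN w * (sumN w - 1)).
  by apply: sqintgM => //; apply: sqintgB => //; apply: (@sqintg_bounded _ _ _ _ _ 1) => // w; rewrite normr1.
have i3 := intgD iB4 i1; have i4 := intgD i3 i2; have i5 := intgD iB2 iN.
have i6 := intgZ eps i5; have i7 := intgZ C i4.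
split; first exact: (intgD i6 i7).
rewrite /X (meanD i6 i7) (meanZ eps i5) (meanZ C i4) (meanD iB2 iN) (meanD i3 i2) (meanD iB4 i1) m1 mN2.
have -> : mean Pr sumB2 = p.+1%:R * dl.
  rewrite mean_sum; last by move=> i _; exact: mB2.
  under eq_bigr do rewrite (incr_mean2 hnoise _ u0 ut).
  by rewrite csum.
have -> : mean Pr sumN = p%:R * (cm * dl).
  rewrite mean_sum; last by move=> j _; exact: sqintg_intg.
  rewrite (eq_bigr (fun _ => cm * dl)) => [|j _].
    by rewrite csum.
  by rewrite (count_mean hnoise j u0 jdom_after) -fine_jdom.
have h4 : mean Pr sumB4 <= p.+1%:R * (128 * dl ^+ 2).
  rewrite mean_sum; last by move=> i _; exact: (incr_intg4 hnoise i u0 ut).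
  apply: (@le_trans _ _ (\sum_(i < p.+1) 128 * dl ^+ 2)).
    by apply: ler_sum => i _; exact: (incr_mean4 hnoise i u0 ut).
  by rewrite csum.
have -> : eps * (p.+1%:R * dl + p%:R * (cm * dl)) = eps * (p.+1%:R + p%:R * cm) * dl by ring.
rewrite lerD2l -(mulrA C); apply: ler_wpM2l => //.
rewrite (_ : (_ + _ + _) * dl ^+ 2 = p.+1%:R * (128 * dl ^+ 2) + p%:R * p.+1%:R * (dl * (cm * dl)) + (p%:R * (cm * dl)) ^+ 2); last by ring.
by rewrite !lerD2r.
Qed.

End noise_moments.

(** * Square distance of two thresholded jump sizes *)

Section threshold_square.
Context {R : realType}.
Local Notation leb := (@lebesgue_measure R).
Local Notation mR := (measurableTypeR R).

Definition cut (a v x : R) : R := a * (0 < v - x)%R%:R.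

Lemma cut_measurable (a v : R) : measurable_fun setT (cut a v : mR -> R).
Proof.
rewrite /cut; apply: measurable_funM => //.
have -> : (fun x : mR => (0 < v - x)%R%:R : R) = \1_(`]-oo, v[%classic : set mR).
  apply/funext => x; rewrite indicE subr_gt0; congr (nat_of_bool _)%:R.
  by apply/idP/idP; rewrite inE/= in_itv.
by apply: measurable_indic; exact: measurable_itv.
Qed.

Let itv_integ (e : R) (i : interval R) : (leb [set` i] < +oo)%E -> integ leb (fun x : mR => e * \1_[set` i] x).
Proof. by move=> h; apply: integ_indic => //; exact: measurable_itv. Qed.

Let itv_int (e : R) (i : interval R) : (leb [set` i] < +oo)%E ->
  \int[leb]_(x in setT) (e * \1_[set` i] x) = e * fine (leb [set` i]).
Proof.
move=> h; rewrite RintegralZl//; last by have := itv_integ 1 h; under eq_fun do rewrite mul1r.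
by rewrite /Rintegral integral_indic// ?setIT//; exact: measurable_itv.
Qed.

Let lebf (b1 b2 : bool) (a b : R) : (leb [set` Interval (BSide b1 a) (BSide b2 b)] < +oo)%E.
Proof. by rewrite lebesgue_measure_itv/=; case: ifP => _ //; rewrite -EFinD ltry. Qed.

Let lebE (b1 b2 : bool) (a b : R) : a <= b -> fine (leb [set` Interval (BSide b1 a) (BSide b2 b)]) = b - a.
Proof.
rewrite lebesgue_measure_itv/= lte_fin le_eqVlt => /predU1P[->|->//].
by rewrite ltxx subrr.
Qed.

Let sq_le (y b : R) : `|y| <= b -> y ^+ 2 <= b ^+ 2.
Proof. by move=> hy; rewrite -(real_normK (num_real y)) lerXn2r// nnegrE// (le_trans _ hy). Qed.

(** Below v both jumps are present, and |a - a'|^2 <= 2 b |a - a'| leaves the product v |a - a'| <=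
    B. Between v and v' only the second is present, and it contributes at most b^2 times the length
    v' - v <= B. These two bounds are exactly what [jumpt_lip] provides. *)
Let cut_square0 (a a' v v' B b cm : R) : 0 <= v -> v <= v' -> `|a| <= b -> `|a'| <= b ->
  v * `|a - a'| <= B -> v' - v <= B ->
  \int[leb]_(x in setT) (oc_ind 0 cm x * (cut a v x - cut a' v' x) ^+ 2) <= (2 * b + b ^+ 2) * B.
Proof.
move=> v0 vv ab ab' h1 h2.
have b0 : 0 <= b := le_trans (normr_ge0 _) ab.
have q1 := sqr_ge0 (a - a'); have q2 := sqr_ge0 b.
pose g (x : mR) := (a - a') ^+ 2 * \1_(`]0, v[%classic) x + b ^+ 2 * \1_(`[v, v'[%classic) x.
have g0 x : 0 <= g x by rewrite addr_ge0// mulr_ge0.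
have ig : integ leb g := integrableD measurableT (itv_integ _ (lebf _ _ _ _)) (itv_integ _ (lebf _ _ _ _)).
have le_g x : oc_ind 0 cm x * (cut a v x - cut a' v' x) ^+ 2 <= g x.
  rewrite {1}/oc_ind; case: (boolP (0 < x <= cm)) => [/andP[x0 xc]|_]; last by rewrite mul0r.
  rewrite mul1r /cut !subr_gt0 /g !indicE.
  have [xv|vx] := ltP x v.
    rewrite (lt_le_trans xv vv) !mulr1 mem_set ?mulr1; last by rewrite /= in_itv/= x0.
    by rewrite memNset ?mulr0 ?addr0//= in_itv/= leNgt xv.
  rewrite mulr0 sub0r memNset ?mulr0 ?add0r; last by rewrite /= in_itv/= x0/= ltNge vx.
  have [xv'|vx'] := ltP x v'; last by rewrite mulr0 oppr0 expr0n/= mulr_ge0.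
  by rewrite mulr1 sqrrN mem_set ?mulr1 ?sq_le//= in_itv/= vx.
apply: (@le_trans _ _ (\int[leb]_(x in setT) g x)).
  have if1 : integ leb (fun x : mR => oc_ind 0 cm x * (cut a v x - cut a' v' x) ^+ 2).
    apply: integ_le ig _ => [|x].
      apply: measurable_funM; first exact: oc_ind_measurable.
      by apply: measurable_funX; apply: measurable_funB; exact: cut_measurable.
    by rewrite ger0_norm ?le_g// mulr_ge0 ?sqr_ge0// /oc_ind; case: (_ < _ <= _).
  by apply: (le_Rintegral measurableT if1 ig) => x _; exact: le_g.
rewrite /g RintegralD//; last 2 first.
- exact: itv_integ (lebf _ _ _ _).
- exact: itv_integ (lebf _ _ _ _).
rewrite !itv_int ?lebf// !lebE// subr0 mulrDl; apply: lerD; last exact: ler_wpM2l.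
rewrite -(real_normK (num_real (a - a'))) expr2.
have n0 := normr_ge0 (a - a').
have n1 : `|a - a'| <= 2 * b by apply: (le_trans (ler_normB _ _)); lra.
have := ler_pM n0 (mulr_ge0 v0 n0) n1 h1.
by rewrite (mulrC v) mulrA.
Qed.

Lemma cut_square (a a' v v' B b cm : R) : 0 <= v -> 0 <= v' -> `|a| <= b -> `|a'| <= b ->
  Num.min v v' * `|a - a'| <= B -> `|v - v'| <= B ->
  \int[leb]_(x in setT) (oc_ind 0 cm x * (cut a v x - cut a' v' x) ^+ 2) <= (2 * b + b ^+ 2) * B.
Proof.
move=> v0 v0' ab ab'; have [vv|vv] := leP v v' => h1 h2.
  by apply: cut_square0 => //; apply: le_trans h2; rewrite distrC ler_norm.
rewrite (_ : (fun x => _) = fun x => oc_ind 0 cm x * (cut a' v' x - cut a v x) ^+ 2); last first.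
  by apply/funext => x; rewrite -sqrrN opprB.
apply: cut_square0 => //; [exact: ltW|by rewrite distrC|].
by apply: le_trans h2; exact: ler_norm.
Qed.

End threshold_square.

(** * One step of the equation *)

Section one_step.
Context {d : measure_display} {T : measurableType d} {R : realType} {K N p : nat}.
Local Open Scope sesquilinear_scope.

Let sub_cancel (k a b : R) : b = a -> k - b + a = k. Proof. by move=> ->; rewrite subrK. Qed.
Let sub4 (a b a' b' x y x' y' g : R) : a - b = x + g * y -> a' - b' = x' + g * y' ->
  a - a' - (b - b') = x - x' + g * (y - y').
Proof. move=> h1 h2; rewrite mulrBr; lra. Qed.
Let split_ind (o a b c g h : R) : o * a = o * (a - g * b) + g * (o * (1 * b - 0 * h)).
Proof. by ring. Qed.

Variable Pr : probability T R.
Variables (W : 'I_p.+1 -> R -> T -> R) (Np : 'I_p -> R.-ker T ~> (marked R)).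
Hypothesis hnoise : noise Pr W Np.
Variables (X : 'I_N.+1 -> 'cV[R[i]]_N.+1) (L : 'I_N.+1 -> 'M[R[i]]_K.+1)
  (P : 'I_p.+1 -> 'M[R[i]]_N.+1).
Hypotheses (Psa : forall i, (P i) ^t* = P i) (Pid : forall i, P i *m P i = P i).
Local Notation op := 'M[R[i]]_K.+1.
Local Notation pc := (pcoef X P).
Local Notation nice := (nice X L P).
Local Notation rate := (rate X L P).
Local Notation jumpt := (jumpt X L P).
Local Notation leb := (@lebesgue_measure R).
Local Notation mR := (measurableTypeR R).
Local Notation F := (noise_filtration Pr W Np).
Variable rho : R -> T -> op.
Hypotheses (hcad : forall w, cadlag (rho ^~ w)) (hst : forall t w, 0 <= t -> nice (rho t w))
  (hadap : forall t c, 0 <= t -> measurable_wrt (F t) (fun w => co c (rho t w))).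
Variable cm : R.
Hypotheses (cm0 : 0 <= cm) (hcm : forall j M, cube M -> rate j M <= cm).
Variables (u t : R).
Hypotheses (u0 : 0 <= u) (ut : u < t).
Local Notation rhom := (rho_ rho).
Local Notation dl := (t - u).
Local Notation coord := (coord (K := K)).
Implicit Types (c : coord) (j : 'I_p) (i : 'I_p.+1) (w : T).

Let sF r : sigma_algebra setT (F r). Proof. exact: noise_filtration_sigma. Qed.
Let mF r : F r `<=` measurable. Proof. exact: (noise_filtration_measurable hnoise). Qed.
Let leF r r' : r <= r' -> F r `<=` F r'. Proof. exact: noise_filtration_le. Qed.
Let ncube (M : op) : nice M -> cube M. Proof. exact: nice_cube. Qed.
Let hmeas s c : 0 <= s -> measurable_fun setT (fun w => co c (rho s w)).
Proof. by move=> s0; exact: measurable_wrt_fun (@mF s) (hadap c s0). Qed.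
Let nlim (M_ : nat -> op) M : (forall n, nice (M_ n)) ->
  (forall c, co c (M_ n) @[n --> \oo] --> co c M) -> nice M.
Proof. exact: nice_lim. Qed.
Let hl s w : 0 < s -> nice (rhom s w).
Proof. exact: (left_st hcad hst nlim). Qed.
Let hu w : nice (rho u w). Proof. exact: hst. Qed.
Let apol psi : pol psi -> adm nice psi. Proof. exact: adm_pol. Qed.

Let ll s : u < s <= t -> 0 < s.
Proof. by case/andP => h _; exact: le_lt_trans h. Qed.

Definition left_size j c s w : R := co c (jumpt j (rhom s w)).
Definition left_rate j s w : R := rate j (rhom s w).
Definition frozen_size j c (s : R) w : R := co c (jumpt j (rho u w)).
Definition frozen_rate j (s : R) w : R := rate j (rho u w).

Let ratec j M_ M : (forall c, co c (M_ n) @[n --> \oo] --> co c M) -> rate j (M_ n) @[n --> \oo] --> rate j M.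
Proof. by move=> h; exact: (pol_cvg (rate_pol X L P j) h). Qed.

Lemma thr_left j c a b : 0 <= a -> threshold Pr W Np a b (fun r w => co c (jumpt j (rho r w)))
  (fun r w => rate j (rho r w)) (left_size j c) (left_rate j) 2.
Proof.
move=> a0; have rr' r : a <= r <= b -> 0 <= r by case/andP => h _; exact: le_trans h.
have ll' s : a < s <= b -> 0 < s by case/andP => h _; exact: le_lt_trans h.
split.
- by move=> r /rr' r0; apply: jumpt_wrt => // c'; exact: hadap.
- by move=> r /rr' r0; apply: (pol_meas (rate_pol X L P j)) => // c'; exact: hadap.
- by move=> r w /rr' r0; apply: jumpt_le; exact: hst.
- by move=> s w /ll' s0; apply: jumpt_le; exact: hl.
- move=> s w _ r_ hr cr; apply: ratec => c'; exact: (left_seq (w := w) (c := c') hcad a0 hr cr).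
- move=> s w _ v0 r_ hr cr; apply: jumpt_cvg; last exact: lt0r_neq0.
  by move=> c'; exact: (left_seq (w := w) (c := c') hcad a0 hr cr).
Qed.

Lemma thr_frozen j c : threshold Pr W Np u t (frozen_size j c) (frozen_rate j) (frozen_size j c) (frozen_rate j) 2.
Proof.
split.
- move=> r /andP[ur _]; apply: (measurable_wrt_sub (leF ur)).
  by apply: jumpt_wrt => // c'; exact: hadap.
- move=> r /andP[ur _]; apply: (measurable_wrt_sub (leF ur)).
  by apply: (pol_meas (rate_pol X L P j)) => // c'; exact: hadap.
- by move=> r w _; apply: jumpt_le; exact: hu.
- by move=> r w _; apply: jumpt_le; exact: hu.
- by move=> s w _ r_ _ _; exact: cvg_cst.
- by move=> s w _ _ r_ _ _; exact: cvg_cst.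
Qed.

Lemma thr_one j : threshold Pr W Np u t (fun _ _ => 1) (frozen_rate j) (fun _ _ => 1) (frozen_rate j) 2.
Proof.
split.
- by move=> r _; exact: measurable_wrt_cst.
- by have [] := thr_frozen j (false, ord0, ord0).
- by move=> r w _; rewrite normr1 ler1n.
- by move=> r w _; rewrite normr1 ler1n.
- by move=> s w _ r_ _ _; exact: cvg_cst.
- by move=> s w _ _ r_ _ _; exact: cvg_cst.
Qed.

(** Lets [threshold_good], which is about a difference, be applied to a single threshold. *)
Lemma thr_zero a b : threshold Pr W Np a b (fun _ _ => 0) (fun _ _ => 0) (fun _ _ => 0) (fun _ _ => 0) 2.
Proof.
split.
- by move=> r _; exact: measurable_wrt_cst.
- by move=> r _; exact: measurable_wrt_cst.
- by move=> r w _; rewrite normr0.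
- by move=> r w _; rewrite normr0.
- by move=> s w _ r_ _ _; exact: cvg_cst.
- by move=> s w _ _ r_ _ _; exact: cvg_cst.
Qed.

Local Notation D := (jdom cm u t).

Definition jump_gap_integrand j c w (z : marked R) : R :=
  \1_D z * (thr_proc (left_size j c) (left_rate j) w z - thr_proc (frozen_size j c) (frozen_rate j) w z).
Definition frozen_jump_ind j w (z : marked R) : R :=
  \1_D z * (thr_proc (fun _ _ => 1) (frozen_rate j) w z - thr_proc (fun _ _ => 0) (fun _ _ => 0) w z).

Definition jump_gap j c := jintf Np j cm u t (jump_gap_integrand j c).
Definition frozen_count j := jintf Np j cm u t (frozen_jump_ind j).

Lemma good_jump j c : good Pr W Np j cm u t (jump_gap_integrand j c).
Proof. exact: (threshold_good hnoise j cm0 u0 ut (thr_left j c t u0) (thr_frozen j c)). Qed.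
Lemma good_one j : good Pr W Np j cm u t (frozen_jump_ind j).
Proof. exact: (threshold_good hnoise j cm0 u0 ut (thr_one j) (thr_zero u t)). Qed.

Lemma jdom_ind a b (z : marked R) : \1_(jdom cm a b) z = oc_ind 0 cm z.1 * oc_ind a b z.2 :> R.
Proof.
rewrite indicE /oc_ind; have -> : (z \in jdom cm a b) = (0 < z.1 <= cm) && (a < z.2 <= b).
  apply/idP/idP; rewrite inE.
    by move=> /pp_cellP[]; rewrite /= in_itv/= => -> [-> ->].
  by move=> /andP[h1 /andP[h2 h3]]; apply/pp_cellP; rewrite /= in_itv/=.
by case: (0 < z.1 <= cm); rewrite ?mul1r ?mul0r.
Qed.

Definition gap w (s : R) : R := oc_ind u t s * dist (rhom s w) (rho u w).
Definition gaps w : R := \int[leb]_(s in setT) gap w s.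
Definition Egap : R := mean Pr gaps.

Let gap_meas : measurable_fun setT (fun wz : T * mR => gap wz.1 wz.2).
Proof.
rewrite /gap (_ : (fun wz : T * mR => _) = fun wz : T * mR => \sum_c `|oc_ind u t wz.2 * co c (rhom wz.2 wz.1) - oc_ind u t wz.2 * co c (rho u wz.1)|).
  apply: measurable_sum => c; apply: measurableT_comp => //; apply: measurable_funB.
    exact: (left_joint hcad hst nlim hmeas (apol (pol_co c)) u0 ut).
  apply: measurable_funM.
    by apply: (measurableT_comp (f := oc_ind _ _ : mR -> R)); [exact: oc_ind_measurable|exact: measurable_snd].
  by apply: (measurableT_comp (f := fun w => co c (rho u w))); [exact: hmeas|exact: measurable_fst].
apply/funext => wz; rewrite /dist mulr_sumr; apply: eq_bigr => c _.
by rewrite -mulrBr normrM ger0_norm// /oc_ind; case: (_ < _ <= _).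
Qed.

Let gap0 w s : 0 <= gap w s.
Proof. by rewrite mulr_ge0 ?dist_ge0// /oc_ind; case: (_ < _ <= _). Qed.

Let gapB w s : `|gap w s| <= 2 * #|coord|%:R.
Proof.
rewrite (ger0_norm (gap0 w s)) /gap /oc_ind; case: (boolP (u < s <= t)) => [h|_]; last by rewrite mul0r; exact: mulr_ge0.
rewrite mul1r; apply: dist_le; apply: ncube; [exact: hl (ll h)|exact: hu].
Qed.

Let gap_out (wz : T * mR) : ~ (setT wz.1 /\ (`]u, t]%classic : set R) wz.2) -> gap wz.1 wz.2 = 0.
Proof. by move=> h; rewrite /gap oc_ind_out ?mul0r// => h2; apply: h. Qed.

Let oc_fin : (leb `]u, t]%classic < +oo)%E. Proof. exact: lebesgue_oc_fin. Qed.
Let prT : (Pr setT < +oo)%E. Proof. by rewrite probability_setT ltry. Qed.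

Lemma gap_integ w : integ leb (gap w : mR -> R).
Proof.
have mg : measurable_fun setT (gap w : mR -> R) by exact: (measurableT_comp gap_meas (measurable_pair1 w)).
apply: (@integ_bounded_supp _ _ _ leb _ `]u, t]%classic _ _ oc_fin mg (gapB w)); first exact: measurable_itv.
by move=> s hs; rewrite /gap oc_ind_out ?mul0r.
Qed.

Let gapsZ B w : B * gaps w = \int[leb]_(s in setT) (B * gap w s).
Proof. by rewrite /gaps RintegralZl//; exact: gap_integ. Qed.

Lemma gaps_intg : intg Pr gaps.
Proof.
exact: (@fubini_bounded_integ _ _ _ _ _ Pr leb (fun wz => gap wz.1 wz.2) setT `]u, t]%classic _
  gap_meas (fun wz => gapB wz.1 wz.2) measurableT (measurable_itv _) prT oc_fin gap_out).
Qed.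

Lemma gaps_ge0 w : 0 <= gaps w. Proof. by apply: Rintegral_ge0. Qed.
Lemma Egap_ge0 : 0 <= Egap. Proof. by apply: mean_ge0 => w; exact: gaps_ge0. Qed.

Lemma gap_prod : \int[(Pr \x leb)%E]_wz gap wz.1 wz.2 = Egap.
Proof.
exact: (@fubini_bounded1 _ _ _ _ _ Pr leb (fun wz => gap wz.1 wz.2) setT `]u, t]%classic _
  gap_meas (fun wz => gapB wz.1 wz.2) measurableT (measurable_itv _) prT oc_fin gap_out).
Qed.

Lemma tint_gap (psi : op -> R) B w : pol psi ->
  (forall M M', cube M -> cube M' -> `|psi M - psi M'| <= B * dist M M') ->
  `|tint rho psi u t w - dl * psi (rho u w)| <= B * gaps w.
Proof.
move=> hpsi hB; have ut' := ltW ut.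
have ig := gap_integ w.
have i1 : integ leb (fun s : mR => oc_ind u t s * psi (rhom s w)).
  have [[B1 hB1] _ _] := apol hpsi.
  apply: (@integ_bounded_supp _ _ _ leb _ `]u, t]%classic `|B1|) => //.
  - exact: (measurableT_comp (left_joint hcad hst nlim hmeas (apol hpsi) u0 ut) (measurable_pair1 w)).
  - move=> s; rewrite /oc_ind; case: (boolP (u < s <= t)) => h; last by rewrite mul0r normr0.
    by rewrite mul1r; apply: le_trans (ler_norm B1); apply: hB1; exact: hl (ll h).
  - by move=> s h; rewrite oc_ind_out// mul0r.
have i2 : integ leb (fun s : mR => psi (rho u w) * oc_ind u t s) by exact: integ_oc.
rewrite mulrC -(Rintegral_oc _ ut') /tint -(RintegralB measurableT i1 i2).
have i3 : integ leb (fun s : mR => oc_ind u t s * psi (rhom s w) - psi (rho u w) * oc_ind u t s).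
  exact: (integrableB measurableT i1 i2).
apply: (le_trans (le_normr_Rintegral measurableT i3)).
have i4 : integ leb (fun s : mR => B * gap w s) by exact: (integrableZl _ _ ig).
rewrite gapsZ.
apply: (le_Rintegral measurableT (integrable_norm i3) i4) => s _.
rewrite /= [psi (rho u w) * _]mulrC -mulrBr normrM /gap /oc_ind; case: (boolP (u < s <= t)) => h; last by rewrite normr0 !mul0r mulr0.
rewrite normr1 !mul1r; apply: hB; apply: ncube; [exact: hl (ll h)|exact: hu].
Qed.

Lemma jump_gap_mean_zero j c : mean_zero_wrt Pr (F u) (jump_gap j c).
Proof. exact: good_mz (good_jump j c). Qed.
Lemma frozen_count_mean_zero j : mean_zero_wrt Pr (F u) (frozen_count j).
Proof. exact: good_mz (good_one j). Qed.
Lemma jump_gap_sqintg j c : sqintg Pr (jump_gap j c).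
Proof. exact: (good_sqintg hnoise u0 (good_jump j c)). Qed.

Let lip B := forall j c M M', nice M -> nice M' ->
  Num.min (rate j M) (rate j M') * `|co c (jumpt j M) - co c (jumpt j M')| <= B * dist M M' /\
  `|rate j M - rate j M'| <= B * dist M M'.

Let sq_norm (x b : R) : `|x| <= b -> `|x ^+ 2| <= b ^+ 2.
Proof. by move=> h; rewrite normrX lerXn2r// nnegrE (le_trans _ h). Qed.

Let inner B j c w s : 0 <= B -> lip B ->
  \int[leb]_(x in setT) (jump_gap_integrand j c w (x, s) ^+ 2) <= (8 * B) * gap w s.
Proof.
move=> B0 hB; rewrite /jump_gap_integrand; under eq_Rintegral do rewrite jdom_ind /=.
rewrite /gap /oc_ind; case: (boolP (u < s <= t)) => [h|_]; last first.
  under eq_Rintegral do rewrite mulr0 mul0r expr0n/=.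
  by rewrite mul0r mulr0 /Rintegral integral0.
have hls := hl w (ll h).
(* The constant of [cut_square] for jump coordinates bounded by b = 2. *)
have e8 : 2 * 2 + 2 ^+ 2 = 8 :> R by ring.
have [h1 h2] := hB j c _ _ hls (hu w).
have r1 : 0 <= rate j (rhom s w) by have [_ /(_ j)[]] := hls.
have r2 : 0 <= rate j (rho u w) by have [_ /(_ j)[]] := hu w.
have b1 := jumpt_le j c hls; have b2 := jumpt_le j c (hu w).
have := cut_square cm r1 r2 b1 b2 h1 h2; rewrite e8 mul1r mulrA.
apply: le_trans; rewrite le_eqVlt; apply/orP; left; apply/eqP.
apply: eq_Rintegral => x _; rewrite mulr1 exprMn; congr (_ * _).
by rewrite /oc_ind; case: (0 < x <= cm); rewrite ?expr1n ?expr0n.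
Qed.

(** By [good_le] the variance is at most a triple integral; [inner] bounds the integral over the
    marks at each time, and Fubini does the rest. *)
Lemma jump_gap_le B j c : 0 <= B -> lip B -> mean Pr (fun w => jump_gap j c w ^+ 2) <= 8 * B * Egap.
Proof.
move=> B0 hB; apply: (le_trans (good_le (good_jump j c))).
have [mH H0 [b Hb] _ _ _] := good_jump j c.
have mH2 : measurable_fun setT (fun wz : T * marked R => jump_gap_integrand j c wz.1 wz.2 ^+ 2) by exact: measurable_funX.
have mHw w : measurable_fun setT (fun z : marked R => jump_gap_integrand j c w z ^+ 2).
  exact: (measurableT_comp mH2 (measurable_pair1 w)).
have mD : measurable D by apply: pp_cell_measurable; exact: measurable_itv.
have fD : (lebs D < +oo)%E by have [] := jdom_after cm u t.
have off w z : ~ D z -> jump_gap_integrand j c w z ^+ 2 = 0 by move=> nz; rewrite H0// expr0n.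
have fu : forall wz : T * marked R, ~ (setT wz.1 /\ D wz.2) -> jump_gap_integrand j c wz.1 wz.2 ^+ 2 = 0.
  by move=> wz h; apply: off => h2; apply: h.
have bd : forall wz : T * marked R, `|jump_gap_integrand j c wz.1 wz.2 ^+ 2| <= b ^+ 2 by move=> wz; exact: sq_norm.
have fc : (leb `]0%R, cm]%classic < +oo)%E by exact: lebesgue_oc_fin.
rewrite (@fubini_bounded1 _ _ _ _ _ Pr (@lebs R) _ setT D _ mH2 bd measurableT mD prT fD fu).
have i1 := @fubini_bounded_integ _ _ _ _ _ Pr (@lebs R) _ setT D _ mH2 bd measurableT mD prT fD fu.
rewrite /Egap -(meanZ _ gaps_intg); apply: (le_mean i1 (intgZ _ gaps_intg)) => w.
have bw : forall z : mR * mR, `|jump_gap_integrand j c w z ^+ 2| <= b ^+ 2 by move=> z; exact: sq_norm.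
have fw : forall z : mR * mR, ~ ((`]0, cm]%classic : set R) z.1 /\ (`]u, t]%classic : set R) z.2) -> jump_gap_integrand j c w z ^+ 2 = 0.
  by move=> z nz; apply: off => hz; apply: nz; case/pp_cellP: hz => h1 [h2 h3]; split=> //; rewrite /= in_itv/= h2.
have mI1 : measurable (`]0, cm]%classic : set mR) by exact: measurable_itv.
have mI2 : measurable (`]u, t]%classic : set mR) by exact: measurable_itv.
rewrite (@fubini_bounded2 _ _ _ _ _ leb leb _ `]0, cm]%classic `]u, t]%classic _ (mHw w) bw mI1 mI2 fc oc_fin fw).
have i2 := @fubini_bounded_integ2 _ _ _ _ _ leb leb _ `]0, cm]%classic `]u, t]%classic _ (mHw w) bw mI1 mI2 fc oc_fin fw.
rewrite gapsZ.
apply: (le_Rintegral measurableT i2) => [|s _]; last exact: inner.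
exact: (integrableZl _ _ (gap_integ w)).
Qed.

Let gap_sqn (G : T * mR -> R) B : measurable_fun setT G -> (forall wz, G wz ^+ 2 <= B * gap wz.1 wz.2) ->
  (sqn (Pr \x leb)%E G <= (B * Egap)%:E)%E.
Proof.
move=> mG hG; have i0 : integ (Pr \x leb)%E (fun wz => gap wz.1 wz.2).
  exact: (@integ_bounded_prod _ _ _ _ _ Pr leb (fun wz => gap wz.1 wz.2) setT `]u, t]%classic _
    gap_meas (fun wz => gapB wz.1 wz.2) measurableT (measurable_itv _) prT oc_fin gap_out).
have i1 : integ (Pr \x leb)%E (fun wz => B * gap wz.1 wz.2) by exact: (integrableZl _ _ i0).
have -> : (B * Egap)%:E = (\int[(Pr \x leb)%E]_wz (B * gap wz.1 wz.2)%:E)%E.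
  rewrite -gap_prod -RintegralZl//.
  by rewrite /Rintegral fineK//; exact: integrable_fin_num.
apply: ge0_le_integral => //.
- by move=> wz _; rewrite lee_fin sqr_ge0.
- by apply/measurable_EFinP; exact: measurable_funX.
- by case/integrableP: i1.
- by move=> wz _; rewrite lee_fin.
Qed.

Definition hc i c (M : op) : R := co c (coefh L pc i M).

Let hc_pol i c : pol (hc i c). Proof. exact: mpol_co (coefh_mpol _ _ _). Qed.

Lemma op_ito_co B0 (H : R -> T -> op) r (Y : T -> op) c :
  is_op_ito_integral Pr F B0 H r Y ->
  is_ito_integral Pr F B0 (fun s w => co c (H s w)) r (fun w => co c (Y w)).
Proof.
case: c => [[[] a] b] /(_ a b)[h1 h2].
  have -> : (fun w => co (true, a, b) (Y w)) = (fun w => complex.Im (Y w a b)) by apply/funext => w; rewrite coIm.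
  by have -> : (fun s w => co (true, a, b) (H s w)) = (fun s w => complex.Im (H s w a b)) by apply/funext => s; apply/funext => w; rewrite coIm.
have -> : (fun w => co (false, a, b) (Y w)) = (fun w => complex.Re (Y w a b)) by apply/funext => w; rewrite coRe.
by have -> : (fun s w => co (false, a, b) (H s w)) = (fun s w => complex.Re (H s w a b)) by apply/funext => s; apply/funext => w; rewrite coRe.
Qed.

Section ito_part.
Variables (i : 'I_p.+1) (Yt Yu : T -> op).
Hypotheses (hYt : is_op_ito_integral Pr F (W i) (fun s w => coefh L pc i (rhom s w)) t Yt)
  (hYu : is_op_ito_integral Pr F (W i) (fun s w => coefh L pc i (rhom s w)) u Yu).

Definition ito_gap c w : R := co c (Yt w) - co c (Yu w) - hc i c (rho u w) * incr W i u t w.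

Lemma ito_gap_ok c B : (forall M M', cube M -> cube M' -> `|hc i c M - hc i c M'| <= B * dist M M') ->
  [/\ mean_zero_wrt Pr (F u) (ito_gap c), sqintg Pr (ito_gap c) &
   mean Pr (fun w => ito_gap c w ^+ 2) <= 8 * B ^+ 2 * #|coord|%:R * Egap].
Proof.
move=> hB; have t0 : 0 < t := le_lt_trans u0 ut.
have mH := left_joint hcad hst nlim hmeas (apol (hc_pol i c)) (lexx 0) t0.
have mHu : measurable_fun setT (fun wz : T * mR => oc_ind u t wz.2 * (hc i c (rhom wz.2 wz.1) - hc i c (rho u wz.1))).
  rewrite (_ : (fun wz => _) = fun wz => oc_ind u t wz.2 * hc i c (rhom wz.2 wz.1) - oc_ind u t wz.2 * hc i c (rho u wz.1)); last first.
    by apply/funext => wz; rewrite mulrBr.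
  apply: measurable_funB; first exact: (left_joint hcad hst nlim hmeas (apol (hc_pol i c)) u0 ut).
  apply: measurable_funM.
    by apply: (measurableT_comp (f := oc_ind _ _ : mR -> R)); [exact: oc_ind_measurable|exact: measurable_snd].
  apply: (measurableT_comp (f := fun w => hc i c (rho u w))); last exact: measurable_fst.
  exact: (adm_measurable hst hmeas (apol (hc_pol i c)) u0).
have bz : bounded_wrt (F u) (fun w => hc i c (rho u w)).
  split; first by apply: (pol_meas (hc_pol i c)) => // c'; exact: hadap.
  by have [b _ [h _]] := pol_lip (hc_pol i c); exists b => w; apply: h; exact: ncube.
have k0 : 0 <= 2 * #|coord|%:R :> R by exact: mulr_ge0.
have hG wz : (oc_ind u t wz.2 * (hc i c (rhom wz.2 wz.1) - hc i c (rho u wz.1))) ^+ 2 <=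
    (2 * B ^+ 2 * #|coord|%:R) * gap wz.1 wz.2.
  rewrite /gap /oc_ind; case: (boolP (u < wz.2 <= t)) => h; last by rewrite !mul0r mulr0 expr0n.
  have n1 := ncube (hl wz.1 (ll h)); have n2 := ncube (hu wz.1).
  rewrite !mul1r -(real_normK (num_real (_ - _))).
  have d0 := dist_ge0 (rhom wz.2 wz.1) (rho u wz.1).
  have := hB _ _ n1 n2 => h1; apply: (@le_trans _ _ ((B * dist (rhom wz.2 wz.1) (rho u wz.1)) ^+ 2)).
    by rewrite lerXn2r// nnegrE (le_trans _ h1).
  rewrite exprMn [X in X * dist _ _](_ : _ = B ^+ 2 * (2 * #|coord|%:R)); last by ring.
  rewrite -mulrA; apply: ler_wpM2l; first exact: sqr_ge0.
  by rewrite expr2; apply: ler_wpM2r => //; exact: dist_le.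
have hs := gap_sqn mHu hG.
have fin := le_lt_trans hs (ltry _).
have [h1 h2 h3] := ito_increment hnoise u0 ut mH (op_ito_co c hYt) (op_ito_co c hYu) bz fin.
split=> //; rewrite -lee_fin -(sqnE h2); apply: (le_trans h3).
apply: (@le_trans _ _ (4%:E * (2 * B ^+ 2 * #|coord|%:R * Egap)%:E)%E); first by apply: lee_wpmul2l.
by rewrite -EFinM lee_fin le_eqVlt; apply/orP; left; apply/eqP; ring.
Qed.

End ito_part.

Section pathwise_jumps.
Variable j : 'I_p.

Let rho_rate w : 0 <= rate j (rho u w) <= cm.
Proof. by have [h /(_ j)[-> _]] := hu w; exact: hcm. Qed.

(** With the rate frozen, the integrand is the indicator of the rectangle [E], contained in [jdom]
    because the rate is at most [cm]. Undoing the compensation leaves the number of points in [E], a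
    natural number, as the Taylor estimate requires of the number of jumps. *)
Lemma frozen_count_nat : {ae Pr, forall w, exists k : nat,
  frozen_count j w + dl * rate j (rho u w) = k%:R /\ k%:R <= count Np j D w}.
Proof.
apply: filterS (count_fin hnoise j u0 (jdom_after cm u t)) => w fN.
set v := rate j (rho u w); have /andP[v0 vc] := rho_rate w.
have mv : measurable (`]0, v[%classic : set mR) by exact: measurable_itv.
pose E : set (marked R) := pp_cell u t `]0, v[%classic.
have mE : measurable E by exact: pp_cell_measurable.
have mD : measurable D by apply: pp_cell_measurable; exact: measurable_itv.
have ED : E `<=` D.
  move=> z /pp_cellP[]; rewrite /= in_itv/= => /andP[h1 h2] h3; apply/pp_cellP; split=> //.
  by rewrite /= in_itv/= h1 (le_trans (ltW h2)).
have eH : frozen_jump_ind j w = \1_E.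
  apply/funext => z; rewrite /frozen_jump_ind jdom_ind /thr_proc mul0r subr0 mul1r subr_gt0 !indicE /frozen_rate -/v /oc_ind.
  have -> : (z \in E) = (0 < z.1 < v) && (u < z.2 <= t).
    apply/idP/idP; rewrite inE.
      by move=> /pp_cellP[]; rewrite /= in_itv/= => -> [-> ->].
    by move=> /andP[h1 /andP[h2 h3]]; apply/pp_cellP; rewrite /= in_itv/=.
  have [h|h] := ltP z.1 v; last by rewrite andbF mulr0.
  by rewrite (le_trans (ltW h) vc) !andbT mulr1; case: (0 < z.1); rewrite ?mul1r ?mul0r.
have NE : (Np j w E <= Np j w D)%E by apply: le_measure; rewrite ?inE.
have fE : (Np j w E < +oo)%E := le_lt_trans NE fN.
have [_ hP _] := hnoise; have [val _ _] := hP j.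
have [eE|[k kE]] := val w E mE; first by move: fE; rewrite eE.
exists k; split.
  rewrite /frozen_count /jintf fN /jint eH /Rintegral !integral_indic// !setIT kE.
  have e : lebs E = (v * dl)%:E.
    have -> : lebs E = (leb `]0%R, v[%classic * leb `]u, t]%classic)%E := product_measure1E leb leb mv (measurable_itv `]u, t]).
    rewrite !lebesgue_measure_itv/= !lte_fin ut -!EFinB subr0.
    by case: ltP => // v0'; rewrite mul0e (le_anti (_ : v <= 0 <= v)) ?mul0r// v0'.
  have e' : fine (lebs E) = dl * v by rewrite e /= mulrC.
  exact: (sub_cancel _ e').
rewrite /count -[k%:R]/(fine k%:R%:E) -kE; apply: fine_le => //; rewrite ge0_fin_numE//.
Qed.

Lemma co_mxintegral d' (Z : measurableType d') (m : {measure set Z -> \bar R}) (A : set Z) (G : Z -> op) c :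
  co c (mxintegral m A G) = \int[m]_(z in A) co c (G z).
Proof.
case: c => [[[] a] b]; rewrite -?coIm -?coRe mxE /=; apply: eq_Rintegral => z _; by rewrite ?coIm ?coRe.
Qed.

Let Psi c w (z : marked R) := thr_proc (left_size j c) (left_rate j) w z.

Definition thr_jump_integral c r w : R :=
  \int[Np j w]_z (\1_(jdom cm 0 r) z * Psi c w z) - \int[@lebs R]_z (\1_(jdom cm 0 r) z * Psi c w z).

(** Restricting the marks to ]0, cm] changes nothing, since the rates along the left limits are at
    most [cm]. *)
Let eJ c r w (m : {measure set (marked R) -> \bar R}) :
    \int[m]_(z in setT `*` `]0, r]) co c (jump_integrand L pc j rho w z) =
    \int[m]_z (\1_(jdom cm 0 r) z * Psi c w z).
Proof.
rewrite Rintegral_mkcond; apply: eq_Rintegral => z _; rewrite patchE.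
have -> : (z \in (setT `*` `]0, r] : set (marked R))) = (0 < z.2 <= r).
  by apply/idP/idP; [rewrite inE /= in_itv/= => -[]|move=> h; rewrite inE /= in_itv/=].
rewrite jdom_ind /oc_ind; case: (boolP (0 < z.2 <= r)) => [/andP[h _]|_]; last by rewrite mulr0 mul0r.
have vc : rate j (rhom z.2 w) <= cm by apply: hcm; exact: ncube (hl w h).
rewrite mulr1 /jump_integrand /Psi /thr_proc subr_gt0 -/(rate j (rhom z.2 w)) -/(left_rate j z.2 w).
have co0 : co c (0 : op) = 0 by rewrite -(subrr 0) coB subrr.
case: (ltP z.1 (left_rate j z.2 w)) => h2; last by rewrite andbF co0 !mulr0.
rewrite (le_trans (ltW h2) vc) !andbT mulr1; case: (0 < z.1); last by rewrite mul0r.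
by rewrite mul1r.
Qed.

Lemma co_jump_term c r w : co c (jump_term Np L pc j rho r w) = thr_jump_integral c r w.
Proof. by rewrite /jump_term coB !co_mxintegral !eJ. Qed.

Let iPsi c w a b (m : {measure set (marked R) -> \bar R}) : 0 <= a -> 0 <= b -> (m (jdom cm a b) < +oo)%E ->
  integ m (fun z => \1_(jdom cm a b) z * Psi c w z).
Proof.
move=> a0 b0 fm; have b1 : 0 < b + 1 by rewrite ltr_wpDl.
have mD r r' : measurable (jdom cm r r') by apply: pp_cell_measurable; exact: measurable_itv.
have g := threshold_good hnoise j cm0 (lexx 0) b1 (thr_left j c (b + 1) (lexx 0)) (thr_zero 0 (b + 1)).
apply: (@integ_bounded_supp _ _ _ m _ (jdom cm a b) 2) => //.
- rewrite (_ : (fun z => _) = fun z => \1_(jdom cm a b) z * (\1_(jdom cm 0 (b + 1)) z * (thr_proc (left_size j c) (left_rate j) w z - thr_proc (fun _ _ => 0) (fun _ _ => 0) w z))).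
    apply: measurable_funM; first exact: measurable_indic.
    exact: (measurableT_comp (good_meas g) (measurable_pair1 w)).
  apply/funext => z; rewrite mulrA !jdom_ind /Psi [thr_proc (fun _ _ => 0) _ _ _]/thr_proc mul0r subr0.
  congr (_ * _); rewrite /oc_ind; case: (0 < z.1 <= cm); last by rewrite !mul0r.
  rewrite !mul1r; case: (boolP (a < z.2 <= b)) => [/andP[h1 h2]|]; last by rewrite mul0r.
  by rewrite (le_lt_trans a0 h1) (le_trans h2) ?mulr1// lerDl.
- move=> z; rewrite jdom_ind /oc_ind; case: (boolP (a < z.2 <= b)) => [/andP[h _]|]; last first.
    by rewrite mulr0 mul0r normr0.
  have h3 : `|left_size j c z.2 w| <= 2 by apply: jumpt_le; apply: hl; exact: le_lt_trans h.
  rewrite mulr1 /Psi /thr_proc; case: (0 < z.1 <= cm); last by rewrite mul0r normr0.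
  by case: (0 < _ - _); rewrite mul1r ?mulr1 ?mulr0 ?normr0.
- by move=> z h; rewrite indicE memNset ?mul0r.
Qed.

Lemma jump_increment c : {ae Pr, forall w,
  co c (jump_term Np L pc j rho t w) - co c (jump_term Np L pc j rho u w) =
  jump_gap j c w + co c (jumpt j (rho u w)) * frozen_count j w}.
Proof.
apply: filterS (count_fin hnoise j (lexx 0) (jdom_after cm 0 t)) => w fN; rewrite !co_jump_term.
have t0 : 0 <= t := le_trans u0 (ltW ut).
have mD a b : measurable (jdom cm a b) by apply: pp_cell_measurable; exact: measurable_itv.
have sub a b : 0 <= a -> b <= t -> jdom cm a b `<=` jdom cm 0 t.
  move=> a0 bt z /pp_cellP[h1 [h2 h3]]; apply/pp_cellP; split=> //.
  by rewrite (le_lt_trans a0 h2) (le_trans h3).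
(* An identity between integrands, used for the point measure and for its intensity; the two results
   are then subtracted. *)
have main (m : {measure set (marked R) -> \bar R}) : (m (jdom cm 0 t) < +oo)%E ->
    \int[m]_z (\1_(jdom cm 0 t) z * Psi c w z) - \int[m]_z (\1_(jdom cm 0 u) z * Psi c w z) =
    \int[m]_z jump_gap_integrand j c w z + co c (jumpt j (rho u w)) * \int[m]_z frozen_jump_ind j w z.
  move=> fm; have fm' a b : 0 <= a -> b <= t -> (m (jdom cm a b) < +oo)%E.
    by move=> a0 bt; apply: le_lt_trans fm; apply: le_measure; rewrite ?inE//; exact: sub.
  have fD := fm' u t u0 (lexx t).
  have i0 := iPsi c w (lexx 0) t0 fm.
  have i1 := iPsi c w (lexx 0) u0 (fm' 0 u (lexx 0) (ltW ut)).
  have i2 : integ m (jump_gap_integrand j c w).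
    have [mH H0 [b Hb] _ _ _] := good_jump j c.
    exact: (integ_bounded_supp (mD u t) fD (measurableT_comp mH (measurable_pair1 w)) (Hb w) (H0 w)).
  have i3 : integ m (frozen_jump_ind j w).
    have [mH H0 [b Hb] _ _ _] := good_one j.
    exact: (integ_bounded_supp (mD u t) fD (measurableT_comp mH (measurable_pair1 w)) (Hb w) (H0 w)).
  have i4 : integ m (fun z => co c (jumpt j (rho u w)) * frozen_jump_ind j w z) by exact: (integrableZl _ _ i3).
  rewrite -RintegralB// -(RintegralZl _ _ i3)// -(RintegralD _ i2 i4)//.
  apply: eq_Rintegral => z _; rewrite -mulrBl /jump_gap_integrand /frozen_jump_ind !jdom_ind -mulrBr.
  have -> : oc_ind 0 t z.2 - oc_ind 0 u z.2 = oc_ind u t z.2 :> R.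
    rewrite /oc_ind; have [zu|uz] := leP z.2 u.
      by rewrite (le_trans zu (ltW ut)) subrr.
    by rewrite (le_lt_trans u0 uz) andbF subr0.
  by rewrite /thr_proc /Psi /thr_proc /frozen_size; exact: split_ind.
have fl : (@lebs R (jdom cm 0 t) < +oo)%E by have [] := jdom_after cm 0 t.
have fD : (Np j w D < +oo)%E.
  by apply: le_lt_trans fN; apply: le_measure; rewrite ?inE//; exact: sub.
rewrite /thr_jump_integral /jump_gap /frozen_count /jintf fD /jint.
have h1 := main (Np j w) fN; have h2 := main (@lebs R) fl.
exact: sub4 h1 h2.
Qed.

End pathwise_jumps.

End one_step.

(** * Taylor's formula along one step of the equation *)

Section taylor_step.
Context {R : realType} {K N p : nat}.
Local Open Scope sesquilinear_scope.
Variables (X : 'I_N.+1 -> 'cV[R[i]]_N.+1) (L : 'I_N.+1 -> 'M[R[i]]_K.+1)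
  (P : 'I_p.+1 -> 'M[R[i]]_N.+1).
Variable f : opE R K -> R.
Hypothesis hf : C2c f.
Local Notation op := 'M[R[i]]_K.+1.
Local Notation pc := (pcoef X P).
Local Notation nice := (nice X L P).
Local Notation rate := (rate X L P).
Local Notation jumpt := (jumpt X L P).
Local Notation fder := (fder f).
Local Notation fhess := (fhess f).
Local Notation frem := (frem f).
Local Notation hop i := (coefh L pc i).
Local Notation coord := (coord (K := K)).
Implicit Types (c : coord) (j : 'I_p) (i : 'I_p.+1).
Variables (I0 : {set 'I_p.+1}) (QI : {set 'I_p}).

Let df x : differentiable f x. Proof. by case: hf. Qed.
Let ddf u x : differentiable (fun y => 'd f y u : R) x. Proof. by case: hf. Qed.
Let cddf u v : continuous (fun x => 'd (fun y => 'd f y u : R) x v : R). Proof. by case: hf. Qed.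
Let csf : compact (closure [set x | f x != 0]). Proof. by case: hf. Qed.

Lemma sqr_sum_in_le (J : finType) (A : {set J}) (a : J -> R) :
  (\sum_(j in A) a j) ^+ 2 <= #|J|%:R * \sum_(j in A) a j ^+ 2.
Proof.
rewrite big_mkcond; apply: (le_trans (sqr_sum_le _)).
rewrite [X in _ <= _ * X]big_mkcond/=; apply: ler_wpM2l => //; apply: ler_sum => j _.
by case: ifP => _ //; rewrite expr0n.
Qed.

Let sq_nat (n : nat) : n%:R * (n%:R - 1) = (n * n.-1)%:R :> R.
Proof. by case: n => [|n]; rewrite ?mul0r// natrM -[n.+1%:R - 1]/(_ - 1) -natr1 addrK. Qed.

Lemma nat_pred_le (m n : nat) : (m%:R : R) <= n%:R -> m%:R * (m%:R - 1) <= n%:R * (n%:R - 1) :> R.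
Proof.
by rewrite !sq_nat !ler_nat => h; apply: leq_mul => //; rewrite -!subn1 leq_sub2r.
Qed.

Let final_le (d q s1 s2 s3 s4 t2 t3 t4 : R) : 0 <= d -> 0 <= s1 -> 0 <= s2 -> 0 <= s3 -> 0 <= s4 ->
  q <= d * s1 -> t2 <= s2 -> t3 <= s3 -> t4 <= s4 -> q + t2 + t3 + t4 <= (d + 1) * (s1 + s2 + s3 + s4).
Proof.
move=> d0 h1 h2 h3 h4 hq k2 k3 k4; have : 0 <= d * (s2 + s3 + s4) by rewrite mulr_ge0 ?addr_ge0.
by rewrite !mulrDr !mulrDl; lra.
Qed.

(** The abstract estimate [rem1_step] for the diffusion directions and jumps at [x]. Indices outside
    [I0] and [QI] are given weight zero, which only decreases the right-hand side. *)
Lemma frem_step eps : 0 < eps -> exists2 C : R, 0 <= C &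
  forall (x y : op) (b : 'I_p.+1 -> R) (k : 'I_p -> nat) (e : coord -> R) , nice x ->
  (forall c, co c y - co c x = \sum_(i in I0) b i * co c (hop i x)
     + \sum_(j in QI) (k j)%:R * co c (jumpt j x) + e c) ->
  `|frem x (y - x) - 2^-1 * (\sum_(i in I0) \sum_(i' in I0) b i * b i' * fhess (hop i x) (hop i' x) x)
     - \sum_(j in QI) (k j)%:R * frem x (jumpt j x)| <=
  eps * (\sum_i b i ^+ 2 + (\sum_j k j)%N%:R) +
  C * (\sum_c e c ^+ 2 + \sum_i b i ^+ 4 + (\sum_j k j)%N%:R * (\sum_i b i ^+ 2)
     + (\sum_j k j)%N%:R * ((\sum_j k j)%N%:R - 1)).
Proof.
move=> e0.
have /choice[Bh hBh] : forall ic : 'I_p.+1 * coord, exists B : R, 0 <= B /\ forall M, cube M -> `|co ic.2 (hop ic.1 M)| <= B.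
  by move=> [i c]; have [B B0 [h _]] := pol_lip (mpol_co c (coefh_mpol L pc i)); exists B.
(* Bounds the norm of every diffusion direction and, with 2 for each coordinate by [jumpt_le], that
   of every jump. *)
pose B : R := \sum_i \sum_c Bh (i, c) + 2 * #|coord|%:R.
have S0 : 0 <= \sum_i \sum_c Bh (i, c).
  by apply: sumr_ge0 => i _; apply: sumr_ge0 => c _; have [] := hBh (i, c).
have B0 : 0 <= B by rewrite addr_ge0// mulr_ge0.
have [C C0 hC] := rem1_step (@ecoord_linear R K) (@ecoord_expand R K) df ddf cddf csf 'I_p.+1 'I_p B0 e0.
exists (C * (#|coord|%:R + 1)) => [|x y b k e nx hxy]; first by rewrite mulr_ge0// addr_ge0.
pose w i := if i \in I0 then b i else 0.
pose k' j := if j \in QI then k j else 0%N.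
have Eh (F G : op) : toE (y - x) = toE (y - x) by [].
pose q := \sum_c `|e c|.
have := hC (toE x) (fun i => toE (hop i x)) (fun j => toE (jumpt j x)) w k' (toE (y - x)) q (\sum_j k' j)%N.
have -> : 2^-1 * (\sum_i \sum_i' w i * w i' * hess f (toE (hop i x)) (toE (hop i' x)) (toE x)) =
  2^-1 * (\sum_(i in I0) \sum_(i' in I0) b i * b i' * fhess (hop i x) (hop i' x) x).
  congr (_ * _); rewrite [RHS]big_mkcond/=; apply: eq_bigr => i _; rewrite /w; case: ifP => _; last first.
    by apply: big1 => i' _; rewrite !mul0r.
  rewrite [RHS]big_mkcond/=; apply: eq_bigr => i' _; case: ifP => _ //.
  by rewrite mulr0 mul0r.
have -> : \sum_j (k' j)%:R * rem1 f (toE x) (toE (jumpt j x)) = \sum_(j in QI) (k j)%:R * frem x (jumpt j x).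
  by rewrite [RHS]big_mkcond/=; apply: eq_bigr => j _; rewrite /k'; case: ifP => _ //; rewrite mul0r.
move=> H; apply: (le_trans (H _ _ _ _)) => {H}.
- move=> i; apply: (@le_trans _ _ (\sum_i \sum_c Bh (i, c))); last by rewrite lerDl mulr_ge0.
  rewrite [leRHS](bigD1 i)//=; apply: (@le_trans _ _ (\sum_c Bh (i, c))).
    by apply: ler_sum => c _; have [_] := hBh (i, c); apply; case: nx.
  by rewrite lerDl; apply: sumr_ge0 => i' _; apply: sumr_ge0 => c _; have [] := hBh (i', c).
- move=> j; apply: (@le_trans _ _ (2 * #|coord|%:R)); last by rewrite lerDr.
  by rewrite mulr_natr -sumr_const; apply: ler_sum => c _; exact: jumpt_le.
- rewrite /q; apply: eq_bigr => c _; congr `|_|.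
  rewrite (cxD (@ecoord_linear R K)) (cxN (@ecoord_linear R K)) (cxD (@ecoord_linear R K)) !ecoord_sum -[ecoord c _]/(co c (y - x)) coB hxy.
  have -> : \sum_i w i * ecoord c (toE (hop i x)) = \sum_(i in I0) b i * co c (hop i x).
    by rewrite [RHS]big_mkcond/=; apply: eq_bigr => i _; rewrite /w; case: ifP => _ //; rewrite mul0r.
  have -> : \sum_j (k' j)%:R * ecoord c (toE (jumpt j x)) = \sum_(j in QI) (k j)%:R * co c (jumpt j x).
    by rewrite [RHS]big_mkcond/=; apply: eq_bigr => j _; rewrite /k'; case: ifP => _ //; rewrite mul0r.
  by rewrite addrC addKr.
- by [].
have kk : ((\sum_j k' j)%N%:R : R) <= (\sum_j k j)%N%:R.
  by rewrite ler_nat; apply: leq_sum => j _; rewrite /k'; case: ifP.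
have w2 : \sum_i w i ^+ 2 <= \sum_i b i ^+ 2.
  by apply: ler_sum => i _; rewrite /w; case: ifP => _ //; rewrite expr0n sqr_ge0.
have w4 : \sum_i w i ^+ 4 <= \sum_i b i ^+ 4.
  by apply: ler_sum => i _; rewrite /w; case: ifP => _ //; rewrite expr0n/= -[4%N]/(2 * 2)%N exprM sqr_ge0.
have b20 : 0 <= \sum_i b i ^+ 2 by apply: sumr_ge0 => i _; exact: sqr_ge0.
have b40 : 0 <= \sum_i b i ^+ 4 by apply: sumr_ge0 => i _; rewrite -[4%N]/(2 * 2)%N exprM sqr_ge0.
have w20 : 0 <= \sum_i w i ^+ 2 by apply: sumr_ge0 => i _; exact: sqr_ge0.
have kp := nat_pred_le kk.
have q2 : q ^+ 2 <= #|coord|%:R * \sum_c e c ^+ 2.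
  apply: (le_trans (sqr_sum_le _)); rewrite le_eqVlt; apply/orP; left; apply/eqP; congr (_ * _).
  by apply: eq_bigr => c _; rewrite real_normK ?num_real.
apply: lerD; first by apply: ler_wpM2l; [exact: ltW|exact: lerD].
rewrite -mulrA; apply: ler_wpM2l => //.
have ee : 0 <= \sum_c e c ^+ 2 by apply: sumr_ge0 => c _; exact: sqr_ge0.
have kb : (\sum_j k' j)%N%:R * (\sum_i w i ^+ 2) <= (\sum_j k j)%N%:R * (\sum_i b i ^+ 2) by exact: ler_pM.
have kn : 0 <= (\sum_j k j)%N%:R * ((\sum_j k j)%N%:R - 1) :> R by rewrite sq_nat.
have kb0 : 0 <= (\sum_j k j)%N%:R * (\sum_i b i ^+ 2) by exact: mulr_ge0.
have d0 : (0 : R) <= #|coord|%:R by [].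
exact: (final_le d0 ee b40 kb0 kn q2 w4 kb kp).
Qed.

Let sum_delta (J : finType) (A : {set J}) (G : J -> R) l : l \in A ->
  \sum_(l' in A) G l' * (l == l')%:R = G l.
Proof.
move=> lA; rewrite (bigD1 l lA)/= eqxx mulr1 big1 ?addr0// => l' /andP[_ ll].
by rewrite eq_sym (negbTE ll) mulr0.
Qed.

(** Here [Xi] and [Kj] are the deviations of the Ito and jump integrals from their frozen versions,
    [b] the Brownian increments and [Nt] the compensated frozen counts. Each is multiplied by a
    function of [x] alone, so this part has mean zero given the past of the step. *)
Definition mart_part (x : op) (dl : R) (Xi : 'I_p.+1 -> coord -> R) (Kj : 'I_p -> coord -> R)
    (b : 'I_p.+1 -> R) (Nt : 'I_p -> R) : R :=
  \sum_c fder c x * (\sum_(i in I0) (Xi i c + co c (hop i x) * b i)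
                     + \sum_(j in QI) (Kj j c + co c (jumpt j x) * Nt j))
  + 2^-1 * (\sum_(i in I0) \sum_(i' in I0) (fhess (hop i x) (hop i' x) x * (b i * b i' - dl * (i == i')%:R)))
  + \sum_(j in QI) frem x (jumpt j x) * Nt j.

Let assemble (fy D F AF MF H Hd h0 k n v Lf dl : R) :
  fy = D + F -> D = AF + MF -> H = Hd - dl * h0 -> n = k - dl * v ->
  fy - dl * (Lf + 2^-1 * h0 + v) - (MF + 2^-1 * H + n) = (AF - dl * Lf) + (F - 2^-1 * Hd - k).
Proof. by move=> -> -> -> ->; rewrite !mulrDr; field. Qed.

Let sq3 (a b c : R) : (a + b + c) ^+ 2 <= 3 * (a ^+ 2 + b ^+ 2 + c ^+ 2).
Proof.
rewrite -subr_ge0 (_ : _ - _ = (a - b) ^+ 2 + (b - c) ^+ 2 + (a - c) ^+ 2); last by ring.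
by rewrite !addr_ge0 ?sqr_ge0.
Qed.

Let step_arith (B t1 e0 C c1 c2 c3 d2 x2 k2 b4 nb nn E : R) : 0 <= C -> 0 <= c1 -> 0 <= c2 -> 0 <= c3 ->
  0 <= B -> 0 <= t1 -> 0 <= d2 -> 0 <= x2 -> 0 <= k2 -> 0 <= b4 -> 0 <= nb -> 0 <= nn ->
  E <= c1 * d2 + c2 * x2 + c3 * k2 ->
  B * t1 + (e0 + C * (E + b4 + nb + nn)) <=
  (B + C * (c1 + c2 + c3 + 1)) * t1 + e0 + (B + C * (c1 + c2 + c3 + 1)) * (d2 + x2 + k2 + b4 + nb + nn).
Proof.
move=> C0 c10 c20 c30 B0 t0 d0 x0 k0 b0 nb0 nn0 hE.
set c := c1 + c2 + c3 + 1; have h1 : E + b4 + nb + nn <= c * (d2 + x2 + k2 + b4 + nb + nn).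
  rewrite /c; have p1 : 0 <= (c2 + c3 + 1) * d2 by rewrite mulr_ge0// !addr_ge0.
  have p2 : 0 <= (c1 + c3 + 1) * x2 by rewrite mulr_ge0// !addr_ge0.
  have p3 : 0 <= (c1 + c2 + 1) * k2 by rewrite mulr_ge0// !addr_ge0.
  have p4 : 0 <= (c1 + c2 + c3) * (b4 + nb + nn) by rewrite mulr_ge0// !addr_ge0.
  rewrite !mulrDl in p1 p2 p3 p4; rewrite !mulrDr !mulrDl; rewrite !mulrDr in p4; lra.
have h2 := ler_wpM2l C0 h1.
have h3 : 0 <= C * c * t1 by rewrite mulr_ge0// mulr_ge0// /c !addr_ge0.
have h4 : 0 <= B * (d2 + x2 + k2 + b4 + nb + nn) by rewrite mulr_ge0// !addr_ge0.
by rewrite mulrDl [(B + _) * (_ + _)]mulrDl -mulrA; rewrite -mulrA in h3; lra.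
Qed.

Definition step_estimate eps BL cm C : Prop :=
  forall (x y : op) (dl : R) (Ac : coord -> R) (Xi : 'I_p.+1 -> coord -> R) (Kj : 'I_p -> coord -> R)
    (b : 'I_p.+1 -> R) (Nt : 'I_p -> R) (k : 'I_p -> nat) (n : nat),
  nice x -> 0 <= dl -> (forall j, 0 <= rate j x <= cm) -> (forall c, `|Ac c| <= BL * dl) ->
  (forall j, Nt j + dl * rate j x = (k j)%:R) -> (\sum_j k j <= n)%N ->
  (forall c, co c y - co c x = Ac c + \sum_(i in I0) (Xi i c + co c (hop i x) * b i)
     + \sum_(j in QI) (Kj j c + co c (jumpt j x) * Nt j)) ->
  `|f (toE y) - f (toE x) - dl * genR X L P f I0 QI x - mart_part x dl Xi Kj b Nt| <=
  C * (\sum_c `|Ac c - dl * co c (coefL L x)|) + eps * (\sum_i b i ^+ 2 + n%:R) +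
  C * (dl ^+ 2 + \sum_c \sum_(i in I0) Xi i c ^+ 2 + \sum_c \sum_(j in QI) Kj j c ^+ 2
       + \sum_i b i ^+ 4 + n%:R * (\sum_i b i ^+ 2) + n%:R * (n%:R - 1)).

Lemma step_bound eps BL cm : 0 < eps -> 0 <= BL -> 0 <= cm ->
  exists2 C : R, 0 <= C & step_estimate eps BL cm C.
Proof.
move=> e0 BL0 cm0; have [Bf Bf0 hBf] := fder_bounded hf; have [C C0 hC] := frem_step e0.
pose M : R := BL + p%:R * (2 * cm).
have M0 : 0 <= M by rewrite addr_ge0// !mulr_ge0.
pose c1 : R := 3 * #|coord|%:R * M ^+ 2; pose c2 : R := 3 * #|'I_p.+1|%:R; pose c3 : R := 3 * #|'I_p|%:R.
have c10 : 0 <= c1 by rewrite !mulr_ge0// sqr_ge0.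
have c20 : 0 <= c2 by rewrite mulr_ge0.
have c30 : 0 <= c3 by rewrite mulr_ge0.
exists (Bf + C * (c1 + c2 + c3 + 1)) => [|x y dl Ac Xi Kj b Nt k n nx dl0 hr hA hN kn hxy].
  by rewrite addr_ge0// mulr_ge0// !addr_ge0.
(* Everything in the increment except frozen Brownian terms and whole frozen jumps. [Nt] is
   compensated while [rem1_step] needs integer counts, so the compensator is moved here, next to the
   drift. *)
pose e c := Ac c - dl * (\sum_(j in QI) co c (jumpt j x) * rate j x) + \sum_(i in I0) Xi i c + \sum_(j in QI) Kj j c.
have hxy' c : co c y - co c x = \sum_(i in I0) b i * co c (hop i x)
     + \sum_(j in QI) (k j)%:R * co c (jumpt j x) + e c.
  rewrite hxy /e !big_split/=.
  have -> : \sum_(i in I0) co c (hop i x) * b i = \sum_(i in I0) b i * co c (hop i x).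
    by apply: eq_bigr => i _; rewrite mulrC.
  have -> : \sum_(j in QI) (k j)%:R * co c (jumpt j x) =
      \sum_(j in QI) co c (jumpt j x) * Nt j + dl * (\sum_(j in QI) co c (jumpt j x) * rate j x).
    rewrite mulr_sumr -big_split/=; apply: eq_bigr => j _; rewrite -hN; ring.
  by move: (\sum_(i in I0) _) (\sum_(i in I0) _) (\sum_(j in QI) _) (\sum_(j in QI) _) (\sum_(j in QI) _) => *; ring.
have {hC} := hC x y b k e nx hxy'.
set Fr := (X in `|X|); set S1 := \sum_i b i ^+ 2; set S4 := \sum_i b i ^+ 4; set m := (\sum_j k j)%N => hF.
have S10 : 0 <= S1 by apply: sumr_ge0 => i _; exact: sqr_ge0.
have S40 : 0 <= S4 by apply: sumr_ge0 => i _; rewrite -[4%N]/(2 * 2)%N exprM sqr_ge0.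
have mn : (m%:R : R) <= n%:R by rewrite ler_nat.
have {hF} hF : `|Fr| <= eps * (S1 + n%:R) + C * (\sum_c e c ^+ 2 + S4 + n%:R * S1 + n%:R * (n%:R - 1)).
  apply: (le_trans hF); apply: lerD.
    by apply: ler_wpM2l; [exact: ltW|rewrite lerD2l].
  apply: ler_wpM2l => //; apply: lerD; last exact: nat_pred_le.
  by rewrite lerD2l; apply: ler_wpM2r.
have -> : f (toE y) - f (toE x) - dl * genR X L P f I0 QI x - mart_part x dl Xi Kj b Nt =
    \sum_c (Ac c - dl * co c (coefL L x)) * fder c x + Fr.
  have -> : \sum_c (Ac c - dl * co c (coefL L x)) * fder c x =
      \sum_c Ac c * fder c x - dl * (\sum_c co c (coefL L x) * fder c x).
    by rewrite mulr_sumr -sumrB; apply: eq_bigr => c _; ring.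
  apply: (assemble (D := \sum_c (co c y - co c x) * fder c x)).
  - rewrite /frem /rem1 -toED [x + _]addrC subrK.
    have -> : 'd f (toE x) (toE (y - x)) = \sum_c (co c y - co c x) * fder c x.
      rewrite -[LHS]/(D1 f x (y - x)) (D1_sum f); by apply: eq_bigr => c _; rewrite coB.
    by rewrite [RHS]addrC subrK.
  - rewrite -big_split/=; apply: eq_bigr => c _; rewrite hxy; ring.
  - rewrite mulr_sumr -sumrB; apply: eq_bigr => i iI.
    rewrite [X in _ = X](_ : _ = \sum_(i' in I0) (b i * b i' * fhess (hop i x) (hop i' x) x - dl * (fhess (hop i x) (hop i' x) x * (i == i')%:R))).
      by apply: eq_bigr => i' _; ring.
    rewrite sumrB; congr (_ - _); rewrite -mulr_sumr; congr (_ * _).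
    exact/esym/sum_delta.
  - rewrite mulr_sumr -sumrB; apply: eq_bigr => j _; rewrite -hN; ring.
apply: (le_trans (ler_normD _ _)).
have hA1 : `|\sum_c (Ac c - dl * co c (coefL L x)) * fder c x| <= Bf * \sum_c `|Ac c - dl * co c (coefL L x)|.
  apply: (le_trans (ler_norm_sum _ _ _)); rewrite mulr_sumr; apply: ler_sum => c _.
  by rewrite normrM mulrC; apply: ler_wpM2r.
apply: (le_trans (lerD hA1 hF)).
apply: step_arith => //.
- by apply: sumr_ge0.
- exact: sqr_ge0.
- by apply: sumr_ge0 => c _; apply: sumr_ge0 => i _; exact: sqr_ge0.
- by apply: sumr_ge0 => c _; apply: sumr_ge0 => i _; exact: sqr_ge0.
- by apply: mulr_ge0.
- by rewrite sq_nat.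
rewrite /c1 /c2 /c3; apply: (@le_trans _ _ (\sum_c (3 * (M ^+ 2 * dl ^+ 2) + 3 * #|'I_p.+1|%:R * (\sum_(i in I0) Xi i c ^+ 2) + 3 * #|'I_p|%:R * (\sum_(j in QI) Kj j c ^+ 2)))); last first.
  rewrite !big_split/= -!mulr_sumr sumr_const -mulr_natl !lerD2r le_eqVlt; apply/orP; left; apply/eqP; ring.
apply: ler_sum => c _; apply: (le_trans (sq3 _ _ _)); rewrite !mulrDr.
apply: lerD; last by rewrite -mulrA; apply: ler_wpM2l => //; exact: sqr_sum_in_le.
apply: lerD; last by rewrite -mulrA; apply: ler_wpM2l => //; exact: sqr_sum_in_le.
apply: ler_wpM2l => //; rewrite -exprMn -real_normK ?num_real// lerXn2r ?nnegrE ?mulr_ge0//.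
apply: (le_trans (ler_normB _ _)); rewrite mulrDl; apply: lerD => //.
rewrite normrM ger0_norm// mulrC; apply: ler_wpM2r => //.
apply: (le_trans (ler_norm_sum _ _ _)).
apply: (@le_trans _ _ (\sum_(j in QI) (2 * cm))).
  apply: ler_sum => j _; rewrite normrM; have /andP[r0 rc] := hr j.
  by rewrite (ger0_norm r0); apply: ler_pM => //; exact: jumpt_le.
rewrite sumr_const -[_ *+ #|_|]mulr_natl; apply: ler_wpM2r; first by rewrite mulr_ge0.
rewrite ler_nat -[leqRHS](card_ord p); exact: max_card.
Qed.

End taylor_step.

(** * The martingale property *)

Section sde_step.
Context {d : measure_display} {T : measurableType d} {R : realType} {K N p : nat}.
Local Open Scope sesquilinear_scope.
Variable Pr : probability T R.
Variables (W : 'I_p.+1 -> R -> T -> R) (Np : 'I_p -> R.-ker T ~> (marked R)).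
Hypothesis hnoise : noise Pr W Np.
Variables (X : 'I_N.+1 -> 'cV[R[i]]_N.+1) (L : 'I_N.+1 -> 'M[R[i]]_K.+1)
  (P : 'I_p.+1 -> 'M[R[i]]_N.+1).
Local Notation op := 'M[R[i]]_K.+1.
Local Notation pc := (pcoef X P).
Local Notation nice := (nice X L P).
Local Notation rate := (rate X L P).
Local Notation jumpt := (jumpt X L P).
Local Notation leb := (@lebesgue_measure R).
Local Notation mR := (measurableTypeR R).
Local Notation F := (noise_filtration Pr W Np).
Local Notation hop i := (coefh L pc i).
Variable rho : R -> T -> op.
Hypotheses (hcad : forall w, cadlag (rho ^~ w)) (hst : forall t w, 0 <= t -> nice (rho t w))
  (hadap : forall t c, 0 <= t -> measurable_wrt (F t) (fun w => co c (rho t w))).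
Variables (I0 : {set 'I_p.+1}) (QI : {set 'I_p}) (Y : 'I_p.+1 -> R -> T -> op) (rho0 : op).
Hypotheses
  (hY : forall i t, i \in I0 -> 0 <= t ->
     is_op_ito_integral Pr F (W i) (fun s w => hop i (rho_ rho s w)) t (Y i t))
  (hsde : forall t, 0 <= t -> {ae Pr, forall w,
     rho t w = rho0 + drift_term L rho t w + \sum_(i in I0) Y i t w
                + \sum_(j in QI) jump_term Np L pc j rho t w}).
Local Notation coord := (coord (K := K)).
Implicit Types (c : coord) (j : 'I_p) (i : 'I_p.+1) (w : T).

Let sF r : sigma_algebra setT (F r). Proof. exact: noise_filtration_sigma. Qed.
Let mF r : F r `<=` measurable. Proof. exact: (noise_filtration_measurable hnoise). Qed.
Let ncube (M : op) : nice M -> cube M. Proof. exact: nice_cube. Qed.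
Let hmeas s c : 0 <= s -> measurable_fun setT (fun w => co c (rho s w)).
Proof. by move=> s0; exact: measurable_wrt_fun (@mF s) (hadap c s0). Qed.
Let nlim (M_ : nat -> op) M : (forall n, nice (M_ n)) ->
  (forall c, co c (M_ n) @[n --> \oo] --> co c M) -> nice M.
Proof. exact: nice_lim. Qed.

Let Lc c (M : op) : R := co c (coefL L M).
Let Lc_pol c : pol (Lc c). Proof. exact: mpol_co (coefL_mpol _). Qed.
Let Lc_adm c : adm nice (Lc c). Proof. exact: adm_pol. Qed.

Lemma co_drift c t w : co c (drift_term L rho t w) = tint rho (Lc c) 0 t w.
Proof.
rewrite /drift_term co_mxintegral Rintegral_mkcond /tint; apply: eq_Rintegral => s _.
rewrite patchE mem_setE in_itv/= /oc_ind; case: ifP => _; first by rewrite mul1r.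
by rewrite mul0r.
Qed.

Let co_sum' (J : finType) (A : {set J}) (G : J -> op) c :
  co c (\sum_(l in A) G l) = \sum_(l in A) co c (G l).
Proof. exact: co_sum. Qed.

Let co4 c (A B C D : op) : co c (A + B + C + D) = co c A + co c B + co c C + co c D.
Proof. by rewrite !coD. Qed.

Let alg4 (a d1 d2 y1 y2 j1 j2 : R) : (a + d1 + y1 + j1) - (a + d2 + y2 + j2) = (d1 - d2) + (y1 - y2) + (j1 - j2).
Proof. by ring. Qed.

Lemma rho_increment c u t : 0 <= u -> u < t -> {ae Pr, forall w,
  co c (rho t w) - co c (rho u w) = tint rho (Lc c) u t w
   + \sum_(i in I0) (co c (Y i t w) - co c (Y i u w))
   + \sum_(j in QI) (co c (jump_term Np L pc j rho t w) - co c (jump_term Np L pc j rho u w))}.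
Proof.
move=> u0 ut; apply: filterS2 (hsde (le_trans u0 (ltW ut))) (hsde u0) => w et eu.
have -> : tint rho (Lc c) u t w = tint rho (Lc c) 0 t w - tint rho (Lc c) 0 u w.
  move: u0; rewrite le_eqVlt => /predU1P[<-|u0]; first by rewrite tint0 subr0.
  by rewrite (tint_split hcad hst nlim hmeas w (Lc_adm c) u0 ut) addrC addKr.
have e r : co c (rho0 + drift_term L rho r w + \sum_(i in I0) Y i r w + \sum_(j in QI) jump_term Np L pc j rho r w) =
    co c rho0 + tint rho (Lc c) 0 r w + \sum_(i in I0) co c (Y i r w) + \sum_(j in QI) co c (jump_term Np L pc j rho r w).
  by rewrite co4 (co_drift c r w) (co_sum' I0 (fun i => Y i r w) c) (co_sum' QI (fun j => jump_term Np L pc j rho r w) c).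
rewrite (etrans (congr1 (co c) et) (e t)) (etrans (congr1 (co c) eu) (e u)) !sumrB; exact: alg4.
Qed.

Lemma adm_bounded_wrt psi u : 0 <= u -> adm nice psi -> bounded_wrt (F u) (fun w => psi (rho u w)).
Proof.
move=> u0 hpsi; split; first by apply: (adm_meas hpsi) => // [w|c]; [exact: hst|exact: hadap].
by have [B hB] := adm_bdd hpsi; exists B => w; apply: hB; exact: hst.
Qed.

Variable f : opE R K -> R.
Hypothesis hf : C2c f.
Local Notation genF := (genR X L P f I0 QI).
Variable cm : R.
Hypotheses (cm0 : 0 <= cm) (hcm : forall j M, cube M -> rate j M <= cm).

Section interval.
Variables u t : R.
Hypotheses (u0 : 0 <= u) (ut : u < t).
Local Notation dl := (t - u).

Definition ito_err i c : T -> R := ito_gap W X L P rho u t i (Y i t) (Y i u) c.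
Definition jump_err j c : T -> R := jump_gap Np X L P rho cm u t j c.
Definition frozen_comp j : T -> R := frozen_count Np X L P rho cm u t j.
Definition mart_incr w : R :=
  mart_part X L P f I0 QI (rho u w) dl (fun i c => ito_err i c w) (fun j c => jump_err j c w)
    (fun i => incr W i u t w) (fun j => frozen_comp j w).

Let t0 : 0 <= t := le_trans u0 (ltW ut).
Let dl0 : 0 <= dl. Proof. by rewrite subr_ge0 ltW. Qed.

Let ito_err_ok i c B : i \in I0 -> (forall M M', cube M -> cube M' -> `|hc X L P i c M - hc X L P i c M'| <= B * dist M M') ->
  [/\ mean_zero_wrt Pr (F u) (ito_err i c), sqintg Pr (ito_err i c) &
   mean Pr (fun w => ito_err i c w ^+ 2) <= 8 * B ^+ 2 * #|coord|%:R * Egap Pr rho u t].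
Proof. by move=> iI; exact: (ito_gap_ok hnoise hcad hst hadap u0 ut (hY iI t0) (hY iI u0)). Qed.

Let hc_pol i c : pol (hc X L P i c). Proof. exact: mpol_co (coefh_mpol _ _ _). Qed.

Let ito_err_mean_zero i c : i \in I0 -> mean_zero_wrt Pr (F u) (ito_err i c).
Proof. by move=> iI; have [B _ [_ hB]] := pol_lip (hc_pol i c); have [] := ito_err_ok iI hB. Qed.
Lemma mart_incr_mean_zero : mean_zero_wrt Pr (F u) mart_incr.
Proof.
have bw psi : adm nice psi -> bounded_wrt (F u) (fun w => psi (rho u w)) by exact: adm_bounded_wrt.
have mz Z V : bounded_wrt (F u) Z -> mean_zero_wrt Pr (F u) V -> mean_zero_wrt Pr (F u) (fun w => Z w * V w).
  by move=> *; exact: mean_zero_wrtM.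
have jw j : bounded_wrt (F u) (fun w => frem f (rho u w) (jumpt j (rho u w))).
  split; first by apply: (frem_jump_wrt hf j (sF u)) => [w|c]; [exact: hst|exact: hadap].
  by have [B _ hB] := frem_jump_bounded X L P hf; exists B => w; apply: hB; exact: hst.
have gw j c : bounded_wrt (F u) (fun w => co c (jumpt j (rho u w))).
  split; first by apply: jumpt_wrt => // c'; exact: hadap.
  by exists 2 => w; apply: jumpt_le; exact: hst.
have Nz j : mean_zero_wrt Pr (F u) (frozen_comp j) := frozen_count_mean_zero hnoise hst hadap cm0 u0 ut j.
have hm i : mpol (fun M => hop i M) by exact: coefh_mpol.
rewrite /mart_incr /mart_part.
apply: mean_zero_wrtD => //; first apply: mean_zero_wrtD => //.
- apply: mean_zero_wrt_sum => // c _; apply: (mz); first by apply: bw; exact: fder_adm.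
  apply: mean_zero_wrtD => //.
    apply: mean_zero_wrt_sum => // i iI; apply: mean_zero_wrtD => //; first exact: ito_err_mean_zero.
    apply: (mz); last exact: (incr_mean_zero hnoise u0 ut).
    exact: (bw _ (adm_pol ncube (mpol_co c (hm i)))).
  apply: mean_zero_wrt_sum => // j _; apply: mean_zero_wrtD => //; first exact: (jump_gap_mean_zero hnoise hcad hst hadap cm0 u0 ut).
  exact: (mz).
- apply: (mz); first exact: bounded_wrt_cst.
  apply: mean_zero_wrt_sum => // i _; apply: mean_zero_wrt_sum => // i' _; apply: (mz).
    exact: (bw _ (fhess_adm X L P hf (hm i) (hm i'))).
  exact: (incr_prod_mean_zero hnoise u0 ut).
- by apply: mean_zero_wrt_sum => // j _; exact: (mz).
Qed.

Local Notation SB2 := (sumB2 W u t).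
Local Notation SB4 := (sumB4 W u t).
Local Notation SN := (sumN Np cm u t).
Local Notation gapu := (gaps rho u t).

Definition ito_err_sum w : R := \sum_c \sum_(i in I0) ito_err i c w ^+ 2.
Definition jump_err_sum w : R := \sum_c \sum_(j in QI) jump_err j c w ^+ 2.
(** The random right-hand side of [step_estimate], with the drift error already replaced by its
    bound through [gaps]. *)
Definition dominator eps BG C w : R :=
  C * (#|coord|%:R * (BG * gapu w)) + C * dl ^+ 2 + C * ito_err_sum w + C * jump_err_sum w
  + (eps * (SB2 w + SN w) + C * (SB4 w + SN w * SB2 w + SN w * (SN w - 1))).

Let dom_le (C g1 g2 e q1 q2 q3 q4 q5 q6 : R) : 0 <= C -> g1 <= g2 ->
  C * g1 + e + C * (q1 + q2 + q3 + q4 + q5 + q6) <=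
  C * g2 + C * q1 + C * q2 + C * q3 + (e + C * (q4 + q5 + q6)).
Proof. by move=> C0 /(ler_wpM2l C0) h; rewrite !mulrDr; lra. Qed.

Lemma step_ae eps BL BG C : 0 <= C -> (forall c M, nice M -> `|Lc c M| <= BL) ->
  (forall c M M', cube M -> cube M' -> `|Lc c M - Lc c M'| <= BG * dist M M') ->
  step_estimate X L P f I0 QI eps BL cm C ->
  {ae Pr, forall w, `|f (toE (rho t w)) - f (toE (rho u w)) - dl * genF (rho u w) - mart_incr w| <= dominator eps BG C w}.
Proof.
move=> C0 hBL hBG hC.
have ae1 : {ae Pr, forall w, forall j, exists k : nat, frozen_comp j w + dl * rate j (rho u w) = k%:R /\
    k%:R <= count Np j (jdom cm u t) w}.
  by apply: filter_forall => j; exact: (frozen_count_nat hnoise hst hcm u0 ut j).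
have ae2 : {ae Pr, forall w, forall c, co c (rho t w) - co c (rho u w) = tint rho (Lc c) u t w
   + \sum_(i in I0) (co c (Y i t w) - co c (Y i u w))
   + \sum_(j in QI) (co c (jump_term Np L pc j rho t w) - co c (jump_term Np L pc j rho u w))}.
  by apply: filter_forall => c; exact: rho_increment.
have ae3 : {ae Pr, forall w, forall jc : 'I_p * coord, co jc.2 (jump_term Np L pc jc.1 rho t w) - co jc.2 (jump_term Np L pc jc.1 rho u w)
    = jump_err jc.1 jc.2 w + co jc.2 (jumpt jc.1 (rho u w)) * frozen_comp jc.1 w}.
  by apply: filter_forall => -[j c]; exact: (jump_increment hnoise hcad hst hadap cm0 hcm u0 ut j c).
apply: filterS3 ae1 ae2 ae3 => w h1 h2 h3.
have /choice[k hk] := h1.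
have /choice[nj hn] : forall j, exists n : nat, count Np j (jdom cm u t) w = n%:R.
  by move=> j; exact: (count_nat hnoise j (jdom_after cm u t) w).
have eN : SN w = (\sum_j nj j)%N%:R by rewrite /sumN natr_sum; apply: eq_bigr => j _.
rewrite /dominator eN.
apply: (le_trans (hC (rho u w) (rho t w) dl (fun c => tint rho (Lc c) u t w) _ _ _ _ k (\sum_j nj j)%N _ _ _ _ _ _ _)).
- exact: hst.
- exact: dl0.
- by move=> j; have n := hst w u0; rewrite hcm ?andbT; [have [_ /(_ j)[]] := n|exact: ncube].
- by move=> c; exact: (tint_norm hcad hst nlim w (hBL c) (Lc_adm c) u0 ut).
- by move=> j; have [] := hk j.
- by apply: leq_sum => j _; rewrite -(ler_nat R) -hn; have [] := hk j.
- move=> c; rewrite h2; congr (_ + _ + _); apply: eq_bigr; last by move=> j _; exact: (h3 (j, c)).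
  by move=> i _; rewrite /ito_err /ito_gap /hc subrK.
apply: dom_le => //; rewrite mulr_natl -sumr_const; apply: ler_sum => c _.
exact: (tint_gap hnoise hcad hst hadap u0 ut w (Lc_pol c) (hBG c)).
Qed.

Let Egap' := Egap Pr rho u t.
Let M0 : R := p.+1%:R + p%:R * cm.
Let M1 : R := 128 * p.+1%:R + p%:R * p.+1%:R * cm + (p%:R * cm) ^+ 2.

Let mean_sum_le (J : finType) (A : {set J}) (G : J -> coord -> T -> R) B :
  (forall l c, l \in A -> sqintg Pr (G l c) /\ mean Pr (fun w => G l c w ^+ 2) <= B) -> 0 <= B ->
  intg Pr (fun w => \sum_c \sum_(l in A) G l c w ^+ 2) /\
  mean Pr (fun w => \sum_c \sum_(l in A) G l c w ^+ 2) <= #|coord|%:R * (#|J|%:R * B).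
Proof.
move=> h B0; have i1 c l : l \in A -> intg Pr (fun w => G l c w ^+ 2) by move=> lA; have [[]] := h l c lA.
have i2 c : intg Pr (fun w => \sum_(l in A) G l c w ^+ 2) by apply: intg_sum => l; exact: i1.
split; first by apply: intg_sum => c _; exact: i2.
rewrite mean_sum => [|c _]; last exact: i2.
rewrite mulr_natl -sumr_const; apply: ler_sum => c _; rewrite mean_sum => [|l]; last exact: i1.
rewrite big_mkcond mulr_natl -sumr_const; apply: ler_sum => l _.
by case: ifP => // lA; have [] := h l c lA.
Qed.

Lemma dominator_mean eps BG BH BJ C : 0 <= eps -> 0 <= C -> 0 <= BJ ->
  (forall i c M M', cube M -> cube M' -> `|hc X L P i c M - hc X L P i c M'| <= BH * dist M M') ->
  (forall j c M M', nice M -> nice M' ->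
    Num.min (rate j M) (rate j M') * `|co c (jumpt j M) - co c (jumpt j M')| <= BJ * dist M M' /\
    `|rate j M - rate j M'| <= BJ * dist M M') ->
  intg Pr (dominator eps BG C) /\
  mean Pr (dominator eps BG C) <= C * (#|coord|%:R * (BG * Egap')) + C * dl ^+ 2
    + C * (#|coord|%:R * (p.+1%:R * (8 * BH ^+ 2 * #|coord|%:R * Egap')))
    + C * (#|coord|%:R * (p%:R * (8 * BJ * Egap')))
    + (eps * M0 * dl + C * M1 * dl ^+ 2).
Proof.
move=> e0 C0 BJ0 hBH hBJ.
have E0 : 0 <= Egap' by exact: Egap_ge0.
have ig : intg Pr gapu := gaps_intg hnoise hcad hst hadap u0 ut.
have ig2 := intgZ BG ig; have ig3 := intgZ #|coord|%:R ig2; have ig4 := intgZ C ig3.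
have ic : intg Pr (fun=> C * dl ^+ 2) := intg_cst Pr _.
have [iX mX] : intg Pr ito_err_sum /\ mean Pr ito_err_sum <= #|coord|%:R * (p.+1%:R * (8 * BH ^+ 2 * #|coord|%:R * Egap')).
  rewrite -[in p.+1%:R](card_ord p.+1); apply: mean_sum_le => [i c iI|].
    by have [_ h1 h2] := ito_err_ok iI (hBH i c).
  exact: (mulr_ge0 (mulr_ge0 (mulr_ge0 (ler0n _ _) (sqr_ge0 _)) (ler0n _ _)) E0).
have [iK mK] : intg Pr jump_err_sum /\ mean Pr jump_err_sum <= #|coord|%:R * (p%:R * (8 * BJ * Egap')).
  rewrite -[in p%:R](card_ord p); apply: mean_sum_le => [j c _|].
    split; first exact: (jump_gap_sqintg hnoise hcad hst hadap cm0 u0 ut j c).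
    exact: (jump_gap_le hnoise hcad hst hadap cm0 u0 ut j c BJ0 hBJ).
  by apply: mulr_ge0 => //; rewrite mulr_ge0.
have iX2 := intgZ C iX; have iK2 := intgZ C iK.
have [iN mN] := noise_remainder hnoise cm0 u0 ut e0 C0.
have j1 := intgD ig4 ic; have j2 := intgD j1 iX2; have j3 := intgD j2 iK2.
split; first exact: (intgD j3 iN).
rewrite /dominator (meanD j3 iN) (meanD j2 iK2) (meanD j1 iX2) (meanD ig4 ic) (meanZ C ig3) (meanZ _ ig2) (meanZ BG ig) (meanZ C iX) (meanZ C iK) mean_cst.
apply: lerD; last exact: mN.
apply: lerD; last exact: ler_wpM2l.
by rewrite lerD2l; exact: ler_wpM2l.
Qed.

Let f_meas r : 0 <= r -> measurable_fun setT (fun w => f (toE (rho r w))).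
Proof. by move=> r0; exact: (adm_measurable hst hmeas (f_adm X L P hf) r0). Qed.

Lemma step_mean A Dom : F u A -> intg Pr Dom ->
  {ae Pr, forall w, `|f (toE (rho t w)) - f (toE (rho u w)) - dl * genF (rho u w) - mart_incr w| <= Dom w} ->
  `|mean Pr (fun w => \1_A w * (f (toE (rho t w)) - f (toE (rho u w)) - dl * genF (rho u w)))| <= mean Pr Dom.
Proof.
move=> FA iD ae; have [iM hM] := mart_incr_mean_zero.
pose Z w := f (toE (rho t w)) - f (toE (rho u w)) - dl * genF (rho u w).
have gadm : adm nice genF by exact: genR_adm.
have mg : measurable_fun setT (fun w => genF (rho u w)) by exact: (adm_measurable hst hmeas gadm u0).
have mZ : measurable_fun setT Z.
  apply: measurable_funB; first by apply: measurable_funB; exact: f_meas.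
  exact: measurable_funM.
have [Bf hBf] := adm_bdd (f_adm X L P hf); have [Bg hBg] := adm_bdd gadm.
have iZ : intg Pr Z.
  apply: (@intg_bounded _ _ _ Pr Z (Bf + Bf + dl * Bg) mZ) => w.
  apply: (le_trans (ler_normB _ _)); apply: lerD.
    by apply: (le_trans (ler_normB _ _)); apply: lerD; apply: hBf; exact: hst.
  by rewrite normrM (ger0_norm dl0); apply: ler_wpM2l => //; apply: hBg; exact: hst.
have bA : bounded_wrt (F u) (\1_A : T -> R) by exact: bounded_wrt_indic (sF u) FA.
have iAM := bounded_intg (@mF u) bA iM.
have iAZ := bounded_intg (@mF u) bA iZ.
have mA : measurable A := mF FA.
have -> : mean Pr (fun w => \1_A w * Z w) = mean Pr (fun w => \1_A w * Z w - \1_A w * mart_incr w).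
  by rewrite meanB// (hM _ bA) subr0.
have iV : intg Pr (fun w => \1_A w * Z w - \1_A w * mart_incr w) by exact: intgB.
apply: (le_trans (norm_mean iV)).
have mV := intg_meas iV; have mD := intg_meas iD.
(* [le_mean] compares pointwise, while [Dom] is a bound only almost everywhere; the minimum
   satisfies the bound everywhere and has the same mean. *)
pose V' w := Num.min `|\1_A w * Z w - \1_A w * mart_incr w| (Dom w).
have mV' : measurable_fun setT V' by apply: measurable_minr => //; exact: measurableT_comp.
have eV : {ae Pr, forall w, `|\1_A w * Z w - \1_A w * mart_incr w| = V' w}.
  apply: filterS ae => w hw; rewrite /V' min_l// -mulrBr normrM.
  rewrite indicE; case: (w \in A); first by rewrite normr1 mul1r.
  by rewrite normr0 mul0r (le_trans _ hw).
have iN := intg_norm iV.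
rewrite (mean_ae (intg_meas iN) mV' eV).
apply: le_mean => //; first exact: (intg_ae mV' iN eV).
by move=> w; rewrite /V' ge_min lexx orbT.
Qed.

End interval.

(** [C] depends on [eps] but not on the step, so the estimates can be summed over any grid; as the
    mesh tends to 0, both terms multiplied by [C] disappear from the sum. *)
Lemma one_step eps : 0 < eps -> exists2 C : R, 0 <= C & forall u t A, 0 <= u -> u < t -> F u A ->
  `|mean Pr (fun w => \1_A w * (f (toE (rho t w)) - f (toE (rho u w)) - (t - u) * genF (rho u w)))| <=
  eps * (t - u) + C * (Egap Pr rho u t + (t - u) ^+ 2).
Proof.
move=> e0.
pose M0 : R := p.+1%:R + p%:R * cm.
have M00 : 0 < M0 by rewrite ltr_pwDl// mulr_ge0.
pose M1 : R := 128 * p.+1%:R + p%:R * p.+1%:R * cm + (p%:R * cm) ^+ 2.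
have M10 : 0 <= M1 by rewrite !addr_ge0 ?sqr_ge0// !mulr_ge0.
have uni (J : finType) (G : J -> op -> R) : (forall l, pol (G l)) -> exists2 B : R, 0 <= B &
    forall l, (forall M, cube M -> `|G l M| <= B) /\
      (forall M M', cube M -> cube M' -> `|G l M - G l M'| <= B * dist M M').
  move=> hG; have /choice[B hB] : forall l, exists B : R, 0 <= B /\ ((forall M, cube M -> `|G l M| <= B) /\
      (forall M M', cube M -> cube M' -> `|G l M - G l M'| <= B * dist M M')).
    by move=> l; have [B B0 h] := pol_lip (hG l); exists B.
  have S0 : 0 <= \sum_l B l by apply: sumr_ge0 => l _; have [] := hB l.
  have le l : B l <= \sum_l B l by rewrite (bigD1 l)//= lerDl; apply: sumr_ge0 => k _; have [] := hB k.
  exists (\sum_l B l) => // l; have [_ [h1 h2]] := hB l.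
  split=> [M h|M M' h h']; first exact: le_trans (h1 _ h) (le l).
  by apply: (le_trans (h2 _ _ h h')); apply: ler_wpM2r => //; exact: dist_ge0.
have [BL BL0 hBL] := uni _ Lc Lc_pol.
have [BH BH0 hBH] := uni _ (fun ic : 'I_p.+1 * coord => hc X L P ic.1 ic.2)
  (fun ic => mpol_co ic.2 (coefh_mpol L pc ic.1)).
have [BJ BJ0 hBJ] := jumpt_lip X L P.
(* [noise_remainder] multiplies the small parameter by [M0]. *)
have eM : 0 < eps / M0 by rewrite divr_gt0.
have [C C0 hC] := step_bound X L P hf I0 QI eM BL0 cm0.
pose m : R := #|coord|%:R.
(* The coefficient of [Egap], up to the factor [C], collected from the drift, Ito and jump errors of
   [dominator_mean]. *)
pose k1 : R := m * BL + m * (p.+1%:R * (8 * BH ^+ 2 * m)) + m * (p%:R * (8 * BJ)).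
have m0 : 0 <= m by [].
have k10 : 0 <= k1.
  have h1 : 0 <= m * BL by apply: mulr_ge0.
  have h2 : 0 <= m * (p.+1%:R * (8 * BH ^+ 2 * m)) by rewrite !mulr_ge0// sqr_ge0.
  have h3 : 0 <= m * (p%:R * (8 * BJ)) by rewrite !mulr_ge0.
  by rewrite /k1 !addr_ge0.
exists (C * (k1 + 1 + M1)) => [|u t A u0 ut FA]; first exact: (mulr_ge0 C0 (addr_ge0 (addr_ge0 k10 ler01) M10)).
have hL1 c M : nice M -> `|Lc c M| <= BL by move=> /ncube h; have [h1 _] := hBL c; exact: h1.
have hL2 c M M' : cube M -> cube M' -> `|Lc c M - Lc c M'| <= BL * dist M M' by have [_ h] := hBL c; exact: h.
have hH i c M M' : cube M -> cube M' -> `|hc X L P i c M - hc X L P i c M'| <= BH * dist M M'.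
  by have [_ h] := hBH (i, c); exact: h.
have [iD mD] := dominator_mean u0 ut BL (ltW eM) C0 BJ0 hH hBJ.
apply: (le_trans (step_mean u0 ut FA iD (step_ae u0 ut C0 hL1 hL2 hC))); apply: (le_trans mD).
have E0 : 0 <= Egap Pr rho u t by exact: Egap_ge0.
have d0 : 0 <= (t - u) ^+ 2 by exact: sqr_ge0.
rewrite -/M0 -/M1 -/m divfK ?gt_eqF//.
have p1 : 0 <= C * k1 * (t - u) ^+ 2 := mulr_ge0 (mulr_ge0 C0 k10) d0.
have p2 : 0 <= C * (1 + M1) * Egap Pr rho u t := mulr_ge0 (mulr_ge0 C0 (addr_ge0 ler01 M10)) E0.
rewrite -subr_ge0 (_ : _ - _ = C * k1 * (t - u) ^+ 2 + C * (1 + M1) * Egap Pr rho u t); first exact: addr_ge0.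
by rewrite /k1; move: (Egap Pr rho u t) => E; ring.
Qed.

(** The sum of the gaps is the time integral of the distance between the left limit at x and the
    process at the grid point before x. It tends to 0 pointwise and is bounded, so dominated
    convergence applies in time and then under [Pr]. *)
Lemma gap_sum_cvg s t : 0 <= s -> s < t ->
  \sum_(k < n.+1) Egap Pr rho (gpt s t n k) (gpt s t n k.+1) @[n --> \oo] --> (0 : R).
Proof.
move=> s0 st; have st' := ltW st.
pose q : R := 2 * #|coord|%:R.
have pk n k : 0 <= gpt s t n k := le_trans s0 (gpt_ge n k st').
have lk n k : gpt s t n k < gpt s t n k.+1 by rewrite -subr_gt0 gptS divr_gt0// subr_gt0.
have ig n k w : integ leb (gap rho (gpt s t n k) (gpt s t n k.+1) w : mR -> R).
  exact: (gap_integ hnoise hcad hst hadap (pk n k) (lk n k) w).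
have igs n k : intg Pr (gaps rho (gpt s t n k) (gpt s t n k.+1)).
  exact: (gaps_intg hnoise hcad hst hadap (pk n k) (lk n k)).
pose g n w (x : R) := gsum s t n (fun r => dist (rho_ rho x w) (rho r w)) x.
pose G n w := \sum_(k < n.+1) gaps rho (gpt s t n k) (gpt s t n k.+1) w.
have eg n w : (fun x : mR => \sum_(k < n.+1) gap rho (gpt s t n k) (gpt s t n k.+1) w x) = g n w.
  by apply/funext => x; apply: eq_bigr => k _; rewrite /gap mulrC.
have igg n w : integ leb (g n w : mR -> R) /\ \int[leb]_(x in setT) g n w x = G n w.
  have [h1 h2] := Rintegral_bigsum (index_enum 'I_n.+1) (fun k : 'I_n.+1 => ig n k w).
  by rewrite -eg.
have mg n w : measurable_fun setT (g n w : mR -> R) by have [/measurable_int/measurable_EFinP] := igg n w.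
have gB n w x : `|g n w x| <= q.
  have [h|h] := boolP (s < x <= t); last by rewrite /g gsum_out// normr0 mulr_ge0.
  have [r [/andP[h1 h2] _] e] := gsum_in n h; rewrite /g e ger0_norm ?dist_ge0//.
  have r0 := le_trans s0 h1.
  apply: dist_le; apply: ncube; last exact: hst.
  by apply: (left_st hcad hst nlim); exact: le_lt_trans h2.
have g0 n w x : ~ (`]s, t]%classic : set R) x -> g n w x = 0.
  by move=> h; rewrite /g gsum_out//; apply/negP => h2; apply: h; rewrite /= in_itv.
have mI : measurable (`]s, t]%classic : set mR) by exact: measurable_itv.
have fI : (leb `]s, t]%classic < +oo)%E by exact: lebesgue_oc_fin.
have cg w x : g n w x @[n --> \oo] --> (0 : R).
  have [h|h] := boolP (s < x <= t); last first.
    by apply: cvg_near_cst; apply: nearW => n; rewrite /g gsum_out.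
  have [r [hr cr e]] := gsum_seq h; rewrite /g; under eq_fun do rewrite e.
  have h0 c : `|co c (rho_ rho x w) - co c (rho (r n) w)| @[n --> \oo] --> (0 : R).
    rewrite -(normr0 R) -(subrr (co c (rho_ rho x w))); apply: cvg_norm; apply: cvgB; first exact: cvg_cst.
    exact: (left_seq (w := w) (c := c) hcad s0 hr cr).
  by have := cvg_bigsum (V := R) (s := index_enum coord) h0; rewrite big1.
have cG w : G n w @[n --> \oo] --> (0 : R).
  rewrite (_ : (fun n => _) = fun n => \int[leb]_(x in setT) g n w x); last first.
    by apply/funext => n; have [_ ->] := igg n w.
  rewrite -[X in _ --> X](_ : \int[leb]_(x in (setT : set mR)) 0 = 0); last by rewrite /Rintegral integral0.
  exact: (@Rintegral_bounded_supp _ _ _ leb (fun n => g n w) (fun=> 0) `]s, t]%classic q mI fI (fun n => mg n w) (cg w) (fun n => gB n w) (fun n => g0 n w)).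
have GB n w : `|G n w| <= q * fine (leb `]s, t]%classic).
  have [_ <-] := igg n w.
  exact: (@Rintegral_norm_bounded_supp _ _ _ leb (g n w) `]s, t]%classic q mI fI (mg n w) (gB n w) (g0 n w)).
have iG n : intg Pr (G n) by apply: intg_sum => k _; exact: igs.
rewrite (_ : (fun n => _) = fun n => mean Pr (G n)); last first.
  by apply/funext => n; rewrite mean_sum// => k _; exact: igs.
rewrite -[X in _ --> X](mean_cst Pr 0).
apply: (@Rintegral_dominated _ _ _ Pr G (fun=> 0) (fun=> q * fine (leb `]s, t]%classic))) => //.
- by move=> n; exact: intg_meas (iG n).
- exact: intg_cst.
Qed.

Let eps0 (x a : R) : 0 <= a -> (forall eps, 0 < eps -> `|x| <= eps * a) -> x = 0.
Proof.
move=> a0 h; apply/eqP; rewrite -normr_le0; apply/ler_addgt0Pr => e e0; rewrite add0r.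
apply: (le_trans (h (e / (a + 1)) _)); first by rewrite divr_gt0// ltr_wpDl.
by rewrite -mulrA ler_piMr ?(ltW e0)// mulrC ler_pdivrMr ?mul1r ?lerDl// ltr_wpDl.
Qed.

Let sum_affine n (a b C : R) (E : nat -> R) :
  \sum_(k < n.+1) (a + C * (E k + b)) = n.+1%:R * a + C * (\sum_(k < n.+1) E k + n.+1%:R * b).
Proof.
have cs (x : R) : \sum_(k < n.+1) x = n.+1%:R * x by rewrite sumr_const card_ord mulr_natl.
by rewrite big_split/= cs -mulr_sumr big_split/= cs.
Qed.

Lemma sde_martingale s t A : 0 <= s -> s < t -> F s A ->
  mean Pr (fun w => \1_A w * (f (toE (rho t w)) - f (toE (rho s w)) - tint rho genF s t w)) = 0.
Proof.
move=> s0 st FA; have st' := ltW st; have gadm : adm nice genF by exact: genR_adm.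
have mA : measurable A := mF FA.
have pk n k : 0 <= gpt s t n k := le_trans s0 (gpt_ge n k st').
have lk n k : gpt s t n k < gpt s t n k.+1 by rewrite -subr_gt0 gptS divr_gt0// subr_gt0.
pose dn n : R := (t - s) / n.+1%:R.
pose S n w := \sum_(k < n.+1) dn n * genF (rho (gpt s t n k) w).
pose Z n k w := f (toE (rho (gpt s t n k.+1) w)) - f (toE (rho (gpt s t n k) w)) - dn n * genF (rho (gpt s t n k) w).
have [Bf hBf] := adm_bdd (f_adm X L P hf); have [Bg hBg] := adm_bdd gadm.
have mf r : 0 <= r -> measurable_fun setT (fun w => f (toE (rho r w))).
  by move=> r0; exact: (adm_measurable hst hmeas (f_adm X L P hf) r0).
have mg r : 0 <= r -> measurable_fun setT (fun w => genF (rho r w)).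
  by move=> r0; exact: (adm_measurable hst hmeas gadm r0).
have ind1 w : `|\1_A w| <= 1 :> R by rewrite indicE; case: (w \in A); rewrite ?normr1 ?normr0.
have mI : measurable_fun setT (\1_A : T -> R) by exact: measurable_indic.
have dn0 n : 0 <= dn n by rewrite divr_ge0// subr_ge0.
have iZ n k : intg Pr (fun w => \1_A w * Z n k w).
  apply: (@intg_bounded _ _ _ Pr _ (Bf + Bf + dn n * Bg)) => [|w].
    apply: measurable_funM => //; apply: measurable_funB; first by apply: measurable_funB; exact: mf.
    by apply: measurable_funM => //; exact: mg.
  rewrite normrM -[leRHS]mul1r; apply: ler_pM => //.
  apply: (le_trans (ler_normB _ _)); apply: lerD.
    by apply: (le_trans (ler_normB _ _)); apply: lerD; apply: hBf; exact: hst.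
  by rewrite normrM (ger0_norm (dn0 n)); apply: ler_wpM2l => //; apply: hBg; exact: hst.
pose V n w := \1_A w * (f (toE (rho t w)) - f (toE (rho s w)) - S n w).
have eV n : V n = fun w => \sum_(k < n.+1) \1_A w * Z n k w.
  apply/funext => w; rewrite /V -mulr_sumr; congr (_ * _); rewrite /Z sumrB; congr (_ - _).
  rewrite -(big_mkord predT (fun k => f (toE (rho (gpt s t n k.+1) w)) - f (toE (rho (gpt s t n k) w)))).
  by rewrite (telescope_sumr (fun k => f (toE (rho (gpt s t n k) w))))// gptn gpt0.
have cV : mean Pr (V n) @[n --> \oo] --> mean Pr (fun w => \1_A w * (f (toE (rho t w)) - f (toE (rho s w)) - tint rho genF s t w)).
  apply: (@Rintegral_dominated _ _ _ Pr V _ (fun=> Bf + Bf + (t - s) * Bg)).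
  - by move=> n; rewrite eV; apply: intg_meas; apply: intg_sum => k _; exact: iZ.
  - move=> w; apply: cvgM; first exact: cvg_cst.
    by apply: cvgB; [exact: cvg_cst|exact: (tint_riemann (w := w) hcad hst nlim gadm s0 st)].
  - exact: intg_cst.
  - move=> n w; rewrite /V normrM -[leRHS]mul1r; apply: ler_pM => //.
    apply: (le_trans (ler_normB _ _)); apply: lerD.
      by apply: (le_trans (ler_normB _ _)); apply: lerD; apply: hBf; apply: hst => //; exact: le_trans st'.
    apply: (le_trans (ler_norm_sum _ _ _)).
    have -> : (t - s) * Bg = \sum_(k < n.+1) dn n * Bg.
      by rewrite sumr_const card_ord -[_ *+ n.+1]mulr_natl /dn; field.
    apply: ler_sum => k _; rewrite normrM (ger0_norm (dn0 n)).
    by apply: ler_wpM2l => //; apply: hBg; exact: hst.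
(* At a fixed [eps] the mesh tends to 0 and leaves at most [eps * (t - s)]. *)
apply: (@eps0 _ (t - s)) => [|eps e0]; first by rewrite subr_ge0.
have [C C0 hC] := one_step e0.
pose B n := eps * (t - s) + C * (\sum_(k < n.+1) Egap Pr rho (gpt s t n k) (gpt s t n k.+1) + (t - s) * dn n).
have VB n : `|mean Pr (V n)| <= B n.
  rewrite eV mean_sum => [|k _]; last exact: iZ.
  apply: (le_trans (ler_norm_sum _ _ _)).
  have -> : B n = \sum_(k < n.+1) (eps * dn n + C * (Egap Pr rho (gpt s t n k) (gpt s t n k.+1) + dn n ^+ 2)).
    by rewrite (sum_affine n _ _ _ (fun k => Egap Pr rho (gpt s t n k) (gpt s t n k.+1))) /B /dn; congr (_ + C * (_ + _)); field.
  apply: ler_sum => k _.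
  (* The event belongs to the past of every grid point, so one and the same [A] serves in all the
     steps. *)
  have FAk : F (gpt s t n k) A by apply: (noise_filtration_le _) FA; exact: gpt_ge.
  by have := hC _ _ _ (pk n k) (lk n k) FAk; rewrite gptS.
have cB : B n @[n --> \oo] --> eps * (t - s).
  rewrite -[X in _ --> X]addr0; apply: cvgD; first exact: cvg_cst.
  rewrite -[X in _ --> X](mulr0 C); apply: cvgM; first exact: cvg_cst.
  rewrite -[X in _ --> X]addr0; apply: cvgD; first exact: gap_sum_cvg.
  rewrite -[X in _ --> X](mulr0 (t - s)); apply: cvgM; first exact: cvg_cst.
  rewrite -[X in _ --> X](mulr0 (t - s)); apply: cvgM; first exact: cvg_cst.
  exact: cvg_harmonic.
by apply: (ler_cvg_to (cvg_norm cV) cB); apply: nearW => n; exact: VB.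
Qed.

End sde_step.

(** * Martingales and Ito integrals at time zero *)

Section martingale_tools.
Context {d : measure_display} {T : measurableType d} {R : realType}.
Variable Pr : probability T R.

Lemma martingale_ext (F : R -> set (set T)) (M M' : R -> T -> R) :
  (forall t, 0 <= t -> M t = M' t) -> martingale Pr F M -> martingale Pr F M'.
Proof.
move=> e [h1 h2 h3]; split=> [t t0|t t0|s t s0 st]; [by rewrite -e//; exact: h1|by rewrite -e//; exact: h2|].
by rewrite -!e//; [exact: h3|exact: le_trans st].
Qed.

Lemma martingale0 (F : R -> set (set T)) : (forall t, sigma_algebra setT (F t)) ->
  martingale Pr F (fun _ _ => 0).
Proof.
by move=> sF; split=> [t _|t _|s t _ _]; [exact: measurable_wrt_cst|exact: intg_cst|split; [exact: measurable_wrt_cst|exact: intg_cst|]].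
Qed.

(** All points of a subdivision of [0, 0] coincide, so the simple integrals vanish and [Y] is an L^2
    limit of zeros. This settles the initial value, since the equation at time 0 still contains
    [Y]. *)
Lemma ito_integral_at0 (F : R -> set (set T)) (B H : R -> T -> R) (Y : T -> R) :
  is_ito_integral Pr F B H 0 Y -> {ae Pr, forall w, Y w = 0}.
Proof.
move=> [mY [m [tau [xi [sp _ cY]]]]].
have e0 n : simple_integral B (m n) (tau n) (xi n) = fun=> 0.
  apply/funext => w; rewrite /simple_integral; apply: big1 => k _.
  have [h1 h2 h3 _ _] := sp n.
  have mono a b : (a <= b <= m n)%N -> tau n a <= tau n b.
    elim: b => [|b ih] /andP[ab bm]; first by move: ab; rewrite leqn0 => /eqP ->.
    move: ab; rewrite leq_eqVlt => /predU1P[-> //|ab].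
    by apply: le_trans (h3 _ bm); apply: ih; rewrite -ltnS ab ltnW.
  have t0 a : (a <= m n)%N -> tau n a = 0.
    move=> am; have k1 := mono 0%N a; have k2 := mono a (m n); rewrite h1 in k1; rewrite h2 in k2.
    by apply/eqP; rewrite eq_le k1 ?k2// am leqnn.
  by rewrite !t0 ?subrr ?mulr0// ltnW.
have i0 : (\int[Pr]_w `|((Y w) ^+ 2)%:E| = 0)%E.
  have -> : (\int[Pr]_w `|((Y w) ^+ 2)%:E|)%E = (\int[Pr]_w ((Y w) ^+ 2)%:E)%E.
    by apply: eq_integral => w _; rewrite gee0_abs// lee_fin sqr_ge0.
  apply: (cvg_unique _ _ cY) => //; rewrite (_ : (fun n => _) = fun=> (\int[Pr]_w ((Y w) ^+ 2)%:E)%E).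
    exact: cvg_cst.
  by apply/funext => n; apply: eq_integral => w _; rewrite e0 subr0.
have mY2 : measurable_fun setT (fun w => ((Y w) ^+ 2)%:E) by apply/measurable_EFinP; exact: measurable_funX.
have := (ae_eq_integral_abs Pr measurableT mY2).1 i0.
apply: filterS => w /(_ I)/= [] /eqP; by rewrite sqrf_eq0 => /eqP.
Qed.

End martingale_tools.

(** * From the equation to the martingale problem *)

Section martingale_problem_of_sde.
Context {d : measure_display} {T : measurableType d} {R : realType} {K N p : nat}.
Local Open Scope sesquilinear_scope.
Variable Pr : probability T R.
Variables (W : 'I_p.+1 -> R -> T -> R) (Np : 'I_p -> R.-ker T ~> (marked R)).
Hypothesis hnoise : noise Pr W Np.
Variables (X : 'I_N.+1 -> 'cV[R[i]]_N.+1) (L : 'I_N.+1 -> 'M[R[i]]_K.+1)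
  (P : 'I_p.+1 -> 'M[R[i]]_N.+1).
Hypotheses (Psa : forall i, (P i) ^t* = P i) (Pid : forall i, P i *m P i = P i).
Local Notation op := 'M[R[i]]_K.+1.
Local Notation pc := (pcoef X P).
Local Notation nice := (nice X L P).
Local Notation leb := (@lebesgue_measure R).
Local Notation mR := (measurableTypeR R).
Local Notation F := (noise_filtration Pr W Np).
Local Notation hop i := (coefh L pc i).
Local Notation coord := (coord (K := K)).
Variable rho : R -> T -> op.
Hypotheses (hca : cadlag_adapted Pr W Np rho) (hst : forall t w, 0 <= t -> is_state (rho t w)).
Variables (I0 : {set 'I_p.+1}) (Y : 'I_p.+1 -> R -> T -> op) (rho0 : op).
Hypotheses (hI0 : I0 = if idxJ pc == finset.set0 then finset.set0 else idxJ0 pc)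
  (hY : forall i t, i \in I0 -> 0 <= t ->
     is_op_ito_integral Pr F (W i) (fun s w => hop i (rho_ rho s w)) t (Y i t))
  (hsde : forall t, 0 <= t -> {ae Pr, forall w,
     rho t w = rho0 + drift_term L rho t w + \sum_(i in I0) Y i t w
                + \sum_(j in idxI pc) jump_term Np L pc j rho t w}).
Implicit Types (c : coord) (w : T).

Let hcad w : cadlag (rho ^~ w). Proof. by case: hca. Qed.
Let hnice t w : 0 <= t -> nice (rho t w). Proof. by move=> t0; apply: state_nice => //; exact: hst. Qed.
Let sF r : sigma_algebra setT (F r). Proof. exact: noise_filtration_sigma. Qed.
Let mF r : F r `<=` measurable. Proof. exact: (noise_filtration_measurable hnoise). Qed.
Let hadap t c : 0 <= t -> measurable_wrt (F t) (fun w => co c (rho t w)).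
Proof.
move=> t0; have [_ /(_ t t0) h] := hca; case: c => -[b k] l; have [h1 h2] := h k l.
case: b; first by under eq_fun do rewrite -coIm.
by under eq_fun do rewrite -coRe.
Qed.
Let hmeas s c : 0 <= s -> measurable_fun setT (fun w => co c (rho s w)).
Proof. by move=> s0; exact: measurable_wrt_fun (@mF s) (hadap c s0). Qed.
Let nlim (M_ : nat -> op) M : (forall n, nice (M_ n)) ->
  (forall c, co c (M_ n) @[n --> \oo] --> co c M) -> nice M.
Proof. exact: nice_lim. Qed.

Local Notation NF := (natural_filtration rho).
Let sN t : sigma_algebra setT (NF t). Proof. exact: smallest_sigma_algebra. Qed.

Let subF t : NF t `<=` F t.
Proof.
apply: smallest_sub; first exact: sF.
move=> A [s [a [b [B [/andP[s0 st] mB e]]]]]; have [_ /(_ s s0 a b)[h1 h2]] := hca.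
by apply: (noise_filtration_le st); case: e => ->; [exact: h1|exact: h2].
Qed.

Let co_nat s t c : 0 <= s <= t -> measurable_wrt (NF t) (fun w => co c (rho s w)).
Proof.
move=> st B mB; apply: sub_sigma_algebra; case: c => -[b k] l; exists s, k, l, B; split=> //.
by case: b; [right|left]; apply/seteqP; split=> w; rewrite /= ?coIm ?coRe.
Qed.

Lemma initial_value : {ae Pr, forall w, rho 0 w = rho0}.
Proof.
have aeY : {ae Pr, forall w, forall ic : 'I_p.+1 * coord, ic.1 \in I0 -> co ic.2 (Y ic.1 0 w) = 0}.
  apply: filter_forall => -[i c] /=; have [iI|_] := boolP (i \in I0); last by apply: nearW => w.
  have := ito_integral_at0 (op_ito_co c (hY iI (lexx 0))).
  by apply: filterS => w h _.
apply: filterS2 aeY (hsde (lexx 0)) => w hw ->.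
have e0 : (setT `*` `]0, 0] : set (marked R)) = set0.
  by apply/seteqP; split=> // z [_]; rewrite /= in_itv/= => /andP[h1 h2]; have := lt_le_trans h1 h2; rewrite ltxx.
apply: co_inj => c; rewrite !coD co_drift tint0 !co_sum big1 => [|i iI]; last exact: (hw (i, c)).
rewrite big1 ?addr0// => j _.
by rewrite /jump_term e0 coB !co_mxintegral !Rintegral_set0 subrr.
Qed.

Variable f : opE R K -> R.
Hypothesis hf : C2c f.
Local Notation genF := (genR X L P f I0 (idxI pc)).
Let gadm : adm nice genF. Proof. exact: genR_adm. Qed.
Let fadm : adm nice (fun M => f (toE M)). Proof. exact: f_adm. Qed.

Let M t w : R := f (toE (rho t w)) - f (toE (rho 0 w)) - tint rho genF 0 t w.

Let M_incr s t w : 0 <= s -> s < t -> M t w - M s w = f (toE (rho t w)) - f (toE (rho s w)) - tint rho genF s t w.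
Proof.
move=> s0 st; have -> : tint rho genF s t w = tint rho genF 0 t w - tint rho genF 0 s w.
  move: s0; rewrite le_eqVlt => /predU1P[<-|s0]; first by rewrite tint0 subr0.
  by rewrite (tint_split hcad hnice nlim hmeas w gadm s0 st) addrC addKr.
rewrite /M; move: (f _) (f _) (f _) (tint _ _ _ _ _) (tint _ _ _ _ _) => *; ring.
Qed.

Let M_wrt t : 0 <= t -> measurable_wrt (NF t) (M t).
Proof.
move=> t0; apply: measurable_wrtB => //; first apply: measurable_wrtB => //.
- by apply: (adm_meas fadm (sN t)) => [w|c]; [exact: hnice|apply: co_nat; rewrite t0/=].
- by apply: (adm_meas fadm (sN t)) => [w|c]; [exact: hnice|apply: co_nat; rewrite lexx].
- move: t0; rewrite le_eqVlt => /predU1P[<-|t0].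
    rewrite (_ : tint rho genF 0 0 = fun=> 0); first exact: measurable_wrt_cst.
    by apply/funext => w; exact: tint0.
  by apply: (tint_wrt hcad hnice nlim gadm (lexx 0) t0) => // r c; exact: co_nat.
Qed.

Let M_intg t : 0 <= t -> intg Pr (M t).
Proof.
move=> t0; have [Bf hBf] := adm_bdd fadm; have [Bg hBg] := adm_bdd gadm.
apply: (@intg_bounded _ _ _ Pr _ (Bf + Bf + Bg * t)) => [|w].
  exact: measurable_wrt_fun (subset_trans (@subF t) (@mF t)) (M_wrt t0).
apply: (le_trans (ler_normB _ _)); apply: lerD.
  by apply: (le_trans (ler_normB _ _)); apply: lerD; apply: hBf; exact: hnice.
move: t0; rewrite le_eqVlt => /predU1P[<-|t0]; first by rewrite tint0 normr0 mulr0.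
by have := tint_norm hcad hnice nlim w hBg gadm (lexx 0) t0; rewrite subr0.
Qed.

Let M_martingale : martingale Pr NF M.
Proof.
split=> [t|t|s t s0 st]; [exact: M_wrt|exact: M_intg|].
have t0 := le_trans s0 st.
split; [exact: M_wrt|exact: M_intg|move=> A NA].
move: st; rewrite le_eqVlt => /predU1P[<-//|st].
have [cm cm0 hcm] := rate_max X L P.
rewrite !mean_restrict; apply/esym/eqP; rewrite -subr_eq0; apply/eqP.
have bA : bounded_wrt (F s) (\1_A : T -> R) by exact: bounded_wrt_indic (sF s) (subF NA).
rewrite -meanB; last 2 first.
- exact: (bounded_intg (@mF s) bA (M_intg t0)).
- exact: (bounded_intg (@mF s) bA (M_intg s0)).
rewrite -[RHS](sde_martingale hnoise hcad hnice hadap hY hsde hf cm0 hcm s0 st (subF NA)).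
by congr (mean Pr _); apply/funext => w; rewrite -mulrBr M_incr.
Qed.

(** On states the generator is real, so the imaginary part integrates to 0. In the real part the
    point 0 is negligible, and [tint_right] exchanges the process for its left limits. *)
Let gen_int t w : 0 <= t -> cintegral leb `[0, t] (fun s => gen L pc f (rho s w)) = (tint rho genF 0 t w)%:C.
Proof.
move=> t0; have eg s : (`[0, t]%classic : set mR) s -> gen L pc f (rho s w) = (genF (rho s w))%:C.
  by rewrite /= in_itv/= => /andP[s0 _]; have [] := gen_genR L Psa Pid f (hst w s0) hI0.
rewrite /cintegral; congr (_ +i* _); last first.
  rewrite (@eq_Rintegral _ _ _ leb _ (fun=> 0)); first by rewrite /Rintegral integral0.
  by move=> s; rewrite inE => hs; rewrite eg.
rewrite (@eq_Rintegral _ _ _ leb _ (fun s => genF (rho s w))); last by move=> s; rewrite inE => hs; rewrite eg.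
move: t0; rewrite le_eqVlt => /predU1P[<-|t0].
  by rewrite tint0 set_itv1 Rintegral_set1.
have e2 : (fun s : mR => oc_ind 0 t s * genF (rho s w)) = patch (fun=> 0) `]0, t]%classic (fun s => genF (rho s w)).
  apply/funext => s; rewrite patchE mem_setE in_itv/= /oc_ind; case: ifP => _; [exact: mul1r|exact: mul0r].
rewrite -(tint_right hcad hnice nlim w gadm (lexx 0) t0) e2 -Rintegral_mkcond.
apply/esym/Rintegral_itv_obnd_cbnd.
have [Bg hBg] := adm_bdd gadm.
have mI : measurable (`]0, t]%classic : set mR) by exact: measurable_itv.
have := right_measurable hcad hnice w gadm (lexx 0) t0; rewrite e2 => mr.
have ir : integ leb (patch (fun=> 0) `]0, t]%classic (fun s => genF (rho s w)) : mR -> R).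
  apply: (@integ_bounded_supp _ _ _ leb _ `]0, t]%classic `|Bg|) => //; first exact: lebesgue_oc_fin.
    move=> s; rewrite patchE mem_setE in_itv/=; case: ifP => [/andP[s0 _]|_]; last by rewrite normr0.
    by apply: le_trans (ler_norm _); apply: hBg; apply: hnice; exact: ltW.
  by move=> s hs; rewrite patchE memNset.
move: ir; rewrite /integ => ir.
apply/(integrable_mkcond _ mI); move: ir; apply: eq_integrable => // s _ /=.
by rewrite !patchE; case: ifP.
Qed.

Lemma gen_cmartingale : cmartingale Pr NF (fun t w => (f (toE (rho t w)) - f (toE (rho 0 w)))%:C
        - cintegral leb `[0, t] (fun s => gen L pc f (rho s w))).
Proof.
split.
  apply: martingale_ext M_martingale => t t0; apply/funext => w.
  by rewrite gen_int// -rmorphB.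
apply: martingale_ext (martingale0 Pr sN) => t t0; apply/funext => w.
by rewrite gen_int// -rmorphB.
Qed.

End martingale_problem_of_sde.

(** Covers both equations: for the pure jump equation [I0] is empty, and so is the family of Ito
    integrals. *)
Lemma sde_martingale_problem d (T : measurableType d) (R : realType) (K N p : nat)
  (Pr : probability T R) (W : 'I_p.+1 -> R -> T -> R) (Np : 'I_p -> R.-ker T ~> (marked R))
  (X : 'I_N.+1 -> 'cV[R[i]]_N.+1) (L : 'I_N.+1 -> 'M[R[i]]_K.+1) (A : 'M[R[i]]_N.+1)
  (lam : 'I_p.+1 -> R) (P : 'I_p.+1 -> 'M[R[i]]_N.+1) (rho : R -> T -> 'M[R[i]]_K.+1)
  (I0 : {set 'I_p.+1}) (Y : 'I_p.+1 -> R -> T -> 'M[R[i]]_K.+1) (rho0 : 'M[R[i]]_K.+1) :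
  noise Pr W Np -> spectral_decomposition A lam P ->
  cadlag_adapted Pr W Np rho -> (forall t w, 0 <= t -> is_state (rho t w)) ->
  I0 = (if idxJ (pcoef X P) == finset.set0 then finset.set0 else idxJ0 (pcoef X P)) ->
  (forall i t, i \in I0 -> 0 <= t -> is_op_ito_integral Pr (noise_filtration Pr W Np) (W i)
     (fun s w => coefh L (pcoef X P) i (rho_ rho s w)) t (Y i t)) ->
  (forall t, 0 <= t -> {ae Pr, forall w,
     rho t w = rho0 + drift_term L rho t w + \sum_(i in I0) Y i t w
                + \sum_(j in idxI (pcoef X P)) jump_term Np L (pcoef X P) j rho t w}) ->
  martingale_problem Pr (gen L (pcoef X P)) rho0 rho.
Proof.
move=> hn [_ hP1 hP2 _ _] hca hst hI0 hY hsde.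
have Psa i : ((P i) ^t*)%sesqui = P i by have [] := hP1 i.
have Pid i : P i *m P i = P i by rewrite hP2 eqxx.
split; first exact: (initial_value hY hsde).
by move=> f hf; exact: (gen_cmartingale hn Psa Pid hca hst hI0 hY hsde hf).
Qed.

Theorem proposition3 (R : realType) (K N p : nat)
  (X : 'I_N.+1 -> 'cV[R[i]]_N.+1) (hX : orthonormal_basis X)
  (L : 'I_N.+1 -> 'M[R[i]]_K.+1) (hL : scaling_limit X L)
  (A : 'M[R[i]]_N.+1) (lam : 'I_p.+1 -> R) (P : 'I_p.+1 -> 'M[R[i]]_N.+1)
  (hA : spectral_decomposition A lam P)
  (hP : pcoef X P ord0 ord0 ord0 != 0)
  (rho0 : 'M[R[i]]_K.+1) (hrho0 : is_state rho0) :
  [/\ idxJ (pcoef X P) = finset.set0 ->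
      forall (d : measure_display) (T : measurableType d)
        (Pr : probability T R) (W : 'I_p.+1 -> R -> T -> R)
        (Np : 'I_p -> R.-ker T ~> marked R)
        (rho : R -> T -> 'M[R[i]]_K.+1),
      noise Pr W Np ->
      solves_jump_sde Pr W Np L (pcoef X P) rho0 rho ->
      (forall t w, 0 <= t -> is_state (rho t w)) ->
      martingale_problem Pr (gen L (pcoef X P)) rho0 rho,
      idxJ (pcoef X P) <> finset.set0 ->
      forall (d : measure_display) (T : measurableType d)
        (Pr : probability T R) (W : 'I_p.+1 -> R -> T -> R)
        (Np : 'I_p -> R.-ker T ~> marked R)
        (rho : R -> T -> 'M[R[i]]_K.+1),
      noise Pr W Np ->
      solves_jump_diffusion_sde Pr W Np L (pcoef X P) rho0 rho ->
      (forall t w, 0 <= t -> is_state (rho t w)) ->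
      martingale_problem Pr (gen L (pcoef X P)) rho0 rho
    & forall (f : opE R K -> R) (rho : 'M[R[i]]_K.+1), C2c f -> is_state rho ->
      (gent L (pcoef X P) f rho)%:C = gen L (pcoef X P) f rho].
Proof.
have [_ hP1 hP2 _ _] := hA.
have Psa i : ((P i) ^t*)%sesqui = P i by have [] := hP1 i.
have Pid i : P i *m P i = P i by rewrite hP2 eqxx.
split.
- move=> J0 d T Pr W Np rho hn [hca hsde] hst.
  apply: (@sde_martingale_problem _ _ _ _ _ _ _ W Np _ _ _ _ _ _ finset.set0 (fun _ _ _ => 0) _ hn hA hca hst) => //.
  + by rewrite J0 eqxx.
  + by move=> i t; rewrite finset.in_set0.
  move=> t t0; apply: filterS (hsde t t0) => w ->.
  (* With [idxJ] empty, the sum over all jump indices is the sum over [idxI]. *)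
  rewrite big_set0 addr0; congr (_ + _); apply: eq_bigl => j.
  by have := finset.in_set0 j; rewrite -J0 finset.in_setC => /negbFE ->.
- move=> /eqP J0 d T Pr W Np rho hn [hca [Y [hY hsde]]] hst.
  apply: (@sde_martingale_problem _ _ _ _ _ _ _ W Np _ _ _ _ _ _ (idxJ0 (pcoef X P)) Y _ hn hA hca hst) => //.
  by rewrite (negbTE J0).
- move=> f rho hf hst.
  have [h1 h2] := @gen_genR _ _ _ _ X L P Psa Pid f rho _ hst erefl.
  by rewrite h1 h2.
Qed.
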